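(* Let $U\subseteq\mathbb{C}$ be open and connected, $z_0\in U$, and let $c:U\to V/\!\!/G=\sigma(V)\subseteq\mathbb{C}^n$ be holomorphic. Then there exists a positive integer $N$ such that $z\mapsto c(z_0+(z-z_0)^N)$ admits a holomorphic lift $\bar c$ into $V$ on some neighborhood of $z_0$, i.e. a holomorphic $\bar c$ with $\sigma\circ\bar c(z)=c(z_0+(z-z_0)^N)$ and $G.\bar c(z)$ closed for all $z$ near $z_0$.
   Context: Let $G$ be a reductive linear algebraic group over $\mathbb{C}$ and $\rho:G\to\mathrm{GL}(V)$ a rational representation on a finite-dimensional complex vector space $V$. Let $\sigma_1,\dots,\sigma_n$ be homogeneous generators of the algebra $\mathbb{C}[V]^G$ of $G$-invariant polynomials, and $\sigma=(\sigma_1,\dots,\sigma_n):V\to\mathbb{C}^n$. The categorical quotient $V/\!\!/G$ is identified with $\sigma(V)\subseteq\mathbb{C}^n$; a map into $\sigma(V)$ is holomorphic if it is holomorphic as a map into $\mathbb{C}^n$. *)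

(* Defs.v *)
From HB Require Import structures.
From mathcomp Require Import all_boot all_order all_algebra.
From mathcomp Require Import all_classical all_reals all_analysis.
From mathcomp Require Import complex.
From mathcomp Require mpoly.
Set Implicit Arguments. Unset Strict Implicit. Unset Printing Implicit Defensive.
Import Order.TTheory GRing.Theory Num.Theory.
Import numFieldNormedType.Exports.
Local Open Scope classical_set_scope.
Local Open Scope ring_scope.

(* The complex plane, with its (modulus) topology and complex derivative.
   [R[i]^o] is R[i] viewed as a normed module over itself. *)
Notation CC R := ((R[i])^o).

(* Coordinates of a matrix g in GL_m: its m*m entries, and (det g)^-1.
   Regular functions on GL_m are polynomials in these m*m+1 coordinates. *)
Definition gl_coords (R : realType) (m : nat) (g : 'M[R[i]]_m) :
    'I_(m * m + 1) -> R[i] :=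
  fun k => match fintype.split k with inl k' => mxvec g 0 k' | inr _ => (\det g)^-1 end.

Definition gl_eval (R : realType) (m : nat)
    (p : mpoly.mpoly (m * m + 1) R[i]) (g : 'M[R[i]]_m) : R[i] :=
  mpoly.meval (gl_coords g) p.

Definition gl_zclosed (R : realType) (m : nat) (H : set 'M[R[i]]_m) : Prop :=
  exists S : set (mpoly.mpoly (m * m + 1) R[i]),
    H = [set g | g \in unitmx /\ forall p, S p -> gl_eval p g = 0].

Definition gl_zconnected (R : realType) (m : nat) (H : set 'M[R[i]]_m) : Prop :=
  forall A B : set 'M[R[i]]_m, gl_zclosed A -> gl_zclosed B ->
    H `<=` A `|` B -> H `&` A `&` B = set0 ->
    H `&` A = set0 \/ H `&` B = set0.

Definition is_subgroup_GL (R : realType) (m : nat) (H : set 'M[R[i]]_m) : Prop :=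
  [/\ H 1%:M,
      forall g, H g -> g \in unitmx,
      forall g h, H g -> H h -> H (g *m h)
    & forall g, H g -> H (invmx g)].

Definition linear_algebraic_group (R : realType) (m : nat)
    (G : set 'M[R[i]]_m) : Prop :=
  is_subgroup_GL G /\ gl_zclosed G.

Definition unipotent_mx (R : realType) (m : nat) (u : 'M[R[i]]_m) : Prop :=
  (u - 1%:M) ^+ m = 0.

(* Reductive: the unipotent radical is trivial, i.e. every Zariski-closed,
   connected, unipotent, normal subgroup of G is trivial. *)
Definition reductive (R : realType) (m : nat) (G : set 'M[R[i]]_m) : Prop :=
  forall H : set 'M[R[i]]_m,
    H `<=` G -> is_subgroup_GL H -> gl_zclosed H -> gl_zconnected H ->
    (forall g h, G g -> H h -> H (g *m h *m invmx g)) ->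
    (forall h, H h -> unipotent_mx h) ->
    H = [set 1%:M].

Definition rational_rep (R : realType) (m d : nat) (G : set 'M[R[i]]_m)
    (rho : 'M[R[i]]_m -> 'M[R[i]]_d) : Prop :=
  [/\ forall g, G g -> rho g \in unitmx,
      forall g h, G g -> G h -> rho (g *m h) = rho g *m rho h
    & exists r : 'I_d -> 'I_d -> mpoly.mpoly (m * m + 1) R[i],
        forall g, G g -> forall i j, rho g i j = gl_eval (r i j) g].

Definition vcoords (R : realType) (d : nat) (v : 'cV[R[i]]_d) : 'I_d -> R[i] :=
  fun k => v k 0.

Definition v_eval (R : realType) (d : nat) (p : mpoly.mpoly d R[i])
    (v : 'cV[R[i]]_d) : R[i] := mpoly.meval (vcoords v) p.

Definition v_zclosed (R : realType) (d : nat) (O : set 'cV[R[i]]_d) : Prop :=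
  exists S : set (mpoly.mpoly d R[i]),
    O = [set v | forall p, S p -> v_eval p v = 0].

Definition invariant_poly (R : realType) (m d : nat) (G : set 'M[R[i]]_m)
    (rho : 'M[R[i]]_m -> 'M[R[i]]_d) (p : mpoly.mpoly d R[i]) : Prop :=
  forall g v, G g -> v_eval p (rho g *m v) = v_eval p v.

Definition homogeneous_generators (R : realType) (m d n : nat)
    (G : set 'M[R[i]]_m) (rho : 'M[R[i]]_m -> 'M[R[i]]_d)
    (sigma : n.-tuple (mpoly.mpoly d R[i])) : Prop :=
  [/\ forall k : 'I_n, tnth sigma k \is @mpoly.ishomog d R[i] (mpoly.mpoly_mdeg__canonical__mpoly_Measure d),
      forall k : 'I_n, invariant_poly G rho (tnth sigma k)
    & forall p, invariant_poly G rho p ->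
        exists q : mpoly.mpoly n R[i], p = mpoly.comp_mpoly sigma q].

Definition sigma_map (R : realType) (d n : nat)
    (sigma : n.-tuple (mpoly.mpoly d R[i])) (v : 'cV[R[i]]_d) : 'rV[R[i]]_n :=
  \row_k v_eval (tnth sigma k) v.

Definition orbit_of (R : realType) (m d : nat) (G : set 'M[R[i]]_m)
    (rho : 'M[R[i]]_m -> 'M[R[i]]_d) (v : 'cV[R[i]]_d) : set 'cV[R[i]]_d :=
  [set rho g *m v | g in G].

Definition holomorphic_on (R : realType) (U : set (CC R))
    (f : CC R -> CC R) : Prop :=
  forall z, U z -> derivable f z 1.

Definition holomorphic_on_rV (R : realType) (k : nat) (U : set (CC R))
    (f : CC R -> 'rV[R[i]]_k) : Prop :=
  forall j : 'I_k, holomorphic_on U (fun z => f z 0 j : CC R).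

Definition holomorphic_on_cV (R : realType) (k : nat) (U : set (CC R))
    (f : CC R -> 'cV[R[i]]_k) : Prop :=
  forall j : 'I_k, holomorphic_on U (fun z => f z j 0 : CC R).

(* Main.v *)
Require Import Defs.
From HB Require Import structures.
From mathcomp Require Import all_boot all_order all_algebra.
From mathcomp Require Import all_field ring zify boolp classical_sets functions.
From mathcomp Require mpoly.
Set Implicit Arguments. Unset Strict Implicit. Unset Printing Implicit Defensive.
Import Order.TTheory GRing.Theory Num.Theory.
Local Open Scope ring_scope.

(** Reductivity yields a Reynolds operator: the radical of a trace form on the Lie algebra is a
nilpotent ideal, which the hypothesis kills, so Casimir elements split off the invariants. Each
fibre of [sigma] contains a minimal closed [G]-stable set, and this set is a closed orbit. A place
of a residue field of functions stands in for a convergent sequence: combined with Puiseux's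
theorem it selects an analytic curve [y] of minimal tangent rank with [sigma (y t) = c (t ^+ N)]
that ends in the minimal set over [c 0]. Since the rank is then constant, a linear differential
equation keeps [y t] on the closed orbit of its fibre. *)

(** The curve [c] is only holomorphic, so the pairs of a parameter and a point over it do not form
    an algebraic set, and curve selection for varieties does not apply. Points over the parameters
    are therefore read as one point over a field of functions of the parameter, which contains the
    meromorphic germs. Its coordinates are moved, one transcendental at a time, into the algebraic
    closure of the germs, where they are Puiseux series; [N] is their ramification index. Closed
    orbits are not preserved by limits, which is why the rank matters. The rank chosen is the least
    one attained by minimal sets over parameters arbitrarily near the centre. To have at most this
    rank is a closed condition and survives the selection, while the minimal sets over the other
    nearby parameters have at least this rank. So the orbit of [y t] is no larger than the closed
    orbit in its closure, and this forces both to coincide. *)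

Module Algebra.
Import mpoly.

(** * Polynomials in several variables and derivations *)

Lemma mpoly_alg_ind (n : nat) (R : comNzRingType) (P : {mpoly R[n]} -> Prop) :
 (forall c, P c%:MP) -> (forall i, P 'X_i) ->
 (forall p q, P p -> P q -> P (p + q)) -> (forall p q, P p -> P q -> P (p * q)) -> forall p, P p.
Proof.
move=> PC PX PD PM p; rewrite [p]mpolyE.
elim/big_ind: _ => [|p1 p2|m _]; [by rewrite -mpolyC0| exact: PD |].
rewrite -mul_mpolyC; apply: (PM) => //; rewrite mpolyXE_id.
elim/big_ind: _ => [|p1 p2|i _]; [by rewrite -mpolyC1| exact: PM |].
elim: (m i) => [|k IH]; first by rewrite expr0 -mpolyC1.
by rewrite exprS; apply: PM.
Qed.
(** Stated for an arbitrary derivation [dlt], so that one formula serves the derivative of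
    univariate polynomials and the vector fields on matrices. *)
Lemma mmap_chain_rule (n : nat) (R S : comNzRingType) (f : {rmorphism R -> S})
  (h : 'I_n -> S) (dlt : S -> S) :
 {morph dlt : x y / x + y} -> (forall x y, dlt (x * y) = dlt x * y + x * dlt y) ->
 (forall c, dlt (f c) = 0) -> forall p, dlt (mmap f h p) = \sum_k mmap f h (mderiv k p) * dlt (h k).
Proof.
move=> dD dM dC p; elim/mpoly_alg_ind: p => [c|i|p q IHp IHq|p q IHp IHq].
- by rewrite mmapC dC big1 // => k _; rewrite mderivC mmap0 mul0r.
- rewrite mmapX mmap1U (bigD1 i) //= big1 ?addr0 => [|k ki].
  rewrite mderivX mnm1E eqxx scale1r.
  by rewrite -{1}[U_(i)%MM]add0m addmK mpolyX0 rmorph1 mul1r.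
 by rewrite mderivX mnm1E eq_sym (negPf ki) scale0r mmap0 mul0r.
- rewrite mmapD dD IHp IHq -big_split; apply: eq_bigr => k _.
 by rewrite mderivD mmapD mulrDl.
- rewrite rmorphM dM IHp IHq mulr_suml mulr_sumr -big_split.
 apply: eq_bigr => k _; rewrite mderivM mmapD !rmorphM mulrDl.
 by rewrite mulrAC -mulrA -mulrA [_ * dlt _]mulrC !mulrA.
Qed.
Lemma horner_mmap (n : nat) (R : comNzRingType) (h : 'I_n -> {poly R}) p (a : R) :
 (mmap polyC h p).[a] = p.@[fun k => (h k).[a]].
Proof.
elim/mpoly_alg_ind: p => [c|k|p q IHp IHq|p q IHp IHq].
- by rewrite mmapC mevalC hornerC.
- by rewrite mmapX mmap1U mevalXU.
- by rewrite mmapD hornerD mevalD IHp IHq.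
- by rewrite rmorphM hornerM mevalM IHp IHq.
Qed.

(** * Left-invariant vector fields on matrices *)

Section MatrixFunctions.
Variables (C : numClosedFieldType) (n : nat).
Implicit Types (p q : {mpoly C[n * n]}) (A B x y : 'M[C]_n).

Definition mev p A : C := p.@[fun k => mxvec A 0 k].

Lemma mevD_ p q A : mev (p + q) A = mev p A + mev q A.
Proof. exact: mevalD. Qed.
Lemma mevB_ p q A : mev (p - q) A = mev p A - mev q A.
Proof. exact: mevalB. Qed.
Lemma mevM_ p q A : mev (p * q) A = mev p A * mev q A.
Proof. exact: mevalM. Qed.
Lemma mevC_ c A : mev c%:MP A = c.
Proof. exact: mevalC. Qed.
Lemma mevZ_ c p A : mev (c *: p) A = c * mev p A.
Proof. exact: mevalZ. Qed.
Lemma mevX_ i j A : mev 'X_(mxvec_index i j) A = A i j.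
Proof. by rewrite /mev mevalXU mxvecE. Qed.
Lemma mev_sum (I : Type) (r : seq I) (P : pred I) (F : I -> {mpoly C[n * n]}) A :
 mev (\sum_(i <- r | P i) F i) A = \sum_(i <- r | P i) mev (F i) A.
Proof. exact: rmorph_sum. Qed.

(* The left-invariant vector field on matrices with value [x] at the identity. *)
Definition vfield x p : {mpoly C[n * n]} :=
 \sum_i \sum_j mderiv (mxvec_index i j) p * \sum_l x l j *: 'X_(mxvec_index i l).

Lemma vfield_linear x : linear (vfield x).
Proof.
move=> c p q; rewrite /vfield scaler_sumr -big_split; apply: eq_bigr => i _ /=.
rewrite scaler_sumr -big_split; apply: eq_bigr => j _ /=.
by rewrite mderivD mderivZ mulrDl scalerAl.
Qed.
HB.instance Definition _ x := GRing.isLinear.Build C _ _ _ (vfield x) (vfield_linear x).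

Lemma vfieldM x p q : vfield x (p * q) = vfield x p * q + p * vfield x q.
Proof.
rewrite /vfield mulr_suml mulr_sumr -big_split; apply: eq_bigr => i _ /=.
rewrite mulr_suml mulr_sumr -big_split; apply: eq_bigr => j _ /=.
by rewrite mderivM mulrDl mulrAC mulrA.
Qed.
Lemma vfieldC x c : vfield x c%:MP = 0.
Proof. by rewrite /vfield big1 // => i _; rewrite big1 // => j _; rewrite mderivC mul0r. Qed.
Lemma mxvec_index_inj (i i' j j' : 'I_n) : (mxvec_index i j == mxvec_index i' j') = (i == i') && (j == j').
Proof.
apply/eqP/andP => [/(congr1 (fun k => vec_mx (delta_mx 0 k) : 'M[C]_n))|[/eqP-> /eqP->]//].
rewrite -!mxvec_delta !mxvecK => /matrixP/(_ i j); rewrite !mxE !eqxx /=.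
by case: (i == i'); case: (j == j') => //= /eqP; rewrite oner_eq0.
Qed.
Lemma vfieldX x i j : vfield x 'X_(mxvec_index i j) = \sum_l x l j *: 'X_(mxvec_index i l).
Proof.
rewrite /vfield (bigD1 i) //= (bigD1 j) //= [X in _ + X + _]big1 => [|j' jj'].
 rewrite [X in _ + X]big1 => [|i' ii'].
  by rewrite !addr0 mderivX mnm1E eqxx scale1r -{1}[U_(_)%MM]add0m addmK mpolyX0 mul1r.
 rewrite big1 // => j' _; rewrite mderivX mnm1E mxvec_index_inj eq_sym (negPf ii').
 by rewrite scale0r mul0r.
by rewrite mderivX mnm1E mxvec_index_inj eqxx eq_sym (negPf jj') scale0r mul0r.
Qed.
Lemma mev_vfield x p A : mev (vfield x p) A = \sum_k mev (mderiv k p) A * mxvec (A *m x) 0 k.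
Proof.
rewrite /vfield mev_sum; under eq_bigr => i _ do rewrite mev_sum.
rewrite pair_bigA /= [RHS](reindex _ (curry_mxvec_bij _ _)) /=.
apply: eq_bigr => -[i j] _ /=; rewrite mevM_ mxvecE mxE; congr (_ * _); rewrite mev_sum.
by apply: eq_bigr => l _; rewrite mevZ_ mevX_ mulrC.
Qed.
Lemma mmap_vfield (S : comNzRingType) (f : {rmorphism C -> S}) (E : 'M[S]_n) x p :
 mmap f (fun k => mxvec E 0 k) (vfield x p) =
 \sum_k mmap f (fun k => mxvec E 0 k) (mderiv k p) * mxvec (E *m map_mx f x) 0 k.
Proof.
rewrite /vfield raddf_sum; under eq_bigr => i _ do rewrite raddf_sum.
rewrite pair_bigA /= [RHS](reindex _ (curry_mxvec_bij _ _)) /=.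
apply: eq_bigr => -[i j] _ /=; rewrite rmorphM mxvecE mxE; congr (_ * _).
rewrite raddf_sum; apply: eq_bigr => l _ /=.
by rewrite mmapZ mmapX mmap1U mxvecE mxE mulrC.
Qed.
Lemma vfieldDl x y p : vfield (x + y) p = vfield x p + vfield y p.
Proof.
rewrite /vfield -big_split; apply: eq_bigr => i _ /=; rewrite -big_split.
apply: eq_bigr => j _ /=; rewrite -mulrDr -big_split; congr (_ * _).
by apply: eq_bigr => l _; rewrite mxE scalerDl.
Qed.
Lemma vfieldZl c x p : vfield (c *: x) p = c *: vfield x p.
Proof.
rewrite /vfield scaler_sumr; apply: eq_bigr => i _ /=; rewrite scaler_sumr.
apply: eq_bigr => j _ /=; rewrite scalerAr; congr (_ * _); rewrite scaler_sumr.
by apply: eq_bigr => l _; rewrite mxE scalerA.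
Qed.
Definition ltrans B p : {mpoly C[n * n]} :=
 p \mPo [tuple mxvec (\matrix_(i, j) \sum_l B i l *: 'X_(mxvec_index l j)
      : 'M[{mpoly C[n * n]}]_n) 0 k | k < n * n].

Lemma mev_ltrans B p A : mev (ltrans B p) A = mev p (B *m A).
Proof.
rewrite /mev comp_mpoly_meval; apply: meval_eq => k; rewrite tnth_mktuple.
case/mxvec_indexP: k => i j; rewrite !mxvecE !mxE rmorph_sum /=.
by apply: eq_bigr => l _; rewrite mevalZ mevalXU mxvecE.
Qed.
(** The line through [A] in the direction [B]. The vector field of [x] at [A] is the derivative
    along the line of direction [A *m x], which turns its invariance into an identity between
    univariate polynomials. *)
Definition pcurve (A B : 'M[C]_n) k : {poly C} := (mxvec A 0 k)%:P + mxvec B 0 k *: 'X.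

Lemma mev_vfield_curve x p A : mev (vfield x p) A = (mmap polyC (pcurve A (A *m x)) p)^`().[0].
Proof.
rewrite (mmap_chain_rule _ (@derivD C) (@derivM C) (@derivC C)).
rewrite mev_vfield horner_sum; apply: eq_bigr => k _; rewrite hornerM; congr (_ * _).
 by rewrite horner_mmap /mev; apply: meval_eq => i; rewrite /pcurve !hornerE ?mulr0 ?addr0.
by rewrite /pcurve derivD derivC add0r derivZ derivX hornerZ hornerC mulr1.
Qed.
(** Left multiplication by [B] carries the line through [A] of direction [A *m x] to the line
    through [B *m A] of direction [B *m A *m x]. *)
Lemma mev_vfield_ltrans x B p A : mev (vfield x (ltrans B p)) A = mev (vfield x p) (B *m A).
Proof.
rewrite !mev_vfield_curve; congr (_^`().[0]); rewrite /ltrans /comp_mpoly.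
elim/mpoly_alg_ind: p => [c|k|p q IHp IHq|p q IHp IHq].
- by rewrite !mmapC.
- rewrite !mmapX !mmap1U tnth_mktuple; case/mxvec_indexP: k => i j.
 rewrite mxvecE mxE raddf_sum /= /pcurve !mxvecE -mulmxA !mxE rmorph_sum scaler_suml -big_split.
 apply: eq_bigr => l _ /=; rewrite mmapZ mmapX mmap1U /pcurve !mxvecE mulrDr -!mul_polyC.
 by rewrite !polyCM !mulrA.
- by rewrite !mmapD IHp IHq.
- by rewrite !rmorphM /= IHp IHq.
Qed.

End MatrixFunctions.
#[global] Opaque vfield.

(** * Functions that are polynomial in given coordinates *)

Section PolynomialFunctions.
Variables (C : comNzRingType) (D : nat) (X : Type) (co : X -> 'I_D -> C).

(** A property of plain functions: determinants, adjugates and compositions are recognised as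
    polynomial without computing a polynomial for them. *)
Definition pf (f : X -> C) := exists p : mpoly D C, forall x, f x = meval (co x) p.

Lemma pf_cst c : pf (fun=> c).
Proof. by exists (mpolyC D c) => x; rewrite mevalC. Qed.
Lemma pf_co i : pf (fun x => co x i).
Proof. by exists (mpolyX _ (mnm1 i)) => x; rewrite mevalXU. Qed.
Lemma pfD f g : pf f -> pf g -> pf (fun x => f x + g x).
Proof. by move=> [p h] [q k]; exists (p + q) => x; rewrite mevalD h k. Qed.
Lemma pfM f g : pf f -> pf g -> pf (fun x => f x * g x).
Proof. by move=> [p h] [q k]; exists (p * q) => x; rewrite mevalM h k. Qed.
Lemma pfN f : pf f -> pf (fun x => - f x).
Proof. by move=> [p h]; exists (- p) => x; rewrite mevalN h. Qed.
Lemma pf_eq f g : (forall x, f x = g x) -> pf f -> pf g.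
Proof. by move=> fg [p h]; exists p => x; rewrite -fg. Qed.
Lemma pf_sum (I : Type) (s : seq I) (P : pred I) (f : I -> X -> C) :
 (forall i, pf (f i)) -> pf (fun x => \sum_(i <- s | P i) f i x).
Proof.
move=> /choice[p h]; exists (\sum_(i <- s | P i) p i) => x.
by rewrite rmorph_sum; apply: eq_bigr => i _; rewrite h.
Qed.
Lemma pf_prod (I : Type) (s : seq I) (P : pred I) (f : I -> X -> C) :
 (forall i, pf (f i)) -> pf (fun x => \prod_(i <- s | P i) f i x).
Proof.
move=> /choice[p h]; exists (\prod_(i <- s | P i) p i) => x.
by rewrite rmorph_prod; apply: eq_bigr => i _; rewrite h.
Qed.
Lemma pf_det k (M : X -> 'M[C]_k) : (forall i j, pf (fun x => M x i j)) -> pf (fun x => \det (M x)).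
Proof.
move=> h; apply: pf_sum => s; apply: pfM; first exact: pf_cst.
by apply: pf_prod => i; apply: h.
Qed.
Lemma pf_comp E (h : 'I_E -> X -> C) p : (forall i, pf (h i)) -> pf (fun x => meval (fun i => h i x) p).
Proof.
move=> hh; elim/mpoly_alg_ind: p => [c|i|p q IHp IHq|p q IHp IHq].
- by apply: pf_eq (pf_cst c) => x; rewrite mevalC.
- by apply: pf_eq (hh i) => x; rewrite mevalXU.
- by apply: pf_eq (pfD IHp IHq) => x; rewrite mevalD.
- by apply: pf_eq (pfM IHp IHq) => x; rewrite mevalM.
Qed.
End PolynomialFunctions.

Lemma pf_lshift (C : comNzRingType) a b (q : mpoly a C) :
 pf (fun x : 'I_(a + b) -> C => x) (fun x => meval (fun k => x (lshift b k)) q).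
Proof. by apply: (@pf_comp _ _ _ _ _ (fun k x => x (lshift b k))) => k; exact: (pf_co id). Qed.

(** * Polynomials of a linear operator *)

Section PolyOperator.
Variables (F : fieldType) (V : lmodType F) (D : {linear V -> V}).

(** Meant for [vfield x], which acts on the infinite-dimensional space of all polynomial functions,
    where [horner_mx] does not apply. *)
Definition polyop (q : {poly F}) (v : V) : V := \sum_(i < size q) q`_i *: iter i D v.

Lemma polyop_wide N (q : {poly F}) v : (size q <= N)%N -> polyop q v = \sum_(i < N) q`_i *: iter i D v.
Proof.
move=> leN; rewrite /polyop -!(big_mkord xpredT (fun i => q`_i *: iter i D v)) [RHS](big_cat_nat (n := size q)) //=.
rewrite [X in _ = _ + X]big_nat_cond [X in _ = _ + X]big1 ?addr0 // => i.
by rewrite andbT => /andP[lei _]; rewrite nth_default ?scale0r.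
Qed.
Lemma polyopDl p q v : polyop (p + q) v = polyop p v + polyop q v.
Proof.
rewrite (polyop_wide _ (size_polyD p q)) (polyop_wide _ (leq_maxl (size p) (size q))).
rewrite (polyop_wide _ (leq_maxr (size p) (size q))).
by rewrite -big_split; apply: eq_bigr => i _; rewrite coefD scalerDl.
Qed.
Lemma polyopZl c p v : polyop (c *: p) v = c *: polyop p v.
Proof.
rewrite !(@polyop_wide (size p)) ?size_scale_leq // scaler_sumr.
by apply: eq_bigr => i _; rewrite coefZ scalerA.
Qed.
Lemma polyopC c v : polyop c%:P v = c *: v.
Proof. by rewrite (@polyop_wide 1) ?size_polyC ?leq_b1 // big_ord1 coefC. Qed.
Lemma polyopMX p v : polyop (p * 'X) v = polyop p (D v).
Proof.
rewrite (@polyop_wide (size p).+1) ?(leq_trans (size_polyMleq _ _)) ?size_polyX ?addn2 ?leqnn //.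
rewrite big_ord_recl coefMX scale0r add0r; apply: eq_bigr => i _.
by rewrite coefMX -iterSr.
Qed.
Lemma polyopDr p v w : polyop p (v + w) = polyop p v + polyop p w.
Proof.
elim/poly_ind: p v w => [|p c IH] v w; first by rewrite !polyopC !scale0r addr0.
by rewrite !polyopDl !polyopMX !polyopC linearD IH scalerDr addrACA.
Qed.
Lemma polyopZr p c v : polyop p (c *: v) = c *: polyop p v.
Proof.
elim/poly_ind: p v => [|p d IH] v; first by rewrite !polyopC !scale0r scaler0.
by rewrite !polyopDl !polyopMX !polyopC linearZ IH scalerDr !scalerA mulrC.
Qed.
Lemma polyopM p q v : polyop (p * q) v = polyop p (polyop q v).
Proof.
elim/poly_ind: q p v => [|q c IH] p v.
 by rewrite mulr0 !polyopC scale0r -[0 in RHS](scale0r 0) polyopZr !scale0r.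
rewrite mulrDr mulrA !polyopDl !polyopMX IH [p * c%:P]mulrC mul_polyC polyopZl polyopC.
by rewrite polyopDr polyopZr.
Qed.
Lemma polyop1 v : polyop 1 v = v.
Proof. by rewrite polyopC scale1r. Qed.
Lemma polyop_XsubC l v : polyop ('X - l%:P) v = D v - l *: v.
Proof. by rewrite -['X]mul1r polyopDl -polyCN !polyopC polyopMX polyop1 scaleNr. Qed.
Lemma polyop_XsubCn l K v : polyop (('X - l%:P) ^+ K) v = iter K (fun w => D w - l *: w) v.
Proof.
elim: K v => [|K IH] v; first by rewrite expr0 polyop1.
by rewrite exprS polyopM IH polyop_XsubC iterS.
Qed.
(** A multiple of [('X - l%:P) ^+ K] kills the generalised eigenvector [v], so [q] acts on it
    through its residue, the constant [c]: only congruences on [q] matter. *)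
Lemma polyop_geig l c K q v : iter K (fun w => D w - l *: w) v = 0 ->
 (('X - l%:P) ^+ K %| q - c%:P)%R -> polyop q v = c *: v.
Proof.
rewrite -polyop_XsubCn => v0 /dvdpP[h qE].
have ->: q = h * ('X - l%:P) ^+ K + c%:P by rewrite -qE subrK.
by rewrite polyopDl polyopM v0 -[0](scale0r 0) polyopZr scale0r add0r polyopC.
Qed.
Lemma polyop_stable (P : V -> Prop) : P 0 -> (forall v w, P v -> P w -> P (v + w)) ->
 (forall c v, P v -> P (c *: v)) -> (forall v, P v -> P (D v)) -> forall q v, P v -> P (polyop q v).
Proof.
move=> P0 PD PZ PDv q v Pv; rewrite /polyop; elim/big_ind: _ => // i _; apply: PZ.
by elim: (i : nat) => //= k; apply: PDv.
Qed.
Lemma iter_linear k : linear (iter k D).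
Proof. by elim: k => [|k IH] c u v //=; rewrite IH linearP. Qed.

End PolyOperator.

(** * Chinese remainders for polynomials *)

Section Interpolation.
Variable F : fieldType.

(** The [e a] are the idempotents of the Chinese remainder theorem modulo the product. Evaluated at
    a matrix killed by the product, they project onto its generalised eigenspaces. *)
Lemma partial_fractions (s : seq F) K : uniq s -> s != [::] ->
 exists e : F -> {poly F}, \sum_(a <- s) e a = 1 /\
  forall a, a \in s -> \prod_(b <- s) ('X - b%:P) ^+ K %| ('X - a%:P) ^+ K * e a.
Proof.
elim: s => // a s IH /= /andP[as_ us] _.
have [->|s0] := eqVneq s [::].
 exists (fun=> 1); split=> [|b]; first by rewrite big_seq1.
 by rewrite inE => /eqP->; rewrite big_seq1 mulr1.
have [e [e1 eM]] := IH us s0; pose T := \prod_(b <- s) ('X - b%:P) ^+ K.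
have cop: coprimep (('X - a%:P) ^+ K) T.
 rewrite /T big_seq_cond; elim/big_ind: _ => [|p q Hp Hq|b].
 - by rewrite coprimep1.
 - by rewrite coprimepMr Hp.
 - rewrite andbT => bs; apply/coprimep_expr/coprimep_expl.
  by rewrite coprimep_XsubC root_XsubC; apply: contraNneq as_ => <-.
have [[u v] /= uv] := Bezout_eq1_coprimepP _ _ cop.
(* In the Bezout relation [u * ('X - a%:P) ^+ K + v * T = 1] the second term serves the new point,
   and the first one multiplies the partition of 1 already found for the other points. *)
exists (fun b => if b == a then v * T else u * ('X - a%:P) ^+ K * e b); split.
 rewrite big_cons eqxx (eq_big_seq (fun b => u * ('X - a%:P) ^+ K * e b)) => [|b bs].
  by rewrite -mulr_sumr e1 mulr1 addrC.
 by case: eqP as_ => // <-; rewrite bs.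
move=> b; rewrite big_cons -/T; case: eqVneq => [->|ba].
 by move=> _; rewrite mulrCA dvdp_mull.
rewrite inE (negPf ba) /= => bs.
set A := ('X - a%:P) ^+ K; set B := ('X - b%:P) ^+ K.
have ->: B * (u * A * e b) = u * (A * (B * e b)) by ring.
by rewrite dvdp_mull // dvdp_mul // eM.
Qed.
Lemma interpolation (s : seq F) K (f : F -> F) :
 exists q : {poly F}, forall a, a \in s -> ('X - a%:P) ^+ K %| q - (f a)%:P.
Proof.
have [s0|s0] := eqVneq (undup s) [::].
 by exists 0 => a; rewrite -mem_undup s0.
have [e [e1 eM]] := partial_fractions K (undup_uniq s) s0.
exists (\sum_(a <- undup s) f a *: e a) => a; rewrite -mem_undup => a_s.
rewrite -[(f a)%:P]mulr1 -e1 mulr_sumr -sumrB big_seq; elim/big_ind: _ => [|p q|b b_s].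
- by rewrite dvdp0.
- exact: dvdp_add.
rewrite mul_polyC -scalerBl; have [->|ba] := eqVneq b a; first by rewrite subrr scale0r dvdp0.
apply: dvdp_trans (_ : e b %| _); last by rewrite -mul_polyC dvdp_mull.
have: ('X - a%:P) ^+ K %| ('X - b%:P) ^+ K * e b.
 apply: dvdp_trans (eM b b_s).
 by rewrite (bigD1_seq a) ?undup_uniq //= dvdp_mulr.
rewrite Gauss_dvdpr //; apply/coprimep_expr/coprimep_expl.
by rewrite coprimep_XsubC root_XsubC.
Qed.

End Interpolation.

(** * Closed matrix groups, their Lie algebras and representations *)

Section MatrixGroup.
Variables (C : numClosedFieldType) (n' : nat).
Local Notation n := n'.+1.
Implicit Types (p q : {mpoly C[n * n]}) (A B x y : 'M[C]_n).

Definition evm (a b : nat) (r : 'M[{mpoly C[n * n]}]_(a, b)) A : 'M[C]_(a, b) := map_mx (fun p => mev p A) r.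

Definition vanishes (G : 'M[C]_n -> Prop) p := forall A, G A -> mev p A = 0.

(** Closed in the space of all matrices, not only among the invertible ones, and with an inverse
    given by polynomials [J]: regular functions on the group are then polynomials in the entries,
    and no denominators occur. *)
Record matrix_group (G : 'M[C]_n -> Prop) : Prop := MatrixGroup { mgrp1 : G 1%:M;
 mgrpM : forall A B, G A -> G B -> G (A *m B);
 mgrp_closed : forall A, (forall p, vanishes G p -> mev p A = 0) -> G A;
 mgrpV : exists J : 'M[{mpoly C[n * n]}]_n, forall A, G A ->
  [/\ G (evm J A), A *m evm J A = 1%:M & evm J A *m A = 1%:M] }.

(** The tangent space at the identity, cut out by the differentials of the equations of [G]. *)
Definition lie (G : 'M[C]_n -> Prop) x := forall p, vanishes G p -> mev (vfield x p) 1%:M = 0.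

Lemma lie0 G : lie G 0.
Proof. by move=> p _; rewrite -(scale0r 0) vfieldZl mevZ_ mul0r. Qed.
Lemma lieD G x y : lie G x -> lie G y -> lie G (x + y).
Proof. by move=> Lx Ly p vp; rewrite vfieldDl mevD_ Lx ?Ly ?addr0. Qed.
Lemma lieZ G c x : lie G x -> lie G (c *: x).
Proof. by move=> Lx p vp; rewrite vfieldZl mevZ_ Lx ?mulr0. Qed.
(** If [p] vanishes on [G], so does [ltrans A p] for [A] in [G]; left-invariance thus spreads the
    condition at the identity over the group. The equations of [G] become stable under the vector
    field. *)
Lemma vanishes_vfield G x p : matrix_group G -> lie G x -> vanishes G p -> vanishes G (vfield x p).
Proof.
move=> GG Lx vp A GA; rewrite -[A]mulmx1 -mev_vfield_ltrans; apply: Lx => B GB.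
by rewrite mev_ltrans vp //; apply: mgrpM.
Qed.
Lemma vanishes_iter G x p k : matrix_group G -> lie G x -> vanishes G p -> vanishes G (iter k (vfield x) p).
Proof. by move=> GG Lx vp; elim: k => //= k; apply: vanishes_vfield. Qed.
Definition is_rep (G : 'M[C]_n -> Prop) d (r : 'M[{mpoly C[n * n]}]_d) :=
 evm r 1%:M = 1%:M /\ forall A B, G A -> G B -> evm r (A *m B) = evm r A *m evm r B.

Definition drep d (r : 'M[{mpoly C[n * n]}]_d) x : 'M[C]_d := evm (map_mx (vfield x) r) 1%:M.

Lemma drep_linear d (r : 'M[{mpoly C[n * n]}]_d) : linear (drep r).
Proof.
by move=> c x y; apply/matrixP => i j; rewrite !mxE vfieldDl vfieldZl mevD_ mevZ_.
Qed.
HB.instance Definition _ d r := GRing.isLinear.Build C _ _ _ (@drep d r) (@drep_linear d r).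

(** Differentiates the multiplicativity of [r] in its second argument at the identity: the
    difference [p] of its two sides is an equation of [G]. *)
Lemma evm_vfield_rep G d r x A : matrix_group G -> @is_rep G d r -> lie G x -> G A ->
 evm (map_mx (vfield x) r) A = evm r A *m drep r x.
Proof.
move=> GG [_ rM] Lx GA; apply/matrixP => i j; rewrite !mxE.
pose p := ltrans A (r i j) - \sum_k mev (r i k) A *: r k j.
have vp: vanishes G p.
 move=> B GB; rewrite /p mevB_ mev_ltrans mev_sum.
 have /matrixP/(_ i j) := rM A B GA GB; rewrite !mxE => ->.
 by apply/eqP; rewrite subr_eq0; apply/eqP/eq_bigr => k _; rewrite mevZ_ !mxE.
have := Lx p vp; rewrite /p linearB /= mevB_ mev_vfield_ltrans mulmx1.
move/eqP; rewrite subr_eq0 => /eqP->; rewrite linear_sum mev_sum.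
by apply: eq_bigr => k _; rewrite linearZ /= mevZ_ !mxE.
Qed.
(** Carries a polynomial of the vector field, acting on functions, to the same polynomial of the
    matrix [drep r x]; relations between vector fields thus become relations in every
    representation. *)
Lemma evm_polyop_rep G d (r : 'M_d.+1) x (q : {poly C}) A : matrix_group G -> is_rep G r -> lie G x -> G A ->
 evm (map_mx (polyop (vfield x) q) r) A = evm r A *m horner_mx (drep r x) q.
Proof.
move=> GG rr Lx GA; have iterE k : evm (map_mx (iter k (vfield x)) r) A = evm r A *m drep r x ^+ k.
 elim: k A GA => [|k IH] A GA.
  by rewrite expr0 mulmx1; congr evm; apply/matrixP => i j; rewrite mxE.
 apply/matrixP => i j; rewrite !mxE iterSr.
 have vw: vanishes G (vfield x (r i j) - \sum_l drep r x l j *: r i l).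
  move=> B GB; rewrite mevB_.
  have /matrixP/(_ i j) := evm_vfield_rep GG rr Lx GB; rewrite !mxE => ->.
  by rewrite mev_sum; apply/eqP; rewrite subr_eq0; apply/eqP/eq_bigr => l _; rewrite mevZ_ !mxE mulrC.
 have Dk : iter k (vfield x) (vfield x (r i j) - \sum_l drep r x l j *: r i l) =
   iter k (vfield x) (vfield x (r i j)) - \sum_l drep r x l j *: iter k (vfield x) (r i l).
  pose f : {linear {mpoly C[n * n]} -> {mpoly C[n * n]}} :=
   HB.pack (iter k (vfield x)) (GRing.isLinear.Build C _ _ _ _ (iter_linear (vfield x) k)).
  rewrite -[iter k (vfield x)]/(f : _ -> _) linearB; congr (_ - _).
  by rewrite linear_sum; apply: eq_bigr => k0 _; rewrite linearZ.
 have := vanishes_iter k GG Lx vw GA; rewrite Dk mevB_ => /eqP.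
 rewrite subr_eq0 => /eqP->; rewrite mev_sum.
 transitivity ((evm r A *m drep r x ^+ k *m drep r x) i j); last first.
  by rewrite -mulmxA -[_ *m drep r x]/(_ * _) -exprSr mxE.
 rewrite mxE; apply: eq_bigr => l _; rewrite mevZ_ mulrC; congr (_ * _).
 by have /matrixP/(_ i l) := IH A GA; rewrite !mxE => <-.
have ->: horner_mx (drep r x) q = \sum_(i < size q) q`_i *: drep r x ^+ i.
 rewrite -[in LHS](coefK q) poly_def rmorph_sum; apply: eq_bigr => i _ /=.
 by rewrite linearZ rmorphXn /= horner_mx_X.
rewrite mulmx_sumr; apply/matrixP => i j; rewrite !mxE summxE mev_sum.
apply: eq_bigr => k _; rewrite mevZ_ -scalemxAr -iterE !mxE.
by [].
Qed.

End MatrixGroup.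

(** * Traces and triangular forms *)

Section TraceLemma.
Variables (C : numClosedFieldType) (d' : nat).
Local Notation d := d'.+1.
Implicit Types (A B T : 'M[C]_d).

Lemma trig_mulmx A B : is_trig_mx A -> is_trig_mx B ->
 is_trig_mx (A *m B) /\ forall i, (A *m B) i i = A i i * B i i.
Proof.
move=> /is_trig_mxP tA /is_trig_mxP tB; split.
 apply/is_trig_mxP => i j ij; rewrite mxE big1 // => k _.
 have [ki|ik] := leqP k i; last by rewrite tA ?mul0r.
 by rewrite tB ?mulr0 // (leq_ltn_trans ki).
move=> i; rewrite mxE (bigD1 i) //= big1 ?addr0 // => k ki.
case: (ltngtP k i) => [lt|gt|/ord_inj e]; [by rewrite tB ?mulr0|by rewrite tA ?mul0r|].
by rewrite e eqxx in ki.
Qed.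
Lemma trig_horner_mx T (p : {poly C}) : is_trig_mx T ->
 is_trig_mx (horner_mx T p) /\ forall i, (horner_mx T p) i i = p.[T i i].
Proof.
move=> tT; elim/poly_ind: p => [|p c [tp dp]].
 rewrite rmorph0; split; first exact: mx0_is_trig.
 by move=> i; rewrite mxE horner0.
rewrite rmorphD rmorphM /= horner_mx_X horner_mx_C.
have [/is_trig_mxP tM dM] := trig_mulmx tp tT; split.
 by apply/is_trig_mxP => i j ij; rewrite mxE tM // mxE -val_eqE ltn_eqF ?addr0.
by move=> i; rewrite mxE dM dp !hornerE mxE eqxx.
Qed.
Lemma char_poly_conj (P z : 'M[C]_d) : P \in unitmx -> char_poly (P *m z *m invmx P) = char_poly z.
Proof.
move=> uP; rewrite /char_poly /char_poly_mx !map_mxM.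
have uP' : map_mx polyC P \in unitmx by rewrite map_unitmx.
have ->: 'X%:M - map_mx polyC P *m map_mx polyC z *m map_mx polyC (invmx P)
  = map_mx polyC P *m ('X%:M - map_mx polyC z) *m map_mx polyC (invmx P).
 by rewrite mulmxBr mulmxBl map_invmx mul_mx_scalar -scalemxAl mulmxV ?scalemx1.
by rewrite !det_mulmx mulrAC -det_mulmx map_invmx mulmxV // det1 mul1r.
Qed.

(* The matrix [horner_mx z q] plays the role of the complex conjugate of the semisimple part of
  [z]; the trace is then the sum of the squared moduli of the eigenvalues. *)
Lemma trace_conj_nilpotent (z : 'M[C]_d) (q : {poly C}) :
 (forall l, eigenvalue z l -> q.[l] = l^*) -> 'X^d %| q ->
 \tr (z *m horner_mx z q) = 0 -> z ^+ d = 0 /\ horner_mx z q = 0.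
Proof.
move=> qconj Xq tr0.
have [P /unitarymx_unit uP] := @Schur C d z isT.
rewrite /similar_to /= conjumx // => tT.
set T := P *m z *m invmx P in tT.
have horT (p : {poly C}) : P *m horner_mx z p *m invmx P = horner_mx T p.
 elim/poly_ind: p => [|p c IH]; first by rewrite !rmorph0 mulmx0 mul0mx.
 rewrite !rmorphD !rmorphM /= !horner_mx_X !horner_mx_C -IH mulmxDr mulmxDl.
 congr (_ + _); last by rewrite mul_mx_scalar -scalemxAl mulmxV ?scalemx1.
 by rewrite /T -!mulmxE !mulmxA mulmxKV.
have eigT i : eigenvalue z (T i i).
 rewrite eigenvalue_root_char -(char_poly_conj z uP).
 by rewrite char_poly_trig // rootE horner_prod (bigD1 i) //= hornerXsubC subrr mul0r.
have [tq dq] := trig_horner_mx q tT.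
have trT : \tr (z *m horner_mx z q) = \sum_i T i i * (T i i)^*.
 have [_ dm] := trig_mulmx tT tq.
 have ->: \tr (z *m horner_mx z q) = \tr (T *m horner_mx T q).
  by rewrite -horT /T !mulmxA mulmxKV // [RHS]mxtrace_mulC !mulmxA mulVmx // mul1mx.
 by apply: eq_bigr => i _; rewrite dm dq qconj.
have T0 i : T i i = 0.
 have := tr0; rewrite trT => /eqP; rewrite psumr_eq0 => [|k _]; last exact: mul_conjC_ge0.
 by move/allP/(_ i (mem_index_enum _)); rewrite /= mul_conjC_eq0 => /eqP.
have cz : char_poly z = 'X^d.
 rewrite -(char_poly_conj z uP).
 rewrite char_poly_trig //; under eq_bigr => i _ do rewrite T0 subr0.
 by rewrite prodr_const card_ord.
have zd : z ^+ d = 0.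
 by have := Cayley_Hamilton z; rewrite cz rmorphXn /= horner_mx_X.
split=> //; have /dvdpP[h ->] := Xq.
by rewrite rmorphM rmorphXn /= horner_mx_X zd mulr0.
Qed.

End TraceLemma.

(** * The conjugate of the semisimple part inside the Lie algebra *)

Section Sharp.
Variables (C : numClosedFieldType) (n' : nat).
Local Notation n := n'.+1.
Implicit Types (p q h : {mpoly C[n * n]}) (A B x y : 'M[C]_n).

Definition esub x (l : C) p := vfield x p - l *: p.
Definition geig x l p := exists K, iter K (esub x l) p = 0.

Lemma iter_esub0 x l K : iter K (esub x l) 0 = 0.
Proof. by elim: K => //= K ->; rewrite /esub linear0 scaler0 subrr. Qed.
Lemma iter_esubD x l K p q : iter K (esub x l) (p + q) = iter K (esub x l) p + iter K (esub x l) q.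
Proof.
by elim: K => //= K ->; rewrite /esub linearD scalerDr opprD addrACA.
Qed.
Lemma esubM x l m p q : esub x (l + m) (p * q) = esub x l p * q + p * esub x m q.
Proof.
rewrite /esub vfieldM scalerDl mulrBl mulrBr -scalerAl -scalerAr; ring.
Qed.
(** Generalised eigenvalues add on products, by the Leibniz rule for [esub]. The number [N] only
    bounds the two exponents for the induction. *)
Lemma iter_esubM x l m N K K' p q : (K + K' <= N)%N -> iter K (esub x l) p = 0 -> iter K' (esub x m) q = 0 ->
 iter (K + K') (esub x (l + m)) (p * q) = 0.
Proof.
elim: N K K' p q => [|N IH] [|K] [|K'] p q //=; rewrite ?addn0 ?add0n.
- by move=> _ -> _; rewrite mul0r.
- by move=> _ -> _; rewrite mul0r.
- by move=> _ -> _; rewrite mul0r -iterS iter_esub0.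
- by move=> _ _ ->; rewrite mulr0 -iterS iter_esub0.
rewrite ltnS => le hp hq; rewrite -[LHS]iterS iterSr esubM iter_esubD.
rewrite (IH K K'.+1) //; last by rewrite -iterSr.
by rewrite addnS -addSn (IH K.+1 K') ?addr0 // ?addSnnS // -iterSr.
Qed.
(** On [p], the field of [x'] acts as the complex conjugate of the semisimple part of the field of
    [x]. The decomposition is a list attached to one function, since the space of functions has
    infinite dimension. *)
Definition sharp_good x x' p := exists s : seq (C * {mpoly C[n * n]}), p = \sum_(t <- s) t.2 /\
 forall t, t \in s -> geig x t.1 t.2 /\ vfield x' t.2 = (t.1)^* *: t.2.

Lemma sharp_goodD x x' p q : sharp_good x x' p -> sharp_good x x' q -> sharp_good x x' (p + q).
Proof.
move=> [s [-> hs]] [s' [-> hs']]; exists (s ++ s'); split; first by rewrite big_cat.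
by move=> t; rewrite mem_cat => /orP[/hs|/hs'].
Qed.
Lemma sharp_goodM x x' p q : sharp_good x x' p -> sharp_good x x' q -> sharp_good x x' (p * q).
Proof.
move=> [s [-> hs]] [s' [-> hs']].
exists [seq (t.1 + t'.1, t.2 * t'.2) | t <- s, t' <- s']; split.
 rewrite big_allpairs_dep mulr_suml; apply: eq_bigr => t _.
 by rewrite mulr_sumr.
move=> _ /allpairsP[[t t'] /= [/hs[[K hK] e] /hs'[[K' hK'] e'] ->]] /=; split.
 by exists (K + K')%N; apply: (iter_esubM (leqnn _)).
by rewrite vfieldM e e' rmorphD scalerDl scalerAl scalerAr.
Qed.
Lemma sharp_goodC x x' c : sharp_good x x' c%:MP.
Proof.
exists [:: (0, c%:MP)]; split=> [|t]; first by rewrite big_seq1.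
rewrite inE => /eqP-> /=; rewrite rmorph0 scale0r !vfieldC; split=> //.
by exists 1%N; rewrite /= /esub vfieldC scale0r subrr.
Qed.
Definition linform i (c : 'cV[C]_n) : {mpoly C[n * n]} := \sum_l c l 0 *: 'X_(mxvec_index i l).

Lemma vfield_linform x i c : vfield x (linform i c) = linform i (x *m c).
Proof.
rewrite /linform linear_sum; under eq_bigr => l _ do rewrite linearZ /= vfieldX scaler_sumr.
rewrite exchange_big; apply: eq_bigr => k _; rewrite mxE scaler_suml.
by apply: eq_bigr => l _; rewrite scalerA mulrC.
Qed.
Lemma linformD i c c' : linform i (c + c') = linform i c + linform i c'.
Proof. by rewrite -big_split; apply: eq_bigr => l _; rewrite mxE scalerDl. Qed.
Lemma linformZ i a c : linform i (a *: c) = a *: linform i c.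
Proof. by rewrite scaler_sumr; apply: eq_bigr => l _; rewrite mxE scalerA. Qed.
Lemma iter_esub_linform x l K i c : iter K (esub x l) (linform i c) = linform i ((x - l%:M) ^+ K *m c).
Proof.
elim: K => [|K IH]; first by rewrite expr0 mul1mx.
rewrite iterS IH /esub vfield_linform exprS -[_ * _]/(_ *m _) -mulmxA mulmxBl mul_scalar_mx.
by rewrite linformD -[X in _ = _ + linform _ X]scaleN1r !linformZ scaleN1r.
Qed.
(** [x'] is a polynomial [Q] of [x], where [Q] is congruent to the conjugate of each eigenvalue.
    Linear forms in the entries split along the spectral projections of [x]; sums and products
    follow, because both fields are derivations and conjugation is additive. *)
Lemma sharp_exists x : exists x', forall p, sharp_good x x' p.
Proof.
have [rs Drs] := closed_field_poly_normal (char_poly x).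
rewrite (monicP (char_poly_monic x)) scale1r in Drs.
have srs : size rs = n.
 by apply/eqP; rewrite -eqSS -(size_char_poly x) Drs size_prod_XsubC.
pose s := undup rs; pose M := \prod_(b <- s) ('X - b%:P) ^+ n.
have M0 : horner_mx x M = 0.
 suff /dvdpP[h ->] : char_poly x %| M by rewrite rmorphM /= Cayley_Hamilton mulr0.
 rewrite Drs -big_undup_iterop_count /M /s.
 elim: (undup rs) => [|a t IH]; first by rewrite !big_nil dvdpp.
 rewrite !big_cons dvdp_mul // -[iterop _ _ _ _]/(_ ^+ _).
 by apply: dvdp_exp2l; rewrite -srs count_size.
have s0 : s != [::].
 apply/negP => /eqP/undup_nil rs0; by rewrite rs0 in srs.
have [e [e1 eM]] := partial_fractions n (undup_uniq rs) s0.
have [Q HQ] := interpolation rs n (fun z => z^*).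
exists (horner_mx x Q) => p; elim/mpoly_alg_ind: p => [c|k|p q|p q].
- exact: sharp_goodC.
- case/mxvec_indexP: k => i j.
 pose ec a : 'cV[C]_n := horner_mx x (e a) *m delta_mx j 0.
 exists [seq (a, linform i (ec a)) | a <- s]; split.
  rewrite big_map /= -[LHS]/(_ : {mpoly C[n * n]}).
  have ->: \sum_(a <- s) linform i (ec a) = linform i (\sum_(a <- s) ec a).
   elim: (s) => [|a t IH]; rewrite ?big_nil ?big_cons ?linformD ?IH //.
   by rewrite /linform big1 // => l _; rewrite mxE scale0r.
  rewrite -mulmx_suml -rmorph_sum /= e1 rmorph1 mul1mx /linform (bigD1 j) //= big1.
   by rewrite addr0 mxE !eqxx scale1r.
  by move=> l lj; rewrite mxE (negPf lj) scale0r.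
 move=> _ /mapP[a a_s ->] /=.
 have key : (x - a%:M) ^+ n *m ec a = 0.
  have ->: (x - a%:M) ^+ n = horner_mx x (('X - a%:P) ^+ n).
   by rewrite rmorphXn rmorphB /= horner_mx_X horner_mx_C.
  rewrite /ec mulmxA -[_ *m horner_mx _ _]/(_ * _) -rmorphM /=.
  by have /dvdpP[h ->] := eM a a_s; rewrite rmorphM /= -/M M0 mulr0 mul0mx.
 split; first by exists n; rewrite iter_esub_linform key /linform big1 // => l _; rewrite mxE scale0r.
 rewrite vfield_linform -linformZ; congr linform.
 have /dvdpP[h hE] := HQ a (etrans (esym (mem_undup _ _)) a_s).
 have ->: Q = h * ('X - a%:P) ^+ n + (a^*)%:P by rewrite -hE subrK.
 rewrite rmorphD rmorphM /= mulmxDl horner_mx_C mul_scalar_mx.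
 have ->: horner_mx x (('X - a%:P) ^+ n) = (x - a%:M) ^+ n.
  by rewrite rmorphXn rmorphB /= horner_mx_X horner_mx_C.
 by rewrite -[_ * _]/(_ *m _) -mulmxA key mulmx0 add0r.
- exact: sharp_goodD.
- exact: sharp_goodM.
Qed.
(** On finitely many functions only finitely many eigenvalues occur, and interpolation at these
    expresses the field of [x'] by that of [x]. The list [L] imposes the same congruence at further
    values, such as the eigenvalues of a matrix of a representation. *)
Lemma sharp_polyop x x' (ps : seq {mpoly C[n * n]}) (L : seq C) K : (forall p, sharp_good x x' p) ->
 exists Q : {poly C}, (forall p, p \in ps -> vfield x' p = polyop (vfield x) Q p) /\
  forall l, l \in L -> ('X - l%:P) ^+ K %| Q - (l^*)%:P.
Proof.
move=> good.
have [N [L' [KN HN]]] : exists N (L' : seq C), (K <= N)%N /\ forall p, p \in ps ->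
  exists s : seq (C * {mpoly C[n * n]}), p = \sum_(t <- s) t.2 /\
   forall t, t \in s -> [/\ iter N (esub x t.1) t.2 = 0, t.1 \in L' & vfield x' t.2 = (t.1)^* *: t.2].
 elim: ps => [|p ps [N [L' [KN IH]]]]; first by exists K, [::].
 have [s [Ds hs]] := good p.
 have [N1 HN1] : exists N1, forall t, t \in s -> iter N1 (esub x t.1) t.2 = 0.
  elim: {Ds} s hs => [|t s IHs] hs; first by exists 0%N.
  have [|N2 HN2] := IHs; first by move=> u us; apply: hs; rewrite inE us orbT.
  have [[K1 hK1] _] := hs t (mem_head _ _).
  exists (N2 + K1)%N => u; rewrite inE => /orP[/eqP->|/HN2 u0].
   by rewrite iterD hK1 iter_esub0.
  by rewrite addnC iterD u0 iter_esub0.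
 exists (N + N1)%N, ([seq t.1 | t <- s] ++ L'); split; first exact: leq_trans KN (leq_addr _ _).
 move=> q; rewrite inE => /orP[/eqP->|/IH[s' [Ds' hs']]].
  exists s; split=> // t ts; split; last by case: (hs t ts).
  - by rewrite iterD HN1 // iter_esub0.
  - by rewrite mem_cat map_f.
 exists s'; split=> // t ts; have [h1 h2 h3] := hs' t ts; split=> //.
 - by rewrite addnC iterD h1 iter_esub0.
 - by rewrite mem_cat h2 orbT.
have [Q HQ] := interpolation (L' ++ L) N (fun z => z^*).
exists Q; split=> [p /HN[s [-> hs]]|l lL]; last first.
 apply: dvdp_trans (HQ l _); last by rewrite mem_cat lL orbT.
 exact: dvdp_exp2l.
rewrite linear_sum /=; elim: s hs => [|t s IH] hs.
 by rewrite !big_nil -[0](scale0r 0) polyopZr !scale0r.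
rewrite !big_cons polyopDr IH => [|u us]; last by apply: hs; rewrite inE us orbT.
have [h1 h2 ->] := hs t (mem_head _ _); congr (_ + _).
by rewrite (@polyop_geig _ _ _ t.1 (t.1^*) N) // HQ // mem_cat h2.
Qed.
(** The replica argument of Chevalley: the space of equations of [G] is stable under the field of
    [x], hence under every polynomial of it, and on a given equation the field of [x'] is such a
    polynomial. *)
Lemma sharp_lie G x x' : matrix_group G -> (forall p, sharp_good x x' p) -> lie G x -> lie G x'.
Proof.
move=> GG good Lx p vp.
have [Q [/(_ p (mem_head _ _))-> _]] := sharp_polyop [:: p] [::] 0 good.
have vG := mgrp1 GG; move: {vG}(1%:M : 'M[C]_n) vG.
apply: (@polyop_stable _ _ (vfield x) (vanishes G)) => //.
- by move=> A _; rewrite -(scale0r 0) mevZ_ mul0r.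
- by move=> u v hu hv A GA; rewrite mevD_ hu ?hv ?addr0.
- by move=> c u hu A GA; rewrite mevZ_ hu ?mulr0.
- by move=> u hu; apply: vanishes_vfield.
Qed.
Lemma sharp_drep G x x' d (r : 'M[{mpoly C[n * n]}]_d.+1) (L : seq C) K :
 matrix_group G -> (forall p, sharp_good x x' p) -> lie G x -> is_rep G r ->
 exists Q : {poly C}, drep r x' = horner_mx (drep r x) Q /\
  forall l, l \in L -> ('X - l%:P) ^+ K %| Q - (l^*)%:P.
Proof.
move=> GG good Lx rr.
have [Q [HQ HL]] := sharp_polyop [seq r ij.1 ij.2 | ij : 'I_d.+1 * 'I_d.+1] L K good.
exists Q; split=> //; have := evm_polyop_rep Q GG rr Lx (mgrp1 GG).
rewrite rr.1 mul1mx => <-; apply/matrixP => i j; rewrite !mxE HQ //.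
by apply/mapP; exists (i, j); rewrite ?mem_enum.
Qed.

End Sharp.

(** A subspace of largest dimension among those contained in [P] is all of [P]. It supplies bases
    and dimensions for spaces that are given by conditions. *)
Lemma subspace_vspace (F : fieldType) (V : vectType F) (P : V -> Prop) :
 P 0 -> (forall c u v, P u -> P v -> P (c *: u + v)) -> exists U : {vspace V}, forall v, v \in U <-> P v.
Proof.
move=> P0 PL; pose Q k := `[< exists U : {vspace V}, \dim U = k /\ forall v, v \in U -> P v >].
have exQ : exists k, Q k.
 by exists 0%N; apply/asboolP; exists 0%VS; rewrite dimv0; split=> // v; rewrite memv0 => /eqP->.
have bQ k : Q k -> (k <= \dim {:V})%N.
 by move=> /asboolP[U [<- _]]; apply/dimvS/subvf.
case: (ex_maxnP exQ bQ) => k /asboolP[U [dU PU]] max; exists U => v; split; first exact: PU.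
move=> Pv; apply/negPn/negP => vU.
have : Q k.+1.
 apply/asboolP; exists (U + <[v]>)%VS; split.
  rewrite dimv_disjoint_sum ?dU ?dim_vline; last first.
   apply/eqP; rewrite -subv0; apply/subvP => w /memv_capP[wU /vlineP[c wE]].
   rewrite memv0; apply/eqP; have [c0|c0] := eqVneq c 0; first by rewrite wE c0 scale0r.
   by case/negP: vU; rewrite -[v](scalerK c0) -wE memvZ.
  by case: eqP vU => [->|_ _]; rewrite ?mem0v ?addn1.
 move=> _ /memv_addP[u uU [w /vlineP[c ->] ->]]; rewrite addrC.
 by apply: PL => //; apply: PU.
by move=> /max; rewrite ltnn.
Qed.
Lemma trace_nilpotent (C : numClosedFieldType) d (z : 'M[C]_d.+1) N : z ^+ N = 0 -> \tr z = 0.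
Proof.
move=> zN; have [P /unitarymx_unit uP] := @Schur C d.+1 z isT.
rewrite /similar_to /= conjumx // => tT; set T := P *m z *m invmx P in tT.
have ->: \tr z = \tr T by rewrite /T mxtrace_mulC mulmxA mulVmx // mul1mx.
apply: big1 => i _; have [_ dT] := trig_horner_mx 'X^N tT.
have := dT i; rewrite rmorphXn /= horner_mx_X hornerXn.
have ->: T ^+ N = P *m z ^+ N *m invmx P.
 elim: (N) => [|k IH]; first by rewrite !expr0 mulmx1 mulmxV.
 by rewrite !exprSr IH -!mulmxE /T !mulmxA mulmxKV.
by rewrite zN mulmx0 mul0mx mxE => /esym/eqP; rewrite expf_eq0 => /andP[_ /eqP].
Qed.

(** * Fitting idempotents and Casimir elements *)

Section Fitting.
Variables (C : numClosedFieldType) (d' : nat).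
Local Notation d := d'.+1.

(** [e] projects onto the generalised eigenspaces of the nonzero eigenvalues of [W]. Being [W] times
    a polynomial of [W], it kills whatever [W] kills and commutes with whatever [W] commutes
    with. *)
Lemma fitting_idempotent (W : 'M[C]_d) : (forall N, W ^+ N <> 0) ->
 exists w : {poly C}, let e := W *m horner_mx W w in e *m e = e /\ e <> 0.
Proof.
move=> nW; have [k [h hp]] := multiplicity_XsubC (char_poly W) 0.
have ch0 : char_poly W != 0 by rewrite monic_neq0 ?char_poly_monic.
move: hp; rewrite ch0 /= subr0 => h0 Dc.
have cop : coprimep ('X^(k.+1)) h.
 by apply: coprimep_expl; rewrite coprimep_sym -['X]subr0 coprimep_XsubC.
have [[u v] /= uv] := Bezout_eq1_coprimepP _ _ cop.
exists (u * 'X^k).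
have eE : W *m horner_mx W (u * 'X^k) = horner_mx W (u * 'X^(k.+1)).
 by rewrite [in RHS]exprS [in RHS]mulrCA [RHS]rmorphM /= horner_mx_X mulmxE.
have Wk : W ^+ k *m horner_mx W h = 0.
 have := Cayley_Hamilton W; rewrite Dc [h * _]mulrC rmorphM rmorphXn /= horner_mx_X.
 by [].
have uv1 : horner_mx W (u * 'X^(k.+1)) + horner_mx W (v * h) = 1%:M.
 by rewrite -rmorphD uv rmorph1.
rewrite /= eE; split.
 apply/eqP; rewrite -subr_eq0 -[X in _ - X]mulmx1 -mulmxBr -uv1 opprD addNKr mulmxN oppr_eq0.
 have ->: horner_mx W (u * 'X^(k.+1)) *m horner_mx W (v * h) =
   horner_mx W (u * 'X * v) *m (W ^+ k *m horner_mx W h).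
  have ->: W ^+ k = horner_mx W 'X^k by rewrite rmorphXn /= horner_mx_X.
  by rewrite !mulmxE -!rmorphM /= exprS; congr horner_mx; ring.
 by rewrite Wk mulmx0.
move=> e0; apply: (nW k).
rewrite -[W ^+ k]mulmx1 -uv1 e0 add0r.
have ->: horner_mx W (v * h) = horner_mx W h *m horner_mx W v by rewrite mulrC rmorphM.
by rewrite mulmxA Wk mul0mx.
Qed.

End Fitting.

Section Casimir.
Variables (C : numClosedFieldType) (d' : nat).
Local Notation d := d'.+1.

(** The Casimir element for the trace form on [T]. Its trace is the dimension of [T], so it is not
    nilpotent; it is independent of the basis, so it commutes with every [u] that normalises [T]. *)
Lemma casimir (T : {vspace 'M[C]_d}) :
 T != 0%VS -> (forall t, t \in T -> (forall s, s \in T -> \tr (t *m s) = 0) -> t = 0) ->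
 exists W : 'M[C]_d, [/\ forall N, W ^+ N <> 0,
  exists (k : nat) (a b : 'I_k -> 'M[C]_d), (forall i, a i \in T /\ b i \in T) /\ W = \sum_i a i *m b i
  & forall u, u \in unitmx -> (forall t, t \in T -> u *m t *m invmx u \in T) -> u *m W = W *m u].
Proof.
move=> T0 nd; pose k := \dim T; pose t : k.-tuple _ := vbasis T.
have tT i : t`_i \in T.
 have [ik|ik] := ltnP i k; last by rewrite nth_default ?size_tuple ?mem0v.
 by apply: vbasis_mem; rewrite mem_nth ?size_tuple.
pose Gm : 'M[C]_k := \matrix_(i, j) \tr (t`_i *m t`_j).
have symG : Gm^T = Gm by apply/matrixP => i j; rewrite !mxE mxtrace_mulC.
have bT : basis_of T t by apply: vbasisP.
(* A vector in the kernel of the Gram matrix gives an element of [T] orthogonal to all of [T]. *)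
have uG : Gm \in unitmx.
 rewrite -row_free_unit -kermx_eq0; apply/eqP/row_matrixP => i0.
 rewrite row0; set v := row i0 _.
 have vG : v *m Gm = 0 by apply/sub_kermxP; rewrite row_sub.
 suff s0 : \sum_i v 0 i *: t`_i = 0.
  have /freeP fr := basis_free bT.
  by apply/rowP => i; rewrite [RHS]mxE; apply: (fr (fun i => v 0 i)).
 apply: nd => [|s sT]; first by apply: memv_suml => i _; rewrite memvZ.
 rewrite (coord_basis bT sT) mulmx_sumr raddf_sum big1 //= => j _.
 rewrite -scalemxAr mxtraceZ mulmx_suml raddf_sum /=.
 have := congr1 (fun M : 'rV_k => M 0 j) vG; rewrite mxE mxE => vj.
 rewrite (eq_bigr (fun i => v 0 i * Gm i j)) ?vj ?mulr0 // => i _.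
 by rewrite -scalemxAl mxtraceZ [Gm i j]mxE.
pose H := invmx Gm.
have symH : H^T = H by rewrite /H trmx_inv symG.
pose W := \sum_(ij : 'I_k * 'I_k) (H ij.1 ij.2 *: t`_(ij.1)) *m t`_(ij.2).
have k0 : (0 < k)%N by rewrite lt0n dimv_eq0.
exists W; split.
- move=> N WN; have := trace_nilpotent WN.
 have ->: \tr W = \tr (H *m Gm).
  rewrite /W raddf_sum /= -(pair_bigA _ (fun i j => \tr ((H i j *: t`_i) *m t`_j))) /=.
  apply: eq_bigr => i _; rewrite mxE; apply: eq_bigr => j _.
  by rewrite -scalemxAl mxtraceZ -[in RHS]symG !mxE.
 rewrite mulVmx // mxtrace1 => /eqP; rewrite pnatr_eq0 => /eqP k00.
 by rewrite k00 in k0.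
- pose N := #|{: 'I_k * 'I_k}|.
 exists N, (fun i => H (enum_val i).1 (enum_val i).2 *: t`_(enum_val i).1),
  (fun i => t`_(enum_val (A := {: 'I_k * 'I_k}) i).2); split.
  by move=> i; rewrite memvZ.
 by rewrite /W (reindex _ (onW_bij _ (enum_val_bij _))).
move=> u uu uT.
pose M : 'M[C]_k := \matrix_(i, j) coord t j (u *m t`_i *m invmx u).
have DM (i : 'I_k) : u *m t`_i *m invmx u = \sum_j M i j *: t`_j.
 rewrite [LHS](coord_basis bT (uT _ (tT i))); apply: eq_bigr => j _.
 by rewrite mxE.
(* Conjugation by [u] preserves traces, so its matrix [M] is orthogonal for the trace form; [MH]
   below is the dual relation for the inverse Gram matrix, which is the invariance of [W]. *)
have MG : M *m Gm *m M^T = Gm.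
 apply/matrixP => i j; rewrite [RHS]mxE.
 have ->: \tr (t`_i *m t`_j) = \tr ((u *m t`_i *m invmx u) *m (u *m t`_j *m invmx u)).
  by rewrite !mulmxA mulmxKV // [RHS]mxtrace_mulC !mulmxA mulVmx // mul1mx.
 have ->: (M *m Gm *m M^T) i j = \sum_a \sum_b M i a * Gm a b * M j b.
  rewrite [LHS]mxE; under eq_bigr => b _ do rewrite [(M *m Gm) i b]mxE mulr_suml.
  by rewrite exchange_big; apply: eq_bigr => a _; apply: eq_bigr => b _; rewrite [M^T _ _]mxE.
 rewrite !DM mulmx_suml raddf_sum /=; apply: eq_bigr => a _.
 rewrite -scalemxAl mxtraceZ mulmx_sumr raddf_sum /= mulr_sumr; apply: eq_bigr => b _.
 by rewrite -scalemxAr mxtraceZ [Gm a b]mxE mulrA mulrAC.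
have uM : M \in unitmx.
 have := uG; rewrite -{1}MG !unitmx_mul => /andP[/andP[]] //.
have MH : M^T *m H *m M = H.
 have e : M *m Gm *m M^T *m H *m M = M by rewrite MG mulmxV // mul1mx.
 have e2 : Gm *m (M^T *m H *m M) = 1%:M.
  apply: (can_inj (mulKmx uM)); rewrite mulmx1 -[RHS]e !mulmxA. by [].
 by rewrite -[LHS](mulKmx uG) e2 mulmx1.
suff : u *m W *m invmx u = W by move=> e; rewrite -[in RHS]e mulmxKV.
rewrite /W mulmx_sumr mulmx_suml.
rewrite -(pair_bigA _ (fun i j => (H i j *: t`_i) *m t`_j)) /=.
rewrite -(pair_bigA _ (fun i j => u *m ((H i j *: t`_i) *m t`_j) *m invmx u)) /=.
have E (i j : 'I_k) : u *m ((H i j *: t`_i) *m t`_j) *m invmx u =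
  \sum_a \sum_b (M i a * H i j * M j b) *: (t`_a *m t`_b).
 have ->: u *m ((H i j *: t`_i) *m t`_j) *m invmx u =
  H i j *: ((u *m t`_i *m invmx u) *m (u *m t`_j *m invmx u)).
  by rewrite !mulmxA mulmxKV // -scalemxAr -!scalemxAl.
 rewrite !DM mulmx_suml scaler_sumr; apply: eq_bigr => a _.
 rewrite mulmx_sumr scaler_sumr; apply: eq_bigr => b _.
 by rewrite -scalemxAl -scalemxAr !scalerA; congr (_ *: _); ring.
under eq_bigr => i _ do under eq_bigr => j _ do rewrite E.
under eq_bigr => i _ do rewrite exchange_big.
rewrite exchange_big; apply: eq_bigr => a _ /=.
under eq_bigr => i _ do rewrite exchange_big.
rewrite exchange_big; apply: eq_bigr => b _ /=.
rewrite -scalemxAl -[in RHS]MH.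
have ->: (M^T *m H *m M) a b = \sum_i \sum_j M i a * H i j * M j b.
 rewrite [LHS]mxE; under eq_bigr => j _ do rewrite [(M^T *m H) a j]mxE mulr_suml.
 by rewrite exchange_big; apply: eq_bigr => i _; apply: eq_bigr => j _; rewrite [M^T _ _]mxE.
rewrite scaler_suml; apply: eq_bigr => i _; rewrite scaler_suml.
by [].
Qed.

End Casimir.

Lemma mulmx3E (C : comNzRingType) a b c d (U : 'M[C]_(a, b)) (M : 'M_(b, c)) (V : 'M_(c, d)) i j :
 (U *m M *m V) i j = \sum_k \sum_l (U i k * V l j) * M k l.
Proof.
rewrite mxE; under eq_bigr => l _ do rewrite mxE mulr_suml.
by rewrite exchange_big; apply: eq_bigr => k _; apply: eq_bigr => l _; ring.
Qed.

(** * Adjoint action and the radical of a trace form *)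

Section Adjoint.
Variables (C : numClosedFieldType) (n' : nat).
Local Notation n := n'.+1.
Implicit Types (p q h : {mpoly C[n * n]}) (A B x y : 'M[C]_n).

Definition rtrans B p : {mpoly C[n * n]} :=
 p \mPo [tuple mxvec (\matrix_(i, j) \sum_l B l j *: 'X_(mxvec_index i l)
      : 'M[{mpoly C[n * n]}]_n) 0 k | k < n * n].

Lemma mev_rtrans B p A : mev (rtrans B p) A = mev p (A *m B).
Proof.
rewrite /mev comp_mpoly_meval; apply: meval_eq => k; rewrite tnth_mktuple.
case/mxvec_indexP: k => i j; rewrite !mxvecE !mxE rmorph_sum /=.
by apply: eq_bigr => l _; rewrite mevalZ mevalXU mxvecE mulrC.
Qed.
Lemma mev_vfield_rtrans x B B' p A : B *m B' = 1%:M ->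
 mev (vfield x (rtrans B p)) A = mev (vfield (B' *m x *m B) p) (A *m B).
Proof.
move=> BB; rewrite !mev_vfield_curve; congr (_^`().[0]); rewrite /rtrans /comp_mpoly.
have ->: A *m B *m (B' *m x *m B) = A *m x *m B.
 by rewrite !mulmxA -[A *m B *m B']mulmxA BB mulmx1.
elim/mpoly_alg_ind: p => [c|k|p q IHp IHq|p q IHp IHq].
- by rewrite !mmapC.
- rewrite !mmapX !mmap1U tnth_mktuple; case/mxvec_indexP: k => i j.
 rewrite mxvecE mxE raddf_sum /= /pcurve !mxvecE !(mxE _ _ i j) rmorph_sum scaler_suml.
 rewrite -big_split.
 apply: eq_bigr => l _ /=; rewrite mmapZ mmapX mmap1U /pcurve !mxvecE mulrDr -!mul_polyC.
 by rewrite !polyCM; ring.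
- by rewrite !mmapD IHp IHq.
- by rewrite !rmorphM /= IHp IHq.
Qed.
Lemma mgrp_unit G A : matrix_group G -> G A -> A \in unitmx.
Proof. by move=> GG GA; have [J /(_ A GA)[_ AJ _]] := mgrpV GG; case/mulmx1_unit: AJ. Qed.
Lemma mgrp_inv G A : matrix_group G -> G A -> G (invmx A).
Proof.
move=> GG GA; have [J /(_ A GA)[GJ AJ _]] := mgrpV GG.
by rewrite -[invmx A]mulmx1 -AJ mulKmx ?(mgrp_unit GG).
Qed.
(** Conjugation combines a left and a right translation, and both map equations of [G] to equations
    of [G]. *)
Lemma lie_Ad G A x : matrix_group G -> G A -> lie G x -> lie G (A *m x *m invmx A).
Proof.
move=> GG GA Lx p vp; have uA := mgrp_unit GG GA.
have := Lx (ltrans A (rtrans (invmx A) p)).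
rewrite mev_vfield_ltrans mulmx1 (mev_vfield_rtrans _ _ _ (mulVmx uA)) mulmxV //; apply.
by move=> B GB; rewrite mev_ltrans mev_rtrans vp //; do !apply: mgrpM => //; apply: mgrp_inv.
Qed.
Lemma drep_Ad G d r A x : matrix_group G -> @is_rep C n' G d r -> G A -> lie G x ->
 drep r (A *m x *m invmx A) = evm r A *m drep r x *m evm r (invmx A).
Proof.
move=> GG rr GA Lx; have uA := mgrp_unit GG GA; apply/matrixP => i j.
pose q := \sum_k \sum_l (mev (r i k) A * mev (r l j) (invmx A)) *: r k l.
have := Lx (ltrans A (rtrans (invmx A) (r i j)) - q).
rewrite linearB /= mevB_ mev_vfield_ltrans mulmx1.
rewrite (mev_vfield_rtrans _ _ _ (mulVmx uA)) mulmxV // => H.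
have {H}: mev (vfield (A *m x *m invmx A) (r i j)) 1%:M - mev (vfield x q) 1%:M = 0.
 apply: H => B GB; rewrite mevB_ mev_ltrans mev_rtrans.
 have /matrixP/(_ i j) : evm r (A *m B *m invmx A) = evm r A *m evm r B *m evm r (invmx A).
  by rewrite !rr.2 //; [apply: mgrpM | apply: mgrp_inv].
 rewrite [LHS]mxE => ->; apply/eqP; rewrite subr_eq0; apply/eqP.
 rewrite mulmx3E mev_sum; apply: eq_bigr => k _; rewrite mev_sum.
 by apply: eq_bigr => l _; rewrite mevZ_ !mxE.
move/eqP; rewrite subr_eq0 [LHS]mxE mxE => /eqP->; rewrite linear_sum mev_sum mulmx3E.
apply: eq_bigr => k _ /=; rewrite linear_sum mev_sum.
by apply: eq_bigr => l _; rewrite linearZ /= mevZ_ !mxE.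
Qed.
(** The constant disappears under differentiation at the identity. Stability of subspaces and
    commutation pass from the group to the Lie algebra through this lemma. *)
Lemma drep_linear_cond G d (r : 'M[{mpoly C[n * n]}]_d) x (f : 'I_d -> 'I_d -> C) (c : C) :
 (forall A, G A -> \sum_i \sum_j f i j * evm r A i j = c) -> lie G x ->
 \sum_i \sum_j f i j * drep r x i j = 0.
Proof.
move=> H Lx; have E0 : mev (vfield x (\sum_i \sum_j f i j *: r i j - c%:MP)) 1%:M = 0.
 apply: Lx => A GA; rewrite mevB_ mevC_ -(H A GA); apply/eqP; rewrite subr_eq0; apply/eqP.
 rewrite mev_sum; apply: eq_bigr => i _; rewrite mev_sum; apply: eq_bigr => j _.
 by rewrite mevZ_ !mxE.
rewrite -[RHS]E0 linearB /= vfieldC subr0 linear_sum mev_sum.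
apply: eq_bigr => i _; rewrite linear_sum mev_sum; apply: eq_bigr => j _.
by rewrite linearZ /= mevZ_ !mxE.
Qed.
Lemma drep_mulmx_cond G d (r : 'M[{mpoly C[n * n]}]_d) x a b (U : 'M_(a, d)) (V : 'M_(d, b)) W :
 (forall A, G A -> U *m evm r A *m V = W) -> lie G x -> U *m drep r x *m V = 0.
Proof.
move=> H Lx; apply/matrixP => i j; rewrite [RHS]mxE.
rewrite mulmx3E; apply: (drep_linear_cond (G := G) (c := W i j)) => // A GA.
by rewrite -mulmx3E H.
Qed.
Lemma drep_comm G d (r : 'M[{mpoly C[n * n]}]_d) x (P : 'M_d) :
 (forall A, G A -> P *m evm r A = evm r A *m P) -> lie G x -> P *m drep r x = drep r x *m P.
Proof.
move=> H Lx; apply/eqP; rewrite -subr_eq0; apply/eqP/matrixP => i j; rewrite [RHS]mxE.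
have E (M : 'M[C]_d) : (P *m M - M *m P) i j = \sum_k \sum_l (P i k *+ (l == j) - P l j *+ (k == i)) * M k l.
 rewrite mxE [in X in _ + X]mxE !mxE; under [RHS]eq_bigr => k _ do
  [under eq_bigr => l _ do rewrite mulrBl; rewrite sumrB].
 rewrite sumrB; congr (_ - _).
  by apply: eq_bigr => k _; rewrite (bigD1 j) //= eqxx big1 ?addr0 // => l /negPf->; rewrite mul0r.
 rewrite [RHS](bigD1 i) //= [X in _ = _ + X]big1 ?addr0 => [|k /negPf ki].
  by apply: eq_bigr => l _; rewrite eqxx mulrC.
 by apply: big1 => l _; rewrite ki mul0r.
rewrite E; apply: (drep_linear_cond (G := G) (c := 0)) => // A GA.
by rewrite -E H // subrr mxE.
Qed.
Definition stdrep : 'M[{mpoly C[n * n]}]_n := \matrix_(i, j) 'X_(mxvec_index i j).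

Lemma evm_stdrep A : evm stdrep A = A.
Proof. by apply/matrixP => i j; rewrite !mxE mevX_. Qed.
Lemma stdrepP G : is_rep G stdrep.
Proof. by split=> *; rewrite !evm_stdrep. Qed.
Lemma drep_std x : drep stdrep x = x.
Proof.
apply/matrixP => i j; rewrite !mxE vfieldX mev_sum (bigD1 i) //= big1 ?addr0 => [|l li].
 by rewrite mevZ_ mevX_ mxE eqxx mulr1.
by rewrite mevZ_ mevX_ mxE eq_sym (negPf li) mulr0.
Qed.
(** The form that reductivity takes on the Lie algebra; the ideals are those stable under
    conjugation by the whole group, not only by its identity component. *)
Definition nil_ideals_trivial G := forall N : {vspace 'M[C]_n}, (forall x, x \in N -> lie G x) ->
 (forall A x, G A -> x \in N -> A *m x *m invmx A \in N) -> (forall x, x \in N -> x ^+ n = 0) -> N = 0%VS.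

(** The factor ['X] removes the constant term, which would contribute a scalar matrix instead of a
    multiple of [P]. *)
Lemma horner_mx_idem d (P y : 'M[C]_d.+1) (Q : {poly C}) :
 P *m P = P -> P *m y = y *m P -> 'X %| Q -> horner_mx (P *m y) Q = P *m horner_mx y Q.
Proof.
move=> PP Py /dvdpP[h ->]; have comm k : P *m y ^+ k = y ^+ k *m P.
 elim: k => [|k IH]; first by rewrite expr0 mulmx1 mul1mx.
 by rewrite exprS -mulmxE mulmxA Py -mulmxA IH mulmxA.
elim/poly_ind: h => [|h c IH]; first by rewrite mul0r !rmorph0 mulmx0.
rewrite mulrDl !rmorphD mulmxDr /=; congr (_ + _); last first.
 by rewrite !rmorphM /= !horner_mx_C !horner_mx_X -!mulmxE !mul_scalar_mx scalemxAr.
rewrite [in LHS]rmorphM [in RHS]rmorphM /= IH !horner_mx_X -!mulmxE.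
have Ph : horner_mx y (h * 'X) *m P = P *m horner_mx y (h * 'X).
 by apply/esym/comm_mx_horner.
by rewrite mulmxA -[P *m _ *m P]mulmxA Ph mulmxA PP mulmxA.
Qed.
Lemma eig_list d (z : 'M[C]_d) : exists s : seq C, forall l, eigenvalue z l -> l \in s.
Proof.
have [rs D] := closed_field_poly_normal (char_poly z); exists rs => l.
rewrite eigenvalue_root_char D rootZ ?root_prod_XsubC //.
by rewrite (monicP (char_poly_monic z)) oner_eq0.
Qed.

(* [x'] below is the element of the Lie algebra conjugate to the semisimple part of [x]. *)
Lemma sharp_trace G d (r : 'M[{mpoly C[n * n]}]_d.+1) P x x' :
 matrix_group G -> (forall p, sharp_good x x' p) -> is_rep G r -> lie G x ->
 P *m P = P -> (forall A, G A -> P *m evm r A = evm r A *m P) -> \tr (P *m drep r x *m drep r x') = 0 ->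
 (P *m drep r x) ^+ d.+1 = 0 /\ P *m drep r x' = 0.
Proof.
move=> GG good rr Lx PP Pr tr0; set y := drep r x in tr0 *.
have Py : P *m y = y *m P by apply: drep_comm Pr Lx.
have [s1 hs1] := eig_list (P *m y).
have [Q [DQ HQ]] := sharp_drep (0 :: s1) d.+1 GG good Lx rr.
rewrite -/y in DQ; rewrite DQ in tr0 *.
have XQ : 'X^(d.+1) %| Q.
 by have := HQ 0 (mem_head _ _); rewrite conjC0 polyC0 !subr0.
have X1Q : 'X %| Q by apply: dvdp_trans XQ; rewrite -{1}[ 'X]expr1 dvdp_exp2l.
rewrite -horner_mx_idem //; apply: trace_conj_nilpotent => //.
 move=> l /hs1 ls; have := HQ l; rewrite inE ls orbT => /(_ isT).
 move/(dvdp_trans (dvdp_exp2l _ (ltn0Sn d))); rewrite expr1 dvdp_XsubCl rootE hornerD hornerN hornerC.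
 by rewrite subr_eq0 => /eqP.
by rewrite horner_mx_idem // mulmxA Py -[y *m P *m P]mulmxA PP -Py.
Qed.
(** Let [rad] be the radical of the trace form, [a] the kernel of [P *m drep r], and [b] the
    orthogonal of [a] in [rad] for the trace of products of matrices. For [x] in [b] the element
    [x'] lies in [a] by [sharp_trace], so [x *m x'] has trace 0 and [x] is nilpotent. Hence [b] is a
    nilpotent ideal, so it is 0, and [rad] embeds in the dual of [a]; as [a] is contained in [rad],
    they are equal. *)
Lemma radical_kernel G d (r : 'M[{mpoly C[n * n]}]_d.+1) P :
 matrix_group G -> nil_ideals_trivial G -> is_rep G r ->
 P *m P = P -> (forall A, G A -> P *m evm r A = evm r A *m P) -> forall x, lie G x ->
 (forall y, lie G y -> \tr (P *m drep r x *m drep r y) = 0) -> P *m drep r x = 0.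
Proof.
move=> GG NI rr PP Pr.
have rV A : G A -> evm r A *m evm r (invmx A) = 1%:M /\ evm r (invmx A) *m evm r A = 1%:M.
 move=> GA; have uA := mgrp_unit GG GA; have GV := mgrp_inv GG GA.
 by rewrite -!rr.2 // mulmxV // mulVmx // rr.1.
pose inrad x := lie G x /\ forall y, lie G y -> \tr (P *m drep r x *m drep r y) = 0.
have [rad Hrad] : exists U : {vspace 'M[C]_n}, forall v, v \in U <-> inrad v.
 apply: subspace_vspace.
  by split=> [|y _]; rewrite ?linear0 ?mulmx0 ?mul0mx ?mxtrace0 //; apply: lie0.
 move=> c u v [Lu hu] [Lv hv]; split=> [|y Ly]; first exact/lieD/Lv/lieZ.
 by rewrite linearP mulmxDr mulmxDl -scalemxAr -scalemxAl mxtraceD mxtraceZ hu ?hv ?mulr0 ?addr0.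
pose ina x := lie G x /\ P *m drep r x = 0.
have [a Ha] : exists U : {vspace 'M[C]_n}, forall v, v \in U <-> ina v.
 apply: subspace_vspace.
  by split; rewrite ?linear0 ?mulmx0 //; apply: lie0.
 move=> c u v [Lu hu] [Lv hv]; split; first exact/lieD/Lv/lieZ.
 by rewrite linearP mulmxDr -scalemxAr hu hv scaler0 addr0.
have a_rad : (a <= rad)%VS.
 apply/subvP => x /Ha[Lx hx]; apply/Hrad; split=> // y Ly.
 by rewrite hx mul0mx mxtrace0.
pose inb x := x \in rad /\ forall y, y \in a -> \tr (x *m y) = 0.
have [b Hb] : exists U : {vspace 'M[C]_n}, forall v, v \in U <-> inb v.
 apply: subspace_vspace; first by split=> [|y _]; rewrite ?mem0v ?mul0mx ?mxtrace0.
 move=> c u v [Lu hu] [Lv hv]; split=> [|y Ly]; first by rewrite memvD ?memvZ.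
 by rewrite mulmxDl -scalemxAl mxtraceD mxtraceZ hu ?hv ?mulr0 ?addr0.
have AdP A x : G A -> lie G x -> P *m drep r (A *m x *m invmx A) =
  evm r A *m (P *m drep r x) *m evm r (invmx A).
 by move=> GA Lx; rewrite (drep_Ad GG rr) // !mulmxA Pr.
have AdK A x : G A -> A *m (invmx A *m x *m A) *m invmx A = x.
 by move=> GA; have uA := mgrp_unit GG GA; rewrite !mulmxA mulmxV // mul1mx mulmxK.
have AdV A x : G A -> lie G x -> lie G (invmx A *m x *m A).
 move=> GA Lx; have := lie_Ad GG (mgrp_inv GG GA) Lx; by rewrite invmxK.
have AdPV A x : G A -> lie G x -> P *m drep r (invmx A *m x *m A) =
  evm r (invmx A) *m (P *m drep r x) *m evm r A.
 by move=> GA Lx; have := AdP _ x (mgrp_inv GG GA) Lx; rewrite invmxK.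
have b0 : b = 0%VS.
 apply: NI.
 - by move=> x /Hb[/Hrad[]].
 - move=> A x GA /Hb[/Hrad[Lx hx] hxa]; have uA := mgrp_unit GG GA.
  have [rA rA'] := rV A GA; apply/Hb; split.
   apply/Hrad; split=> [|y Ly]; first exact: lie_Ad.
   have trc (M N : 'M[C]_d.+1) : \tr (evm r A *m M *m evm r (invmx A) *m
     (evm r A *m N *m evm r (invmx A))) = \tr (M *m N).
    rewrite !mulmxA -[_ *m evm r (invmx A) *m evm r A]mulmxA rA' mulmx1.
    by rewrite mxtrace_mulC !mulmxA rA' mul1mx.
   have Ly' := AdV A y GA Ly.
   by rewrite -[y](AdK A) // AdP // (drep_Ad GG rr) // trc hx.
  move=> y /Ha[Ly hy]; rewrite -[y](AdK A) // !mulmxA mulmxKV // mxtrace_mulC !mulmxA mulVmx //.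
  rewrite mul1mx -!mulmxA (mulmxA (invmx A)); apply: hxa; apply/Ha; split; first exact: AdV.
  by rewrite AdPV // hy mulmx0 mul0mx.
 - move=> x /Hb[/Hrad[Lx hx] hxa].
  have [x' good] := sharp_exists x; have Lx' := sharp_lie GG good Lx.
  have [_ Px'] := sharp_trace GG good rr Lx PP Pr (hx x' Lx').
  have x'a : x' \in a by apply/Ha.
  (* The same trace lemma, now for the identity representation, turns the orthogonality of [x] and
     [x'] into the nilpotency of [x]. *)
  have := sharp_trace (P := 1%:M) GG good (stdrepP G) Lx (mul1mx _) (fun A _ => etrans (mul1mx _) (esym (mulmx1 _))).
  by rewrite !mul1mx !drep_std => /(_ (hxa x' x'a))[].
have dimle : (\dim rad <= \dim a)%N.
 pose phi (x : 'M[C]_n) : 'rV[C]_(\dim a) := \row_i \tr (x *m (vbasis a)`_i).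
 have phil : linear phi.
  by move=> c u v; apply/rowP => i; rewrite !mxE mulmxDl -scalemxAl mxtraceD mxtraceZ.
 pose phiL : {linear 'M[C]_n -> 'rV[C]_(\dim a)} := HB.pack phi (GRing.isLinear.Build C _ _ _ _ phil).
 have ker0 : (rad :&: lker (linfun phiL))%VS = 0%VS.
  apply/eqP; rewrite -subv0 -b0; apply/subvP => x /memv_capP[xr].
  rewrite memv_ker lfunE /= => /eqP phx; apply/Hb; split=> // y ya.
  rewrite (coord_vbasis ya) mulmx_sumr raddf_sum big1 //= => i _.
  rewrite -scalemxAr mxtraceZ; have /rowP/(_ i) := phx; rewrite !mxE => ->.
  by rewrite mulr0.
 rewrite -(limg_dim_eq ker0); apply: leq_trans (dimvS (subvf _)) _.
 by rewrite dimvf /dim /= mul1n.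
move=> x Lx hx; have xr : x \in rad by apply/Hrad.
have /eqP eqar : a == rad by rewrite eqEdim a_rad.
by have /Ha[] : x \in a by rewrite eqar.
Qed.

End Adjoint.

(** * The Reynolds operator *)

Section Reynolds.
Variables (C : numClosedFieldType) (n' : nat).
Local Notation n := n'.+1.
Variables (G : 'M[C]_n -> Prop) (d' : nat).
Local Notation d := d'.+1.
Variable r : 'M[{mpoly C[n * n]}]_d.
Hypotheses (GG : matrix_group G) (NI : nil_ideals_trivial G) (rr : is_rep G r).

Definition rep_stable k (S : 'M[C]_(k, d)) := forall A, G A -> (S *m evm r A <= S)%MS.
(** Keeping every stable subspace, without naming one, is what later lets the operator respect
    vanishing on any stable set of points. *)
Definition rep_preserving (P : 'M[C]_d) := forall k (S : 'M[C]_(k, d)), rep_stable S -> (S *m P <= S)%MS.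
Definition rep_commuting (P : 'M[C]_d) := forall A, G A -> P *m evm r A = evm r A *m P.

Lemma rep_preservingD P Q : rep_preserving P -> rep_preserving Q -> rep_preserving (P + Q).
Proof. by move=> hP hQ k S hS; rewrite mulmxDr addmx_sub ?hP ?hQ. Qed.
Lemma rep_preservingZ c P : rep_preserving P -> rep_preserving (c *: P).
Proof. by move=> hP k S hS; rewrite -scalemxAr scalemx_sub ?hP. Qed.
Lemma rep_preservingM P Q : rep_preserving P -> rep_preserving Q -> rep_preserving (P *m Q).
Proof. by move=> hP hQ k S hS; rewrite mulmxA (submx_trans (submxMr _ (hP _ _ hS))) ?hQ. Qed.
Lemma rep_preserving1 : rep_preserving 1%:M.
Proof. by move=> k S _; rewrite mulmx1. Qed.
Lemma rep_preserving0 : rep_preserving 0.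
Proof. by move=> k S _; rewrite mulmx0 sub0mx. Qed.
Lemma rep_preserving_evm A : G A -> rep_preserving (evm r A).
Proof. by move=> GA k S; apply. Qed.
Lemma rep_preserving_horner P (q : {poly C}) : rep_preserving P -> rep_preserving (horner_mx P q).
Proof.
move=> hP; elim/poly_ind: q => [|q c IH]; first by rewrite rmorph0; apply: rep_preserving0.
rewrite rmorphD rmorphM /= horner_mx_X horner_mx_C -scalemx1; apply: rep_preservingD.
 exact: rep_preservingM.
exact/rep_preservingZ/rep_preserving1.
Qed.
Lemma rep_preserving_drep x : lie G x -> rep_preserving (drep r x).
Proof.
move=> Lx k S hS; rewrite submxE; apply/eqP.
apply: (drep_mulmx_cond (G := G) (W := 0)) Lx => A GA; apply/eqP.
by rewrite -submxE hS.
Qed.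
Lemma rank_idem_sub (P e : 'M[C]_d) : P *m P = P -> e *m e = e -> e <> 0 ->
 P *m e = e -> e *m P = e -> (\rank (P - e)%R < \rank P)%N.
Proof.
move=> PP ee e0 Pe eP; rewrite ltn_neqAle; apply/andP; split; last first.
 apply: mxrankS; apply/submxP; exists (1%:M - e).
 by rewrite mulmxBl mul1mx eP.
apply/negP => /eqP rk; apply: e0.
have le : (P - e <= P)%MS by apply/submxP; exists (1%:M - e); rewrite mulmxBl mul1mx eP.
have : (P <= P - e)%MS by have := mxrank_leqif_sup le; rewrite rk => -[_] <-.
move/submxP => [W PW]; rewrite -[e]ee -{1}eP -mulmxA Pe -{1}eP PW.
by rewrite -!mulmxA mulmxBl Pe ee subrr !mulmx0.
Qed.
(** Descent on the rank of [P], from the identity. While [P] does not kill the Lie algebra, the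
    trace form on the image [T] is nondegenerate by [radical_kernel], and the Fitting idempotent of
    its Casimir element can be subtracted from [P]. This idempotent kills the invariants, so [P]
    continues to fix them. *)
Lemma infinitesimal_reynolds : exists P : 'M[C]_d,
 [/\ rep_commuting P, rep_preserving P, forall x, lie G x -> P *m drep r x = 0 &
  forall k (u : 'M[C]_(k, d)), (forall x, lie G x -> u *m drep r x = 0) -> u *m P = u].
Proof.
suff H : forall N (P : 'M[C]_d), (\rank P < N)%N -> P *m P = P -> rep_commuting P -> rep_preserving P ->
  (forall k (u : 'M[C]_(k, d)), (forall x, lie G x -> u *m drep r x = 0) -> u *m P = u) ->
  exists P : 'M[C]_d, [/\ rep_commuting P, rep_preserving P, forall x, lie G x -> P *m drep r x = 0 &
  forall k (u : 'M[C]_(k, d)), (forall x, lie G x -> u *m drep r x = 0) -> u *m P = u].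
 apply: (H (\rank (1%:M : 'M[C]_d)).+1 1%:M) => //; first by rewrite mulmx1.
 - by move=> A _; rewrite mulmx1 mul1mx.
 - exact: rep_preserving1.
 - by move=> k u _; rewrite mulmx1.
elim=> // N IH P rkP PP Pc Pp Pu.
have [done|/existsNP[x /not_implyP[Lx /eqP nx]]] :=
 pselect (forall x, lie G x -> P *m drep r x = 0); first by exists P.
have PdC y : lie G y -> P *m drep r y = drep r y *m P by move=> Ly; apply: drep_comm Pc Ly.
have [T HT] : exists U : {vspace 'M[C]_d}, forall v, v \in U <-> exists2 y, lie G y & v = P *m drep r y.
 apply: subspace_vspace; first by exists 0; [apply: lie0|rewrite linear0 mulmx0].
 move=> c u v [y Ly ->] [z Lz ->]; exists (c *: y + z); first exact/lieD/Lz/lieZ.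
 by rewrite linearP mulmxDr scalemxAr.
have T0 : T != 0%VS.
 apply/eqP => T0; move/negP: nx; apply; rewrite -memv0 -T0; apply/HT; by exists x.
have [|W [nW [k [a [b [abT DW]]]] WC]] := casimir T0.
 move=> t /HT[y Ly ->] h; apply: (radical_kernel GG NI rr) => // z Lz.
 have -> : P *m drep r y *m drep r z = P *m drep r y *m (P *m drep r z).
  by rewrite [RHS]mulmxA; congr (_ *m _); rewrite PdC // -mulmxA PP.
 by apply: h; apply/HT; exists z.
have WcG A : G A -> W *m evm r A = evm r A *m W.
 move=> GA; have uA := mgrp_unit GG GA; have GV := mgrp_inv GG GA.
 have r1 : evm r A *m evm r (invmx A) = 1%:M by rewrite -rr.2 // mulmxV // rr.1.
 have [u1 _] := mulmx1_unit r1.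
 have ri : invmx (evm r A) = evm r (invmx A).
  by rewrite -[LHS]mulmx1 -r1 mulKmx.
 apply/esym/WC => // t /HT[y Ly ->]; apply/HT; exists (A *m y *m invmx A).
  exact: lie_Ad.
 by rewrite (drep_Ad GG rr) // ri !mulmxA Pc.
have PW : P *m W = W.
 rewrite DW mulmx_sumr; apply: eq_bigr => i _; have [/HT[y _ ->] _] := abT i.
 by rewrite !mulmxA PP.
have WP : W *m P = W.
 rewrite DW mulmx_suml; apply: eq_bigr => i _; have [_ /HT[y Ly ->]] := abT i.
 by rewrite -!mulmxA -PdC // (mulmxA P P) PP.
have Wp : rep_preserving W.
 rewrite DW; elim/big_ind: _ => [|? ? ? ?|i _]; first exact: rep_preserving0.
  exact: rep_preservingD.
 have [/HT[y Ly ->] /HT[z Lz ->]] := abT i.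
 by do !apply: rep_preservingM => //; apply: rep_preserving_drep.
have uW j (u : 'M[C]_(j, d)) : (forall x, lie G x -> u *m drep r x = 0) -> u *m W = 0.
 move=> hu; rewrite DW mulmx_sumr big1 // => i _; have [/HT[y Ly ->] _] := abT i.
 by rewrite PdC // !mulmxA hu ?mul0mx.
have [w [ee e0]] := fitting_idempotent nW; set e := W *m horner_mx W w in ee e0.
have We : e = horner_mx W w *m W.
 by rewrite /e; apply: comm_mx_horner.
have Pe : P *m e = e by rewrite /e mulmxA PW.
have eP : e *m P = e by rewrite We -mulmxA WP.
have ec : rep_commuting e.
 move=> A GA; rewrite /e -mulmxA.
 have /esym -> : evm r A *m horner_mx W w = horner_mx W w *m evm r A.
  by apply: comm_mx_horner; rewrite /comm_mx WcG.
 by rewrite !mulmxA WcG.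
apply: (IH (P - e)).
- exact: leq_trans (rank_idem_sub PP ee e0 Pe eP) rkP.
- by rewrite mulmxBl !mulmxBr PP Pe eP ee subrr subr0.
- by move=> A GA; rewrite mulmxBl mulmxBr Pc // ec.
- rewrite -scaleN1r; apply: rep_preservingD => //; apply: rep_preservingZ.
 by apply: rep_preservingM => //; apply: rep_preserving_horner.
- by move=> j u hu; rewrite mulmxBr Pu // /e mulmxA uW // mul0mx subr0.
Qed.
(** Stands for the finiteness of the number of connected components, expressed by the locally
    constant regular functions. *)
Definition finite_valued_invariants := forall p : {mpoly C[n * n]},
 (forall x, lie G x -> vanishes G (vfield x p)) -> exists s : seq C, forall A, G A -> mev p A \in s.

(** The entries of [evm r A *m P] are killed by the Lie algebra, so these matrices take finitely
    many values; their average is invariant under the whole group. *)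
Lemma reynolds_operator : finite_valued_invariants -> exists P : 'M[C]_d,
 [/\ forall A, G A -> P *m evm r A = P, rep_preserving P &
  forall k (u : 'M[C]_(k, d)), (forall A, G A -> u *m evm r A = u) -> u *m P = u].
Proof.
move=> FIN; have [P [Pc Pp Pd Pu]] := infinitesimal_reynolds.
pose p i j := \sum_k P k j *: r i k.
have pE A i j : mev (p i j) A = (evm r A *m P) i j.
 by rewrite /p mev_sum mxE; apply: eq_bigr => k _; rewrite mevZ_ !mxE mulrC.
have pfin i j : exists s : seq C, forall A, G A -> mev (p i j) A \in s.
 apply: FIN => x Lx A GA; rewrite /p linear_sum mev_sum.
 have /matrixP/(_ i j) : evm r A *m drep r x *m P = 0.
  by rewrite -mulmxA -(drep_comm (G := G)) // Pd // mulmx0.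
 rewrite -(evm_vfield_rep GG rr Lx GA) [RHS]mxE mxE => E; rewrite -[RHS]E.
 by apply: eq_bigr => k _; rewrite linearZ /= mevZ_ !mxE mulrC.
have [S HS] : exists S : 'I_d -> 'I_d -> seq C, forall i j A, G A -> (evm r A *m P) i j \in S i j.
 exists (fun i j => projT1 (cid (pfin i j))) => i j A GA.
 by have := projT2 (cid (pfin i j)) A GA; rewrite pE.
pose L := flatten [seq S ij.1 ij.2 | ij : 'I_d * 'I_d].
have HL i j A : G A -> (evm r A *m P) i j \in L.
 move=> GA; apply/flattenP; exists (S i j); last exact: HS.
 by apply/mapP; exists (i, j); rewrite ?mem_enum.
(* All matrices with entries in the finite list [L]; filtering them enumerates the values that
   occur. *)
pose allm := [seq (\matrix_(i, j) ssval (f (i, j)) : 'M[C]_d) | f : {ffun 'I_d * 'I_d -> seq_sub L}].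
pose Th := undup [seq M <- allm | `[< exists2 A, G A & M = evm r A *m P >]].
have memTh M : reflect (exists2 A, G A & M = evm r A *m P) (M \in Th).
 rewrite mem_undup mem_filter; apply: (iffP idP) => [/andP[/asboolP]//|ex].
 apply/andP; split; first exact/asboolP.
 have [A GA ->] := ex; apply/mapP.
 exists [ffun ij : 'I_d * 'I_d => SeqSub (HL ij.1 ij.2 A GA)]; first by rewrite mem_enum.
 by apply/matrixP => i j; rewrite [RHS]mxE ffunE.
have Th0 : (0 < size Th)%N.
 have : evm r 1%:M *m P \in Th by apply/memTh; exists 1%:M => //; apply: mgrp1.
 by case: (Th).
have sz0 : (size Th)%:R != 0 :> C by rewrite pnatr_eq0 -lt0n.
pose Rm := (size Th)%:R^-1 *: \sum_(M <- Th) M.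
have PP : P *m P = P by rewrite Pu.
exists Rm; split.
- move=> A GA; rewrite /Rm -scalemxAl mulmx_suml; congr (_ *: _).
 have GV := mgrp_inv GG GA; have uA := mgrp_unit GG GA.
 have ri : evm r A *m evm r (invmx A) = 1%:M by rewrite -rr.2 // mulmxV // rr.1.
 have [u1 _] := mulmx1_unit ri.
 (* Right multiplication by [evm r A] is injective and maps the finite list [Th] into itself, so it
    permutes the terms of the average. *)
 have inj : injective (fun M : 'M[C]_d => M *m evm r A) by apply: can_inj (mulmxK u1).
 rewrite -(big_map (fun M : 'M[C]_d => M *m evm r A) xpredT (fun M => M)).
 apply: perm_big; apply: uniq_perm; rewrite ?map_inj_uniq ?undup_uniq //.
 have [|||_ //] := @uniq_min_size _ [seq M *m evm r A | M <- Th] Th;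
  rewrite ?map_inj_uniq ?undup_uniq ?size_map //.
 move=> _ /mapP[M /memTh[B GB ->] ->]; apply/memTh; exists (B *m A); first exact: mgrpM.
 by rewrite rr.2 // -!mulmxA Pc.
- apply: rep_preservingZ; rewrite big_seq; elim/big_ind: _ => [|? ? ? ?|M /memTh[A GA ->]].
 + exact: rep_preserving0.
 + exact: rep_preservingD.
 + by apply: rep_preservingM => //; apply: rep_preserving_evm.
- move=> k u hu; rewrite /Rm -scalemxAr mulmx_sumr.
 have uP : u *m P = u.
  apply: Pu => x Lx; rewrite -[LHS]mulmx1.
  apply: (drep_mulmx_cond (G := G) (W := u)) Lx => A GA.
  by rewrite mulmx1 hu.
 rewrite (eq_big_seq (fun=> u)) => [|M /memTh[A GA ->]]; last by rewrite mulmxA hu.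
 by rewrite big_const_seq count_predT iter_addr_0 -scaler_nat scalerA mulVf ?scale1r.
Qed.

End Reynolds.

(** * Engel's theorem *)

Section Engel.
Variables (C : numClosedFieldType) (n' : nat).
Local Notation n := n'.+1.
Implicit Types (a b x y : 'M[C]_n) (M H : {vspace 'M[C]_n}).

Definition bracket_closed M := forall a b, a \in M -> b \in M -> a * b - b * a \in M.

(** General enough for both uses: commutators on matrices within the induction, and multiplication
    of column vectors in the final application. *)
Record nil_action M (V : vectType C) (phi : 'M[C]_n -> V -> V) : Prop := NilAction {
 nact_lin : forall a, linear (phi a); nact_linl : forall c a b v, phi (c *: a + b) v = c *: phi a v + phi b v;
 nact_br : forall a b v, phi (a * b - b * a) v = phi a (phi b v) - phi b (phi a v);
 nact_nil : forall a, a \in M -> exists k, forall v, iter k (phi a) v = 0 }.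

(** Iterated commutators with [a] are sums of terms [a ^+ i * v * a ^+ j] with [i + j] the number of
    iterations; after [n + n] of them one exponent is at least [n]. *)
Lemma ad_action M : (forall x, x \in M -> x ^+ n = 0) -> nil_action M (fun a v => a * v - v * a).
Proof.
move=> nil; split.
- by move=> a c u v; rewrite mulrDr mulrDl -scalerAr -scalerAl scalerBr opprD addrACA.
- by move=> c a b v; rewrite mulrDr mulrDl -scalerAr -scalerAl scalerBr opprD addrACA.
- move=> a b v; rewrite !(mulrBl, mulrBr) !mulrA.
 move: (a * b * v) (b * a * v) (a * v * b) (b * v * a) (v * a * b) (v * b * a).
 by move=> t1 t2 t3 t4 t5 t6; apply/matrixP => i j; rewrite !mxE; ring.
move=> a aM; exists (n + n)%N => v.
have lin k (u w : 'M[C]_n) : iter k (fun v => a * v - v * a) (u - w) =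
  iter k (fun v => a * v - v * a) u - iter k (fun v => a * v - v * a) w.
 elim: k => //= k ->; rewrite mulrBr mulrBl; set t1 := a * _; set t2 := a * _.
 by rewrite !opprB addrACA [RHS]addrACA; congr (_ + _); rewrite addrC.
suff H k i j : (n + n <= k + i + j)%N -> iter k (fun v => a * v - v * a) (a ^+ i * v * a ^+ j) = 0.
 by have := H (n + n)%N 0%N 0%N; rewrite !expr0 mul1r mulr1 !addn0 => ->.
elim: k i j => [|k IH] i j h.
 have [le|gt] := leqP n i.
  by rewrite -(subnKC le) exprD nil // !mul0r.
 have le : (n <= j)%N.
  by rewrite -(leq_add2l n) (leq_trans h) // add0n leq_add2r ltnW.
 by rewrite -(subnK le) exprD nil // !mulr0.
rewrite iterSr.
have -> : a * (a ^+ i * v * a ^+ j) - a ^+ i * v * a ^+ j * a =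
  a ^+ i.+1 * v * a ^+ j - a ^+ i * v * a ^+ j.+1 by rewrite exprS exprSr !mulrA.
rewrite lin !IH ?subrr //.
 by move: h; lia.
by move: h; lia.
Qed.
(** Engel's theorem for [U] modulo [U'], without forming quotients. Let [H] be a maximal proper
    subalgebra of [M]. The induction hypothesis for commutators on [M] modulo [H] gives [x]
    normalising [H], so that [H] and [x] span [M]. Applied to [V], it gives vectors that [H] sends
    into [U']; these are stable under [x], and the last iterate of [x] outside [U'] is the required
    one. *)
Lemma engel_action k M : (\dim M <= k)%N -> bracket_closed M -> (forall x, x \in M -> x ^+ n = 0) ->
 forall (V : vectType C) (phi : 'M[C]_n -> V -> V), nil_action M phi ->
 forall U' U : {vspace V}, ~~ (U <= U')%VS -> (forall a u, a \in M -> u \in U' -> phi a u \in U') ->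
 (forall a u, a \in M -> u \in U -> phi a u \in U) ->
 exists2 u, u \in U & u \notin U' /\ forall a, a \in M -> phi a u \in U'.
Proof.
elim: k M => [|k IH] M dM brM nilM V phi act U' U nUU st' st.
 have M0 : M = 0%VS by apply/eqP; rewrite -dimv_eq0 -leqn0.
 have /subvPn[u uU uU'] := nUU; exists u => //; split=> // a.
 rewrite M0 memv0 => /eqP->; have := nact_linl act (-1) 0 0 u.
 by rewrite scaler0 addr0 scaleN1r addNr => ->; rewrite mem0v.
have [M0|M0] := eqVneq M 0%VS; first by apply: (IH M) => //; rewrite M0 dimv0.
pose Q j := `[< exists H : {vspace 'M[C]_n},
  [/\ \dim H = j, (H <= M)%VS, (j < \dim M)%N & bracket_closed H] >].
have exQ : exists j, Q j.
 exists 0%N; apply/asboolP; exists 0%VS; split; rewrite ?dimv0 ?sub0v ?lt0n ?dimv_eq0 //.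
 by move=> a b; rewrite !memv0 => /eqP-> /eqP->; rewrite mulr0 subrr.
have bQ j : Q j -> (j <= \dim M)%N by move=> /asboolP[H [_ _ /ltnW]].
case: (ex_maxnP exQ bQ) => j /asboolP[H [dH HM lj brH]] max.
have nMH : ~~ (M <= H)%VS.
 by apply/negP => /dimvS; rewrite dH leqNgt lj.
have dHk : (\dim H <= k)%N by rewrite dH -ltnS (leq_trans lj).
have nilH x : x \in H -> x ^+ n = 0 by move=> xH; apply/nilM/(subvP HM).
have [x xM [xH hx]] := IH H dHk brH nilH _ _ (ad_action nilH) H M nMH
 (fun a u aH uH => brH a u aH uH) (fun a u aH uM => brM a u (subvP HM a aH) uM).
have HxM : (H + <[x]>)%VS = M.
 have le : (H + <[x]> <= M)%VS by rewrite subv_add HM -memvE.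
 apply/eqP; rewrite eqEdim le /= leqNgt; apply/negP => lt.
 have := max (\dim (H + <[x]>)%VS); rewrite leqNgt -dH.
 have ltd : (\dim H < \dim (H + <[x]>))%N.
  rewrite ltn_neqAle dimvS ?addvSl // andbT; apply/negP => /eqP e.
  have /eqP E : H == (H + <[x]>)%VS by rewrite eqEdim addvSl e /=.
  by move/negP: xH; apply; rewrite E memvE addvSr.
 rewrite ltd => /(_ _)/negP; apply => //; apply/asboolP; exists (H + <[x]>)%VS; split=> //.
 move=> _ _ /memv_addP[a aH [_ /vlineP[c ->] ->]] /memv_addP[b bH [_ /vlineP[e ->] ->]].
 have ->: (a + c *: x) * (b + e *: x) - (b + e *: x) * (a + c *: x) =
   (a * b - b * a) + (e *: (a * x - x * a) - c *: (b * x - x * b)).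
  rewrite !(mulrDl, mulrDr) -!scalerAl -!scalerAr !scalerA [c * e]mulrC.
  move: (a * b) (b * a) (a * x) (x * a) (b * x) (x * b) (x * x) => t1 t2 t3 t4 t5 t6 t7.
  by apply/matrixP => p q; rewrite !mxE; ring.
 apply: (subvP (addvSl _ _)); rewrite memvD ?brH // memvB ?memvZ ?hx //.
have actH : nil_action H phi.
 by case: act => h1 h2 h3 h4; split=> // a aH; apply/h4/(subvP HM).
have [u0 u0U [u0U' hu0]] := IH H dHk brH nilH V phi actH U' U nUU
 (fun a u aH => st' a u (subvP HM a aH)) (fun a u aH => st a u (subvP HM a aH)).
pose U0 w := w \in U /\ forall a, a \in H -> phi a w \in U'.
have U0x w : U0 w -> U0 (phi x w).
 move=> [wU hw]; split=> [|a aH]; first exact: st.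
 have := nact_br act a x w => /esym/eqP; rewrite subr_eq => /eqP ->.
 by apply: memvD; [apply: hw; apply: hx | apply: st' => //; apply: hw].
have [K hK] := nact_nil act xM.
have ex : exists i, iter i (phi x) u0 \in U' by exists K; rewrite hK mem0v.
case: (ex_minnP ex) => -[|i] hi min; first by rewrite /= (negPf u0U') in hi.
exists (iter i (phi x) u0).
 by suff [] : U0 (iter i (phi x) u0) by []; elim: (i) => [|l /U0x].
have [_ U0i] : U0 (iter i (phi x) u0) by elim: (i) => [|l /U0x].
split; first by apply/negP => /min; rewrite ltnn.
move=> b; rewrite -HxM => /memv_addP[a aH [_ /vlineP[c ->] ->]].
by rewrite addrC (nact_linl act); apply: memvD; [apply/memvZ/hi | apply: U0i].
Qed.

End Engel.

(** * Nilpotent ideals and their flags *)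

Section NilIdeal.
Variables (C : numClosedFieldType) (n' : nat).
Local Notation n := n'.+1.
Variables (G : 'M[C]_n -> Prop) (N : {vspace 'M[C]_n}).
Hypotheses (GG : matrix_group G) (Nlie : forall x, x \in N -> lie G x)
 (NAd : forall A x, G A -> x \in N -> A *m x *m invmx A \in N) (Nnil : forall x, x \in N -> x ^+ n = 0).

(** The stability of [N] under conjugation is differentiated. The map [psi] has kernel [N], so the
    entries of [psi (A *m y *m evm J A)] are equations of [G]; their derivative at the identity is
    [psi] of the commutator. *)
Lemma ideal_bracket x y : lie G x -> y \in N -> x * y - y * x \in N.
Proof.
move=> Lx yN; have [J HJ] := mgrpV GG.
(* The derivative of the inverse at the identity, by differentiating [A *m evm J A = 1%:M]. *)
have dJ : evm (map_mx (vfield x) J) 1%:M = - x.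
 have [_ J1 _] := HJ _ (mgrp1 GG); rewrite mul1mx in J1.
 apply/matrixP => i j; rewrite [RHS]mxE.
 have := Lx (\sum_k 'X_(mxvec_index i k) * J k j - ((i == j)%:R)%:MP).
 rewrite linearB /= vfieldC subr0 linear_sum mev_sum => E.
 have {}E : \sum_k mev (vfield x ('X_(mxvec_index i k) * J k j)) 1%:M = 0.
  apply: E => A GA; rewrite mevB_ mevC_ mev_sum; apply/eqP; rewrite subr_eq0; apply/eqP.
  have [_ /matrixP/(_ i j) + _] := HJ A GA; rewrite !mxE => <-.
  by apply: eq_bigr => k _; rewrite mevM_ mevX_ !mxE.
 move: E; under eq_bigr => k _ do rewrite vfieldM mevD_ !mevM_ mevX_ vfieldX mev_sum.
 rewrite big_split /= [X in _ + X](bigD1 i) //= [X in _ + (_ + X)]big1 ?addr0 => [|k ki]; last first.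
  by rewrite mxE eq_sym (negPf ki) mul0r.
 rewrite mxE eqxx mul1r => /eqP; rewrite addr_eq0 => /eqP E.
 rewrite !mxE; apply: oppr_inj; rewrite opprK -E.
 rewrite (bigD1 j) //= [X in _ + X]big1 ?addr0 => [|k kj].
  have /matrixP/(_ j j) := J1; rewrite !mxE eqxx => ->; rewrite mulr1.
  rewrite (bigD1 i) //= big1 ?addr0 ?mevZ_ ?mevX_ ?mxE ?eqxx ?mulr1 // => l li.
  by rewrite mevZ_ mevX_ mxE eq_sym (negPf li) mulr0.
 have /matrixP/(_ k j) := J1; rewrite !mxE (negPf kj) => ->; by rewrite mulr0.
pose psi : 'End('M[C]_n) := (\1 - projv N)%VF.
have psi0 z : (z \in N) = (psi z == 0).
 rewrite /psi lfunE /= lfunE /= lfunE /= subr_eq0 eq_sym.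
 apply/idP/eqP => [|<-]; [exact: projv_id|exact: memv_proj].
rewrite psi0; apply/eqP/matrixP => a b; rewrite [RHS]mxE.
pose f i j := psi (delta_mx i j) a b.
have psiE (M : 'M[C]_n) : psi M a b = \sum_i \sum_j f i j * M i j.
 rewrite {1}[M]matrix_sum_delta linear_sum summxE; apply: eq_bigr => i _.
 rewrite linear_sum summxE; apply: eq_bigr => j _.
 by rewrite linearZ /= mxE mulrC.
pose q i j := \sum_k \sum_l (y k l) *: ('X_(mxvec_index i k) * J l j).
have qE A i j : mev (q i j) A = (A *m y *m evm J A) i j.
 rewrite mulmx3E /q mev_sum; apply: eq_bigr => k _; rewrite mev_sum; apply: eq_bigr => l _.
 by rewrite mevZ_ mevM_ mevX_ !mxE mulrC.
have := Lx (\sum_i \sum_j f i j *: q i j).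
have -> : mev (vfield x (\sum_i \sum_j f i j *: q i j)) 1%:M = psi (x * y - y * x) a b.
 rewrite psiE linear_sum mev_sum; apply: eq_bigr => i _; rewrite linear_sum mev_sum.
 apply: eq_bigr => j _; rewrite linearZ /= mevZ_; congr (_ * _).
 have [_ J1 _] := HJ _ (mgrp1 GG); rewrite mul1mx in J1.
 have -> : x * y - y * x = x *m y *m evm J 1%:M + 1%:M *m y *m evm (map_mx (vfield x) J) 1%:M.
  by rewrite J1 mulmx1 mul1mx dJ mulmxN.
 rewrite mxE !mulmx3E -big_split /q linear_sum mev_sum; apply: eq_bigr => k _.
 rewrite linear_sum mev_sum -big_split; apply: eq_bigr => l _ /=.
 rewrite linearZ /= mevZ_ vfieldM mevD_ !mevM_ mevX_ vfieldX mev_sum !mxE.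
 rewrite (bigD1 i) //= big1 ?addr0 ?mevZ_ ?mevX_ ?mxE ?eqxx ?mulr1 => [|l' li]; first by ring.
 by rewrite mevZ_ mevX_ mxE eq_sym (negPf li) mulr0.
apply=> A GA; have [GJ AJ _] := HJ A GA.
have ri : evm J A = invmx A by rewrite -[RHS]mulmx1 -AJ mulKmx // (mgrp_unit GG).
transitivity (psi (A *m y *m evm J A) a b).
 rewrite psiE mev_sum; apply: eq_bigr => i _; rewrite mev_sum; apply: eq_bigr => j _.
 by rewrite mevZ_ qE.
have : A *m y *m evm J A \in N by rewrite ri NAd.
by rewrite psi0 => /eqP->; rewrite mxE.
Qed.
(** [W i.+1] consists of the vectors that [N] sends into [W i], so its stability comes from that of
    [N] under conjugation. Engel's theorem makes the dimension grow at each step until it is [n]. *)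
Lemma nil_flag : exists W : nat -> {vspace 'cV[C]_n},
 [/\ W 0%N = 0%VS, W n = fullv, forall i, (W i <= W i.+1)%VS,
  forall i A w, G A -> w \in W i -> A *m w \in W i &
  forall i x w, x \in N -> w \in W i.+1 -> x *m w \in W i].
Proof.
have next (U : {vspace 'cV[C]_n}) : exists U1 : {vspace 'cV[C]_n}, forall w,
  w \in U1 <-> forall x, x \in N -> x *m w \in U.
 apply: subspace_vspace; first by move=> x _; rewrite mulmx0 mem0v.
 by move=> c u v hu hv x xN; rewrite mulmxDr -scalemxAr memvD ?memvZ ?hu ?hv.
pose W := fix W i := if i is j.+1 then projT1 (cid (next (W j))) else 0%VS.
have WS i w : w \in W i.+1 <-> forall x, x \in N -> x *m w \in W i.
 exact: projT2 (cid (next (W i))) w.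
have Wsub i : (W i <= W i.+1)%VS.
 elim: i => [|i IH]; first exact: sub0v.
 apply/subvP => w /WS hw; apply/WS => x xN; exact: (subvP IH) (hw x xN).
have br : bracket_closed N by move=> a b aN bN; apply: ideal_bracket => //; apply: Nlie.
have act : nil_action N (fun (a : 'M[C]_n) (v : 'cV[C]_n) => a *m v).
 split.
 - by move=> a c u v; rewrite mulmxDr -scalemxAr.
 - by move=> c a b v; rewrite mulmxDl -scalemxAl.
 - by move=> a b v; rewrite mulmxBl -!mulmxA.
 - move=> a aN; exists n => v; have iterE k : iter k (mulmx a) v = a ^+ k *m v.
   by elim: k => [|k IH]; rewrite ?expr0 ?mul1mx // iterS IH exprS mulmxA.
  by rewrite iterE Nnil ?mul0mx.
have dimW i : (i <= n)%N -> (i <= \dim (W i))%N.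
 elim: i => // i IH lei; have {}IH := IH (ltnW lei).
 have [full|nfull] := boolP (fullv <= W i)%VS.
  have : (fullv <= W i.+1)%VS := subv_trans full (Wsub i).
  by move/dimvS; rewrite dimvf /dim /= muln1; apply: leq_trans.
 have [|u _ [uW hu]] := engel_action (leqnn _) br Nnil act nfull _ (fun _ u _ _ => memvf _).
  by move=> a u aN /(subvP (Wsub i))/WS; apply.
 have uW1 : u \in W i.+1 by apply/WS.
 apply: leq_ltn_trans IH _; rewrite ltn_neqAle dimvS // andbT; apply/negP => /eqP e.
 have /eqP E : W i == W i.+1 by rewrite eqEdim Wsub e /=.
 by rewrite E uW1 in uW.
exists W; split=> //.
- apply/eqP; rewrite eqEdim subvf dimvf /dim /= muln1; exact: dimW.
- elim=> [|i IH] A w GA.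
  by rewrite !memv0 => /eqP->; rewrite mulmx0.
 have uA := mgrp_unit GG GA.
 move/WS => hw; apply/WS => x xN.
 have -> : x *m (A *m w) = A *m ((invmx A *m x *m invmx (invmx A)) *m w).
  by rewrite invmxK !mulmxA mulmxV // mul1mx.
 by apply: IH => //; apply: hw; apply: NAd => //; apply: mgrp_inv.
- by move=> i x w xN /WS; apply.
Qed.

End NilIdeal.

(** * Exponentials of nilpotent matrices *)

Section Exponential.
Variables (C : numClosedFieldType) (n' : nat).
Local Notation n := n'.+1.

Definition expm (x : 'M[C]_n) : 'M[C]_n := \sum_(k < n) (k`!%:R)^-1 *: x ^+ k.

(** For an equation [p] of [G], the value of [p] at the exponential of [t x] is a polynomial in [t].
    Its derivatives at 0 are the values at the identity of iterated vector fields of [p], all 0, so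
    it vanishes also at 1. *)
Lemma expm_lie G x : matrix_group G -> lie G x -> x ^+ n = 0 -> G (expm x).
Proof.
move=> GG Lx xn; apply: (mgrp_closed GG) => p vp.
pose E : 'M[{poly C}]_n := \matrix_(i, j) \sum_(k < n) ((k`!%:R)^-1 * (x ^+ k) i j) *: 'X^k.
have E0 k : (mxvec E 0 k).[0] = mxvec (1%:M : 'M[C]_n) 0 k.
 case/mxvec_indexP: k => i j; rewrite !mxvecE mxE horner_sum (bigD1 ord0) //= big1 => [|k k0].
  by rewrite hornerZ ?hornerXn ?expr0 ?hornerE fact0 invr1 mul1r ?mulr1 ?addr0.
 by rewrite hornerZ hornerXn expr0n (negPf (_ : k != 0%N :> nat)) ?mulr0 // -val_eqE.
have E1 k : (mxvec E 0 k).[1] = mxvec (expm x) 0 k.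
 case/mxvec_indexP: k => i j; rewrite !mxvecE mxE summxE horner_sum; apply: eq_bigr => k _.
 by rewrite hornerZ hornerXn expr1n mulr1 mxE.
have dE k : (mxvec E 0 k)^`() = mxvec (E *m map_mx polyC x) 0 k.
 case/mxvec_indexP: k => i j; rewrite !mxvecE mxE raddf_sum /=.
 rewrite [RHS]mxE; transitivity (\sum_(k < n) ((k`!%:R)^-1 * (x ^+ k.+1) i j) *: 'X^k : {poly C}).
  rewrite big_ord_recl /= derivZ ?expr0 -polyC1 derivC scaler0 add0r [RHS]big_ord_recr /=.
  rewrite xn [X in _ * X]mxE mulr0 scale0r addr0.
  apply: eq_bigr => k _; rewrite /bump /= add1n derivZ derivXn -scaler_nat scalerA /=.
  congr (_ *: _); rewrite factS natrM invfM; set y := (x ^+ _) i j.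
  transitivity (k.+1%:R^-1 * k.+1%:R * (k`!%:R^-1 * y)); first by ring.
  by rewrite mulVf ?pnatr_eq0 // mul1r.
 under [RHS]eq_bigr => l _ do rewrite !mxE mulr_suml.
 rewrite [RHS]exchange_big; apply: eq_bigr => k _ /=; rewrite exprSr mxE mulr_sumr scaler_suml.
 by apply: eq_bigr => l _; rewrite [RHS]mulrC mul_polyC scalerA; congr (_ *: _); ring.
pose phi (q : {mpoly C[n * n]}) : {poly C} := mmap polyC (fun k => mxvec E 0 k) q.
have dphi q : (phi q)^`() = phi (vfield x q).
 rewrite /phi (mmap_chain_rule _ (@derivD C) (@derivM C) (@derivC C)) mmap_vfield.
 by apply: eq_bigr => k _; rewrite dE.
have dphin j q : (phi q)^`(j) = phi (iter j (vfield x) q).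
 by elim: j => [//|j IH]; rewrite derivnS IH dphi.
have phi0 : phi p = 0.
 apply/polyP => j; rewrite coef0.
 have : ((phi p)^`(j)).[0] = 0.
  rewrite dphin horner_mmap; rewrite -[RHS](vanishes_iter j GG Lx vp (mgrp1 GG)).
  exact: meval_eq.
 rewrite horner_coef0 coef_derivn addn0 ffactnn => /eqP; rewrite mulrn_eq0.
 by rewrite -[(_ == 0)%N]negbK -lt0n fact_gt0 /= => /eqP.
have : (phi p).[1] = 0 by rewrite phi0 horner0.
by rewrite horner_mmap => e; rewrite -[RHS]e; apply: meval_eq.
Qed.
(** If the nilpotency index of [x] is [j.+2], the product of [x ^+ j] with the exponential is
    [x ^+ j + x ^+ j.+1], which differs from [x ^+ j]. *)
Lemma expm_eq1 x : x ^+ n = 0 -> expm x = 1%:M -> x = 0.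
Proof.
move=> xn ex; apply/eqP/negPn/negP => x0.
have exj : exists j, x ^+ j == 0 by exists n; apply/eqP.
case: (ex_minnP exj) => -[|[|j]] /eqP xj min; first by move/eqP: xj; rewrite expr0 oner_eq0.
 by move: x0; rewrite -[x]expr1 xj eqxx.
have : x ^+ j * expm x = x ^+ j by rewrite ex mulr1.
have jn : (j.+1 < n)%N by apply: min; apply/eqP.
have n1 : (1 < n)%N by apply: leq_ltn_trans jn.
rewrite /expm mulr_sumr (bigD1 ord0) //= (bigD1 (Ordinal n1)) //= big1 => [|i /andP[i0 i1]].
 rewrite addr0 ?expr0 ?fact0 invr1 !scale1r mulr1 ?expr1 -exprSr.
 move/eqP; rewrite -subr_eq0 addrAC subrr add0r => /min; by rewrite ltnn.
have i2 : (2 <= i)%N by move: i0 i1; rewrite -!val_eqE /=; case: (val i) => [|[|]].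
by rewrite -scalerAr -exprD -(subnKC i2) addnA addn2 exprD xj mul0r scaler0.
Qed.

End Exponential.

(** * Maximal ideals and the Nullstellensatz *)

Record ring_ideal (A : comNzRingType) (I : A -> Prop) : Prop := RingIdeal { ideal0 : I 0;
 idealD : forall p q, I p -> I q -> I (p + q); idealM : forall p q, I q -> I (p * q) }.

(** Zorn's lemma. With [Op] empty it gives maximal ideals; with [Op] the action of a group, the
    ideals of the minimal closed stable sets. *)
Lemma maximal_stable_ideal (A : comNzRingType) (Op : (A -> A) -> Prop) (I : A -> Prop) :
 ring_ideal I -> (forall f p, Op f -> I p -> I (f p)) -> ~ I 1 ->
 exists M : A -> Prop, [/\ ring_ideal M, (forall f p, Op f -> M p -> M (f p)), forall p, I p -> M p, ~ M 1 &
  forall J : A -> Prop, ring_ideal J -> (forall f p, Op f -> J p -> J (f p)) -> ~ J 1 ->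
   (forall p, M p -> J p) -> forall p, J p -> M p].
Proof.
move=> II IO I1.
pose good (X : set A) := [/\ ring_ideal X, (forall f p, Op f -> X p -> X (f p)), (I `<=` X)%classic & ~ X 1].
pose P (X : set A) := X = set0 \/ good X.
have [|M [PM maxM]] := @Zorn_bigcup A P.
 move=> F FP tot; have [[X0 [FX0 nX0]]|nF] := pselect (exists X, F X /\ X <> set0); last first.
  left; apply/seteqP; split=> // x [X FX Xx]; case: nF; exists X; split=> // X0.
  by rewrite X0 in Xx.
 have HX0 : good X0 by case: (FP _ FX0).
 have [iX0 OX0 IX0 X01] := HX0.
 have idX Z z : F Z -> Z z -> good Z.
  by move=> FZ Zz; case: (FP _ FZ) => [Z0|//]; rewrite Z0 in Zz.
 right; split.
 - split; first by exists X0 => //; apply: ideal0.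
  + move=> p q [X FX Xp] [Y FY Yq]; have [XY|YX] := tot _ _ FX FY.
    by exists Y => //; have [h _ _ _] := idX _ _ FY Yq; apply: (idealD h) => //; apply: XY.
   by exists X => //; have [h _ _ _] := idX _ _ FX Xp; apply: (idealD h) => //; apply: YX.
  + by move=> p q [X FX Xq]; exists X => //; have [h _ _ _] := idX _ _ FX Xq; apply: idealM.
 - by move=> f p Of [X FX Xp]; exists X => //; have [_ h _ _] := idX _ _ FX Xp; apply: h.
 - by move=> p Ip; exists X0 => //; apply: IX0.
 - by move=> [X FX X1]; have [_ _ _ h] := idX _ _ FX X1.
have HM : good M.
 case: PM => // M0; case: (maxM I); last by right; split.
 by rewrite M0; split; [move=> x|move=> /(_ 0 (ideal0 II))].
have [iM OM IM M1] := HM; exists M; split=> // J iJ OJ J1 MJ p Jp; apply: contrapT => nMp.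
apply: (maxM J); first by split=> // /(_ p Jp).
by right; split=> // x Ix; apply: MJ; apply: IM.
Qed.
Lemma maximal_ideal (A : comNzRingType) (I : A -> Prop) : ring_ideal I -> ~ I 1 ->
 exists M : A -> Prop, [/\ ring_ideal M, forall p, I p -> M p, ~ M 1 &
  forall p, ~ M p -> exists q, M (1 - q * p)].
Proof.
move=> II I1; have [|M [iM _ IM M1 maxM]] := @maximal_stable_ideal A (fun=> False) I II _ I1 => //.
exists M; split=> // p nMp; apply: contrapT => nq; pose N x := exists q m, M m /\ x = m + q * p.
apply/nMp/(maxM N) => //.
- split; first by exists 0, 0; rewrite mul0r addr0; split=> //; apply: ideal0.
 + move=> _ _ [q1 [m1 [h1 ->]]] [q2 [m2 [h2 ->]]]; exists (q1 + q2), (m1 + m2).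
  by split; [apply: idealD | ring].
 + move=> x _ [q1 [m1 [h1 ->]]]; exists (x * q1), (x * m1).
  by split; [apply: idealM | ring].
- by move=> [q [m [Mm E]]]; apply: nq; exists q; rewrite E addrK.
- by move=> x Mx; exists 0, x; rewrite mul0r addr0.
- by exists 1, 0; rewrite mul1r add0r; split=> //; apply: ideal0.
Qed.
(** Uncountability in the form in which it is applied: of countably many sets that cover the field,
    one has finite subsets of every size. *)
Definition uncountable_field (C : fieldType) := forall S : nat -> C -> Prop, (forall a, exists D, S D a) ->
 exists D, forall N, exists s : seq C, [/\ uniq s, size s = N & forall a, a \in s -> S D a].

Section Nullstellensatz.
Variables (C : closedFieldType) (n : nat).
Hypothesis unc : uncountable_field C.

Lemma mpoly_dependent D (s : seq C) (p : C -> {mpoly C[n]}) :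
 uniq s -> (#|{: 'X_{1..n < D}}| < size s)%N -> (forall a, (msize (p a) <= D)%N) ->
 exists c : C -> C, (exists2 a, a \in s & c a != 0) /\ \sum_(a <- s) c a *: p a = 0.
Proof.
move=> us lt sp; pose N := #|{: 'X_{1..n < D}}|.
pose Mx : 'M[C]_(size s, N) := \matrix_(i, j) (p s`_i)@_(bmnm (enum_val j)).
have : kermx Mx != 0.
 rewrite kermx_eq0 /row_free neq_ltn.
 by rewrite (leq_ltn_trans (rank_leq_col Mx)).
case/rowV0Pn => v /sub_kermxP vM v0.
pose c a : C := if insub (index a s) is Some i then v 0 i else 0.
have cE (i : 'I_(size s)) : c s`_i = v 0 i.
 rewrite /c index_uniq //; case: insubP => [j _ /val_inj->//|].
 by rewrite ltn_ord.
exists c; split.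
 have /rV0Pn[i vi] := v0; exists s`_i; first by rewrite mem_nth.
 by rewrite cE.
rewrite (big_nth 0) big_mkord; apply/mpolyP => m; rewrite mcoeff0 raddf_sum /=.
under eq_bigr => i _ do rewrite mcoeffZ cE.
have [mD|mD] := ltnP (mdeg m) D; last first.
 by apply: big1 => i _; rewrite memN_msupp_eq0 ?mulr0 // msize_mdeg_ge // (leq_trans (sp _)).
have /rowP/(_ (enum_rank (BMultinom mD))) := vM; rewrite !mxE => e; rewrite -[RHS]e.
by apply: eq_bigr => i _; rewrite mxE enum_rankK.
Qed.

(** If the class of [x] modulo a maximal ideal is not a scalar, every [x - a] has an inverse [q a].
    By uncountability, more of these than the dimension allows have representatives of degree below
    one bound [D], so they are linearly dependent. Clearing denominators makes [x] algebraic over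
    [C], hence a scalar. *)
Theorem nullstellensatz (I : {mpoly C[n]} -> Prop) : ring_ideal I -> ~ I 1 ->
 exists v : 'I_n -> C, forall p, I p -> p.@[v] = 0.
Proof.
move=> II I1; have [M [iM IM M1 maxM]] := maximal_ideal II I1.
have MN p : M p -> M (- p) by move=> h; rewrite -mulN1r; apply: idealM.
have prime p q : M (p * q) -> M p \/ M q.
 move=> Mpq; have [|nMp] := pselect (M p); [by left|right].
 have [u Mu] := maxM p nMp.
 have ->: q = q * (1 - u * p) + u * (p * q) by ring.
 by apply: idealD => //; apply: idealM.
have key (x : {mpoly C[n]}) : exists l, M (x - l%:MP).
 apply: contrapT => nl.
 pose S D a := exists2 q : {mpoly C[n]}, (msize q <= D)%N & M (1 - q * (x - a%:MP)).
 have [a|D HD] := unc (S := S).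
  have [q Mq] := maxM (x - a%:MP) (fun h => nl (ex_intro _ a h)).
  by exists (msize q), q.
 have [s [us ss hs]] := HD (#|{: 'X_{1..n < D}}|.+1).
 have ex a : exists q : {mpoly C[n]}, (msize q <= D)%N /\ (a \in s -> M (1 - q * (x - a%:MP))).
  have [/hs[q]|nas] := boolP (a \in s); first by exists q.
  by exists 0; rewrite msize0.
 pose q a := projT1 (cid (ex a)).
 have qD a : (msize (q a) <= D)%N by have [] := projT2 (cid (ex a)).
 have qM a : a \in s -> M (1 - q a * (x - a%:MP)) by have [] := projT2 (cid (ex a)).
 have [|c [[a0 a0s ca0] c0]] := @mpoly_dependent D s q us _ qD; first by rewrite ss.
 (* The linear relation between the inverses of the [x - a], multiplied by the product of all these
    differences. *)
 pose h : {poly C} := \sum_(a <- s) c a *: \prod_(b <- s | b != a) ('X - b%:P).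
 pose ev (f : {poly C}) : {mpoly C[n]} := (map_poly (@mpolyC n C) f).[x].
 have evM f g : ev (f * g) = ev f * ev g by rewrite /ev rmorphM hornerM.
 have evX b : ev ('X - b%:P) = x - b%:MP.
  by rewrite /ev rmorphB /= map_polyX map_polyC /= hornerD hornerN hornerX hornerC.
 have Mh : M (ev h).
  pose Pi := \prod_(b <- s) (x - b%:MP : {mpoly C[n]}).
  have evP a : a \in s -> ev (\prod_(b <- s | b != a) ('X - b%:P)) * (x - a%:MP) = Pi.
   move=> a_s; rewrite /Pi (bigD1_seq a) //= mulrC; congr (_ * _).
   rewrite /ev rmorph_prod horner_prod; apply: eq_bigr => b _; exact: evX.
  have -> : ev h = \sum_(a <- s) c a *: ev (\prod_(b <- s | b != a) ('X - b%:P)).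
   rewrite /ev /h raddf_sum horner_sum /=; apply: eq_bigr => a _.
   by rewrite linearZ /= hornerZ mul_mpolyC.
  have E : \sum_(a <- s) c a *: ev (\prod_(b <- s | b != a) ('X - b%:P)) =
   \sum_(a <- s) (c a *: ev (\prod_(b <- s | b != a) ('X - b%:P))) * (1 - q a * (x - a%:MP)).
   have -> : \sum_(a <- s) (c a *: ev (\prod_(b <- s | b != a) ('X - b%:P))) * (1 - q a * (x - a%:MP))
    = \sum_(a <- s) c a *: ev (\prod_(b <- s | b != a) ('X - b%:P)) - (\sum_(a <- s) c a *: q a) * Pi.
    rewrite mulr_suml -sumrB; apply: eq_big_seq => a a_s.
    by rewrite mulrBr mulr1 -(evP a a_s) -!scalerAl; congr (_ - _ *: _); ring.
   by rewrite c0 mul0r subr0.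
  rewrite E big_seq; elim/big_ind: _ => [|? ? ? ?|a a_s]; first exact: ideal0.
   exact: idealD.
  by apply: idealM => //; apply: qM.
 have h0 : h != 0.
  apply/eqP => h0; have : h.[a0] = 0 by rewrite h0 horner0.
  rewrite /h horner_sum (bigD1_seq a0) //= [X in _ + X]big1 => [|a aa0].
   rewrite addr0 hornerZ => /eqP; rewrite mulf_eq0 (negPf ca0) /= horner_prod.
   rewrite prodf_seq_eq0 => /hasP[b bs /andP[ba]]; rewrite hornerXsubC subr_eq0 => /eqP e.
   by rewrite e eqxx in ba.
  rewrite hornerZ horner_prod; apply/eqP; rewrite mulf_eq0; apply/orP; right.
  rewrite prodf_seq_eq0; apply/hasP; exists a0 => //=.
  by rewrite eq_sym aa0 hornerXsubC subrr eqxx.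
 have [rs Dh] := closed_field_poly_normal h.
 have l0 : lead_coef h != 0 by rewrite lead_coef_eq0.
 have : M (ev (\prod_(z <- rs) ('X - z%:P))).
  have -> : \prod_(z <- rs) ('X - z%:P) = (lead_coef h)^-1 *: h.
   by apply: (scalerI l0); rewrite -Dh scalerA mulfV ?scale1r.
  rewrite -mul_polyC evM; exact: idealM.
 elim: rs {Dh} => [|z rs IH]; first by rewrite big_nil /ev rmorph1 hornerC.
 by rewrite big_cons evM evX => /prime[h1|//]; apply: nl; exists z.
pose v i := projT1 (cid (key 'X_i)).
have vM i : M ('X_i - (v i)%:MP) := projT2 (cid (key 'X_i)).
have red p : M (p - (p.@[v])%:MP).
 elim/mpoly_alg_ind: p => [c|i|p q Hp Hq|p q Hp Hq].
 - by rewrite mevalC subrr; apply: ideal0.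
 - by rewrite mevalXU.
 - by rewrite mevalD mpolyCD opprD addrACA; apply: idealD.
 - have -> : p * q - (p * q).@[v]%:MP = q * (p - (p.@[v])%:MP) + (p.@[v])%:MP * (q - (q.@[v])%:MP).
   by rewrite mevalM mpolyCM; ring.
  by apply: idealD => //; apply: idealM.
exists v => p /IM Mp; apply/eqP/negPn/negP => nz; apply: M1.
have -> : 1 = ((p.@[v])^-1)%:MP * (p - (p - (p.@[v])%:MP)).
 by rewrite opprB addrCA subrr addr0 -mpolyCM mulVf.
by apply: idealM => //; apply: idealD => //; apply: MN.
Qed.

End Nullstellensatz.

(** * Places and their extension *)

Section Places.
Variables (L : fieldType) (C : closedFieldType) (kap : {rmorphism C -> L}).

(** The graph of a ring morphism from a subring of [L] onto [C]; [rr0] makes the relation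
    functional. *)
Record ring_relation (W : L -> C -> Prop) : Prop := RingRelation { rrC : forall c, W (kap c) c;
 rrD : forall a b x y, W a x -> W b y -> W (a + b) (x + y);
 rrM : forall a b x y, W a x -> W b y -> W (a * b) (x * y); rr0 : forall c, W 0 c -> c = 0 }.

(** A valuation ring of [L] with residue field [C], given by its residue map. *)
Record place (W : L -> C -> Prop) : Prop := Place { place_rr : ring_relation W;
 place_val : forall x, (exists c, W x c) \/ (x <> 0 /\ W x^-1 0) }.

Lemma rr_fun W a x y : ring_relation W -> W a x -> W a y -> x = y.
Proof.
move=> RW ax ay; apply/eqP; rewrite -subr_eq0; apply/eqP/(rr0 RW).
rewrite -(subrr a) -[- a]mulN1r -[- y]mulN1r; apply: rrD => //; apply: rrM => //.
by rewrite -(rmorphN1 kap); apply: rrC.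
Qed.
Lemma poly_ideal_root (J : {poly C} -> Prop) :
 (forall p q, J p -> J q -> J (p + q)) -> (forall p q, J q -> J (p * q)) -> ~ J 1 ->
 exists xi, forall q, J q -> q.[xi] = 0.
Proof.
move=> JD JM J1; have [J0|/existsNP[q /not_implyP[Jq /eqP q0]]] :=
 pselect (forall q, J q -> q = 0); first by exists 0 => q /J0->; rewrite horner0.
pose Q k := `[< exists q, [/\ J q, q != 0 & size q = k] >].
have exQ : exists k, Q k by exists (size q); apply/asboolP; exists q.
case: (ex_minnP exQ) => k /asboolP[m [Jm m0 sm]] min.
have [|xi rxi] := closed_rootP m _.
 apply/eqP => sm1; have /size_poly1P[c c0 mE] : size m == 1%N by apply/eqP.
 by apply: J1; rewrite -[1](_ : (c^-1)%:P * m = 1); [exact: JM | rewrite mE -polyCM mulVf].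
exists xi => p Jp; rewrite (divp_eq p m) hornerD hornerM (eqP rxi) mulr0 add0r.
have Jr : J (p %% m).
 have -> : p %% m = p + (- (p %/ m)) * m by rewrite {2}(divp_eq p m) mulNr addrAC subrr add0r.
 by apply: JD => //; apply: JM.
have [->|r0] := eqVneq (p %% m) 0; first by rewrite horner0.
have := min (size (p %% m)); rewrite leqNgt -sm ltn_modp m0 => /(_ _)/negP; case=> //.
by apply/asboolP; exists (p %% m).
Qed.

Section Maximal.
Variable W : L -> C -> Prop.
Hypothesis RW : ring_relation W.
Hypothesis maxW : forall W', ring_relation W' -> (forall a c, W a c -> W' a c) -> forall a c, W' a c -> W a c.

Definition prel (P : {poly L}) (Q : {poly C}) := forall i, W P`_i Q`_i.

Lemma W00 : W 0 0. Proof. by rewrite -(rmorph0 kap); apply: rrC. Qed.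
Lemma W_sum k (f : 'I_k -> L) (g : 'I_k -> C) : (forall i, W (f i) (g i)) -> W (\sum_i f i) (\sum_i g i).
Proof.
move=> h; elim: k f g h => [|k IH] f g h; first by rewrite !big_ord0; apply: W00.
by rewrite !big_ord_recl; apply: rrD => //; apply: IH.
Qed.
Lemma prelD P Q P' Q' : prel P Q -> prel P' Q' -> prel (P + P') (Q + Q').
Proof. by move=> h h' i; rewrite !coefD; apply: rrD. Qed.
Lemma prelM P Q P' Q' : prel P Q -> prel P' Q' -> prel (P * P') (Q * Q').
Proof. by move=> h h' i; rewrite !coefM; apply: W_sum => j; apply: rrM. Qed.
Lemma prelC a c : W a c -> prel a%:P c%:P.
Proof. by move=> h i; rewrite !coefC; case: eqP => // _; apply: W00. Qed.
Lemma prelX : prel 'X 'X.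
Proof.
move=> i; rewrite !coefX; case: eqP => _; last exact: W00.
by rewrite -(rmorph1 kap); apply: rrC.
Qed.
(** Such an equation excludes a value for [x], since it would reduce to [1 = 0]. *)
Definition dependent x := exists P : {poly L}, [/\ W P`_0 1, forall i, (0 < i)%N -> W P`_i 0 & P.[x] = 0].

(** The reductions of the polynomials that vanish at [x] form an ideal of [{poly C}]. If it is
    proper it has a root [xi], and sending [x] to [xi] extends [W]; by maximality [x] already had
    this value. *)
Lemma dom_or_dependent x : (exists c, W x c) \/ dependent x.
Proof.
pose J Q := exists2 P, prel P Q & P.[x] = 0.
have [[P hP Px]|J1] := pselect (J 1).
 right; exists P; split=> //; first by have := hP 0%N; rewrite coef1.
 by move=> i i0; have := hP i; rewrite coef1 (gtn_eqF i0).
left; have [|p q [P hP Px]|xi hxi] := poly_ideal_root _ _ J1.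
- move=> p q [P hP Px] [P' hP' Px']; exists (P + P'); first exact: prelD.
 by rewrite hornerD Px Px' addr0.
- exists (map_poly kap p * P); last by rewrite hornerM Px mulr0.
 by apply: prelM => // i; rewrite coef_map; apply: rrC.
exists xi; pose W' a c := exists P Q, [/\ prel P Q, P.[x] = a & Q.[xi] = c].
apply: (maxW (W' := W')).
- split.
 + move=> c; exists (kap c)%:P, c%:P; split; rewrite ?hornerC //; apply: prelC; exact: rrC.
 + move=> _ _ _ _ [P [Q [h <- <-]]] [P' [Q' [h' <- <-]]]; exists (P + P'), (Q + Q').
  by rewrite !hornerD; split=> //; apply: prelD.
 + move=> _ _ _ _ [P [Q [h <- <-]]] [P' [Q' [h' <- <-]]]; exists (P * P'), (Q * Q').
  by rewrite !hornerM; split=> //; apply: prelM.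
 + by move=> _ [P [Q [h Px <-]]]; apply: hxi; exists P.
- by move=> a c h; exists a%:P, c%:P; rewrite !hornerC; split=> //; apply: prelC.
- by exists 'X, 'X; rewrite !hornerX; split=> //; apply: prelX.
Qed.
(** Otherwise the equation that excludes a value for [b^-1], multiplied by a power of [b], reduces
    to [1 = 0]. *)
Lemma W_inv1 b : W b 1 -> W b^-1 1.
Proof.
move=> Wb; have b0 : b != 0.
 by apply/eqP => b0; rewrite b0 in Wb; have := rr0 RW Wb; apply/eqP/oner_neq0.
have [[c Wc]|[P [P0 Pi Pb]]] := dom_or_dependent b^-1.
 have := rrM RW Wb Wc; rewrite mulfV // mul1r => h.
 have W11 : W 1 1 by rewrite -(rmorph1 kap); apply: rrC.
 by rewrite (rr_fun RW W11 h).
exfalso; have Wbk k : W (b ^+ k) 1.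
 elim: k => [|k IH]; first by rewrite expr0 -(rmorph1 kap); apply: rrC.
 by rewrite exprS -[1]mulr1; apply: rrM.
have : W (b ^+ (size P) * P.[b^-1]) 1.
 rewrite horner_coef mulr_sumr; case sP: (size P) => [|k].
  have : P`_0 = 0 by rewrite nth_default ?sP.
  by move=> e; rewrite e in P0; have := rr0 RW P0 => /eqP; rewrite oner_eq0.
 rewrite big_ord_recl -[X in W _ X]addr0; apply: rrD => //.
  by rewrite expr0 mulr1 -[1]mulr1; apply: rrM.
 have E0 : \sum_(i < k) (0 : C) = 0 by apply: big1.
 rewrite -[X in W _ X]E0; apply: W_sum => i; rewrite mulrCA -[X in W _ X](mul0r 1); apply: (rrM RW); first exact: Pi.
 rewrite exprVn lift0 -expfB; last by rewrite ltnS ltn_ord.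
 exact: Wbk.
by rewrite Pb mulr0 => /(rr0 RW)/eqP; rewrite oner_eq0.
Qed.
Lemma W_inv b c : W b c -> c != 0 -> W b^-1 c^-1.
Proof.
move=> Wb c0; have h : W (kap c^-1 * b) 1 by rewrite -(mulVf c0); apply: rrM => //; apply: rrC.
have := rrM RW (rrC RW c^-1) (W_inv1 h); rewrite mulr1 invfM -fmorphV invrK mulrA.
by rewrite -rmorphM mulVf // rmorph1 mul1r.
Qed.
(** The equation of [x^-1], multiplied by a power of [x] and divided by its constant term, is a
    monic equation [B] of [x] of degree [k] whose other coefficients reduce to 0. Subtracting a
    multiple of it removes the leading term of [P] and keeps the reductions. *)
Lemma dependent_reduce x (P P' : {poly L}) : x != 0 ->
 W P`_0 1 -> (forall i, (0 < i)%N -> W P`_i 0) -> P.[x] = 0 ->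
 W P'`_0 1 -> (forall i, (0 < i)%N -> W P'`_i 0) -> P'.[x^-1] = 0 -> (size P' <= size P)%N ->
 exists P2 : {poly L}, [/\ W P2`_0 1, forall i, (0 < i)%N -> W P2`_i 0, P2.[x] = 0 & (size P2 < size P)%N].
Proof.
move=> x0 h0 hi hx h0' hi' hx' les.
have b0 : P'`_0 != 0.
 by apply/eqP => e; rewrite e in h0'; have := rr0 RW h0' => /eqP; rewrite oner_eq0.
have sP' : (0 < size P')%N.
 by rewrite lt0n size_poly_eq0; apply: contraNneq b0 => ->; rewrite coef0.
have sP1 : (1 < size P)%N.
 rewrite ltnNge; apply/negP => /size1_polyC e; move: hx; rewrite e hornerC => e0.
 by rewrite e0 in h0; have := rr0 RW h0 => /eqP; rewrite oner_eq0.
pose k := (size P).-1; have sPk : size P = k.+1 by rewrite /k prednK // ltnW.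
pose B : {poly L} := \poly_(j < k.+1) ((P'`_0)^-1 * P'`_(k - j)).
have Bk : B`_k = 1 by rewrite coef_poly ltnSn subnn mulVf.
have Bx : B.[x] = 0.
 have -> : B.[x] = (P'`_0)^-1 * x ^+ k * P'.[x^-1]; last by rewrite hx' mulr0.
 rewrite horner_poly (horner_coef_wide _ (_ : (size P' <= k.+1)%N)); last by rewrite -sPk.
 rewrite mulr_sumr (reindex_inj rev_ord_inj); apply: eq_bigr => j _ /=.
 rewrite subSS subKn; last by rewrite -ltnS.
 have jk : (j <= k)%N by rewrite -ltnS.
 have -> : x ^+ (k - j) = x ^+ k / x ^+ j.
  by rewrite -[X in _ = X / _](congr1 (GRing.exp x) (subnK jk)) exprD mulfK // expf_neq0.
 by rewrite exprVn mulrACA.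
have WB j : (j < k)%N -> W B`_j 0.
 move=> jk; rewrite coef_poly ltnS (ltnW jk) -[X in W _ X](mulr0 1); apply: (rrM RW) => //.
  exact: W_inv1.
 by apply: hi'; rewrite subn_gt0.
pose a := P`_k; have Wa : exists c, W a c.
 have [k0|k0] := posnP k; first by exists 1; rewrite /a k0.
 by exists 0; apply: hi.
have [c Wac] := Wa.
have WP2 j : (j < k)%N -> W (a * B`_j) 0 by move=> jk; rewrite -[X in W _ X](mulr0 c); apply: (rrM RW) => //; apply: WB.
have N1 : W (-1) (-1) by rewrite -(rmorphN1 kap); apply: rrC.
exists (P - a *: B); split.
- rewrite coefB coefZ -[X in W _ X](addr0 1); apply: rrD => //.
 rewrite -mulN1r -[X in W _ X](mulr0 (-1)); apply: (rrM RW) => //; apply: WP2; rewrite /k.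
 by rewrite -ltnS prednK // ltnW.
- move=> i i0; have [ik|ki] := ltnP i k.
  rewrite coefB coefZ -[X in W _ X](addr0 0); apply: (rrD RW); first exact: hi.
  by rewrite -mulN1r -[X in W _ X](mulr0 (-1)); apply: (rrM RW) => //; apply: WP2.
 have -> : (P - a *: B)`_i = 0; last exact: W00.
 rewrite coefB coefZ; move: ki; rewrite leq_eqVlt => /orP[/eqP<-|ki]; first by rewrite Bk mulr1 subrr.
 by rewrite !nth_default ?mulr0 ?subrr // ?sPk // (leq_trans (size_poly _ _)).
- by rewrite hornerD hornerN hornerZ hx Bx mulr0 subrr.
rewrite sPk ltnS; apply/leq_sizeP => i ki; rewrite coefB coefZ.
move: ki; rewrite leq_eqVlt => /orP[/eqP<-|ki]; first by rewrite Bk mulr1 subrr.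
by rewrite !nth_default ?mulr0 ?subrr // ?sPk // (leq_trans (size_poly _ _)).
Qed.
(** If neither [x] nor [x^-1] had a value, their two equations would shorten each other without
    end. *)
Lemma maximal_place : place W.
Proof.
split=> // x; have [|nx] := pselect (exists c, W x c); [by left|right].
have x0 : x != 0 by apply/eqP => x0; apply: nx; exists 0; rewrite x0; apply: W00.
have [[c Wc]|dV] := dom_or_dependent x^-1.
 split; first exact/eqP; have [c0|c0] := eqVneq c 0; first by rewrite -[0 in X in W _ X]c0.
 by case: nx; exists c^-1; rewrite -[x]invrK; apply: W_inv.
have [|dx] := dom_or_dependent x; first by move/nx.
exfalso.
suff H : forall N (P P' : {poly L}), (size P + size P' < N)%N ->
 W P`_0 1 -> (forall i, (0 < i)%N -> W P`_i 0) -> P.[x] = 0 ->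
 W P'`_0 1 -> (forall i, (0 < i)%N -> W P'`_i 0) -> P'.[x^-1] = 0 -> False.
 have [P [? ? ?]] := dx; have [P' [? ? ?]] := dV.
 exact: (H _ P P' (ltnSn _)).
elim=> // N IH P P' lt h0 hi hx h0' hi' hx'.
have [le|/ltnW le] := leqP (size P') (size P).
 have [P2 [g0 gi gx glt]] := dependent_reduce x0 h0 hi hx h0' hi' hx' le.
 apply: (IH P2 P') => //; rewrite -ltnS; apply: leq_trans lt.
 by rewrite ltnS -addSn leq_add2r.
have [||P2 [g0 gi gx glt]] := @dependent_reduce x^-1 P' P _ h0' hi' hx' h0 hi _ le.
- by rewrite invr_eq0.
- by rewrite invrK.
apply: (IH P P2) => //; rewrite -ltnS; apply: leq_trans lt.
by rewrite ltnS -addnS leq_add2l.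
Qed.

End Maximal.

Theorem place_extension (S : L -> C -> Prop) : ring_relation S ->
 exists2 W, place W & forall a c, S a c -> W a c.
Proof.
move=> RS; pose rel (X : set (L * C)) a c := X (a, c).
pose P (X : set (L * C)) := X = set0 \/ (ring_relation (rel X) /\ forall a c, S a c -> X (a, c)).
have [|M [PM maxM]] := @Zorn_bigcup (L * C) P.
 move=> F FP tot; have [[X0 [FX0 nX0]]|nF] := pselect (exists X, F X /\ X <> set0); last first.
  left; apply/seteqP; split=> // x [X FX Xx]; case: nF; exists X; split=> // X0.
  by rewrite X0 in Xx.
 have RX Z z : F Z -> Z z -> ring_relation (rel Z).
  by move=> FZ Zz; case: (FP _ FZ) => [Z0|[]//]; rewrite Z0 in Zz.
 have [RX0 SX0] : ring_relation (rel X0) /\ forall a c, S a c -> X0 (a, c) by case: (FP _ FX0).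
 have both X Y u v : F X -> X u -> F Y -> Y v -> exists Z, [/\ F Z, Z u & Z v].
  move=> FX Xu FY Yv; have [XY|YX] := tot _ _ FX FY; first by exists Y; split=> //; apply: XY.
  by exists X; split=> //; apply: YX.
 right; split; last by move=> a c Sac; exists X0 => //; apply: SX0.
 split.
 - by move=> c; exists X0 => //; apply: rrC RX0 c.
 - move=> a b x y [X FX Xa] [Y FY Yb]; have [Z [FZ Za Zb]] := both _ _ _ _ FX Xa FY Yb.
  by exists Z => //; apply: rrD (RX _ _ FZ Za) _ _ _ _ Za Zb.
 - move=> a b x y [X FX Xa] [Y FY Yb]; have [Z [FZ Za Zb]] := both _ _ _ _ FX Xa FY Yb.
  by exists Z => //; apply: rrM (RX _ _ FZ Za) _ _ _ _ Za Zb.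
 - by move=> c [X FX Xc]; apply: rr0 (RX _ _ FX Xc) _ Xc.
have HM : ring_relation (rel M) /\ forall a c, S a c -> M (a, c).
 case: PM => // M0; case: (maxM [set t | S t.1 t.2]%classic).
  rewrite M0; split; first by move=> t.
  by move=> /(_ (kap 0, 0) (rrC RS 0)).
 by right; split=> //; case: RS => *; split.
have [RM SM] := HM; exists (rel M) => //; apply: maximal_place => // W' RW' sub a c Wac.
apply: contrapT => nM; apply: (maxM [set t | W' t.1 t.2]%classic).
 split; first by move=> [u v] /sub.
 by move=> /(_ (a, c) Wac).
right; split; last by move=> u v /SM/sub.
by case: RW' => *; split.
Qed.

End Places.

(** * Orders of magnitude at a place *)

Section PlaceTheory.
Variables (L : fieldType) (C : closedFieldType) (kap : {rmorphism C -> L}).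
Variable W : L -> C -> Prop.
Hypothesis PW : place kap W.
Let RW := place_rr PW.

(** Here and below: finite elements, infinitesimal elements, and pairs of the same order of
    magnitude. *)
Definition pdom x := exists c, W x c.
Definition pinf x := W x 0.
Definition psim x y := exists2 c, c != 0 & W (x / y) c.

Lemma pl0 : W 0 0. Proof. by rewrite -(rmorph0 kap); apply: rrC. Qed.
Lemma pl1 : W 1 1. Proof. by rewrite -(rmorph1 kap); apply: rrC. Qed.
Lemma plN a c : W a c -> W (- a) (- c).
Proof.
by move=> h; rewrite -mulN1r -[- c]mulN1r; apply: (rrM RW) => //; rewrite -(rmorphN1 kap); apply: rrC.
Qed.
Lemma plB a b c d : W a c -> W b d -> W (a - b) (c - d).
Proof. by move=> h /plN; apply: (rrD RW). Qed.
Lemma pdom_or x : pdom x \/ (x <> 0 /\ pinf x^-1). Proof. exact: place_val PW x. Qed.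
Lemma pinf_dom x : pinf x -> pdom x. Proof. by exists 0. Qed.
Lemma pdomD x y : pdom x -> pdom y -> pdom (x + y).
Proof. by move=> [c ?] [d ?]; exists (c + d); apply: (rrD RW). Qed.
Lemma pdomM x y : pdom x -> pdom y -> pdom (x * y).
Proof. by move=> [c ?] [d ?]; exists (c * d); apply: (rrM RW). Qed.
Lemma pinfD x y : pinf x -> pinf y -> pinf (x + y).
Proof. by move=> ? ?; rewrite /pinf -[X in W _ X](addr0 0); apply: (rrD RW). Qed.
Lemma pinfMl x y : pdom x -> pinf y -> pinf (x * y).
Proof. by move=> [c ?] ?; rewrite /pinf -[X in W _ X](mulr0 c); apply: (rrM RW). Qed.
Lemma pinfMr x y : pinf x -> pdom y -> pinf (x * y).
Proof. by move=> ? ?; rewrite mulrC; apply: pinfMl. Qed.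
Lemma pinf1 : ~ pinf 1.
Proof. by move=> h; have := rr_fun RW pl1 h => /eqP; rewrite oner_eq0. Qed.
Lemma pl_inv x c : W x c -> c != 0 -> W x^-1 c^-1.
Proof.
move=> Wx c0; have [[d Wd]|[x0]] := pdom_or x^-1.
 have x0 : x != 0 by apply/eqP => x0; move: c0; rewrite (rr0 RW (c := c)) ?eqxx // -x0.
 have := rrM RW Wx Wd; rewrite mulfV // => /(rr_fun RW pl1) e.
 suff -> : c^-1 = d by [].
 by rewrite -[LHS]mulr1 e mulKf.
by rewrite /pinf invrK => /(rr_fun RW Wx) e; rewrite e eqxx in c0.
Qed.
Lemma pinf_ndom x : x != 0 -> pinf x -> ~ pdom x^-1.
Proof.
by move=> x0 mx dx; apply: pinf1; rewrite -(mulfV x0); apply: pinfMr.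
Qed.
Lemma pinf_exp x k : (0 < k)%N -> pinf (x ^+ k) -> pinf x.
Proof.
move=> k0 mk; have [[c Wc]|[x0 mx]] := pdom_or x.
 have Wk j : W (x ^+ j) (c ^+ j).
  by elim: j => [|j IH]; [rewrite !expr0; apply: pl1 | rewrite !exprS; apply: (rrM RW)].
 have /eqP := rr_fun RW (Wk k) mk; rewrite expf_eq0 k0 => /eqP c0.
 by rewrite /pinf -c0.
exfalso; have: pinf ((x^-1) ^+ k).
 by case: k k0 {mk} => // k _; rewrite exprS; apply: pinfMr => //; elim: k => [|k IH];
  [rewrite expr0; exists 1; apply: pl1 | rewrite exprS; apply: pdomM => //; apply: pinf_dom].
rewrite exprVn => h; apply: (@pinf_ndom (x ^+ k)) => //; last exact: pinf_dom.
by rewrite expf_neq0 //; apply/eqP.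
Qed.
Lemma pdom_total x y : x != 0 -> y != 0 -> pdom (x / y) \/ pdom (y / x).
Proof.
by move=> x0 y0; case: (pdom_or (x / y)) => [|[_ /pinf_dom]]; [left | rewrite invf_div; right].
Qed.
(** Magnitudes are totally ordered, so a finite family has an element of least magnitude. *)
Lemma pdom_min (T : eqType) (f : T -> L) (s : seq T) : s != [::] -> {in s, forall b, f b != 0} ->
 exists2 b, b \in s & {in s, forall b', pdom (f b / f b')}.
Proof.
elim: s => [//|a s IH] _ h.
have ha : pdom (f a / f a) by rewrite mulfV ?h ?mem_head //; exists 1; apply: pl1.
case: s IH h => [|a' s] IH h.
 by exists a; rewrite ?mem_head // => b'; rewrite inE => /eqP->.
have [|b bs hb] := IH isT; first by move=> b bs; apply: h; rewrite inE bs orbT.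
have fb : f b != 0 by apply: h; rewrite inE bs orbT.
have [d|d] := pdom_total (h a (mem_head _ _)) fb.
 exists a; first exact: mem_head.
 move=> b'; rewrite inE => /orP[/eqP->//|b's].
 have -> : f a / f b' = (f a / f b) * (f b / f b') by rewrite mulrA mulfVK.
 by apply: pdomM => //; apply: hb.
exists b; first by rewrite inE bs orbT.
by move=> b'; rewrite inE => /orP[/eqP->//|b's]; apply: hb.
Qed.
Lemma psim_refl x : x != 0 -> psim x x.
Proof. by move=> x0; exists 1; rewrite ?oner_neq0 // mulfV //; apply: pl1. Qed.
Lemma psimM x y x' y' : psim x y -> psim x' y' -> psim (x * x') (y * y').
Proof.
move=> [c c0 h] [c' c'0 h']; exists (c * c'); first by rewrite mulf_neq0.
by rewrite invfM mulrACA; apply: (rrM RW).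
Qed.
Lemma psim_sym x y : psim x y -> psim y x.
Proof.
move=> [c c0 h]; exists c^-1; first by rewrite invr_eq0.
by rewrite -[y / x]invrK invfM invrK mulrC; apply: pl_inv => //; rewrite mulrC.
Qed.
Lemma psim_neq0 x y : psim x y -> (x != 0) && (y != 0).
Proof.
move=> [c c0 h]; rewrite -negb_or; apply: contra c0 => /orP[]/eqP e; move: h.
 by rewrite e mul0r => /(rr0 RW)->.
by rewrite e invr0 mulr0 => /(rr0 RW)->.
Qed.
Lemma psimV x y : psim x y -> psim x^-1 y^-1.
Proof. by move=> /psim_sym[c c0 h]; exists c => //; rewrite invrK mulrC. Qed.
Lemma psim_pinf x y : psim x y -> pinf y -> pinf x.
Proof.
move=> s my; have /andP[_ y0] := psim_neq0 s; rewrite -[x](mulfVK y0); apply: pinfMl => //.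
by case: s => c _; exists c.
Qed.
Lemma psim_addl x y : x != 0 -> pinf (y / x) -> psim (x + y) x.
Proof.
move=> x0 h; exists 1; first exact: oner_neq0.
by rewrite mulrDl mulfV // -[X in W _ X]addr0; apply: (rrD RW) => //; apply: pl1.
Qed.

End PlaceTheory.

(** * Replacing one element by an element of a closed subfield *)

Section Selection.
Variables (L : fieldType) (C K : closedFieldType) (kap : {rmorphism C -> L}).
Variable W : L -> C -> Prop.
Hypothesis PW : place kap W.
Variables (kapK : {rmorphism C -> K}) (iota : {rmorphism K -> L}).
Hypothesis kapKE : forall c, iota (kapK c) = kap c.
Variable z : K.
Hypotheses (z0 : z != 0) (mz : pinf W (iota z)).
Let RW := place_rr PW.

Lemma closed_nth_root k (c : K) : (0 < k)%N -> exists e, e ^+ k = c.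
Proof.
move=> k0; have /closed_rootP[e] : size ('X^k - c%:P) != 1%N.
 by rewrite size_XnsubC //; case: k k0.
by rewrite /root !hornerE ?hornerXn subr_eq0 => /eqP <-; exists e.
Qed.
Lemma iota_neq0 (e : K) : (iota e != 0) = (e != 0). Proof. by rewrite fmorph_eq0. Qed.

Section Near.
Variable u : L.
Hypothesis u0 : u != 0.

(** [P] holds for every [s] in the cut of [u], as far as finitely many elements of [K] can test it:
    infinitely smaller than the elements of [Up], infinitely larger than those of [Lo]. *)
Definition near_elt (P : K -> Prop) := exists Up Lo : seq K,
 [/\ {in Up, forall e, e != 0 /\ pinf W (u / iota e)}, {in Lo, forall e, e != 0 /\ pinf W (iota e / u)}
  & forall s, s != 0 -> {in Up, forall e, pinf W (iota s / iota e)} ->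
    {in Lo, forall e, pinf W (iota e / iota s)} -> P s].

Lemma near_and P Q : near_elt P -> near_elt Q -> near_elt (fun s => P s /\ Q s).
Proof.
move=> [U1 [L1 [h1 h2 h3]]] [U2 [L2 [g1 g2 g3]]]; exists (U1 ++ U2), (L1 ++ L2); split.
- by move=> e; rewrite mem_cat => /orP[/h1|/g1].
- by move=> e; rewrite mem_cat => /orP[/h2|/g2].
by move=> s s0 hU hL; split; [apply: h3 | apply: g3] => // e he; [apply: hU|apply: hL|apply: hU|apply: hL];
 rewrite mem_cat he ?orbT.
Qed.
Lemma near_imp (P Q : K -> Prop) : (forall s, s != 0 -> P s -> Q s) -> near_elt P -> near_elt Q.
Proof.
move=> PQ [U1 [L1 [h1 h2 h3]]]; exists U1, L1; split=> // s s0 hU hL.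
by apply: PQ => //; apply: h3.
Qed.
Lemma near_true (P : K -> Prop) : (forall s, s != 0 -> P s) -> near_elt P.
Proof. by move=> hP; exists [::], [::]; split=> // s s0 _ _; apply: hP. Qed.
Lemma near_all (T : eqType) (l : seq T) (P : T -> K -> Prop) :
 {in l, forall t, near_elt (P t)} -> near_elt (fun s => {in l, forall t, P t s}).
Proof.
elim: l => [|a l IH] h; first exact: near_true.
have ha := h a (mem_head _ _); have hl : near_elt (fun s => {in l, forall t, P t s}).
 by apply: IH => t tl; apply: h; rewrite inE tl orbT.
apply: near_imp (near_and ha hl) => s _ [pa pl] t; rewrite inE => /orP[/eqP->//|]; exact: pl.
Qed.
Lemma near_up e : e != 0 -> pinf W (u / iota e) -> near_elt (fun s => pinf W (iota s / iota e)).
Proof.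
move=> e0 he; exists [:: e], [::]; split=> // [e'|s s0 h _]; first by rewrite inE => /eqP->.
by apply: h; rewrite mem_head.
Qed.
Lemma near_lo e : e != 0 -> pinf W (iota e / u) -> near_elt (fun s => pinf W (iota e / iota s)).
Proof.
move=> e0 he; exists [::], [:: e]; split=> // [e'|s s0 _ h]; first by rewrite inE => /eqP->.
by apply: h; rewrite mem_head.
Qed.
(** Between the nearest bounds [l] and [e] lies the square root of their product. If one side is
    empty, the other bound is shifted by the infinitesimal [z]. *)
Lemma near_exists P : near_elt P -> exists2 s, s != 0 & P s.
Proof.
move=> [Up [Lo [hU hL hP]]].
have UpX : Up != [::] -> exists2 e, e \in Up & {in Up, forall e', pdom W (iota e / iota e')}.
 by move=> U0; apply: (pdom_min PW (f := iota)) => // b /hU[]; rewrite iota_neq0.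
have LoX : Lo != [::] -> exists2 e, e \in Lo & {in Lo, forall e', pdom W (iota e' / iota e)}.
 move=> L0; have [|e eL he] := pdom_min PW (f := fun e => (iota e)^-1) L0.
  by move=> b /hL[]; rewrite invr_eq0 iota_neq0.
 by exists e => // e' e'L; have := he _ e'L; rewrite invrK mulrC.
have div3 (a b c : L) : b != 0 -> a / c = (a / b) * (b / c).
 by move=> b0; rewrite mulrA mulfVK.
have [/eqP U0|/UpX[e eU he]] := boolP (Up == [::]); have [/eqP L0|/LoX[l lL hl]] := boolP (Lo == [::]).
- exists 1; first exact: oner_neq0.
 by apply: hP; rewrite ?oner_neq0 // ?U0 ?L0.
- have [l0 _] := hL _ lL; exists (l / z); first by rewrite mulf_neq0 ?invr_eq0.
 apply: hP; rewrite ?mulf_neq0 ?invr_eq0 ?U0 // => e' /hl he'.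
 rewrite (div3 _ (iota l)) ?iota_neq0 //; apply: (pinfMl PW) => //.
 by rewrite rmorphM fmorphV invfM invrK mulrA mulfV ?iota_neq0 // mul1r.
- have [e0 _] := hU _ eU; exists (e * z); first by rewrite mulf_neq0.
 apply: hP; rewrite ?mulf_neq0 ?L0 // => e' /he he'.
 by rewrite rmorphM mulrAC; apply: (pinfMl PW).
have [e0 me] := hU _ eU; have [l0 ml] := hL _ lL.
have mle : pinf W (iota l / iota e) by rewrite (div3 _ u) //; apply: (pinfMr PW) => //; apply: pinf_dom.
have [s sE] := @closed_nth_root 2 (l * e) isT.
have s0 : s != 0 by apply/eqP => s0; move/eqP: sE; rewrite s0 expr0n eq_sym mulf_eq0 (negPf l0) (negPf e0).
have mse : pinf W (iota s / iota e).
 apply: (@pinf_exp _ _ _ _ PW _ 2) => //; rewrite expr_div_n -!rmorphXn sE rmorphM expr2 rmorphM.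
 by rewrite invfM mulrACA mulfV ?iota_neq0 // mulr1.
have mls : pinf W (iota l / iota s).
 apply: (@pinf_exp _ _ _ _ PW _ 2) => //; rewrite expr_div_n -!rmorphXn sE rmorphM expr2 rmorphM.
 by rewrite invfM mulrACA mulfV ?iota_neq0 // mul1r.
exists s => //; apply: hP => // [e' /he h|e' /hl h].
 by rewrite (div3 _ (iota e)) ?iota_neq0 //; apply: (pinfMr PW).
by rewrite (div3 _ (iota l)) ?iota_neq0 //; apply: (pinfMl PW).
Qed.

Hypothesis nunit : forall d, ~ psim W u (iota d).

(* With no [d] comparable to [u], each factor [u + d] behaves like [u] or like [d]. *)
Lemma near_linear (d : K) : exists c k, c != 0 /\ psim W (u + iota d) (iota c * u ^+ k) /\
 near_elt (fun s => psim W (iota s + iota d) (iota c * iota s ^+ k)).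
Proof.
have [->|d0] := eqVneq d 0.
 exists 1, 1%N; rewrite oner_neq0 rmorph1 mul1r rmorph0 addr0 expr1; split=> //; split.
  exact: (psim_refl PW).
 by apply: near_true => s s0; rewrite ?mul1r ?addr0 ?expr1; apply: (psim_refl PW); rewrite iota_neq0.
have d0' : iota d != 0 by rewrite iota_neq0.
have [[c Wc]|[_ mud]] := pdom_or PW (iota d / u); last first.
 have {}mud : pinf W (u / iota d) by rewrite -[u / _]invrK invfM invrK mulrC.
 exists d, 0%N; rewrite expr0 mulr1; split=> //; split.
  by rewrite addrC; apply: (psim_addl PW).
 by apply: near_imp (near_up d0 mud) => s s0 h; rewrite addrC; apply: (psim_addl PW).
have c0 : c = 0.
 apply/eqP; apply: contrapT => /negP c0; apply: (@nunit d).
 by apply: (psim_sym PW); exists c.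
rewrite c0 in Wc; exists 1, 1%N; rewrite oner_neq0 rmorph1 mul1r expr1; split=> //; split.
 exact: (psim_addl PW).
apply: near_imp (near_lo d0 Wc) => s s0 h; rewrite ?mul1r ?expr1; apply: (psim_addl PW) => //.
by rewrite iota_neq0.
Qed.
(** Factor by factor over the roots of [p]. One monomial gives the magnitude of [p] both at [u] and
    at all [s] in the cut of [u], with the origin at [b1]. *)
Lemma near_poly (b1 : K) (p : {poly K}) : p != 0 -> exists c k, c != 0 /\
 psim W (map_poly iota p).[iota b1 + u] (iota c * u ^+ k) /\
 near_elt (fun s => psim W (iota p.[b1 + s]) (iota c * iota s ^+ k)).
Proof.
move=> p0; have [r pE] := closed_field_poly_normal p.
have lp : lead_coef p != 0 by rewrite lead_coef_eq0.
move: (lead_coef p) lp pE => l l0 ->; elim: r => [|b r [c [k [c0 [h1 h2]]]]].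
 rewrite big_nil alg_polyC; exists l, 0%N; split=> //; split.
  rewrite expr0 mulr1 map_polyC hornerC /=.
  by apply: (psim_refl PW); rewrite iota_neq0.
 by apply: near_true => s s0; rewrite ?expr0 ?mulr1 hornerC; apply: (psim_refl PW); rewrite iota_neq0.
have [c' [k' [c'0 [g1 g2]]]] := near_linear (b1 - b).
exists (c' * c), (k' + k)%N; split; first by rewrite mulf_neq0.
rewrite big_cons scalerAr; split.
 rewrite [map_poly _ _]rmorphM hornerM exprD [iota (c' * c)]rmorphM mulrACA; apply: (psimM PW) => //; rewrite rmorphB /= map_polyX map_polyC /= !hornerE.
 by have -> : iota b1 + u - iota b = u + iota (b1 - b) by rewrite rmorphB; ring.
apply: near_imp (near_and g2 h2) => s s0 [g h]; rewrite hornerM exprD [iota (c' * c)]rmorphM [iota (_.[_] * _)]rmorphM.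
rewrite [X in psim W _ X]mulrACA.
apply: (psimM PW) => //; rewrite !hornerE.
by have -> : iota (b1 + s - b) = iota s + iota (b1 - b) by rewrite !rmorphB !rmorphD; ring.
Qed.
Lemma near_ratio (c c' : K) k k' : c != 0 -> c' != 0 -> pinf W ((iota c * u ^+ k) / (iota c' * u ^+ k')) ->
 near_elt (fun s => pinf W ((iota c * iota s ^+ k) / (iota c' * iota s ^+ k'))).
Proof.
move=> c0 c'0; have [lt|le] := ltnP k k'.
 have k0 : (0 < k' - k)%N by rewrite subn_gt0.
 have E v : v != 0 -> (iota c * v ^+ k) / (iota c' * v ^+ k') = iota (c / c') / v ^+ (k' - k).
  move=> v0; rewrite -{1}(subnK (ltnW lt)) exprD rmorphM fmorphV.
  by field; rewrite iota_neq0 c'0 !expf_neq0.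
 have [e eE] := closed_nth_root (c / c') k0.
 have e0 : e != 0.
  apply/eqP => e0; move/eqP: eE; rewrite e0 expr0n (gtn_eqF k0) eq_sym mulf_eq0 invr_eq0.
  by rewrite (negPf c0) (negPf c'0).
 rewrite E // -eE rmorphXn -expr_div_n => /(pinf_exp PW k0) h.
 apply: near_imp (near_lo e0 h) => s s0 hs; rewrite E ?iota_neq0 // -eE rmorphXn -expr_div_n.
 case: (k' - k)%N k0 => // j _; rewrite exprS; apply: (pinfMr PW) => //.
 elim: j => [|j IH]; first by exists 1; rewrite expr0; apply: (pl1 PW).
 by rewrite exprS; apply: (pdomM PW) => //; apply: pinf_dom.
move: le; rewrite leq_eqVlt => /orP[/eqP->|lt] h.
 apply: near_true => s s0; move: h; have E v : v != 0 -> (iota c * v ^+ k) / (iota c' * v ^+ k) = iota c / iota c'.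
  by move=> v0; field; rewrite iota_neq0 c'0 !expf_neq0.
 by rewrite !E ?iota_neq0.
have k0 : (0 < k - k')%N by rewrite subn_gt0.
have E v : v != 0 -> (iota c * v ^+ k) / (iota c' * v ^+ k') = v ^+ (k - k') / iota (c' / c).
 move=> v0; rewrite -{1}(subnK (ltnW lt)) exprD rmorphM fmorphV.
 by field; rewrite !iota_neq0 c'0 c0 !expf_neq0.
have [e eE] := closed_nth_root (c' / c) k0.
have e0 : e != 0.
 apply/eqP => e0; move/eqP: eE; rewrite e0 expr0n (gtn_eqF k0) eq_sym mulf_eq0 invr_eq0.
 by rewrite (negPf c0) (negPf c'0).
move: h; rewrite E // -eE rmorphXn -expr_div_n => /(pinf_exp PW k0) h.
apply: near_imp (near_up e0 h) => s s0 hs; rewrite E ?iota_neq0 // -eE rmorphXn -expr_div_n.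
case: (k - k')%N k0 => // j _; rewrite exprS; apply: (pinfMr PW) => //.
elim: j => [|j IH]; first by exists 1; rewrite expr0; apply: (pl1 PW).
by rewrite exprS; apply: (pdomM PW) => //; apply: pinf_dom.
Qed.

End Near.

Lemma C_avoid (s : seq C) : exists c : C, c \notin s.
Proof.
have /closed_nonrootP[x] : \prod_(b <- s) ('X - b%:P) != 0 by rewrite monic_neq0 // monic_prod_XsubC.
by rewrite root_prod_XsubC; exists x.
Qed.
Lemma psim_poly (x : L) (a : K) (p : {poly K}) : p != 0 ->
 (forall b, root p b -> psim W (iota (a - b)) (x - iota b)) -> psim W (iota p.[a]) (map_poly iota p).[x].
Proof.
move=> p0; have [r pE] := closed_field_poly_normal p.
have lp : lead_coef p != 0 by rewrite lead_coef_eq0.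
move=> h; have {}h b : b \in r -> psim W (iota (a - b)) (x - iota b).
 by move=> br; apply: h; rewrite pE rootZ // root_prod_XsubC.
move: (lead_coef p) lp pE => l l0 ->; elim: r h => [|b r IH] h.
 by rewrite big_nil alg_polyC map_polyC !hornerC; apply: (psim_refl PW); rewrite iota_neq0.
rewrite big_cons scalerAr [map_poly _ _]rmorphM !hornerM [iota (_.[_] * _)]rmorphM; apply: (psimM PW).
 by rewrite rmorphB /= map_polyX map_polyC /= !hornerE; apply: h; rewrite mem_head.
by apply: IH => b' b'r; apply: h; rewrite inE b'r orbT.
Qed.
(** Let [b1] be the root nearest to [x] among the roots of all polynomials concerned, and [u] the
    difference. If [u] has the magnitude of some [d] in [K], a general point [b1 + kapK ze * d] has
    the same distances from the roots as [x], up to magnitude. Otherwise [u] defines a cut in [K],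
    and [near_exists] applies. *)
Lemma selection (x : L) (cond : seq ({poly K} * {poly K})) (nz : seq {poly K}) : (forall k, iota k != x) ->
 {in cond, forall pq, pq.2 != 0 /\ pinf W ((map_poly iota pq.1).[x] / (map_poly iota pq.2).[x])} ->
 {in nz, forall e, e != 0} ->
 exists a, {in cond, forall pq, pq.2.[a] != 0 /\ pinf W (iota (pq.1.[a] / pq.2.[a]))} /\
  {in nz, forall e : {poly K}, e.[a] != 0}.
Proof.
move=> xK hc hn.
(* The factor ['X] only ensures that the list of roots is not empty. *)
pose P : {poly K} := 'X * (\prod_(pq <- cond | pq.1 != 0) pq.1 * \prod_(pq <- cond) pq.2 * \prod_(e <- nz) e).
have P0 : P != 0.
 rewrite mulf_neq0 ?polyX_eq0 // !mulf_neq0 // prodf_seq_neq0; apply/allP => t th.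
 - by apply/implyP.
 - by have [] := hc _ th.
 - exact: hn.
have [r PE] := closed_field_poly_normal P.
have rP b : root P b -> b \in r by rewrite PE rootZ ?lead_coef_eq0 // root_prod_XsubC.
have r1 pq b : pq \in cond -> pq.1 != 0 -> root pq.1 b -> b \in r.
 move=> pc p0 rb; apply: rP; rewrite !rootM; apply/orP; right; apply/orP; left; apply/orP; left.
 by rewrite /root (big_rem pq) //= p0 hornerM (eqP rb) mul0r.
have r2 pq b : pq \in cond -> root pq.2 b -> b \in r.
 move=> pc rb; apply: rP; rewrite !rootM; apply/orP; right; apply/orP; left; apply/orP; right.
 by rewrite /root (big_rem pq) //= hornerM (eqP rb) mul0r.
have r3 e b : e \in nz -> root e b -> b \in r.
 move=> pc rb; apply: rP; rewrite !rootM; apply/orP; right; apply/orP; right.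
 by rewrite /root (big_rem e) //= hornerM (eqP rb) mul0r.
have rn : r != [::].
 have : 0 \in r by apply: rP; rewrite rootM rootX eqxx.
 by case: r {PE rP r1 r2 r3}.
have xb b : x - iota b != 0 by rewrite subr_eq0 eq_sym.
have [b1 b1r hb1] := pdom_min PW (f := fun b => x - iota b) rn (fun b _ => xb b).
set u := x - iota b1 in hb1; have u0 : u != 0 by exact: xb.
have div3 (a b c : L) : b != 0 -> a / c = (a / b) * (b / c).
 by move=> b0; rewrite mulrA mulfVK.
have [[d [c c0 Wc]]|nu] := pselect (exists d, psim W u (iota d)).
 have /andP[_ d0] := psim_neq0 PW (ex_intro2 _ _ c c0 Wc).
 have Wc' : W (iota d / u) c^-1 by rewrite -invf_div; apply: (pl_inv PW).
 pose w b := xget 0 [set w | W (u / (x - iota b)) w]%classic.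
 have Ww b : b \in r -> W (u / (x - iota b)) (w b) by move=> /hb1 h; exact: (xgetPex 0 h).
 (* The excluded values are those for which the distance to some root would drop to a smaller
    magnitude. *)
 have [ze hze] := C_avoid [seq (w b - 1) * c / w b | b <- r].
 exists (b1 + kapK ze * d).
 have H p : p != 0 -> (forall b, root p b -> b \in r) ->
   psim W (iota p.[b1 + kapK ze * d]) (map_poly iota p).[x].
  move=> p0 rp; apply: psim_poly => // b /rp br.
  exists (ze * c^-1 * w b + (1 - w b)).
   have [w0|w0] := eqVneq (w b) 0; first by rewrite w0 mulr0 add0r subr0 oner_neq0.
   apply: contraNneq hze => e; apply/mapP; exists b => //; apply: (mulIf w0).
   rewrite mulfVK //; have -> : ze * w b = c * (ze * c^-1 * w b + (1 - w b)) + (w b - 1) * c by field.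
   by rewrite e mulr0 add0r.
  have -> : iota (b1 + kapK ze * d - b) / (x - iota b) =
    kap ze * (iota d / u) * (u / (x - iota b)) + (1 - u / (x - iota b)).
   have aux (X U B1 B Z D : L) : U = X - B1 -> U != 0 -> X - B != 0 ->
     (B1 + Z * D - B) / (X - B) = Z * (D / U) * (U / (X - B)) + (1 - U / (X - B)).
    by move=> -> h1 h2; field; rewrite ?h1 ?h2.
   by rewrite rmorphB rmorphD rmorphM kapKE; apply: aux.
  apply: (rrD RW); last by apply: (plB PW); [apply: (pl1 PW)|apply: Ww].
  apply: (rrM RW); last exact: Ww.
  by apply: (rrM RW) => //; apply: (rrC RW).
 split=> [pq pc|e en]; last first.
  by have /andP[] := psim_neq0 PW (H e (hn _ en) (fun b => r3 _ _ en)); rewrite iota_neq0.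
 have [q0 mpq] := hc _ pc; have sq := H _ q0 (fun b => r2 _ _ pc).
 split; first by have /andP[] := psim_neq0 PW sq; rewrite iota_neq0.
 have [->|p0] := eqVneq pq.1 0; first by rewrite horner0 mul0r rmorph0; apply: (pl0 PW).
 rewrite rmorphM fmorphV; apply: (psim_pinf PW) mpq; apply: (psimM PW); last exact: (psimV PW).
 by apply: H => // b; apply: r1.
have nu' d : ~ psim W u (iota d) by move=> h; apply: nu; exists d.
have xE : x = iota b1 + u by rewrite /u addrC subrK.
have [|s s0 [h1 h2]] := @near_exists u u0 (fun s =>
  {in cond, forall pq : {poly K} * {poly K}, pq.2.[b1 + s] != 0 /\ pinf W (iota (pq.1.[b1 + s] / pq.2.[b1 + s]))} /\
  {in nz, forall e : {poly K}, e.[b1 + s] != 0}); last by exists (b1 + s).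
apply: near_and; last first.
 apply: (near_all (P := fun (e : {poly K}) s => e.[b1 + s] != 0)) => e en.
 have [c [k [c0 [_ h]]]] := near_poly u0 nu' b1 (hn _ en).
 by apply: near_imp h => s s0 /(psim_neq0 PW)/andP[]; rewrite iota_neq0.
apply: (near_all (P := fun (pq : {poly K} * {poly K}) s => pq.2.[b1 + s] != 0 /\
 pinf W (iota (pq.1.[b1 + s] / pq.2.[b1 + s])))) => pq pc.
have [q0 mpq] := hc _ pc.
have [c [k [c0 [g1 g2]]]] := near_poly u0 nu' b1 q0.
have [p0|p0] := eqVneq pq.1 0.
 apply: near_imp g2 => s s0 /(psim_neq0 PW)/andP[]; rewrite iota_neq0 => h _; split=> //.
 by rewrite p0 horner0 mul0r rmorph0; apply: (pl0 PW).
have [c' [k' [c'0 [g1' g2']]]] := near_poly u0 nu' b1 p0.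
rewrite -xE in g1 g1'.
have := near_ratio u0 c'0 c0 (psim_pinf PW (psimM PW (psim_sym PW g1') (psimV PW (psim_sym PW g1))) mpq).
move=> /near_and/(_ (near_and g2 g2')); apply: near_imp => s s0 [h [hq hp]].
split; first by have /andP[] := psim_neq0 PW hq; rewrite iota_neq0.
rewrite rmorphM fmorphV; apply: (psim_pinf PW) h; apply: (psimM PW) => //; exact: (psimV PW).
Qed.

End Selection.

(** * Common eigenvectors and infinitesimal roots *)

Section CommonEigen.
Variables (K : closedFieldType) (n : nat).
Implicit Types (A V : 'M[K]_n.+1) (v : 'rV[K]_n.+1).

Lemma eigenvector_in A V v : v != 0 -> (v <= V)%MS -> stablemx V A ->
 exists (w : 'rV[K]_n.+1) a, [/\ w != 0, (w <= V)%MS & w *m A = a *: w].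
Proof.
move=> v0 vV VA; have [r rE] := closed_field_poly_normal (char_poly A).
have : v *m horner_mx A (\prod_(a <- r) ('X - a%:P)) = 0.
 have := Cayley_Hamilton A; rewrite rE (monicP (char_poly_monic A)) scale1r => ->.
 by rewrite mulmx0.
elim: r v v0 vV {rE} => [|a r IH] v v0 vV.
 by rewrite big_nil rmorph1 mulmx1 => e; rewrite e eqxx in v0.
rewrite big_cons rmorphM -mulmxE mulmxA; set w := v *m _.
have wE : w = v *m A - a *: v.
 by rewrite /w rmorphB /= horner_mx_X horner_mx_C mulmxBr mul_mx_scalar.
have [w0 _|w0] := eqVneq w 0.
 by exists v, a; split=> //; apply/eqP; rewrite -subr_eq0 -wE w0.
apply: IH => //; rewrite wE addmx_sub //; last by rewrite eqmx_opp scalemx_sub.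
by apply: submx_trans VA; apply: submxMr.
Qed.
Lemma common_eigen (As : seq 'M[K]_n.+1) V : V != 0 -> {in As, forall A, stablemx V A} ->
 {in As &, forall A B, comm_mx A B} ->
 exists2 v : 'rV[K]_n.+1, v != 0 & (v <= V)%MS /\ {in As, forall A, exists a, v *m A = a *: v}.
Proof.
elim: As V => [|A As IH] V V0 VA cA.
 by exists (nz_row V); rewrite ?nz_row_eq0 // nz_row_sub; split.
have [|||w [a [w0 wV wA]]] := @eigenvector_in A V (nz_row V).
- by rewrite nz_row_eq0.
- exact: nz_row_sub.
- by apply: VA; rewrite mem_head.
have sub : (w <= V :&: eigenspace A a)%MS by rewrite sub_capmx wV; apply/eigenspaceP.
have [|B BA|B B' BA B'A|v v0 [vV vA]] := IH (V :&: eigenspace A a)%MS.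
- by apply: contraNneq w0 => e; move: sub; rewrite e submx0.
- have cBA : comm_mx A B by apply: cA; rewrite inE ?eqxx ?BA ?orbT.
 rewrite sub_capmx; apply/andP; split.
  apply: (submx_trans (submxMr _ (capmxSl _ _))); apply: VA; by rewrite inE BA orbT.
 by apply: (submx_trans (submxMr _ (capmxSr _ _))); apply: comm_mx_stable_eigenspace.
- by apply: cA; rewrite inE ?BA ?B'A orbT.
exists v => //; split; first exact: submx_trans vV (capmxSl _ _).
move=> B; rewrite inE => /orP[/eqP->|]; last exact: vA.
by exists a; apply/eigenspaceP; apply: submx_trans vV (capmxSr _ _).
Qed.

End CommonEigen.

Section Criteria.
Variables (L : fieldType) (C : closedFieldType) (kap : {rmorphism C -> L}).
Variable W : L -> C -> Prop.
Hypothesis PW : place kap W.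

Lemma pinf_sum (I : Type) (r : seq I) (P : pred I) (F : I -> L) :
 (forall i, P i -> pinf W (F i)) -> pinf W (\sum_(i <- r | P i) F i).
Proof.
move=> h; apply: (big_ind (pinf W)) => //; first by apply: (pl0 PW).
by move=> *; apply: (pinfD PW).
Qed.
Lemma pinf_root_coef (g : {poly L}) b y : g.[b * y] = 0 -> pinf W y ->
 g`_0 = 0 \/ exists2 l, (0 < l < size g)%N & g`_l * b ^+ l != 0 /\ pinf W (g`_0 / (g`_l * b ^+ l)).
Proof.
move=> gy my; have [->|g0] := eqVneq g`_0 0; [by left | right].
apply: contrapT => nl; apply: (pinf1 PW).
have E : 1 = \sum_(0 <= l < size g | (0 < l)%N) - (g`_l * b ^+ l / g`_0) * y ^+ l.
 have s0 : (0 < size g)%N by rewrite lt0n size_poly_eq0; apply: contraNneq g0 => ->; rewrite coef0.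
 apply: (mulfI g0); rewrite mulr1 mulr_sumr; apply/eqP; rewrite -subr_eq0 -sumrN; apply/eqP.
 rewrite -[RHS]gy horner_coef -(big_mkord xpredT (fun i => g`_i * (b * y) ^+ i)).
 rewrite [RHS](bigD1_seq 0%N) ?mem_index_iota ?iota_uniq //= expr0 mulr1; congr (_ + _).
 under [RHS]eq_bigl do rewrite -lt0n.
 by apply: eq_bigr => l _; rewrite exprMn; field.
rewrite E big_seq_cond; apply: pinf_sum => l; rewrite mem_index_iota => /andP[/= ls l0].
have [/eqP gl0|gl0] := boolP (g`_l * b ^+ l == 0).
 by rewrite gl0 mul0r oppr0 mul0r; apply: (pl0 PW).
apply: (pinfMl PW); last first.
 case: l l0 {ls gl0} => // l _; rewrite exprS; apply: (pinfMr PW) => //.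
 elim: l => [|l IH]; first by exists 1; rewrite expr0; apply: (pl1 PW).
 by rewrite exprS; apply: (pdomM PW) => //; apply: pinf_dom.
rewrite -mulN1r; apply: (pdomM PW).
 by exists (-1); rewrite -(rmorphN1 kap); apply: (rrC (place_rr PW)).
have [//|[_]] := pdom_or PW (g`_l * b ^+ l / g`_0); rewrite invf_div => h.
by case: nl; exists l; rewrite ?l0 ?ls.
Qed.

Variables (K : closedFieldType) (iota : {rmorphism K -> L}).

(** If no root is infinitesimal, the inverses of the roots are finite, and so are the coefficients
    of the product of the [1 - y^-1 *: 'X], which is [q] divided by its constant term. *)
Lemma coef_pinf_root (g : {poly K}) b : (1 < size g)%N -> (g`_0 = 0 \/ exists2 l, (0 < l < size g)%N &
   g`_l * b ^+ l != 0 /\ pinf W (iota (g`_0 / (g`_l * b ^+ l)))) ->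
 exists2 y, g.[b * y] = 0 & pinf W (iota y).
Proof.
move=> sg [g0|[l /andP[l0 lg] [gl0 h]]].
 by exists 0; rewrite ?mulr0 ?horner_coef0 // rmorph0; apply: (pl0 PW).
have [g0|g0] := eqVneq g`_0 0.
 by exists 0; rewrite ?mulr0 ?horner_coef0 // rmorph0; apply: (pl0 PW).
pose q : {poly K} := \poly_(i < size g) (g`_i * b ^+ i).
have qE y : q.[y] = g.[b * y].
 by rewrite horner_poly horner_coef; apply: eq_bigr => i _; rewrite exprMn mulrA.
have q0 : q`_0 = g`_0 by rewrite coef_poly (ltnW sg) expr0 mulr1.
have [r rE] := closed_field_poly_normal q.
have qn0 : q != 0 by apply: contraNneq g0 => e; rewrite -q0 e coef0.
have [[y yr my]|nr] := pselect (exists2 y, y \in r & pinf W (iota y)).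
 by exists y => //; rewrite -qE; apply/eqP; rewrite -/(root q y) rE rootZ ?lead_coef_eq0 // root_prod_XsubC.
exfalso; have r0 y : y \in r -> y != 0.
 move=> yr; have ry : root q y by rewrite rE rootZ ?lead_coef_eq0 // root_prod_XsubC.
 by apply: contraNneq g0 => y0; rewrite -q0 -horner_coef0 -[X in q.[X]]y0.
have E : q = q`_0 *: \prod_(y <- r) (1 - y^-1 *: 'X).
 have [c cE] : exists c, q = c *: \prod_(y <- r) (1 - y^-1 *: 'X).
  rewrite rE; elim: (r) (lead_coef q) r0 => [|y s IH] c s0; first by exists c; rewrite !big_nil.
  have [|c' e] := IH c; first by move=> y' y's; apply: s0; rewrite inE y's orbT.
  exists (- (y * c')); rewrite !big_cons.
  have -> : 'X - y%:P = (- y) *: (1 - y^-1 *: 'X).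
   by rewrite scalerBr !scaleNr opprK scalerA mulfV ?s0 ?mem_head // scale1r alg_polyC addrC.
  by rewrite -scalerAl scalerA mulrC -scalerA scalerAr e -scalerAr scalerA mulNr.
 have c0 : (\prod_(y <- r) (1 - y^-1 *: 'X) : {poly K})`_0 = 1.
  rewrite -horner_coef0 horner_prod big1 // => y _.
  by rewrite !hornerE ?mulr0 ?subr0.
 by rewrite {2}cE coefZ c0 mulr1.
have D i : pdom W (iota (\prod_(y <- r) (1 - y^-1 *: 'X) : {poly K})`_i).
 have : {in r, forall y, pdom W (iota y^-1)}.
  move=> y yr; have [[c Wc]|[_]] := pdom_or PW (iota y^-1); first by exists c.
  by rewrite -fmorphV invrK => h'; case: nr; exists y.
 elim: (r) i => [|y s IH] i hs.
  by rewrite big_nil coef1 rmorph_nat; case: eqP => _; [exists 1; apply: (pl1 PW)|exists 0; apply: (pl0 PW)].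
 have {}IH j : pdom W (iota (\prod_(y <- s) (1 - y^-1 *: 'X) : {poly K})`_j).
  by apply: IH => y' y's; apply: hs; rewrite inE y's orbT.
 rewrite big_cons mulrBl mul1r -scalerAl coefB coefZ coefXM rmorphB rmorphM -mulNr.
 apply: (pdomD PW) => //; apply: (pdomM PW).
  rewrite -mulN1r; apply: (pdomM PW); last by apply: hs; rewrite mem_head.
  by exists (-1); rewrite -(rmorphN1 kap); apply: (rrC (place_rr PW)).
 by case: eqP => // _; rewrite rmorph0; exists 0; apply: (pl0 PW).
apply: (pinf_ndom PW _ h); first by rewrite fmorph_eq0 mulf_neq0 // invr_eq0.
rewrite -fmorphV invf_div.
have -> : g`_l * b ^+ l = q`_l by rewrite coef_poly lg.
by rewrite E coefZ q0 mulrC mulKf.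
Qed.
(** Divide by the largest [dl j]. If it were not infinitesimal, the values of the quotients would be
    the coefficients of a nonzero polynomial of degree below [D] that vanishes on [S]. *)
Lemma pinf_vandermonde D (B : pred 'I_D) (dl : 'I_D -> L) (S : seq C) : uniq S -> (D <= size S)%N ->
 {in S, forall s, pinf W (\sum_(i < D | B i) kap s ^+ i * dl i)} -> forall i, B i -> pinf W (dl i).
Proof.
move=> uS sS hS i0 Bi0; have [->|d0] := eqVneq (dl i0) 0; first exact: (pl0 PW).
pose r := [seq i <- enum 'I_D | B i && (dl i != 0)].
have i0r : i0 \in r by rewrite mem_filter Bi0 d0 mem_enum.
have [||j jr hj] := pdom_min PW (f := fun i => (dl i)^-1) (s := r).
- by case: (r) i0r.
- by move=> i; rewrite mem_filter invr_eq0 => /andP[/andP[]].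
have {}hj i : B i -> pdom W (dl i / dl j).
 move=> Bi; have [->|di0] := eqVneq (dl i) 0; first by rewrite mul0r; exists 0; apply: (pl0 PW).
 by have := hj i; rewrite mem_filter Bi di0 mem_enum invrK mulrC; apply.
move: jr; rewrite mem_filter => /andP[/andP[Bj dj0] _].
suff dj : pinf W (dl j).
 by rewrite -[dl i0](mulfVK dj0); apply: (pinfMl PW) => //; apply: hj.
have [[c Wc]|[_ mj]] := pdom_or PW (dl j)^-1; last by rewrite -[dl j]invrK.
have [dc|ndc] := pselect (pinf W (dl j)); first by [].
exfalso; pose w i := xget 0 [set w | W (dl i / dl j) w]%classic.
have Ww i : B i -> W (dl i / dl j) (w i) by move=> /hj h; exact: (xgetPex 0 h).
have wj : w j = 1.
 by apply: (rr_fun (place_rr PW) (Ww j Bj)); rewrite mulfV //; apply: (pl1 PW).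
pose p : {poly C} := \sum_(i < D | B i) w i *: 'X^i.
have p0 : p != 0.
 apply/eqP => /(congr1 (fun p : {poly C} => p`_j)); rewrite coef0 coef_sum (bigD1 j) //= big1.
  by rewrite coefZ coefXn eqxx wj mulr1 addr0 => /eqP; rewrite oner_eq0.
 by move=> i /andP[_ ij]; rewrite coefZ coefXn eq_sym (inj_eq val_inj) (negPf ij) mulr0.
have sp : (size p <= D)%N.
 apply: (leq_trans (size_sum _ _ _)); apply/bigmax_leqP => i _.
 by apply: (leq_trans (size_scale_leq _ _)); rewrite size_polyXn.
have : all (root p) S.
 apply/allP => s /hS h; apply/eqP; rewrite horner_sum.
 have h' : pinf W ((dl j)^-1 * \sum_(i < D | B i) kap s ^+ i * dl i).
  by apply: (pinfMl PW) => //; exists c.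
 apply: (rr_fun (place_rr PW) _ h').
 rewrite mulr_sumr; elim/big_ind2: _ => [||i Bi]; first exact: (pl0 PW).
  by move=> *; apply: (rrD (place_rr PW)).
 rewrite hornerZ hornerXn mulrC -mulrA mulrC; apply: (rrM (place_rr PW)); first exact: Ww.
 by rewrite -rmorphXn; apply: (rrC (place_rr PW)).
by move=> aS; have := max_poly_roots p0 aS uS; rewrite ltnNge => /negP; apply; apply: leq_trans sS.
Qed.

End Criteria.

Lemma pigeonhole (T : finType) (D M : nat) (f : 'I_M -> T) : (D * #|T| < M)%N ->
 exists t, (D < #|[set i | f i == t]|)%N.
Proof.
move=> lt; apply: contrapT => nt; move: lt; apply/negP; rewrite -leqNgt.
rewrite -[M]card_ord -sum1_card (partition_big f xpredT) //= mulnC -sum_nat_const.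
apply: leq_sum => t _; rewrite sum1_card; apply: contrapT => /negP; rewrite -ltnNge => h.
by apply: nt; exists t; rewrite cardsE; apply: leq_trans h (eq_leq (eq_card _)).
Qed.

(** * Elimination of one transcendental element *)

Section Step.
Variables (L : fieldType) (C K : closedFieldType) (kap : {rmorphism C -> L}).
Variable W : L -> C -> Prop.
Hypothesis PW : place kap W.
Variables (kapK : {rmorphism C -> K}) (iota : {rmorphism K -> L}).
Hypothesis kapKE : forall c, iota (kapK c) = kap c.
Variable z : K.
Hypotheses (z0 : z != 0) (mz : pinf W (iota z)).
Variable x : L.
Hypothesis xK : forall k, iota k != x.

Let ev : {rmorphism {poly K} -> L} := horner_eval x \o map_poly iota.

Lemma ev_eq0 p : (ev p == 0) = (p == 0).
Proof.
apply/idP/idP => [|/eqP->]; last by rewrite rmorph0.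
apply: contraLR => p0; have [r rE] := closed_field_poly_normal p.
rewrite rE -mul_polyC rmorphM rmorph_prod mulf_neq0 //.
 by rewrite /ev /= /horner_eval map_polyC hornerC fmorph_eq0 lead_coef_eq0.
rewrite prodf_seq_neq0; apply/allP => b _ /=.
by rewrite /horner_eval rmorphB /= map_polyX map_polyC !hornerE /= subr_eq0 eq_sym xK.
Qed.
(** Membership in the field generated by [K] and [x]. *)
Definition ratx u := exists p q : {poly K}, q != 0 /\ u = ev p / ev q.

Lemma ratx_ev p : ratx (ev p).
Proof. by exists p, 1; rewrite oner_neq0 rmorph1 divr1. Qed.
Lemma ratxD u v : ratx u -> ratx v -> ratx (u + v).
Proof.
move=> [p [q [q0 ->]]] [p' [q' [q'0 ->]]]; exists (p * q' + p' * q), (q * q'); split.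
 by rewrite mulf_neq0.
by rewrite rmorphD !rmorphM; field; rewrite !ev_eq0 ?q0 ?q'0.
Qed.
Lemma ratxM u v : ratx u -> ratx v -> ratx (u * v).
Proof.
move=> [p [q [q0 ->]]] [p' [q' [q'0 ->]]]; exists (p * p'), (q * q'); split.
 by rewrite mulf_neq0.
by rewrite !rmorphM; field; rewrite !ev_eq0 ?q0 ?q'0.
Qed.
Lemma ratxV u : ratx u -> ratx u^-1.
Proof.
move=> [p [q [q0 ->]]]; have [->|p0] := eqVneq p 0.
 by rewrite rmorph0 mul0r invr0 -(rmorph0 ev); apply: ratx_ev.
by exists q, p; rewrite invf_div.
Qed.
Lemma ratxN u : ratx u -> ratx (- u).
Proof. by move=> h; rewrite -mulN1r; apply: ratxM => //; rewrite -(rmorphN1 ev); apply: ratx_ev. Qed.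
Lemma ratx0 : ratx 0. Proof. by rewrite -(rmorph0 ev); apply: ratx_ev. Qed.
Lemma ratx1 : ratx 1. Proof. by rewrite -(rmorph1 ev); apply: ratx_ev. Qed.
Lemma ratx_common (T : finType) (f : T -> L) : (forall t, ratx (f t)) ->
 exists (b : {poly K}) (g : T -> {poly K}), b != 0 /\ forall t, f t * ev b = ev (g t).
Proof.
move=> h; have /choice[pq hpq] : forall t, exists pq : {poly K} * {poly K}, pq.2 != 0 /\ f t = ev pq.1 / ev pq.2.
 by move=> t; have [p [q ?]] := h t; exists (p, q).
exists (\prod_t (pq t).2), (fun t => (pq t).1 * \prod_(t' | t' != t) (pq t').2); split.
 by rewrite prodf_seq_neq0; apply/allP => t _; have [] := hpq t.
move=> t; have [q0 ->] := hpq t; rewrite (bigD1 t) //= !rmorphM mulrA; congr (_ * _).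
by rewrite mulfVK // ev_eq0.
Qed.
Definition algx u := exists2 g : {poly L}, g \is monic & (forall i, ratx g`_i) /\ root g u.

(** The span over this field as an intersection of stable predicates, which keeps coefficients out
    of the proofs; [xspanP] recovers them. *)
Definition xspan (s : seq L) v := forall T : L -> Prop, T 0 -> (forall a b, T a -> T b -> T (a + b)) ->
 (forall c a, ratx c -> T a -> T (c * a)) -> {in s, forall v, T v} -> T v.

Lemma xspanP s v : xspan s v -> exists c : 'I_(size s) -> L, (forall i, ratx (c i)) /\ v = \sum_i c i * s`_i.
Proof.
move=> h; apply: (h (fun v => exists c : 'I_(size s) -> L, (forall i, ratx (c i)) /\ v = \sum_i c i * s`_i)) => {h v}.
- by exists (fun=> 0); split=> [i|]; [apply: ratx0 | rewrite big1 // => i _; rewrite mul0r].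
- move=> _ _ [c [hc ->]] [d [hd ->]]; exists (fun i => c i + d i); split=> [i|]; first exact: ratxD.
 by rewrite -big_split; apply: eq_bigr => i _; rewrite mulrDl.
- move=> k _ rk [c [hc ->]]; exists (fun i => k * c i); split=> [i|]; first exact: ratxM.
 by rewrite mulr_sumr; apply: eq_bigr => i _; rewrite mulrA.
move=> u us; have lt : (index u s < size s)%N by rewrite index_mem.
exists (fun i => if i == Ordinal lt then 1 else 0); split=> [i|].
 by case: eqP => _; [apply: ratx1|apply: ratx0].
rewrite (bigD1 (Ordinal lt)) //= eqxx mul1r nth_index // big1 ?addr0 // => i /negPf->.
by rewrite mul0r.
Qed.
Lemma finite_module (ys : seq L) : {in ys, forall y, algx y} ->
 exists2 s : seq L, 1 \in s & {in ys, forall y, {in s, forall v, xspan s (y * v)}}.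
Proof.
elim: ys => [|y ys IH] hy; first by exists [:: 1]; rewrite ?mem_head.
have [|s s1 hs] := IH; first by move=> y' h; apply: hy; rewrite inE h orbT.
have [g gm [gr gy]] := hy y (mem_head _ _).
have sg : (1 < size g)%N.
 rewrite ltnNge; apply/negP => /size1_polyC e; move: gy gm; rewrite e rootC => /eqP->.
 by rewrite monicE lead_coef0 eq_sym oner_eq0.
pose n := (size g).-1; have sgn : size g = n.+1 by rewrite /n prednK // ltnW.
have n0 : (0 < n)%N by rewrite -ltnS -sgn.
pose s' := [seq v * y ^+ j | v <- s, j <- seq.iota 0 n].
have ms' v j : v \in s -> (j < n)%N -> v * y ^+ j \in s'.
 by move=> vs jn; apply/allpairsP; exists (v, j); rewrite vs mem_iota.
exists s'; first by rewrite -(mulr1 1) -{2}(expr0 y) ms'.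
move=> y' y'h w0 /allpairsP[[v j] /= [vs]]; rewrite mem_iota add0n => /= jn -> T T0 TD TZ Ts.
move: y'h; rewrite inE => /orP[/eqP->|y'ys]; last first.
 rewrite mulrA; apply: (hs _ y'ys _ vs (fun w => T (w * y ^+ j))).
 - by rewrite mul0r.
 - by move=> a b ha hb; rewrite mulrDl; apply: TD.
 - by move=> c a rc ha; rewrite -mulrA; apply: TZ.
 - by move=> w ws; apply: Ts; apply: ms'.
rewrite mulrCA -exprS; have [lt|] := ltnP j.+1 n; first by apply: Ts; apply: ms'.
rewrite leq_eqVlt ltnS leqNgt jn orbF => /eqP <-.
have -> : v * y ^+ n = \sum_(i < n) (- g`_i) * (v * y ^+ i).
 move/eqP: gy; rewrite horner_coef sgn big_ord_recr /= => /eqP.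
 have -> : g`_n = 1 by rewrite -(monicP gm) lead_coefE sgn.
 rewrite mul1r addrC addr_eq0 => /eqP->; rewrite -sumrN mulr_sumr.
 by apply: eq_bigr => i _; rewrite mulrN mulNr mulrCA.
elim/big_ind: _ => // i _; apply: TZ; first exact: ratxN.
by apply: Ts; apply: ms'.
Qed.
Definition stable_family k (e : 'I_k -> L) (y : L) :=
 forall i, exists c : 'I_k -> L, (forall j, ratx (c j)) /\ y * e i = \sum_j c j * e j.

(** A stable family of least size is free: a relation would express one member by the others, and
    these would still form a stable family. *)
Lemma free_module (ys : seq L) : {in ys, forall y, algx y} ->
 exists k (e : 'I_k.+1 -> L), [/\ {in ys, forall y, stable_family e y}, exists i, e i != 0 &
  forall c : 'I_k.+1 -> L, (forall i, ratx (c i)) -> \sum_i c i * e i = 0 -> forall i, c i = 0].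
Proof.
move=> /finite_module[s s1 hs].
pose Q k := `[< exists e : 'I_k -> L, {in ys, forall y, stable_family e y} /\ exists i, e i != 0 >].
have exQ : exists k, Q k.
 exists (size s); apply/asboolP; exists (fun i => s`_i); split.
  by move=> y yy i; apply: xspanP; apply: hs => //; rewrite mem_nth.
 have lt : (index 1%R s < size s)%N by rewrite index_mem.
 by exists (Ordinal lt); rewrite /= nth_index // oner_neq0.
case: (ex_minnP exQ) => -[|k] /asboolP[e [es [i0 ei0]]] mink; first by case: i0 ei0.
exists k, e; split=> //; first by exists i0.
move=> c hc cE; apply: contrapT => /existsNP[j /eqP cj].
suff : Q k by move=> /mink; rewrite ltnn.
apply/asboolP; exists (fun i => e (lift j i)).
have ej : e j = \sum_(i < k) (- ((c j)^-1 * c (lift j i))) * e (lift j i).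
 move: cE; rewrite (bigD1_ord j) //= => /eqP; rewrite addr_eq0 => /eqP E.
 apply: (mulfI cj); rewrite E -sumrN mulr_sumr; apply: eq_bigr => i _.
 by rewrite !mulrA mulrN mulVKf // mulNr.
split.
 move=> y yy i; have [d [hd dE]] := es y yy (lift j i).
 exists (fun l => d (lift j l) + d j * - ((c j)^-1 * c (lift j l))); split.
  move=> l; apply: ratxD => //; apply: ratxM => //; apply: ratxN; apply: ratxM => //; exact: ratxV.
 rewrite dE (bigD1_ord j) //= ej mulr_sumr -big_split; apply: eq_bigr => l _ /=.
 by rewrite mulrDl addrC mulrA.
apply: contrapT => ne; move: ei0; have E l : e (lift j l) = 0.
 by apply/eqP; apply: contrapT => /negP h; apply: ne; exists l.
have e0 : e j = 0 by rewrite ej big1 // => l _; rewrite E mulr0.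
by case: (unliftP j i0) => [l ->|->]; rewrite ?E ?e0 eqxx.
Qed.

Section EigenPoly.
Variables (D k N : nat) (b : {poly K}) (M : 'I_D -> 'M[{poly K}]_k.+1) (P : {mpoly K[D]}).
Hypothesis PN : (msize P <= N)%N.

(** [P] at the matrices [M i], each standing for [b] times its variable and homogenised by powers of
    [b]. *)
Definition mx_poly : 'M[{poly K}]_k.+1 :=
 \sum_(m <- msupp P) ((P@_m)%:P * b ^+ (N - mdeg m)) *: \prod_(i < D) M i ^+ m i.

Lemma mx_poly_eigen (F : fieldType) (h : {rmorphism {poly K} -> F}) (u : 'rV[F]_k.+1) (mu : 'I_D -> F) :
 (forall i, u *m map_mx h (M i) = (h b * mu i) *: u) ->
 u *m map_mx h mx_poly = (h b ^+ N * \sum_(m <- msupp P) h (P@_m)%:P * \prod_i mu i ^+ m i) *: u.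
Proof.
move=> hu.
have hX i j : u *m map_mx h (M i ^+ j) = (h b * mu i) ^+ j *: u.
 elim: j => [|j IH]; first by rewrite !expr0 map_mx1 mulmx1 scale1r.
 by rewrite exprS map_mxM mulmxA hu -scalemxAl IH scalerA -exprS.
have hP (r : seq 'I_D) (m : 'X_{1..D}) : u *m map_mx h (\prod_(i <- r) M i ^+ m i) = (\prod_(i <- r) (h b * mu i) ^+ m i) *: u.
 elim: r => [|i r IH]; first by rewrite !big_nil map_mx1 mulmx1 scale1r.
 by rewrite !big_cons map_mxM mulmxA hX -scalemxAl IH scalerA.
rewrite /mx_poly raddf_sum mulmx_sumr mulr_sumr scaler_suml big_seq [RHS]big_seq.
apply: eq_bigr => m mP; rewrite /= map_mxZ -scalemxAr hP scalerA rmorphM rmorphXn; congr (_ *: _).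
have le : (mdeg m <= N)%N by apply: leq_trans PN; apply: ltnW; apply: msize_mdeg_lt.
under eq_bigr do rewrite exprMn; rewrite big_split /= -expr_sum -mdegE.
by rewrite -{2}(subnK le) exprD; ring.
Qed.
End EigenPoly.

Lemma C_many n : exists2 s : seq C, uniq s & size s = n.
Proof.
elim: n => [|n [s us ss]]; first by exists [::].
by have [c cs] := C_avoid s; exists (c :: s); rewrite /= ?cs ?us ?ss.
Qed.

(** The [y i] act on a finite-dimensional space over the field of [K] and [x] by commuting matrices
    with the common eigenvector [E]. Specialising [x] to a suitable [a] in [K] keeps them commuting,
    and the eigenvalues of a common eigenvector over [K] give the [y' i]. All the differences from
    the [b0 i] have to be infinitesimal on one eigenvector: this is arranged for the combinations
    [N s] with many [s], a pigeonhole finds one system of eigenvalues common to [D] of them, and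
    [pinf_vandermonde] separates the differences. *)
Theorem step D (B : pred 'I_D) (y : 'I_D -> L) (b0 : 'I_D -> C) :
 (forall i, algx (y i)) -> (forall i, B i -> W (y i) (b0 i)) ->
 exists y' : 'I_D -> K, (forall P : {mpoly K[D]}, mmap iota y P = 0 -> P.@[y'] = 0) /\
  forall i, B i -> W (iota (y' i)) (b0 i).
Proof.
move=> ya yB; have [|k [e [es [i0 ei0] fr]]] := @free_module [seq y i | i <- enum 'I_D].
 by move=> _ /mapP[i _ ->].
have {}es i : stable_family e (y i) by apply: es; apply: map_f; rewrite mem_enum.
have /choice[c hc] : forall t : 'I_D * 'I_k.+1, exists c : 'I_k.+1 -> L, (forall j, ratx (c j)) /\ y t.1 * e t.2 = \sum_j c j * e j.
 by move=> [i j]; apply: es.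
have [|b [g [bn0 hg]]] := @ratx_common ('I_D * 'I_k.+1 * 'I_k.+1)%type (fun t => c t.1 t.2).
 by move=> t; apply: (hc t.1).1.
pose M i : 'M[{poly K}]_k.+1 := \matrix_(l, j) g (i, j, l).
pose E := \row_j e j.
have E0 : E != 0 by apply/eqP => /rowP/(_ i0); rewrite !mxE => /eqP; rewrite (negPf ei0).
have EM i : E *m map_mx ev (M i) = (ev b * y i) *: E.
 apply/rowP => j; rewrite !mxE -mulrA (hc (i, j)).2 mulr_sumr; apply: eq_bigr => l _.
 by rewrite !mxE -hg /=; ring.
have free (A : 'M[{poly K}]_k.+1) : E *m map_mx ev A = 0 -> A = 0.
 move=> EA; apply/matrixP => l j; rewrite mxE; apply/eqP; rewrite -ev_eq0; apply/eqP.
 apply: (fr (fun l => ev (A l j))) => [i|]; first exact: ratx_ev.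
 move/rowP/(_ j): EA; rewrite !mxE => EA; rewrite -[RHS]EA; apply: eq_bigr => i _; by rewrite !mxE mulrC.
have cM i j : M i *m M j = M j *m M i.
 apply/eqP; rewrite -subr_eq0; apply/eqP/free; rewrite map_mxB mulmxBr !map_mxM !mulmxA !EM.
 by rewrite -!scalemxAl !EM !scalerA mulrC subrr.
pose N s : 'M[{poly K}]_k.+1 := \sum_(i | B i) (kapK s ^+ i)%:P *: (M i - ((kapK (b0 i))%:P * b)%:M).
have NE (F : fieldType) (h : {rmorphism {poly K} -> F}) (u : 'rV[F]_k.+1) (mu : 'I_D -> F) s :
  (forall i, u *m map_mx h (M i) = (h b * mu i) *: u) ->
  u *m map_mx h (N s) = (h b * \sum_(i | B i) h (kapK s ^+ i)%:P * (mu i - h (kapK (b0 i))%:P)) *: u.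
 move=> hu; rewrite raddf_sum mulmx_sumr mulr_sumr scaler_suml; apply: eq_bigr => i _ /=.
 rewrite map_mxZ map_mxB map_scalar_mx -scalemxAr mulmxBr hu mul_mx_scalar -scalerBl scalerA rmorphM.
 by congr (_ *: _); ring.
have evC c0 : ev c0%:P = iota c0 by rewrite /ev /= /horner_eval map_polyC hornerC.
pose chi s := char_poly (N s).
(* That [N s] has an eigenvalue infinitesimal with respect to [b] is expressed by coefficients of
   its characteristic polynomial, in the form that [selection] preserves. *)
have HS s : exists cnd : seq ({poly K} * {poly K}),
  {in cnd, forall pq, pq.2 != 0 /\ pinf W ((map_poly iota pq.1).[x] / (map_poly iota pq.2).[x])} /\
  forall a, b.[a] != 0 -> {in cnd, forall pq, pq.2.[a] != 0 /\ pinf W (iota (pq.1.[a] / pq.2.[a]))} ->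
   exists2 yy, eigenvalue (map_mx (horner_eval a) (N s)) (b.[a] * yy) & pinf W (iota yy).
 have [||h0|[l /andP[l0 ls] [gl mg]]] := @pinf_root_coef _ _ _ _ PW (map_poly ev (chi s)) (ev b)
   (\sum_(i | B i) kap s ^+ i * (y i - kap (b0 i))).
 - apply/eqP; rewrite -/(root _ _) map_char_poly -eigenvalue_root_char; apply/eigenvalueP; exists E => //.
  rewrite (NE _ _ _ _ _ EM); congr (_ *: _); congr (_ * _); apply: eq_bigr => i _.
  by rewrite !evC rmorphXn !kapKE.
 - apply: (pinf_sum PW) => i Bi; apply: (pinfMl PW).
   by rewrite -rmorphXn; exists (s ^+ i); apply: (rrC (place_rr PW)).
  by rewrite /pinf -(subrr (b0 i)); apply: (plB PW); [apply: yB | apply: (rrC (place_rr PW))].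
 - have c0 : (chi s)`_0 = 0 by apply/eqP; rewrite -ev_eq0 -coef_map h0.
  exists [::]; split=> // a ba _.
  have [||yy yr my] := @coef_pinf_root _ _ _ _ PW _ iota (map_poly (horner_eval a) (chi s)) b.[a].
  + by rewrite map_char_poly size_char_poly.
  + by left; rewrite coef_map c0 /= /horner_eval horner0.
  exists yy => //; rewrite eigenvalue_root_char -map_char_poly; exact/eqP.
 rewrite !coef_map -rmorphXn -rmorphM in gl mg.
 exists [:: ((chi s)`_0, (chi s)`_l * b ^+ l)]; split.
  move=> pq; rewrite inE => /eqP->; split=> //.
  by rewrite -ev_eq0.
 move=> a ba /(_ _ (mem_head _ _))/=[q0 mq].
 have [||yy yr my] := @coef_pinf_root _ _ _ _ PW _ iota (map_poly (horner_eval a) (chi s)) b.[a].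
 + by rewrite map_char_poly size_char_poly.
 + right; exists l; last first.
   by rewrite !coef_map /= /horner_eval; move: q0 mq; rewrite !hornerM !horner_exp.
  by rewrite l0 map_char_poly size_char_poly -(size_char_poly (map_mx ev (N s))) -map_char_poly.
 exists yy => //; rewrite eigenvalue_root_char -map_char_poly; exact/eqP.
(* One more than [D] times the number of ways to choose an eigenvalue of each matrix, as the
   pigeonhole demands. *)
have [U uU sU] := C_many (D * #|{ffun 'I_D -> 'I_k.+1}|).+1.
have /choice[cnd hcnd] := HS.
have [||a [ha hb]] := selection PW kapKE z0 mz (cond := flatten [seq cnd s | s <- U]) (nz := [:: b]) xK.
- by move=> pq /flatten_mapP[s sU' h]; apply: (hcnd s).1.
- by move=> q; rewrite inE => /eqP->.
have ba : b.[a] != 0 by apply: hb; rewrite mem_head.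
pose A i := map_mx (horner_eval a) (M i).
have cA i j : comm_mx (A i) (A j) by rewrite /comm_mx -!map_mxM cM.
have HV s : s \in U -> exists t : 'rV[K]_k.+1 * ('I_D -> K), [/\ t.1 != 0, forall i, t.1 *m A i = t.2 i *: t.1 &
  pinf W (\sum_(i < D | B i) kap s ^+ i * (iota (t.2 i / b.[a]) - kap (b0 i)))].
 move=> sU'; have [|yy ev_ my] := (hcnd s).2 a ba.
  by move=> pq h; apply: ha; apply/flatten_mapP; exists s.
 have cN i : comm_mx (map_mx (horner_eval a) (N s)) (A i).
  rewrite /comm_mx -!map_mxM /N mulmx_suml mulmx_sumr; congr map_mx; apply: eq_bigr => j _.
  by rewrite -scalemxAl -scalemxAr mulmxBl mulmxBr cM scalar_mxC.
 have [||B1 B2 /mapP[i1 _ ->] /mapP[i2 _ ->]|v v0 [vV vA]] := @common_eigen K k [seq A i | i <- enum 'I_D]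
   (eigenspace (map_mx (horner_eval a) (N s)) (b.[a] * yy)).
 - exact: ev_.
 - by move=> _ /mapP[i _ ->]; apply: comm_mx_stable_eigenspace.
 - exact: cA.
 have /choice[la hla] : forall i, exists la, v *m A i = la *: v.
  by move=> i; apply: vA; apply: map_f; rewrite mem_enum.
 exists (v, la); split=> //=.
 have hv i : v *m map_mx (horner_eval a) (M i) = (horner_eval a b * (la i / b.[a])) *: v.
  by rewrite /horner_eval mulrC mulfVK // -hla.
 have := NE _ (horner_eval a) v _ s hv; move/eigenspaceP: vV => -> /eqP.
 rewrite -subr_eq0 -scalerBl scaler_eq0 (negPf v0) orbF subr_eq0 => /eqP /(mulfI ba) yyE.
 move: my; rewrite yyE rmorph_sum /=; congr (pinf W _); apply: eq_bigr => i _.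
 by rewrite /horner_eval !hornerC [X in X = _]rmorphM -!kapKE -rmorphXn -rmorphB !rmorphXn.
have /choice[F hF] : forall i : 'I_(size U), exists t : 'rV[K]_k.+1 * ('I_D -> K), [/\ t.1 != 0, forall j, t.1 *m A j = t.2 j *: t.1 &
  pinf W (\sum_(j < D | B j) kap U`_i ^+ j * (iota (t.2 j / b.[a]) - kap (b0 j)))].
 by move=> i; apply: HV; rewrite mem_nth.
pose r i := projT1 (closed_field_poly_normal (char_poly (A i))).
have rE i : char_poly (A i) = \prod_(w <- r i) ('X - w%:P).
 by rewrite /r; case: (closed_field_poly_normal _) => /= q {1}->; rewrite (monicP (char_poly_monic _)) scale1r.
have sr i : size (r i) = k.+1.
 by apply: succn_inj; rewrite -(size_char_poly (A i)) rE size_prod_XsubC.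
have Fr i j : (F i).2 j \in r j.
 have [v0 vA _] := hF i; rewrite -root_prod_XsubC -rE -eigenvalue_root_char; apply/eigenvalueP.
 by exists (F i).1; rewrite ?vA.
pose f i : {ffun 'I_D -> 'I_k.+1} := [ffun j => inord (index ((F i).2 j) (r j))].
have fE i j : (F i).2 j = nth 0 (r j) (f i j).
 by rewrite ffunE inordK ?nth_index //; move: (Fr i j); rewrite -index_mem sr.
have [|t Dt] := @pigeonhole _ D (size U) f; first by rewrite sU.
have [i1 i1t] : exists i1, i1 \in [set i | f i == t].
 by apply/set0Pn; rewrite -card_gt0; apply: leq_ltn_trans Dt.
have Ft i : i \in [set i | f i == t] -> (F i).2 =1 (F i1).2.
 by move: i1t; rewrite !inE => /eqP e1 /eqP e2 j; rewrite !fE e1 e2.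
pose y' i := (F i1).2 i / b.[a]; exists y'.
have [v0 vA _] := hF i1; split.
 move=> P Py; have hu i : (F i1).1 *m map_mx (horner_eval a) (M i) = (horner_eval a b * y' i) *: (F i1).1.
  by rewrite /horner_eval /y' mulrC mulfVK // -vA.
 (* A relation between the [y i] kills [E], so by freeness it is a relation between the matrices,
    and it specialises with them. *)
 have P0 : mx_poly (msize P) b M P = 0.
  apply: free; rewrite (mx_poly_eigen (leqnn _) EM).
  have -> : \sum_(m <- msupp P) ev (P@_m)%:P * \prod_i y i ^+ m i = 0; last by rewrite mulr0 scale0r.
  by rewrite -[RHS]Py /mmap; apply: eq_bigr => m _; rewrite evC.
 have := mx_poly_eigen (leqnn (msize P)) hu; rewrite P0 map_mx0 mulmx0 => /esym/eqP.
 rewrite scaler_eq0 (negPf v0) orbF mulf_eq0 expf_eq0 (negPf ba) andbF => /= /eqP eP.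
 rewrite mevalE -[RHS]eP; apply: eq_bigr => m _; by rewrite /horner_eval hornerC.
move=> i Bi.
rewrite -[iota _](subrK (kap (b0 i))) -[X in W _ X]add0r; apply: (rrD (place_rr PW)); last exact: (rrC (place_rr PW)).
apply: (@pinf_vandermonde _ _ _ _ PW D B (fun i => iota (y' i) - kap (b0 i))
 [seq U`_(nat_of_ord i) | i <- enum [set i | f i == t]]) Bi.
- rewrite map_inj_uniq ?enum_uniq // => i2 i3 /eqP; rewrite nth_uniq // => /eqP; exact: val_inj.
- by rewrite size_map -cardE ltnW.
move=> _ /mapP[i2 i2t ->]; rewrite mem_enum in i2t; have [_ _] := hF i2.
by congr (pinf W _); apply: eq_bigr => j _; rewrite Ft.
Qed.

End Step.

(** * Residue fields, closed subfields and selection over a place *)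

Lemma quotient_field (A : comNzRingType) (M : A -> Prop) : ring_ideal M -> ~ M 1 ->
 (forall p, ~ M p -> exists q, M (1 - q * p)) ->
 exists (F : fieldType) (pi : {rmorphism A -> F}), (forall f, exists a, pi a = f) /\
  forall a, pi a = 0 <-> M a.
Proof.
move=> iM M1 maxM; pose I0 : {pred A} := fun a => `[< M a >].
have hI : idealr_closed I0.
 split; first by apply/asboolP; apply: ideal0 iM.
  by apply/negP => /asboolP.
 move=> a u v /asboolP Mu /asboolP Mv; apply/asboolP; apply: (idealD iM) => //; exact: (idealM iM).
pose I : idealr A := HB.pack_for (idealr A) I0 (isIdealr.Build A I0 hI).
pose Q : comNzRingType := {ideal_quot I}.
pose pi : {rmorphism A -> Q} := (\pi_{ideal_quot I})%qT.
have pi0 a : pi a = 0 <-> M a.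
 rewrite -[0](rmorph0 pi); split.
  by move=> /eqP; rewrite -Quotient.idealrBE subr0 => /asboolP.
 by move=> Ma; apply/eqP; rewrite -Quotient.idealrBE subr0; apply/asboolP.
have pis f : exists a, pi a = f by exists (repr f); apply: reprK.
have /choice[inv hinv] : forall f : Q, exists g, (f != 0 -> g * f = 1) /\ (f = 0 -> g = 0).
 move=> f; have [->|f0] := eqVneq f 0; first by exists 0.
 have [a aE] := pis f; have [|q Mq] := maxM a.
  by move/pi0; rewrite aE => /eqP; rewrite (negPf f0).
 exists (pi q); split=> [_|/eqP]; last by rewrite (negPf f0).
 by apply/esym/eqP; rewrite -aE -rmorphM -subr_eq0 -(rmorph1 pi) -rmorphB; apply/eqP/pi0.
pose F : fieldType := HB.pack_for fieldType Q (GRing.ComNzRing_isField.Build Q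
 (fun f => (hinv f).1) ((hinv 0).2 erefl)).
by exists F, pi.
Qed.
Lemma closed_field_of (F : fieldType) : (forall p : {poly F}, p \is monic -> (1 < size p)%N -> exists x, root p x) ->
 exists (K : closedFieldType) (i : {rmorphism F -> K}), bijective i.
Proof.
move=> h; have ax : GRing.closed_field_axiom F.
 move=> n P n0; pose p : {poly F} := 'X^n - \poly_(i < n) P i.
 have sp : (size (- \poly_(i < n) P i) < size ('X^n : {poly F}))%N.
  by rewrite size_polyXn size_polyN ltnS size_poly.
 have [||x /eqP] := h p.
 - by rewrite monicE /p lead_coefDl // lead_coefXn.
 - by rewrite /p size_polyDl // size_polyXn ltnS.
 rewrite /p hornerD hornerN hornerXn horner_poly => /eqP; rewrite subr_eq0 => /eqP e.
 by exists x.
case: F h ax => T c _ ax; pose Kcc := Field_isAlgClosed.Build (GRing.Field.Pack c) ax.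
pose K : closedFieldType := HB.pack T (GRing.Field.Pack c) Kcc.
by exists K, (idfun : {rmorphism K -> K}); exists id.
Qed.

Section SubFieldType.
Variables (L : fieldType) (SS : divringClosed L).
Record sub_field := SubFieldElt { sub_field_val : L; _ : sub_field_val \in SS }.
HB.instance Definition _ := [isSub for sub_field_val].
HB.instance Definition _ := [Choice of sub_field by <:].
HB.instance Definition _ := [SubChoice_isSubIntegralDomain of sub_field by <:].
HB.instance Definition _ := [SubIntegralDomain_isSubField of sub_field by <:].
End SubFieldType.

Lemma subfield_type (L : fieldType) (S : L -> Prop) : S 1 ->
 (forall a b, S a -> S b -> S (a - b)) -> (forall a b, S a -> S b -> S (a / b)) ->
 exists (F : fieldType) (i : {rmorphism F -> L}), forall u, S u <-> exists k, i k = u.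
Proof.
move=> S1 SB SV; pose S0 : {pred L} := fun a => `[< S a >].
have hS : divring_closed S0.
 split; first exact/asboolP.
  by move=> a b /asboolP ? /asboolP ?; apply/asboolP; apply: SB.
 by move=> a b /asboolP ? /asboolP ?; apply/asboolP; apply: SV.
pose SS : divringClosed L := HB.pack_for (divringClosed L) S0 (GRing.isDivringClosed.Build L S0 hS).
exists (sub_field SS), (\val : {rmorphism sub_field SS -> L}) => u; split.
 by move=> /asboolP Su; exists (@SubFieldElt L SS u Su).
by move=> [[k hk] /= <-]; apply/asboolP.
Qed.
Lemma closed_subfield (L : closedFieldType) (S : L -> Prop) : S 1 ->
 (forall a b, S a -> S b -> S (a - b)) -> (forall a b, S a -> S b -> S (a / b)) ->
 (forall (p : {poly L}) u, p \is monic -> (forall i, S p`_i) -> root p u -> S u) ->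
 exists (K : closedFieldType) (i : {rmorphism K -> L}), forall u, S u <-> exists k, i k = u.
Proof.
move=> S1 SB SV SR; have [F [i iP]] := subfield_type S1 SB SV.
have [p mp sp|K [j [j' jK j'K]]] := @closed_field_of F.
 have [u ru] : exists u, root (map_poly i p) u.
  by apply/closed_rootP; rewrite size_map_poly; case: (size p) sp => [|[]].
 have [k ku] : exists k, i k = u.
  apply/iP/(SR (map_poly i p)) => //; first by rewrite map_monic.
  by move=> l; rewrite coef_map; apply/iP; exists p`_l.
 by exists k; move: ru; rewrite -ku fmorph_root.
have j'z : zmod_morphism j' by move=> a b; apply: (can_inj jK); rewrite rmorphB !j'K.
have j'm : monoid_morphism j'.
 by split=> [|a b]; apply: (can_inj jK); rewrite ?rmorph1 ?rmorphM !j'K.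
pose j2 : {rmorphism K -> F} := HB.pack_for {rmorphism K -> F} j'
  (GRing.isZmodMorphism.Build K F j' j'z) (GRing.isMonoidMorphism.Build K F j' j'm).
exists K, (i \o j2) => u; rewrite iP; split=> -[k <-]; last by exists (j' k).
by exists (j k); rewrite /= jK.
Qed.
Lemma lift_rmorphism (K K1 L : fieldType) (i : {rmorphism K -> L}) (i1 : {rmorphism K1 -> L}) :
 (forall k, exists k1, i1 k1 = i k) -> exists j : {rmorphism K -> K1}, forall k, i1 (j k) = i k.
Proof.
move=> /choice[j jE].
have jz : zmod_morphism j by move=> a b; apply: (fmorph_inj i1); rewrite rmorphB !jE rmorphB.
have jm : monoid_morphism j.
 by split=> [|a b]; apply: (fmorph_inj i1); rewrite ?rmorph1 ?rmorphM !jE ?rmorph1 ?rmorphM.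
by exists (HB.pack_for {rmorphism K -> K1} j
  (GRing.isZmodMorphism.Build K K1 j jz) (GRing.isMonoidMorphism.Build K K1 j jm)).
Qed.
Lemma mmap_meval (K L : fieldType) (i : {rmorphism K -> L}) D (y : 'I_D -> K) (P : {mpoly K[D]}) :
 mmap i (fun k => i (y k)) P = i P.@[y].
Proof.
rewrite mevalE /mmap rmorph_sum; apply: eq_bigr => m _; rewrite rmorphM rmorph_prod.
by congr (_ * _); apply: eq_bigr => k _; rewrite rmorphXn.
Qed.
Lemma mmap_map (K K1 L : fieldType) (i1 : {rmorphism K1 -> L}) (j : {rmorphism K -> K1}) (i : {rmorphism K -> L})
 D (y : 'I_D -> L) (P : {mpoly K[D]}) : (forall k, i1 (j k) = i k) -> mmap i1 y (map_mpoly j P) = mmap i y P.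
Proof.
move=> ji; rewrite /mmap (perm_big _ (msupp_map_mpoly _ (fmorph_inj j))) /=.
by apply: eq_bigr => m _; rewrite mcoeff_map_mpoly /= ji.
Qed.

Section CurveSelectionOmega.
Variables (L : closedFieldType) (C : closedFieldType) (kap : {rmorphism C -> L}).
Variable W : L -> C -> Prop.
Hypothesis PW : place kap W.

(** The algebraic closure of the field of [K] and [x], taken inside the closed field [L]. *)
Lemma closure_adjoin (K : closedFieldType) (iota : {rmorphism K -> L}) (x : L) : (forall k, iota k != x) ->
 exists (K1 : closedFieldType) (i1 : {rmorphism K1 -> L}), [/\ forall k, exists k1, i1 k1 = iota k,
  exists k1, i1 k1 = x & forall k1, algx iota x (i1 k1)].
Proof.
move=> xK; have [||F [i iP]] := @subfield_type L (ratx iota x) (ratx1 _ _).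
- by move=> a b ha hb; apply: (ratxD xK) => //; apply: (ratxN xK).
- by move=> a b ha hb; apply: (ratxM xK) => //; apply: ratxV.
have [|||K1 [i1 i1P]] := @closed_subfield L (integralOver i) (integral1 i).
- by move=> a b; apply: integral_sub.
- by move=> a b; apply: integral_div.
- move=> p u mp hp ru; apply: (integral_root_monic mp ru) => a /(nthP 0)[l _ <-]; exact: hp.
have hi u : ratx iota x u -> exists k1, i1 k1 = u.
 by move=> /iP[k <-]; apply/i1P; apply: integral_id.
exists K1, i1; split.
- by move=> k; apply: hi; have := ratx_ev iota x k%:P; rewrite /= /horner_eval map_polyC hornerC.
- by apply: hi; have := ratx_ev iota x 'X; rewrite /= /horner_eval map_polyX hornerX.
move=> k1; have [|p mp rp] := (i1P (i1 k1)).2; first by exists k1.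
exists (map_poly i p); first by rewrite map_monic.
by split=> // l; rewrite coef_map; apply/iP; exists p`_l.
Qed.

(** Induction on the number of coordinates outside [K]: adjoin one of them as [x], move the others
    into the algebraic closure [K1], and return to [K] by [step]. *)
Theorem selection_omega D (B : pred 'I_D) (y : 'I_D -> L) (b0 : 'I_D -> C) n
 (K : closedFieldType) (kapK : {rmorphism C -> K}) (iota : {rmorphism K -> L}) (z : K) :
 (forall i, B i -> W (y i) (b0 i)) -> (forall c, iota (kapK c) = kap c) -> z != 0 -> pinf W (iota z) ->
 (#|[pred i | `[< ~ exists k, iota k = y i >]]| <= n)%N ->
 exists y' : 'I_D -> K, (forall P : {mpoly K[D]}, mmap iota y P = 0 -> P.@[y'] = 0) /\
  forall i, B i -> W (iota (y' i)) (b0 i).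
Proof.
move=> yB; elim: n K kapK iota z => [|n IH] K kapK iota z kE z0 mz hn.
 have /choice[y' hy'] : forall i, exists k, iota k = y i.
  move=> i; apply: contrapT => h; move: hn; rewrite leqn0 => /eqP/card0_eq/(_ i).
  by rewrite inE => /asboolP.
 exists y'; split=> [P|i Bi]; last by rewrite hy'; apply: yB.
 have -> : y = (fun k => iota (y' k)) by apply: funext => k; rewrite hy'.
 by rewrite mmap_meval => /eqP; rewrite fmorph_eq0 => /eqP.
have [/asboolP[i1 hi1]|ny] := boolP `[< exists i, ~ exists k, iota k = y i >]; last first.
 apply: (IH _ _ _ _ kE z0 mz); rewrite (_ : #|_| = 0)%N //; apply: eq_card0 => i.
 by rewrite inE; apply/asboolP => h; move/asboolP: ny; apply; exists i.
have xK k : iota k != y i1 by apply/eqP => h; apply: hi1; exists k.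
have [K1 [io1 [h1 [kx kxE] h2]]] := closure_adjoin xK.
have [j jE] := lift_rmorphism h1.
have [||||y1 [y1P y1W]] := IH K1 (j \o kapK) io1 (j z).
- by move=> c /=; rewrite jE.
- by rewrite fmorph_eq0.
- by rewrite jE.
- rewrite -ltnS; apply: leq_trans hn; apply: proper_card; apply/properP; split.
  apply/fintype.subsetP => i; rewrite !inE => /asboolP h [k kE']; move: h => /asboolP; apply.
  by have [k1 k1E] := h1 k; exists k1; rewrite k1E.
 exists i1; first by apply/asboolP.
 by apply/negP => /asboolP; apply; exists kx.
have [||y' [y'P y'W]] := step PW kE z0 mz xK (y := fun i => io1 (y1 i)) (B := B) (b0 := b0).
- by move=> i; apply: h2.
- exact: y1W.
exists y'; split=> // P Py; apply: y'P; rewrite -(mmap_map _ _ jE) mmap_meval y1P ?rmorph0 //.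
by rewrite (mmap_map _ _ jE).
Qed.

(** [selection_omega] for the algebraic closure of [S] in [L]. An equation with value [a] in [S] is
    a polynomial relation over this closure, so it is kept. *)
Theorem selection_subfield D (B : pred 'I_D) (y : 'I_D -> L) (b0 : 'I_D -> C) (S : L -> Prop) (z : L) :
 S 1 -> (forall a b, S a -> S b -> S (a - b)) -> (forall a b, S a -> S b -> S (a / b)) ->
 (forall c, S (kap c)) -> S z -> z != 0 -> pinf W z -> (forall i, B i -> W (y i) (b0 i)) ->
 exists u : 'I_D -> L, [/\ forall i, exists2 q : {poly L}, q \is monic & (forall l, S q`_l) /\ root q (u i),
  forall (p : {mpoly C[D]}) a, S a -> mmap kap y p = a -> mmap kap u p = a &
  forall i, B i -> W (u i) (b0 i)].
Proof.
move=> S1 SB SV Sk Sz z0 mz yB; have [F [i iP]] := subfield_type S1 SB SV.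
have [|||K [io ioP]] := @closed_subfield L (integralOver i) (integral1 i).
- by move=> a b; apply: integral_sub.
- by move=> a b; apply: integral_div.
- move=> p u mp hp ru; apply: (integral_root_monic mp ru) => a /(nthP 0)[l _ <-]; exact: hp.
have hi u : S u -> exists k, io k = u by move=> /iP[k <-]; apply/ioP; apply: integral_id.
have [kapK kE] : exists kapK : {rmorphism C -> K}, forall c, io (kapK c) = kap c.
 by apply: lift_rmorphism => c; apply: hi.
have [zK zE] := hi z Sz.
have [|||y' [y'P y'W]] := @selection_omega D B y b0 D K kapK io zK yB kE.
- by apply: contra_neq z0 => e; rewrite -zE e rmorph0.
- by rewrite zE.
- by apply: leq_trans (max_card _) _; rewrite card_ord.
exists (fun k => io (y' k)); split=> //.
 move=> k; have [|q mq rq] := (ioP (io (y' k))).2; first by exists (y' k).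
 exists (map_poly i q); first by rewrite map_monic.
 by split=> // l; rewrite coef_map; apply/iP; exists q`_l.
move=> p a /hi[aK <-] e; have := y'P (map_mpoly kapK p - aK%:MP).
rewrite mmapB mmapC (mmap_map _ _ kE) e subrr mevalB mevalC => /(_ erefl)/eqP; rewrite subr_eq0 => /eqP e'.
by rewrite -e' -mmap_meval (mmap_map _ _ kE).
Qed.

End CurveSelectionOmega.

(** [T f c] reads: [f] tends to [c]. The functions that vanish wherever some function with nonzero
    limit does not vanish are made 0 by a maximal ideal. The quotient is algebraically closed, as
    equations are solved pointwise, and passing to the limit is a ring relation on it, which extends
    to a place. *)
Lemma limit_place (X : pointedType) (C : closedFieldType) (T : (X -> C) -> C -> Prop) :
 (forall c, T (fun=> c) c) -> (forall f g c d, T f c -> T g d -> T (fun x => f x + g x) (c + d)) ->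
 (forall f g c d, T f c -> T g d -> T (fun x => f x * g x) (c * d)) ->
 (forall f c, T f c -> c != 0 -> exists x, f x != 0) ->
 exists (L : closedFieldType) (kap : {rmorphism C -> L}) (pi : (X -> C) -> L) (W : L -> C -> Prop),
  [/\ place kap W, forall c, pi (fun=> c) = kap c, (forall f g, pi (fun x => f x + g x) = pi f + pi g),
    (forall f g, pi (fun x => f x * g x) = pi f * pi g) & (forall f c, T f c -> W (pi f) c) /\
    (forall f g c, T f c -> c != 0 -> (forall x, f x != 0 -> g x = 0) -> pi g = 0) /\
    forall u, exists f, pi f = u].
Proof.
move=> TC TD TM Tn.
pose I (g : X -> C) := exists f c, [/\ T f c, c != 0 & forall x, f x != 0 -> g x = 0].
have iI : ring_ideal (A := (X -> C : comNzRingType)) I.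
 split.
 - by exists (fun=> 1), 1; rewrite oner_neq0.
 - move=> p q [f [c [h1 h2 h3]]] [g [d [k1 k2 k3]]]; exists (fun x => f x * g x), (c * d).
  split; [exact: TM|by rewrite mulf_neq0|] => x; rewrite mulf_eq0 negb_or => /andP[fx gx].
  by rewrite fctE h3 // k3 // addr0.
 - by move=> p q [f [c [h1 h2 h3]]]; exists f, c; split=> // x /h3 h; rewrite fctE h mulr0.
have I1 : ~ I 1.
 move=> [f [c [h1 h2 h3]]]; have [x /h3] := Tn _ _ h1 h2.
 by move/eqP; rewrite oner_eq0.
have [M [iM IM M1 maxM]] := maximal_ideal iI I1.
have [F [p [psur p0]]] := quotient_field iM M1 maxM.
have [q mq sq|L [i ibij]] := @closed_field_of F.
 have /choice[rep repE] := psur.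
 have [n sqn] : exists n, size q = n.+1 by exists (size q).-1; rewrite prednK // ltnW.
 pose Q x : {poly C} := 'X^n + \poly_(k < n) rep q`_k x.
 have sQ x : size (Q x) = size q.
  rewrite /Q size_polyDl; first by rewrite size_polyXn sqn.
  by rewrite size_polyXn ltnS size_poly.
 have /choice[w hw] : forall x, exists w, root (Q x) w.
  by move=> x; apply/closed_rootP; rewrite sQ; case: (size q) sq => [|[]].
 exists (p w); apply/eqP; rewrite horner_coef sqn big_ord_recr /=.
 have -> : q`_n = 1 by rewrite -(monicP mq) lead_coefE sqn.
 rewrite mul1r -rmorphXn.
 have -> : \sum_(k < n) q`_k * p w ^+ k = p (\sum_(k < n) rep q`_k * w ^+ k).
  by rewrite rmorph_sum; apply: eq_bigr => k _; rewrite rmorphM rmorphXn repE.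
 rewrite -rmorphD -[RHS](rmorph0 p); congr (p _); apply: funext => x.
 transitivity (Q x).[w x]; last exact/eqP/hw.
 rewrite addrC addrfctE exprfctE fct_sumE /Q hornerD hornerXn horner_poly; congr (_ + _).
 by apply: eq_bigr => k _; rewrite mulrfctE exprfctE.
have cm : zmod_morphism (fun c : C => (fun=> c) : X -> C) by move=> a b; apply: funext.
have cm' : monoid_morphism (fun c : C => (fun=> c) : X -> C) by split=> [|a b]; apply: funext.
pose cst0 : {rmorphism C -> (X -> C)} := HB.pack_for {rmorphism C -> (X -> C)} (fun c : C => (fun=> c) : X -> C)
  (GRing.isZmodMorphism.Build _ _ _ cm) (GRing.isMonoidMorphism.Build _ _ _ cm').
pose kap : {rmorphism C -> L} := i \o p \o cst0.
pose S a c := exists2 f, T f c & a = i (p f).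
have RS : ring_relation kap S.
 split.
 - by move=> c; exists (fun=> c).
 - move=> _ _ c d [f h ->] [g k ->]; exists (fun x => f x + g x); first exact: TD.
  by rewrite -rmorphD -rmorphD.
 - move=> _ _ c d [f h ->] [g k ->]; exists (fun x => f x * g x); first exact: TM.
  by rewrite -rmorphM -rmorphM.
 - move=> c [f h /esym/eqP]; rewrite fmorph_eq0 => /eqP/p0 Mf; apply/eqP; apply: contrapT => /negP c0.
  (* If [f] with nonzero limit were 0 in the quotient, both terms of this decomposition of 1 would
     lie in the ideal: the first is a multiple of [f], and the second vanishes where [f] does
     not. *)
  apply: M1; have -> : (1 : X -> C) = (fun x => (f x)^-1) * f + (1 - (fun x => (f x)^-1) * f) by rewrite addrC subrK.
  apply: (idealD iM); first exact: (idealM iM).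
  apply: IM; exists f, c; split=> // x fx.
  by rewrite addrfctE opprfctE mulrfctE mulVf // subrr.
have [W PW SW] := place_extension RS.
exists L, kap, (i \o p), W; split=> //.
- by move=> f g /=; rewrite -rmorphD -rmorphD.
- by move=> f g /=; rewrite -rmorphM -rmorphM.
split; first by move=> f c Tf; apply: SW; exists f.
split; last by move=> u; case: ibij => i' _ iK; have [f fE] := psur (i' u); exists f; rewrite /= fE iK.
move=> f g c Tf c0 h /=; have -> : p g = 0 by apply/p0; apply: IM; exists f, c.
by rewrite rmorph0.
Qed.

(** * Degrees, minors and row spaces *)

Section Degree.
Variables (C : idomainType).

Lemma msizeM_deg d (p q : {mpoly C[d]}) a b : (msize p <= a.+1)%N -> (msize q <= b.+1)%N -> (msize (p * q) <= (a + b).+1)%N.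
Proof.
have [->|p0] := eqVneq p 0; first by rewrite mul0r msize0.
have [->|q0] := eqVneq q 0; first by rewrite mulr0 msize0.
by rewrite msizeM //; lia.
Qed.
Lemma msize_comp_linear d e (lq : d.-tuple {mpoly C[e]}) (p : {mpoly C[d]}) :
 (forall i, (msize (tnth lq i) <= 2)%N) -> (msize (p \mPo lq) <= msize p)%N.
Proof.
move=> h; rewrite comp_mpolyEX; apply: leq_trans (mmeasure_sum _ _ _ _) _.
apply/bigmax_leqP_seq => m mp _; apply: leq_trans (msizeZ_le _ _) _.
apply: leq_trans (msize_mdeg_lt mp); rewrite comp_mpolyX mdegE.
elim/big_rec2: _ => [|i k q _ IH]; first by rewrite msize1.
rewrite addnC addnC; apply: msizeM_deg => //.
elim: (m i) => [|l IHl]; first by rewrite expr0 msize1.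
by rewrite exprS; apply: (@msizeM_deg _ _ _ 1 l).
Qed.
Lemma msize_linform d e (f : 'I_e -> C) (g : 'I_e -> 'I_d) : (msize (\sum_j f j *: 'X_(g j)) <= 2)%N.
Proof.
apply: leq_trans (mmeasure_sum _ _ _ _) _; apply/bigmax_leqP => i _; apply: leq_trans (msizeZ_le _ _) _.
by rewrite msizeX mdeg1.
Qed.
Lemma mpoly_basis d D (p : {mpoly C[d]}) : (msize p <= D)%N ->
 p = \sum_(k < #|{: 'X_{1..d < D}}|) p@_(enum_val k : 'X_{1..d < D}) *: 'X_[(enum_val k : 'X_{1..d < D})].
Proof.
move=> h; rewrite {1}(mpolywE h) (reindex (@enum_val _ (mem {: 'X_{1..d < D}}))) //=.
by apply: onW_bij; apply: enum_val_bij.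
Qed.
End Degree.

Section Minors.
Variable F : fieldType.

Lemma mxrank_sub a b c e (f : 'I_c -> 'I_a) (g : 'I_e -> 'I_b) (M : 'M[F]_(a, b)) : (\rank (mxsub f g M) <= \rank M)%N.
Proof.
have -> : mxsub f g M = rowsub f 1%:M *m M *m colsub g 1%:M.
 apply/matrixP => i j; rewrite !mxE (bigD1 (g j)) //= big1 => [|k kg]; last by rewrite !mxE (negPf kg) mulr0.
 rewrite addr0 !mxE eqxx mulr1 (bigD1 (f i)) //= big1 => [|k kg]; first by rewrite !mxE eqxx mul1r addr0.
 by rewrite !mxE eq_sym (negPf kg) mul0r.
exact: leq_trans (mxrankM_maxl _ _) (mxrankM_maxr _ _).
Qed.
(** Turns a bound on the rank into polynomial equations, which pass to closures and to selected
    curves. *)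
Lemma rank_minors a b (M : 'M[F]_(a, b)) k :
 (forall (f : 'I_k.+1 -> 'I_a) (g : 'I_k.+1 -> 'I_b), \det (mxsub f g M) = 0) <-> (\rank M <= k)%N.
Proof.
split=> [h|rk f g]; last first.
 apply/eqP; apply: contraLR rk => d0; rewrite -ltnNge; apply: leq_trans (mxrank_sub f g M).
 by rewrite mxrank_unit // unitmxE unitfE.
rewrite leqNgt; apply/negP => lt.
pose f i := maxrankfun M (widen_ord lt i).
have fr : row_free (rowsub f M).
 have /row_freeP[B NB] := maxrowsub_free M; apply/row_freeP; exists (B *m colsub (widen_ord lt) 1%:M).
 have -> : rowsub f M = rowsub (widen_ord lt) (rowsub (maxrankfun M) M) by apply/matrixP => i j; rewrite !mxE.
 rewrite mulmxA mul_rowsub_mx NB; apply/matrixP => i j; rewrite !mxE (bigD1 (widen_ord lt i)) //=.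
 rewrite big1 => [|k' ki]; last by rewrite !mxE eq_sym (negPf ki) mul0r.
 by rewrite addr0 !mxE eqxx mul1r.
have full : row_full (rowsub f M)^T by rewrite /row_full mxrank_tr.
pose g := fullrankfun full.
have := h f g; apply/eqP; rewrite -unitfE -unitmxE -unitmx_tr.
have -> : (mxsub f g M)^T = rowsub g (rowsub f M)^T by apply/matrixP => i j; rewrite !mxE.
exact: fullrowsub_unit.
Qed.
Lemma full_minor a b (M : 'M[F]_(a, b)) : exists (f : 'I_(\rank M) -> 'I_a) (g : 'I_(\rank M) -> 'I_b), \det (mxsub f g M) != 0.
Proof.
case E: (\rank M) => [|k]; first by exists (fun i : 'I_0 => match notF (ltn_ord i) with end), (fun i : 'I_0 => match notF (ltn_ord i) with end); rewrite det_mx00 oner_neq0.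
apply: contrapT => no; suff : (\rank M <= k)%N by rewrite E ltnn.
by apply/rank_minors => f g; apply/eqP; apply: contrapT => /negP h; apply: no; exists f, g.
Qed.
End Minors.

Lemma rowspace_of (F : fieldType) s (P : 'rV[F]_s -> Prop) : P 0 -> (forall c u v, P u -> P v -> P (c *: u + v)) ->
 exists k (S : 'M[F]_(k, s)), forall u, (u <= S)%MS <-> P u.
Proof.
move=> P0 PD; have [U UP] := subspace_vspace P0 PD.
exists (\dim U), (\matrix_(i < \dim U) tnth (vbasis U) i) => u; rewrite -UP; split.
 move=> /submxP[a ->]; rewrite mulmx_sum_row; apply: memv_suml => i _; rewrite rowK memvZ //.
 exact/vbasis_mem/mem_tnth.
move=> /coord_vbasis ->; apply: summx_sub => i _; apply: scalemx_sub.
by rewrite (_ : _`_i = row i (\matrix_(i < \dim U) tnth (vbasis U) i)) ?row_sub // rowK (tnth_nth 0).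
Qed.

(** * Group action on polynomials and minimal closed stable sets *)

Section PolynomialRep.
Variables (C : numClosedFieldType) (n' : nat).
Local Notation n := n'.+1.
Variables (G : 'M[C]_n -> Prop) (d : nat) (r : 'M[{mpoly C[n * n]}]_d).
Hypotheses (GG : matrix_group G) (rr : is_rep G r).

Definition ev (p : {mpoly C[d]}) (v : 'cV[C]_d) := p.@[fun i => v i 0].
Definition act A (p : {mpoly C[d]}) : {mpoly C[d]} := p \mPo [tuple \sum_j (evm r A) i j *: 'X_j | i < d].

Lemma ev_act A p v : ev (act A p) v = ev p (evm r A *m v).
Proof.
rewrite /ev /act comp_mpoly_meval; apply: meval_eq => i; rewrite tnth_mktuple mxE raddf_sum /=.
by apply: eq_bigr => j _; rewrite mevalZ mevalXU.
Qed.
Lemma msize_act A p : (msize (act A p) <= msize p)%N.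
Proof. by apply: msize_comp_linear => i; rewrite tnth_mktuple; apply: msize_linform. Qed.
Lemma actC A c : act A c%:MP = c%:MP. Proof. by rewrite /act comp_mpolyC. Qed.
Lemma actX A i : act A 'X_i = \sum_j (evm r A) i j *: 'X_j.
Proof. by rewrite /act comp_mpolyXU -tnth_nth tnth_mktuple. Qed.
Lemma actD A p q : act A (p + q) = act A p + act A q. Proof. exact: rmorphD. Qed.
Lemma actM A p q : act A (p * q) = act A p * act A q. Proof. exact: rmorphM. Qed.
Lemma actZ A c p : act A (c *: p) = c *: act A p. Proof. by rewrite -!mul_mpolyC actM actC. Qed.
Lemma act_sum A (I : Type) (s : seq I) (P : pred I) F : act A (\sum_(i <- s | P i) F i) = \sum_(i <- s | P i) act A (F i).
Proof. exact: rmorph_sum. Qed.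
(** Substitution acts from the right, which agrees with the row convention of [rep_stable]. *)
Lemma act_act A B p : G A -> G B -> act B (act A p) = act (A *m B) p.
Proof.
move=> GA GB; elim/mpoly_alg_ind: p => [c|i|p q IHp IHq|p q IHp IHq].
- by rewrite !actC.
- rewrite !actX act_sum rr.2 //; under eq_bigr do rewrite actZ actX scaler_sumr.
 rewrite exchange_big /=; apply: eq_bigr => k _; rewrite mxE scaler_suml; apply: eq_bigr => j _.
 by rewrite scalerA.
- by rewrite !actD IHp IHq.
- by rewrite !actM IHp IHq.
Qed.
Lemma act1 p : act 1%:M p = p.
Proof.
elim/mpoly_alg_ind: p => [c|i|p q IHp IHq|p q IHp IHq]; rewrite ?actC ?actD ?actM ?IHp ?IHq //.
rewrite actX rr.1 (bigD1 i) //= big1 ?addr0 => [|j ji]; first by rewrite mxE eqxx scale1r.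
by rewrite mxE eq_sym (negPf ji) scale0r.
Qed.
Definition vco (A : 'M[C]_n) := fun k => mxvec A 0 k.

Lemma pf_act p m : pf vco (fun A => (act A p)@_m).
Proof.
elim/mpoly_alg_ind: p m => [c|i|p q IHp IHq|p q IHp IHq] m.
- by apply: (@pf_eq _ _ _ _ (fun=> (c%:MP : {mpoly C[d]})@_m)); [move=> A; rewrite actC|apply: pf_cst].
- apply: (@pf_eq _ _ _ _ (fun A => \sum_j mev (r i j) A * ('X_j : {mpoly C[d]})@_m)).
  by move=> A; rewrite actX raddf_sum /=; apply: eq_bigr => j _; rewrite mcoeffZ mxE.
 by apply: pf_sum => j; apply: pfM; [exists (r i j)|apply: pf_cst].
- by apply: pf_eq (pfD (IHp m) (IHq m)) => A; rewrite actD mcoeffD.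
- apply: (@pf_eq _ _ _ _ (fun A => \sum_(k : 'X_{1..d < (mdeg m).+1, (mdeg m).+1} | m == (k.1 + k.2)%MM) (act A p)@_k.1 * (act A q)@_k.2)).
  by move=> A; rewrite actM mcoeffM.
 by apply: pf_sum => k; apply: pfM.
Qed.

Hypotheses (NI : nil_ideals_trivial G) (FIN : finite_valued_invariants G).

(** Polynomials of bounded degree form a representation [RD] in the basis of monomials. The third
    clause is [rep_preserving] for the row space of the polynomials in [I]. *)
Theorem poly_reynolds D : exists L : {mpoly C[d]} -> {mpoly C[d]},
 [/\ linear L, forall A p, G A -> act A (L p) = L p,
  (forall I : {mpoly C[d]} -> Prop, I 0 -> (forall c p q, I p -> I q -> I (c *: p + q)) ->
   (forall A p, G A -> I p -> I (act A p)) -> forall p, (msize p <= D)%N -> I p -> I (L p)) &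
  forall p, (msize p <= D)%N -> (forall A, G A -> act A p = p) -> L p = p].
Proof.
(* The shift by one ensures that the monomial 1 is present, so that the matrices have positive
   size. *)
pose E := D.+1; pose T : finType := 'X_{1..d < E}.
have [s' sE] : exists s', #|{: T}| = s'.+1.
 exists #|{: T}|.-1; rewrite prednK //; apply/card_gt0P.
 have h0 : (mdeg (0%MM : 'X_{1..d}) < E)%N by rewrite mdeg0.
 by exists (BMultinom h0).
pose mm (k : 'I_s'.+1) : 'X_{1..d} := (enum_val (cast_ord (esym sE) k) : T).
have basis (p : {mpoly C[d]}) : (msize p <= E)%N -> p = \sum_k p@_(mm k) *: 'X_[mm k].
 move=> h; rewrite {1}(mpoly_basis h) (reindex (cast_ord (esym sE))) //=.
 by apply: onW_bij; exists (cast_ord sE) => x; rewrite ?cast_ordK ?cast_ordKV.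
have mm_inj : injective mm.
 by move=> k l /val_inj/enum_val_inj/cast_ord_inj.
have mms k : (msize ('X_[mm k] : {mpoly C[d]}) <= E)%N.
 by rewrite msizeX; exact: bmdeg.
pose rw (p : {mpoly C[d]}) : 'rV[C]_s'.+1 := \row_k p@_(mm k).
pose po (u : 'rV[C]_s'.+1) : {mpoly C[d]} := \sum_k u 0 k *: 'X_[mm k].
have rwK p : (msize p <= E)%N -> po (rw p) = p.
 by move=> h; rewrite [RHS]basis //; apply: eq_bigr => k _; rewrite mxE.
have poK u : rw (po u) = u.
 apply/rowP => k; rewrite mxE raddf_sum (bigD1 k) //= mcoeffZ mcoeffX eqxx mulr1 big1 ?addr0 // => l lk.
 by rewrite mcoeffZ mcoeffX (inj_eq mm_inj) (negPf lk) mulr0.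
have pos u : (msize (po u) <= E)%N.
 by apply: leq_trans (mmeasure_sum _ _ _ _) _; apply/bigmax_leqP => k _; apply: leq_trans (msizeZ_le _ _) (mms k).
have poL c u v : po (c *: u + v) = c *: po u + po v.
 rewrite /po scaler_sumr -big_split; apply: eq_bigr => k _.
 by rewrite !mxE scalerDl scalerA.
have rwL c p q : rw (c *: p + q) = c *: rw p + rw q.
 by apply/rowP => k; rewrite !mxE mcoeffD mcoeffZ.
have /choice[rD hrD] : forall kl : 'I_s'.+1 * 'I_s'.+1, exists P, forall A, (act A 'X_[mm kl.1])@_(mm kl.2) = P.@[vco A].
 by move=> kl; apply: pf_act.
pose RD : 'M[{mpoly C[n * n]}]_s'.+1 := \matrix_(k, l) rD (k, l).
have RDE A k l : evm RD A k l = (act A 'X_[mm k])@_(mm l) by rewrite (hrD (k, l)) !mxE.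
have rw_act A p : (msize p <= E)%N -> rw (act A p) = rw p *m evm RD A.
 move=> h; apply/rowP => l; rewrite [RHS]mxE mxE {1}[p]basis // act_sum raddf_sum /=; apply: eq_bigr => k _.
 by rewrite actZ mcoeffZ RDE [rw p _ _]mxE.
have acts A p : (msize p <= E)%N -> (msize (act A p) <= E)%N by apply: leq_trans (msize_act _ _).
have rX k : rw 'X_[mm k] = delta_mx 0 k.
 by apply/rowP => l; rewrite !mxE mcoeffX (inj_eq mm_inj) eq_sym.
have repD : is_rep G RD.
 split; first by apply/matrixP => k l; rewrite RDE act1 mcoeffX mxE (inj_eq mm_inj).
 move=> A B GA GB; apply/row_matrixP => k; rewrite !rowE -rX -!rw_act // -act_act // rw_act ?acts //.
 by rewrite rw_act // mulmxA.
have [P [PA Pp Pi]] := reynolds_operator GG NI repD FIN.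
exists (fun p => po (rw p *m P)); split.
- by move=> c p q; rewrite rwL mulmxDl -scalemxAl poL.
- by move=> A p GA; rewrite -[LHS]rwK ?acts ?pos // rw_act ?pos // poK -mulmxA PA.
- move=> I I0 IL Ia p hp Ip; have hp' : (msize p <= E)%N by apply: leqW.
 have [||k [S hS]] := @rowspace_of C _ (fun u => I (po u)).
 + by rewrite (_ : po 0 = 0) // /po big1 // => k _; rewrite mxE scale0r.
 + by move=> c u v hu hv; rewrite poL; apply: IL.
 apply/hS; apply: submx_trans (Pp k S _); first by apply: submxMr; apply/hS; rewrite rwK.
 move=> A GA; apply/row_subP => i; rewrite row_mul; apply/hS.
 have -> : po (row i S *m evm RD A) = act A (po (row i S)).
  by rewrite -[RHS]rwK ?acts ?pos // rw_act ?pos // poK.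
 by apply: Ia => //; apply/hS; apply: row_sub.
- move=> p hp pA; have hp' : (msize p <= E)%N by apply: leqW.
 by rewrite Pi ?rwK // => A GA; rewrite -rw_act // pA.
Qed.
Definition stable (X : 'cV[C]_d -> Prop) := forall A v, G A -> X v -> X (evm r A *m v).
Definition zclosed (X : 'cV[C]_d -> Prop) := forall v, (forall p, (forall w, X w -> ev p w = 0) -> ev p v = 0) -> X v.
(** By [min_min] every orbit in the set is dense in it. Such a set takes the place of the closed
    orbit until [minset_orbit] shows that it is one. *)
Record minset (Y : 'cV[C]_d -> Prop) : Prop := MinSet { min_ex : exists v, Y v; min_stable : stable Y;
 min_closed : zclosed Y;
 min_min : forall w f, Y w -> (forall A, G A -> ev f (evm r A *m w) = 0) -> forall v, Y v -> ev f v = 0 }.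

Hypothesis unc : uncountable_field C.

Lemma nullstellensatz_ev (I : {mpoly C[d]} -> Prop) : ring_ideal I -> ~ I 1 ->
 exists v, forall p, I p -> ev p v = 0.
Proof.
move=> iI I1; have [v hv] := nullstellensatz unc iI I1; exists (\col_i v i) => p /hv <-.
by apply: meval_eq => i; rewrite mxE.
Qed.
(** The equations of the set form a maximal proper stable ideal above those of [X]. The
    Nullstellensatz provides a point; maximality makes the orbits dense. *)
Lemma exists_minset X : (exists v, X v) -> stable X -> zclosed X -> exists2 Y, minset Y & forall v, Y v -> X v.
Proof.
move=> [x0 Xx0] Xs Xc; pose I p := forall w, X w -> ev p w = 0.
have iI : ring_ideal I.
 split; first by move=> w _; rewrite /ev meval0.
  by move=> p q hp hq w Xw; rewrite /ev mevalD -!/(ev _ _) hp // hq // addr0.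
 by move=> p q hq w Xw; rewrite /ev mevalM -!/(ev _ _) hq // mulr0.
pose Op (f : {mpoly C[d]} -> {mpoly C[d]}) := exists2 A, G A & f = act A.
have [||M [iM OM IM M1 maxM]] := @maximal_stable_ideal _ Op I iI.
- by move=> _ p [A GA ->] Ip w Xw; rewrite ev_act; apply: Ip; apply: Xs.
- by move=> /(_ _ Xx0)/eqP; rewrite /ev meval1 oner_eq0.
pose Y v := forall p, M p -> ev p v = 0.
exists Y; last by move=> v Yv; apply: Xc => p /IM/Yv.
split.
- exact: nullstellensatz_ev.
- by move=> A v GA Yv p Mp; rewrite -ev_act; apply: Yv; apply: OM => //; exists A.
- by move=> v hv p Mp; apply: hv => w; apply.
move=> w f Yw hf v Yv; pose J p := forall A, G A -> ev p (evm r A *m w) = 0.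
apply: Yv; apply: (maxM J) => //.
- split; first by move=> A _; rewrite /ev meval0.
  by move=> p q hp hq A GA; rewrite /ev mevalD -!/(ev _ _) hp // hq // addr0.
 by move=> p q hq A GA; rewrite /ev mevalM -!/(ev _ _) hq // mulr0.
- move=> _ p [B GB ->] Jp A GA; rewrite ev_act mulmxA -rr.2 //; apply: Jp; exact: (mgrpM GG).
- by move=> /(_ _ (mgrp1 GG))/eqP; rewrite /ev meval1 oner_eq0.
- by move=> p Mp A GA; rewrite -ev_act; apply: Yw; apply: OM => //; exists A.
Qed.
(** The translates of [f0] have no common zero on [Y], so 1 is on [Y] a combination of them. The
    same combination of translates of each [p j], followed by a Reynolds operator, is [q j]. The
    [p j] are kept apart so that their coefficients may later vary with a parameter. *)
Lemma invariant_transfer Y b (I : finType) (p : I -> {mpoly C[d]}) (c : I -> C) : minset Y -> Y b ->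
 \sum_j c j * ev (p j) b != 0 -> exists q : I -> {mpoly C[d]}, [/\ forall j A, G A -> act A (q j) = q j,
  (forall X, stable X -> forall a : I -> C, (forall x, X x -> \sum_j a j * ev (p j) x = 0) ->
    forall x, X x -> \sum_j a j * ev (q j) x = 0) & forall y, Y y -> \sum_j c j * ev (q j) y = 1].
Proof.
move=> mY Yb f0b; pose f0 : {mpoly C[d]} := \sum_j c j *: p j.
have evs (a : I -> C) (q : I -> {mpoly C[d]}) x : ev (\sum_j a j *: q j) x = \sum_j a j * ev (q j) x.
 by rewrite /ev raddf_sum /=; apply: eq_bigr => j _; rewrite mevalZ.
pose comb (s : seq ({mpoly C[d]} * 'M[C]_n)) (f : {mpoly C[d]}) := \sum_(k <- s) k.1 * act k.2 f.
pose J q := exists2 s : seq ({mpoly C[d]} * 'M[C]_n), (forall k, k \in s -> G k.2) &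
  forall y, Y y -> ev q y = ev (comb s f0) y.
have iJ : ring_ideal J.
 split.
 - by exists [::] => // y _; rewrite /comb big_nil.
 - move=> q1 q2 [s1 h1 k1] [s2 h2 k2]; exists (s1 ++ s2).
   by move=> k; rewrite mem_cat => /orP[/h1|/h2].
  by move=> y Yy; rewrite /comb big_cat /ev !mevalD -!/(ev _ _) k1 // k2.
 - move=> q1 q2 [s h k]; exists [seq (q1 * t.1, t.2) | t <- s].
   by move=> _ /mapP[t /h ? ->].
  move=> y Yy; rewrite /comb big_map /=; under eq_bigr do rewrite -mulrA.
  by rewrite -mulr_sumr /ev !mevalM -!/(ev _ _) k.
have [s sG sE] : J 1.
 apply: contrapT => J1; have [v hv] := nullstellensatz_ev iJ J1.
 have Yv : Y v.
  apply: (min_closed mY) => q hq; apply: hv; exists [::] => // y Yy.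
  by rewrite hq // /comb big_nil /ev meval0.
 case/eqP: f0b; rewrite -evs; apply: (min_min mY Yv) => // A GA.
 rewrite -ev_act; apply: hv; exists [:: (1, A)]; first by move=> k; rewrite inE => /eqP->.
 by move=> y _; rewrite /comb big_seq1 mul1r.
pose e j := comb s (p j).
(* Large enough for every [e j] and for the constant 1. *)
pose D := (1 + \sum_j msize (e j))%N.
have eD j : (msize (e j) <= D)%N by rewrite /D (bigD1 j) //= addnCA leq_addr.
have [L [Ll La Lp Li]] := poly_reynolds D.
have Ls (a : I -> C) : L (\sum_j a j *: e j) = \sum_j a j *: L (e j).
 have L0 : L 0 = 0 by have := Ll (-1) 0 0; rewrite scaler0 addr0 scaleN1r addNr.
 by apply: (big_rec2 (fun x y => L x = y)) => // j x y _ <-; rewrite Ll.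
have sD (a : I -> C) : (msize (\sum_j a j *: e j) <= D)%N.
 by apply: leq_trans (mmeasure_sum _ _ _ _) _; apply/bigmax_leqP => j _; apply: leq_trans (msizeZ_le _ _) (eD j).
have vsub (X : 'cV[C]_d -> Prop) : stable X -> forall q, (msize q <= D)%N -> (forall x, X x -> ev q x = 0) -> forall x, X x -> ev (L q) x = 0.
 move=> Xs; apply: (Lp (fun q => forall x, X x -> ev q x = 0)).
 - by move=> x _; rewrite /ev meval0.
 - by move=> k q1 q2 h1 h2 x Xx; rewrite /ev mevalD mevalZ -!/(ev _ _) h1 // h2 // mulr0 addr0.
 - by move=> A q GA h x Xx; rewrite ev_act; apply: h; apply: Xs.
have comb_sum (a : I -> C) : \sum_j a j *: e j = comb s (\sum_j a j *: p j).
 rewrite /e /comb; under eq_bigr do rewrite scaler_sumr.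
 rewrite exchange_big /=; apply: eq_bigr => k _; rewrite act_sum mulr_sumr.
 by apply: eq_bigr => j _; rewrite actZ scalerAr.
have ev_comb f x : ev (comb s f) x = \sum_(k <- s) ev k.1 x * ev f (evm r k.2 *m x).
 rewrite /comb /ev raddf_sum /=; apply: eq_bigr => k _; by rewrite mevalM -!/(ev _ _) ev_act.
exists (fun j => L (e j)); split.
- by move=> j A GA; apply: La.
- move=> X Xs a ha x Xx; rewrite -evs -Ls; apply: (vsub X) => // x' Xx'.
 rewrite comb_sum ev_comb big1_seq // => k /andP[_ ks]; rewrite evs ha ?mulr0 //.
 by apply: Xs => //; apply: sG.
- move=> y Yy; rewrite -evs -Ls.
 have L1 : L 1 = 1.
  by apply: Li; [rewrite msize1 /D|move=> A _; rewrite -[1](@mpolyC1 d C) actC].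
 have := vsub Y (min_stable mY) (\sum_j c j *: e j - 1) _ _ y Yy.
 have -> : L (\sum_j c j *: e j - 1) = L (\sum_j c j *: e j) - 1.
  by rewrite addrC -scaleN1r Ll L1 scaleN1r addrC.
 have evB (q1 q2 : {mpoly C[d]}) x : ev (q1 - q2) x = ev q1 x - ev q2 x by rewrite /ev mevalB.
 have ev1 x : ev 1 x = 1 by rewrite /ev meval1.
 rewrite evB ev1 => h; apply/eqP; rewrite -subr_eq0; apply/eqP/h.
  apply: leq_trans (mmeasureD_le _ _ _) _; rewrite geq_max sD mmeasureN msize1; by [].
 by move=> w Yw; rewrite evB comb_sum -/f0 -sE // subrr.
Qed.
(** The composite of [h] with the orbit map of [w] is an equation of [G]; this is its derivative at
    the identity in the direction [x]. *)
Lemma lie_der Y h x w : lie G x -> stable Y -> (forall v, Y v -> ev h v = 0) -> Y w ->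
 \sum_i ev (mderiv i h) w * (drep r x *m w) i 0 = 0.
Proof.
move=> Lx Ys hY Yw; pose u i : {mpoly C[n * n]} := \sum_l w l 0 *: r i l.
have uE i A : mev (u i) A = (evm r A *m w) i 0.
 by rewrite /u mev_sum mxE; apply: eq_bigr => l _; rewrite mevZ_ mxE mulrC.
have evu p A : mev (mmap (@mpolyC (n * n) C) u p) A = ev p (evm r A *m w).
 elim/mpoly_alg_ind: p => [c|i|p q IHp IHq|p q IHp IHq].
 - by rewrite mmapC /ev mevalC mevC_.
 - by rewrite mmapX mmap1U /ev mevalXU uE.
 - by rewrite mmapD mevD_ IHp IHq /ev mevalD.
 - by rewrite rmorphM mevM_ IHp IHq /ev mevalM.
have vp : vanishes G (mmap (@mpolyC (n * n) C) u h) by move=> A GA; rewrite evu hY //; apply: Ys.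
have e := Lx _ vp; rewrite (mmap_chain_rule _ (raddfD _) (vfieldM x) (vfieldC x)) mev_sum in e.
rewrite -[RHS]e; apply: eq_bigr => i _; rewrite mevM_ evu rr.1 mul1mx; congr (_ * _).
rewrite -[X in mev X _]/(vfield x (u i)) /u linear_sum mev_sum mxE; apply: eq_bigr => l _.
by rewrite linearZ mevZ_ mulrC !mxE.
Qed.

Section ConstantRank.
Variables (e : nat) (Fv : 'cV[C]_d -> 'M[C]_n -> 'cV[C]_e).
Definition rmx k (w : 'cV[C]_d) (As : 'I_k -> 'M[C]_n) : 'M[C]_(e, k) := \matrix_(j, l) Fv w (As l) j 0.
Definition rank_le w q := forall k (As : 'I_k -> 'M[C]_n), (forall l, G (As l)) -> (\rank (rmx w As) <= q)%N.

(** The bound on the rank is a system of polynomial equations; by the equivariance of [Fv] they hold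
    along the orbit of [w], hence on all of [Y]. *)
Lemma rank_le_min Y q w v : minset Y ->
 (forall A j, G A -> exists p : {mpoly C[d]}, forall x, Fv x A j 0 = ev p x) ->
 (forall B, G B -> exists T : 'M[C]_e, forall x A, G A -> Fv (evm r B *m x) (B *m A) = T *m Fv x A) ->
 Y w -> rank_le w q -> Y v -> rank_le v q.
Proof.
move=> mY Fpf FT Yw rw Yv k As GAs; apply/rank_minors => f g.
have [p hp] : pf (fun x : 'cV[C]_d => fun i => x i 0) (fun x => \det (mxsub f g (rmx x As))).
 apply: pf_det => i j; have [p hp] := Fpf _ (f i) (GAs (g j)); exists p => x.
 by rewrite -[RHS]hp !mxE.
rewrite hp; apply: (min_min mY Yw) Yv => B GB; rewrite /ev -hp.
have [T hT] := FT B GB; have uB := mgrp_unit GG GB; pose As' l := invmx B *m As l.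
have GAs' l : G (As' l) by apply: (mgrpM GG) => //; apply: (mgrp_inv GG).
have -> : rmx (evm r B *m w) As = T *m rmx w As'.
 apply/matrixP => i j; transitivity ((T *m Fv w (As' j)) i 0).
  by rewrite -hT ?GAs' // /As' mulKVmx // mxE.
 by rewrite !mxE; apply: eq_bigr => l _; rewrite ?mxE.
have /rank_minors : (\rank (T *m rmx w As') <= q)%N by apply: leq_trans (mxrankM_maxr _ _) (rw _ _ GAs').
by apply.
Qed.
End ConstantRank.

Lemma evm_ltrans B (p : {mpoly C[n * n]}) : (msize (ltrans B p) <= msize p)%N.
Proof.
apply: msize_comp_linear => k; rewrite tnth_mktuple; case/mxvec_indexP: k => i j.
rewrite mxvecE mxE; apply: leq_trans (mmeasure_sum _ _ _ _) _; apply/bigmax_leqP => l _.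
by apply: leq_trans (msizeZ_le _ _) _; rewrite msizeX mdeg1.
Qed.

(* If [w] is off the orbit of [v], the Nullstellensatz writes 1 as a combination of the entries of
  [rho(A) v - w] with coefficients of bounded degree; such a linear system is solvable at [w] iff two
  ranks agree, ranks are constant on a minimal set, and the system has no solution at [w = v]. *)
Theorem minset_orbit Y v w : minset Y -> Y v -> Y w -> exists2 A, G A & w = evm r A *m v.
Proof.
(* The functions that restrict on [G] to the ideal of the equations saying that [A] maps [v] to [w];
   a common zero is such an [A]. *)
move=> mY Yv Yw; pose I (q : {mpoly C[n * n]}) := exists a : 'I_d -> {mpoly C[n * n]},
 forall A, G A -> mev q A = \sum_i mev (a i) A * (evm r A *m v - w) i 0.
have mev0 A : mev (0 : {mpoly C[n * n]}) A = 0 by rewrite /mev meval0.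
have iI : ring_ideal I.
 split.
 - by exists (fun=> 0) => A _; rewrite mev0 big1 // => i _; rewrite mul0r.
 - move=> p q [a ha] [b hb]; exists (fun i => a i + b i) => A GA; rewrite mevD_ ha // hb // -big_split.
  by apply: eq_bigr => i _; rewrite mevD_ mulrDl.
 - move=> p q [a ha]; exists (fun i => p * a i) => A GA; rewrite mevM_ ha // mulr_sumr.
  by apply: eq_bigr => i _; rewrite mevM_ mulrA.
have [I1|I1] := pselect (I 1); last first.
 have [x hx] := nullstellensatz unc iI I1; pose A : 'M[C]_n := vec_mx (\row_k x k).
 have mvA p : mev p A = p.@[x] by apply: meval_eq => k; rewrite vec_mxK mxE.
 have GA : G A.
  apply: (mgrp_closed GG) => p vp; rewrite mvA; apply: hx; exists (fun=> 0) => B GB.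
  by rewrite vp // big1 // => i _; rewrite /mev meval0 mul0r.
 exists A => //; apply/colP => i; apply/eqP; rewrite eq_sym -subr_eq0.
 have : I (\sum_j v j 0 *: r i j - (w i 0)%:MP).
  exists (fun j => (j == i)%:R%:MP) => B GB; rewrite mevB_ mevC_ mev_sum.
  rewrite [RHS](bigD1 i) //= [X in _ = _ + X]big1 => [|j ji]; last by rewrite mevC_ (negPf ji) mul0r.
  rewrite mevC_ eqxx mul1r addr0 !mxE; congr (_ - _); apply: eq_bigr => j _.
  by rewrite mevZ_ mxE mulrC.
 move/hx; rewrite -mvA mevB_ mevC_ mev_sum => e; rewrite mxE -[X in _ == X]e.
 by apply/eqP; congr (_ - _); apply: eq_bigr => j _; rewrite mevZ_ mxE mulrC.
have [a ha] := I1; pose D := (\sum_i msize (a i))%N.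
have aD i : (msize (a i) <= D)%N by rewrite /D (bigD1 i) //= leq_addr.
pose T : finType := 'X_{1..(n * n)%N < D}; pose J : finType := (T * 'I_d)%type; pose e := #|{: J}|.
pose Fv (w' : 'cV[C]_d) A : 'cV[C]_e := \col_j (mev 'X_[((enum_val j : J).1 : T)] A * (evm r A *m v - w') (enum_val j : J).2 0).
have sumJ (F : J -> C) : \sum_(j < e) F (enum_val j) = \sum_(m : T) \sum_i F (m, i).
 rewrite pair_big /= [RHS](reindex (@enum_val _ (mem {: J}))) /=; last by apply: onW_bij; apply: enum_val_bij.
 by apply: eq_bigr => j _; case: (enum_val j).
have Tbasis (p : {mpoly C[n * n]}) A : (msize p <= D)%N -> mev p A = \sum_(m : T) p@_m * mev 'X_[m] A.
 by move=> h; rewrite {1}(mpolywE h) mev_sum; apply: eq_bigr => m _; rewrite mevZ_.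
have Fpf A j : G A -> exists p : {mpoly C[d]}, forall x, Fv x A j 0 = ev p x.
 move=> _; pose i := (enum_val j : J).2.
 exists ((mev 'X_[((enum_val j : J).1 : T)] A)%:MP * (((evm r A *m v) i 0)%:MP - 'X_i)) => x.
 by rewrite /ev mevalM mevalB !mevalC mevalXU mxE [in RHS]mxE [(_ - _ : 'cV_d) _ _]mxE [(- x) _ _]mxE [in LHS]mxE.
(* Left translation by [B] on the products of a monomial and a coordinate; it is the same for all
   points, as equivariance requires. *)
pose TB B : 'M[C]_e := \matrix_(j, k) ((ltrans B 'X_[((enum_val j : J).1 : T)])@_((enum_val k : J).1 : T) * (evm r B) (enum_val j : J).2 (enum_val k : J).2).
have FT B x A : G B -> G A -> Fv (evm r B *m x) (B *m A) = TB B *m Fv x A.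
 move=> GB GA; apply/colP => j; rewrite [LHS]mxE [RHS]mxE; set m := (enum_val j).1; set i := (enum_val j).2.
 pose F (k : J) := (ltrans B 'X_[(m : T)])@_(k.1 : T) * evm r B i k.2 * (mev 'X_[(k.1 : T)] A * (evm r A *m v - x) k.2 0).
 transitivity (\sum_(k < e) F (enum_val k)); last by apply: eq_bigr => k _; rewrite !mxE /F !mxE.
 rewrite sumJ rr.2 // -mulmxA -mulmxBr [X in _ * X]mxE.
 rewrite -mev_ltrans Tbasis; last by apply: leq_trans (evm_ltrans _ _) _; rewrite msizeX; exact: bmdeg.
 rewrite mulr_suml; apply: eq_bigr => m' _; rewrite mulr_sumr; apply: eq_bigr => i' _; rewrite /F /=.
 by ring.
pose Fv1 w' A : 'cV[C]_(1 + e) := col_mx (const_mx 1) (Fv w' A).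
have Fpf1 A j : G A -> exists p : {mpoly C[d]}, forall x, Fv1 x A j 0 = ev p x.
 move=> GA; rewrite /Fv1; case: (@splitP 1 e j) => k jk.
  exists 1 => x; rewrite /ev meval1 (_ : j = lshift e k) ?col_mxEu ?mxE //; exact: val_inj.
 have [p hp] := Fpf A k GA; exists p => x; rewrite -hp (_ : j = rshift 1 k) ?col_mxEd //; exact: val_inj.
have FT1 B : G B -> exists T : 'M[C]_(1 + e), forall x A, G A -> Fv1 (evm r B *m x) (B *m A) = T *m Fv1 x A.
 move=> GB; exists (block_mx 1%:M 0 0 (TB B)) => x A GA.
 by rewrite /Fv1 mul_block_col FT // !mul0mx addr0 add0r mul1mx.
have FT0 B : G B -> exists T : 'M[C]_e, forall x A, G A -> Fv (evm r B *m x) (B *m A) = T *m Fv x A.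
 by move=> GB; exists (TB B) => x A GA; apply: FT.
have ex : exists q, `[< rank_le Fv v q >] by exists e; apply/asboolP => k As _; apply: rank_leq_row.
case: (ex_minnP ex) => q /asboolP rq minq.
have [k [As [GAs rAs]]] : exists k (As : 'I_k -> 'M[C]_n), (forall l, G (As l)) /\ (q <= \rank (rmx Fv v As))%N.
 case: q rq minq => [|q] rq minq; first by exists 0%N, (fun=> 1%:M); split=> // l; apply: (mgrp1 GG).
 apply: contrapT => no; have /minq : `[< rank_le Fv v q >]; last by rewrite ltnn.
 apply/asboolP => k As GAs; rewrite leqNgt; apply/negP => lt; apply: no; exists k, As; by split.
have rqw : rank_le Fv w q by apply: (rank_le_min mY Fpf FT0 Yv rq Yw).
(* The coefficients of the identity for 1: at [w] they exhibit the row of ones as a combination of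
   the rows of [Fv], so adding this row does not raise the rank. *)
pose a0 : 'rV[C]_e := \row_j (a (enum_val j : J).2)@_((enum_val j : J).1 : T).
have a0E A : G A -> (a0 *m Fv w A) 0 0 = 1.
 move=> GA; transitivity (mev 1 A); last by rewrite /mev meval1.
 rewrite ha // mxE; pose F (k : J) := (a k.2)@_(k.1 : T) * (mev 'X_[(k.1 : T)] A * (evm r A *m v - w) k.2 0).
 transitivity (\sum_(k < e) F (enum_val k)); first by apply: eq_bigr => j _; rewrite !mxE /F !mxE.
 rewrite sumJ exchange_big /=; apply: eq_bigr => i _; rewrite (Tbasis (a i)) // mulr_suml.
 by apply: eq_bigr => m _; rewrite /F mulrA.
have rmx1E x k' (As' : 'I_k' -> 'M[C]_n) : rmx Fv1 x As' = col_mx (const_mx 1) (rmx Fv x As').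
 apply/matrixP => i j; rewrite mxE /Fv1 -[i](@splitK 1 e); case: (fintype.split i) => i' /=.
  by rewrite !col_mxEu !mxE.
 by rewrite !col_mxEd !mxE.
have rqw1 : rank_le Fv1 w q.
 move=> k' As' GAs'; rewrite rmx1E; apply: leq_trans (rqw k' As' GAs'); apply: mxrankS.
 rewrite col_mx_sub submx_refl andbT; apply/submxP; exists a0; apply/rowP => l; rewrite !mxE.
 rewrite -[LHS](a0E _ (GAs' l)) mxE; apply: eq_bigr => j _; by rewrite [rmx _ _ _ _ _]mxE.
have rqv1 : rank_le Fv1 v q by apply: (rank_le_min mY Fpf1 FT1 Yw rqw1 Yv).
(* At the point [v] the added group element 1 gives a zero column below an entry 1, so there the row
   of ones is independent and raises the rank beyond [q]. *)
pose As' (l : 'I_k.+1) := if unlift ord_max l is Some l' then As l' else 1%:M.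
have GAs' l : G (As' l) by rewrite /As'; case: (unlift _ _) => [l'|]; [apply: GAs|apply: (mgrp1 GG)].
have := rqv1 _ As' GAs'; rewrite rmx1E leqNgt => /negP; case.
have c0 j : rmx Fv v As' j ord_max = 0.
 by rewrite mxE /As' unlift_none mxE rr.1 mul1mx subrr [X in _ * X]mxE mulr0.
have dj : mxdirect ((const_mx 1 : 'rV[C]_k.+1) + rmx Fv v As').
 apply/mxdirect_addsP/eqP; rewrite -submx0; apply/rV_subP => x; rewrite sub_capmx => /andP[/sub_rVP[c ->] /submxP[y E]].
 have /rowP/(_ ord_max) := E; rewrite !mxE mulr1 big1 => [->|j _]; last by rewrite c0 mulr0.
 by rewrite scale0r sub0mx.
pose c1 : 'rV[C]_k.+1 := const_mx 1.
have rk : \rank (col_mx c1 (rmx Fv v As')) = (\rank c1 + \rank (rmx Fv v As'))%N.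
 by rewrite -addsmxE (mxdirectP dj).
have r1 : \rank c1 = 1%N.
 rewrite rank_rV; case: eqP => // /rowP/(_ 0); rewrite !mxE => /eqP; by rewrite oner_eq0.
rewrite -[X in col_mx X]/c1 rk r1 add1n ltnS; apply: leq_trans rAs _.
have -> : rmx Fv v As = mxsub id (lift ord_max) (rmx Fv v As') by apply/matrixP => j l; rewrite !mxE /As' liftK.
exact: mxrank_sub.
Qed.

End PolynomialRep.

End Algebra.

From mathcomp Require Import all_classical all_reals all_analysis.
From mathcomp Require Import complex lra.
Import -(notations) mpoly.
Import Algebra.
Import Order.TTheory GRing.Theory Num.Theory.
Import numFieldNormedType.Exports.
Local Open Scope classical_set_scope.
Local Open Scope ring_scope.
Local Open Scope complex_scope.

Local Notation Re := complex.Re.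
Local Notation Im := complex.Im.

Notation CC R := ((R[i])^o).

(** * Complex modulus, continuity and differentiability *)

Section ComplexNorm.
Variable R : realType.
Implicit Types (z w v : R[i]) (x y : R).

(** The modulus with values in [R], so that estimates take place in the ordered field [R]. *)
Definition nm z : R := Num.sqrt ((Re z) ^+ 2 + (Im z) ^+ 2).

Lemma nmE z : `|z| = (nm z)%:C. Proof. exact: normc_def. Qed.
Lemma nm_ge0 z : 0 <= nm z. Proof. exact: sqrtr_ge0. Qed.
Lemma nmM z w : nm (z * w) = nm z * nm w.
Proof. by apply: (@complexI R); have := normrM (z : R[i]) w; rewrite !nmE => ->; rewrite -rmorphM. Qed.
Lemma nmD z w : nm (z + w) <= nm z + nm w.
Proof. by rewrite -lecR; have := ler_normD (z : R[i]) w; rewrite !nmE -rmorphD. Qed.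
Lemma nmN z : nm (- z) = nm z.
Proof. by apply: (@complexI R); rewrite -!nmE normrN. Qed.
Lemma nmB z w : nm (z - w) = nm (w - z). Proof. by rewrite -nmN opprB. Qed.
Lemma nmV z : nm z^-1 = (nm z)^-1.
Proof. by apply: (@complexI R); have := normfV (z : R[i]); rewrite !nmE => ->; rewrite -fmorphV. Qed.
Lemma nmX z n : nm (z ^+ n) = nm z ^+ n.
Proof. by apply: (@complexI R); have := normrX n (z : R[i]); rewrite !nmE => ->; rewrite -rmorphXn. Qed.
Lemma nm0 : nm 0 = 0. Proof. by apply: (@complexI R); rewrite -nmE normr0. Qed.
Lemma nm1 : nm 1 = 1. Proof. by apply: (@complexI R); rewrite -nmE normr1. Qed.
Lemma nm_eq0 z : (nm z == 0) = (z == 0).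
Proof. by rewrite -(inj_eq (@complexI R)) -nmE normr_eq0. Qed.
Lemma nm_gt0 z : (0 < nm z) = (z != 0).
Proof. by rewrite lt_neqAle nm_ge0 andbT eq_sym nm_eq0. Qed.
Lemma nmC x : nm x%:C = `|x|.
Proof. by rewrite /nm /= expr0n /= addr0 sqrtr_sqr. Qed.
Lemma nmi : nm 'i = 1.
Proof. by rewrite /nm /= expr0n expr1n /= add0r sqrtr1. Qed.
Lemma ge_nm_Re z : `|Re z| <= nm z.
Proof. by rewrite -sqrtr_sqr ler_sqrt ?addr_ge0 ?sqr_ge0 // lerDl sqr_ge0. Qed.
Lemma ge_nm_Im z : `|Im z| <= nm z.
Proof. by rewrite -sqrtr_sqr ler_sqrt ?addr_ge0 ?sqr_ge0 // lerDr sqr_ge0. Qed.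
Lemma complexRI z : z = (Re z)%:C + 'i * (Im z)%:C.
Proof. by case: z => a b; apply/eqP; rewrite eq_complex /= !(mul0r, mul1r, mulr0, subr0, add0r, addr0, oppr0) !eqxx. Qed.
Lemma nm_le z : nm z <= `|Re z| + `|Im z|.
Proof. by rewrite {1}(complexRI z); apply: le_trans (nmD _ _) _; rewrite nmM nmi mul1r !nmC. Qed.
Lemma nm_sum (I : Type) (r : seq I) (P : pred I) (F : I -> R[i]) :
 nm (\sum_(i <- r | P i) F i) <= \sum_(i <- r | P i) nm (F i).
Proof.
elim/big_rec2: _ => [|i x y _ h]; first by rewrite nm0.
by apply: le_trans (nmD _ _) _; rewrite lerD2l.
Qed.
Lemma nmBD z w v : nm (z - w) <= nm (z - v) + nm (v - w).
Proof. by rewrite -[z - w](subrKA v) nmD. Qed.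
Lemma nm_ball (z w : R[i]) (r : R) : nm (w - z) < r - nm z -> nm w < r.
Proof. by move=> h; rewrite -[w](subrK z); apply: le_lt_trans (nmD _ _) _; rewrite -ltrBrDr. Qed.
Lemma posC (e : R[i]) : 0 < e -> exists2 x : R, 0 < x & e = x%:C.
Proof.
rewrite ltcE /= => /andP[/eqP h1 h2]; exists (Re e) => //.
by rewrite [LHS]complexRI h1 /= mulr0 addr0.
Qed.
Lemma near_nmP (z : CC R) (P : set (CC R)) :
 nbhs z P <-> exists2 r : R, 0 < r & forall w, nm (w - z) < r -> P w.
Proof.
split=> [/nbhs_ballP[e /= /posC[r r0 ->] h]|[r r0 h]].
 exists r => // w wr; apply: h; rewrite -ball_normE /ball_ /= -normrN opprB nmE ltcR //.
apply/nbhs_ballP; exists r%:C; first by rewrite /= ltcR.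
by move=> w; rewrite -ball_normE /ball_ /= -normrN opprB nmE ltcR; apply: h.
Qed.
Definition cont (f : R[i] -> R[i]) z := forall e : R, 0 < e -> exists2 r : R, 0 < r &
 forall w, nm (w - z) < r -> nm (f w - f z) < e.

Lemma cont_cst c z : cont (fun=> c) z.
Proof. by move=> e e0; exists 1 => // w _; rewrite subrr nm0. Qed.
Lemma cont_id z : cont id z. Proof. by move=> e e0; exists e. Qed.
Lemma contD f g z : cont f z -> cont g z -> cont (fun w => f w + g w) z.
Proof.
move=> hf hg e e0; have e2 : 0 < e / 2 by rewrite divr_gt0.
have [r r0 hr] := hf _ e2; have [s s0 hs] := hg _ e2.
exists (Num.min r s); first by rewrite lt_min r0.
move=> w; rewrite lt_min => /andP[/hr wr /hs ws].
rewrite opprD addrACA [e]splitr; apply: le_lt_trans (nmD _ _) _; exact: ltrD.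
Qed.
Lemma contN f z : cont f z -> cont (fun w => - f w) z.
Proof. by move=> hf e /hf[r r0 hr]; exists r => // w /hr; rewrite -opprD nmN. Qed.
Lemma contM f g z : cont f z -> cont g z -> cont (fun w => f w * g w) z.
Proof.
move=> hf hg e e0; pose A := nm (f z) + 1; pose B := nm (g z) + 1.
have A0 : 0 < A by rewrite ltr_wpDl ?nm_ge0.
have B0 : 0 < B by rewrite ltr_wpDl ?nm_ge0.
have [r r0 hr] : exists2 r : R, 0 < r & forall w, nm (w - z) < r -> nm (f w - f z) < e / 2 / B.
 by apply: hf; rewrite !divr_gt0.
have [s s0 hs] : exists2 r : R, 0 < r & forall w, nm (w - z) < r -> nm (g w - g z) < e / 2 / A.
 by apply: hg; rewrite !divr_gt0.
have [t t0 ht] := hg 1 ltr01.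
exists (Num.min r (Num.min s t)); first by rewrite !lt_min r0 s0.
move=> w; rewrite !lt_min => /and3P[/hr wr /hs ws /ht wt].
have -> : f w * g w - f z * g z = (f w - f z) * g w + f z * (g w - g z).
 by rewrite mulrBl mulrBr addrA subrK.
apply: le_lt_trans (nmD _ _) _; rewrite !nmM [ltRHS]splitr; apply: ler_ltD.
 have gB : nm (g w) <= B.
  by rewrite -[g w](subrK (g z)) /B addrC; apply: le_trans (nmD _ _) _; rewrite lerD2l ltW.
 apply: le_trans (ler_pM (nm_ge0 _) (nm_ge0 _) (ltW wr) gB) _.
 by rewrite mulfVK // gt_eqF.
apply: le_lt_trans (_ : A * nm (g w - g z) < _).
 by apply: ler_wpM2r; rewrite ?nm_ge0 // lerDl.
by rewrite mulrC -ltr_pdivlMr.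
Qed.
Lemma contV f z : f z != 0 -> cont f z -> cont (fun w => (f w)^-1) z.
Proof.
move=> f0 hf e e0; have n0 : 0 < nm (f z) by rewrite nm_gt0.
have n2 : 0 < nm (f z) / 2 by rewrite divr_gt0.
have [r r0 hr] := hf _ n2.
have [s s0 hs] : exists2 r : R, 0 < r & forall w, nm (w - z) < r -> nm (f w - f z) < e * (nm (f z) / 2) * nm (f z).
 by apply: hf; rewrite !mulr_gt0.
exists (Num.min r s); first by rewrite lt_min r0.
move=> w; rewrite lt_min => /andP[/hr wr /hs ws].
have fw : nm (f z) / 2 <= nm (f w).
 have := nmD (f z - f w) (f w); rewrite subrK (nmB (f z)) => h; move: (nm _) (nm _) wr h => a b; lra.
have fw0 : f w != 0 by rewrite -nm_gt0; apply: lt_le_trans fw.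
have -> : (f w)^-1 - (f z)^-1 = (f z - f w) / (f w * f z) by field; rewrite f0.
rewrite nmM nmV nmM nmB ltr_pdivrMr; last by rewrite mulr_gt0 ?nm_gt0.
apply: lt_le_trans ws _; rewrite -mulrA; apply: ler_wpM2l; first exact: ltW.
by apply: ler_wpM2r => //; apply: ltW.
Qed.
Lemma cont_comp f g z : cont f z -> cont g (f z) -> cont (fun w => g (f w)) z.
Proof.
by move=> hf hg e /hg[r r0 hr]; have [s s0 hs] := hf r r0; exists s => // w /hs/hr.
Qed.
Lemma cont_eq f g z : (exists2 r : R, 0 < r & forall w, nm (w - z) < r -> f w = g w) -> cont f z -> cont g z.
Proof.
move=> [r r0 fg] h e e0; have [s s0 hs] := h e e0.
exists (Num.min r s); first by rewrite lt_min r0.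
move=> w; rewrite lt_min => /andP[wr ws]; rewrite -fg // -fg ?subrr ?nm0 //; exact: hs.
Qed.
Lemma cont_ext f g z : f =1 g -> cont f z -> cont g z.
Proof. by move=> fg; apply: cont_eq; exists 1. Qed.
Lemma cont_neq0 f z : cont f z -> f z != 0 -> exists2 r : R, 0 < r & forall w, nm (w - z) < r -> f w != 0.
Proof.
move=> h f0; have [|r r0 hr] := h (nm (f z)); first by rewrite nm_gt0.
exists r => // w /hr; apply: contraTneq => ->; by rewrite sub0r nmN ltxx.
Qed.

(* Caratheodory's form of differentiability. *)
Definition cder (f : R[i] -> R[i]) z d :=
 exists phi : R[i] -> R[i], [/\ forall w, f w - f z = phi w * (w - z), phi z = d & cont phi z].

Lemma cder_derivable (f : CC R -> CC R) (z d : CC R) : cder f z d -> derivable f z 1.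
Proof.
move=> [phi [h1 h2 h3]]; apply/cvg_ex; exists (phi z : CC R); apply/cvgrPdist_lt => _ /posC[e e0 ->].
have [r r0 hr] := h3 e e0; apply/near_nmP; exists r => // h; rewrite subr0 => hh h0.
have := hr (h + z); rewrite addrK => /(_ hh).
rewrite nmE ltcR nmB; congr (_ < _); congr (nm _); congr (_ - _).
by rewrite /= /GRing.scale /= mulr1 h1 addrK mulrC mulfK.
Qed.
Lemma derivable_cder (f : CC R -> CC R) (z : CC R) : derivable f z 1 -> exists d, cder f z d.
Proof.
move=> /cvg_ex[l /cvgrPdist_lt H]; exists l.
exists (fun w => if w == z then l else (f w - f z) / (w - z)); split.
- move=> w; have [->|wz] := eqVneq w z; first by rewrite !subrr mulr0.
 by rewrite mulfVK // subr_eq0.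
- by rewrite eqxx.
move=> e e0; have e0' : 0 < e%:C :> R[i] by rewrite ltcR.
have /near_nmP[r r0 hr] := H _ e0'; exists r => // w wr; rewrite eqxx.
case: (boolP (w == z)) => [_|wz]; first by rewrite subrr nm0.
have := hr (w - z); rewrite subr0 => /(_ wr); rewrite subr_eq0 => /(_ wz).
rewrite nmE ltcR nmB; congr (_ < _); congr (nm _); congr (_ - _).
by rewrite /= /GRing.scale /= mulr1 subrK mulrC.
Qed.
Lemma cder_unique f z d d' : cder f z d -> cder f z d' -> d = d'.
Proof.
move=> [p [p1 p2 p3]] [q [q1 q2 q3]].
have h := contD p3 (contN q3).
apply/eqP; rewrite -p2 -q2 -subr_eq0 -nm_eq0; apply/eqP/le_anti; rewrite nm_ge0 andbT.
apply/ler_addgt0Pr => e e0; rewrite add0r; have [r r0 hr] := h e e0.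
have := hr ((r / 2)%:C + z); rewrite addrK nmC gtr0_norm ?divr_gt0 // ltr_pdivrMr // ltr_pMr // ltr1n.
move=> /(_ isT); have r2 : (r / 2)%:C != 0 :> R[i] by rewrite (inj_eq (@complexI R)) gt_eqF ?divr_gt0.
have -> : p ((r / 2)%:C + z) - q ((r / 2)%:C + z) = 0.
 apply: (mulIf r2); rewrite mul0r mulrBl; apply/eqP; rewrite subr_eq0; apply/eqP.
 by have := p1 ((r / 2)%:C + z); have := q1 ((r / 2)%:C + z); rewrite addrK => -> ->.
by rewrite sub0r nmN => /ltW.
Qed.
Lemma cder_cont f z d : cder f z d -> cont f z.
Proof.
move=> [p [p1 _ p3]]; apply: (@cont_eq (fun w => f z + p w * (w - z))).
 by exists 1 => // w _; rewrite -p1 addrC subrK.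
apply: contD; first exact: cont_cst.
by apply: contM => //; apply: contD; [apply: cont_id | apply: cont_cst].
Qed.
Lemma cder_cst c z : cder (fun=> c) z 0.
Proof. by exists (fun=> 0); split=> // [w|]; [rewrite subrr mul0r | apply: cont_cst]. Qed.
Lemma cder_id z : cder id z 1.
Proof. by exists (fun=> 1); split=> // [w|]; [rewrite mul1r | apply: cont_cst]. Qed.
Lemma cderD f g z d e : cder f z d -> cder g z e -> cder (fun w => f w + g w) z (d + e).
Proof.
move=> [p [p1 <- p3]] [q [q1 <- q3]]; exists (fun w => p w + q w); split=> //; last exact: contD.
by move=> w; rewrite mulrDl -p1 -q1; ring.
Qed.
Lemma cderM f g z d e : cder f z d -> cder g z e -> cder (fun w => f w * g w) z (d * g z + f z * e).
Proof.
move=> hf hg; move: (hf) (hg) => [p [p1 <- p3]] [q [q1 <- q3]].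
exists (fun w => p w * g w + f z * q w); split=> //.
 by move=> w; rewrite mulrDl mulrAC -p1 -mulrA -q1; ring.
apply: contD; apply: contM => //; [exact: cder_cont hg | exact: cont_cst].
Qed.
Lemma cderV f z d : f z != 0 -> cder f z d -> cder (fun w => (f w)^-1) z (- (d / f z ^+ 2)).
Proof.
move=> f0 hf; move: (hf) => [p [p1 <- p3]].
have [r r0 hr] := cont_neq0 (cder_cont hf) f0.
exists (fun w => if f w == 0 then ((f w)^-1 - (f z)^-1) / (w - z) else - (p w / (f w * f z))); split.
- move=> w; case: eqP => [fw|/eqP fw].
  have wz : w - z != 0 by rewrite subr_eq0; apply: contraNneq f0 => <-; rewrite fw.
  by rewrite mulfVK.
 have := p1 w; set X := p w; move=> E; apply: (mulIf fw); apply: (mulIf f0).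
 transitivity (- (f w - f z)); first by field; rewrite f0.
 by rewrite E; field; rewrite f0.
- by rewrite (negPf f0) expr2.
apply: (@cont_eq (fun w => - (p w / (f w * f z)))).
 by exists r => // w /hr /negPf->.
apply: contN; apply: contM => //; apply: contV; first by rewrite mulf_neq0.
by apply: contM; [exact: cder_cont hf | exact: cont_cst].
Qed.
Lemma cder_comp f g z d e : cder f z d -> cder g (f z) e -> cder (fun w => g (f w)) z (e * d).
Proof.
move=> hf; move: (hf) => [p [p1 <- p3]] [q [q1 <- q3]]; exists (fun w => q (f w) * p w); split=> //.
 by move=> w; rewrite q1 p1 mulrA.
by apply: contM => //; apply: (cont_comp (cder_cont hf)).
Qed.
Lemma cder_eq f g z d : (exists2 r : R, 0 < r & forall w, nm (w - z) < r -> f w = g w) -> cder f z d -> cder g z d.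
Proof.
move=> [r r0 fg] [p [p1 p2 p3]].
have fz : f z = g z by apply: fg; rewrite subrr nm0.
exists (fun w => if nm (w - z) < r then p w else (g w - g z) / (w - z)); split.
- move=> w; case: ifP => [wr|/negbT wr]; first by rewrite -fg // -fz.
 by rewrite mulfVK // -nm_gt0; apply: lt_le_trans r0 _; rewrite leNgt.
- by rewrite subrr nm0 r0.
by apply: cont_eq p3; exists r => // w ->.
Qed.
Lemma cder_ext f g z d : f =1 g -> cder f z d -> cder g z d.
Proof. by move=> fg; apply: cder_eq; exists 1. Qed.
Lemma cderX f z d n : cder f z d -> cder (fun w => f w ^+ n) z (n%:R * f z ^+ n.-1 * d).
Proof.
move=> hf; elim: n => [|n IH]; first by rewrite !mul0r; apply: cder_cst.
have := cderM hf IH; congr (cder _ _ _); first by apply: funext => w; rewrite exprS.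
case: n {IH} => [|n]; first by rewrite !mul0r mulr0 expr0 /=; ring.
by rewrite /= exprS; ring.
Qed.
Lemma cderN f z d : cder f z d -> cder (fun w => - f w) z (- d).
Proof.
move=> h; have := cderM (cder_cst (-1) z) h; rewrite mul0r add0r mulN1r.
by congr (cder _ _ _); apply: funext => w; rewrite mulN1r.
Qed.
End ComplexNorm.

(** * Real integrals by primitives *)

Section RealPrimitive.
Variable R : realType.
Notation mu := (@lebesgue_measure R).

(** The bound 2 leaves room around the square of half-side 1 used for Cauchy's formula. *)
Lemma primitive_exists (phi : R -> R) : continuous phi ->
 exists Phi : R -> R, forall x : R, `|x| < 2 -> is_derive x 1 Phi (phi x).
Proof.
move=> cphi; exists (fun x => \int[mu]_(t in `[-2, x]) phi t)%R => x x2.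
have intp : mu.-integrable `[-2, 2] (EFin \o phi).
 apply: continuous_compact_integrable; first exact: segment_compact.
 exact: continuous_subspaceT.
move: x2; rewrite ltr_norml => /andP[x1 x2].
have [||d e] := continuous_FTC1_closed x2 intp.
- exact: x1.
- exact: cphi.
by rewrite -e derive1E; apply: derivableP.
Qed.
Lemma derive0_cst (F : R -> R) (a b : R) : `|a| < 2 -> `|b| < 2 ->
 (forall x : R, `|x| < 2 -> is_derive x 1 F 0) -> F a = F b.
Proof.
wlog ab : a b / a <= b.
 by move=> H a2 b2 h; have [/H|/ltW/H] := lerP a b; [exact|move=> /(_ b2 a2 h)->].
move=> a2 b2 h; move: ab; rewrite le_eqVlt => /orP[/eqP->//|ab].
have in2 x : x \in `[a, b] -> `|x| < 2.
 rewrite in_itv /= => /andP[ax xb]; move: a2 b2; rewrite !ltr_norml => /andP[? ?] /andP[? ?]; lra.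
have [x xab|| c _ E] := @MVT R F (fun=> 0) a b ab.
- by apply: h; apply: in2; apply: subset_itv_oo_cc.
- apply: derivable_within_continuous => x /in2/h hx; exact: ex_derive.
by move: E; rewrite mul0r => /eqP; rewrite subr_eq0 => /eqP.
Qed.
Lemma derive_bound (F phi : R -> R) (a b M : R) : `|a| < 2 -> `|b| < 2 -> a <= b ->
 (forall x : R, `|x| < 2 -> is_derive x 1 F (phi x)) -> (forall x, a <= x <= b -> M <= phi x) ->
 M * (b - a) <= F b - F a.
Proof.
move=> a2 b2 + h hM; rewrite le_eqVlt => /orP[/eqP->|ab]; first by rewrite !subrr mulr0.
have in2 x : x \in `[a, b] -> `|x| < 2.
 rewrite in_itv /= => /andP[ax xb]; move: a2 b2; rewrite !ltr_norml => /andP[? ?] /andP[? ?]; lra.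
have [x xab|| c cab E] := @MVT R F phi a b ab.
- by apply: h; apply: in2; apply: subset_itv_oo_cc.
- apply: derivable_within_continuous => x /in2/h hx; exact: ex_derive.
rewrite E ler_pM2r ?subr_gt0 // hM //.
by move: cab; rewrite in_itv /= => /andP[/ltW-> /ltW->].
Qed.
Definition prim (phi : R -> R) : R -> R :=
 if pselect (continuous phi) is left h then projT1 (cid (primitive_exists h)) else cst 0.

Lemma primP (phi : R -> R) : continuous phi -> forall x : R, `|x| < 2 -> is_derive x 1 (prim phi) (phi x).
Proof. by move=> h; rewrite /prim; case: pselect => // h'; case: (cid _). Qed.
(** The integral as an increment of a chosen primitive: additivity in the bounds is immediate. For a
    discontinuous integrand [prim] is a default value. *)
Definition ri (phi : R -> R) (a b : R) := prim phi b - prim phi a.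

Lemma ri_FTC (phi Psi : R -> R) (a b : R) : continuous phi -> `|a| < 2 -> `|b| < 2 ->
 (forall x : R, `|x| < 2 -> is_derive x 1 Psi (phi x)) -> ri phi a b = Psi b - Psi a.
Proof.
move=> h a2 b2 hP; have := @derive0_cst (prim phi - Psi) a b a2 b2 _.
rewrite /ri => H; have := H _; rewrite !fctE => {}H; apply/eqP; rewrite -subr_eq0.
have -> : prim phi b - prim phi a - (Psi b - Psi a) = (prim phi b - Psi b) - (prim phi a - Psi a) by ring.
rewrite subr_eq0; apply/eqP/esym/H => x x2; rewrite -(subrr (phi x)).
by apply: is_deriveB; [apply: primP | apply: hP].
Qed.
Lemma riD (phi psi : R -> R) a b : continuous phi -> continuous psi -> `|a| < 2 -> `|b| < 2 ->
 ri (fun x => phi x + psi x) a b = ri phi a b + ri psi a b.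
Proof.
move=> h k a2 b2.
have c1 : continuous (fun x => phi x + psi x) by move=> x; apply: cvgD; [apply: h | apply: k].
have d1 x : `|x| < 2 -> is_derive x (1 : R) (prim phi + prim psi) (phi x + psi x).
 by move=> x2; apply: is_deriveD; apply: primP.
by rewrite (ri_FTC c1 a2 b2 d1) /ri !fctE; ring.
Qed.
Lemma riZ (phi : R -> R) c a b : continuous phi -> `|a| < 2 -> `|b| < 2 ->
 ri (fun x => c * phi x) a b = c * ri phi a b.
Proof.
move=> h a2 b2.
have c1 : continuous (fun x => c * phi x) by move=> x; apply: cvgM; [apply: cvg_cst | apply: h].
have d1 x : `|x| < 2 -> is_derive x (1 : R) (c *: prim phi) (c * phi x).
 by move=> x2; apply: is_deriveZ; apply: primP.
by rewrite (ri_FTC c1 a2 b2 d1) /ri !fctE /GRing.scale /=; ring.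
Qed.
Lemma ri_ge (phi : R -> R) a b M : continuous phi -> `|a| < 2 -> `|b| < 2 -> a <= b ->
 (forall x, a <= x <= b -> M <= phi x) -> M * (b - a) <= ri phi a b.
Proof. by move=> h a2 b2 ab hM; apply: (@derive_bound _ phi) => //; apply: primP. Qed.
Lemma ri_bound (phi : R -> R) a b M : continuous phi -> `|a| < 2 -> `|b| < 2 -> a <= b ->
 (forall x, a <= x <= b -> `|phi x| <= M) -> `|ri phi a b| <= M * (b - a).
Proof.
move=> h a2 b2 ab hM; rewrite ler_norml -mulNr; apply/andP; split.
 by apply: ri_ge => // x /hM; rewrite ler_norml => /andP[].
rewrite -[leLHS]opprK lerNl -mulNr -[- ri _ _ _]mulN1r -riZ //.
apply: ri_ge => //; first by move=> x; apply: cvgM; [apply: cvg_cst | apply: h].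
by move=> x /hM; rewrite ler_norml mulN1r lerN2 => /andP[].
Qed.
End RealPrimitive.

(** * Complex integrals over rectangles *)

Section ComplexIntegral.
Variable R : realType.
Notation C := R[i].

Definition rcont (phi : R -> C) := forall x e : R, 0 < e -> exists2 r : R, 0 < r &
 forall y, `|y - x| < r -> nm (phi y - phi x) < e.

Lemma rcont_Re phi : rcont phi -> continuous (fun x => Re (phi x)).
Proof.
move=> h x; apply/cvgrPdist_lt => e e0; have [r r0 hr] := h x e e0.
exists r => // y; rewrite /ball_ /= distrC => /hr hy.
apply: le_lt_trans hy; rewrite nmB -raddfB; exact: ge_nm_Re.
Qed.
Lemma rcont_Im phi : rcont phi -> continuous (fun x => Im (phi x)).
Proof.
move=> h x; apply/cvgrPdist_lt => e e0; have [r r0 hr] := h x e e0.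
exists r => // y; rewrite /ball_ /= distrC => /hr hy.
apply: le_lt_trans hy; rewrite nmB -raddfB; exact: ge_nm_Im.
Qed.
Definition ci (phi : R -> C) (a b : R) : C :=
 (ri (fun x => Re (phi x)) a b)%:C + 'i * (ri (fun x => Im (phi x)) a b)%:C.

Lemma mulc_Re (z w : C) : Re (z * w) = Re z * Re w - Im z * Im w. Proof. by case: z; case: w. Qed.
Lemma mulc_Im (z w : C) : Im (z * w) = Re z * Im w + Im z * Re w. Proof. by case: z; case: w. Qed.
Lemma ciD phi psi a b : rcont phi -> rcont psi -> `|a| < 2 -> `|b| < 2 ->
 ci (fun x => phi x + psi x) a b = ci phi a b + ci psi a b.
Proof.
move=> h k a2 b2; rewrite /ci.
have -> : (fun x => Re (phi x + psi x)) = (fun x => Re (phi x) + Re (psi x)) by apply: funext => x; rewrite raddfD.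
have -> : (fun x => Im (phi x + psi x)) = (fun x => Im (phi x) + Im (psi x)) by apply: funext => x; rewrite raddfD.
rewrite !riD //; [|exact: rcont_Im|exact: rcont_Im|exact: rcont_Re|exact: rcont_Re].
by rewrite !rmorphD; ring.
Qed.
Lemma ciZ phi c a b : rcont phi -> `|a| < 2 -> `|b| < 2 -> ci (fun x => c * phi x) a b = c * ci phi a b.
Proof.
move=> h a2 b2; rewrite /ci; have hr := rcont_Re h; have hi := rcont_Im h.
have cZ (k : R) (u : R -> R) : continuous u -> continuous (fun x => k * u x).
 by move=> cu x; apply: cvgM; [apply: cvg_cst | apply: cu].
have -> : (fun x => Re (c * phi x)) = (fun x => Re c * Re (phi x) + (- Im c) * Im (phi x)).
 by apply: funext => x; rewrite mulc_Re mulNr.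
have -> : (fun x => Im (c * phi x)) = (fun x => Re c * Im (phi x) + Im c * Re (phi x)).
 by apply: funext => x; rewrite mulc_Im.
rewrite !riD ?riZ //; try exact: cZ.
apply/eqP; rewrite eq_complex /= !(mul0r, mul1r, mulr0, subr0, add0r, addr0, oppr0).
by rewrite !mulc_Re !mulc_Im /= !(mul0r, mul1r, mulr0, subr0, add0r, addr0, oppr0) mulNr !eqxx.
Qed.
(** The factor 2 comes from bounding the real and the imaginary part separately. *)
Lemma ci_bound phi a b M : rcont phi -> `|a| < 2 -> `|b| < 2 -> a <= b ->
 (forall x, a <= x <= b -> nm (phi x) <= M) -> nm (ci phi a b) <= 2 * M * (b - a).
Proof.
move=> h a2 b2 ab hM; apply: le_trans (nmD _ _) _; rewrite nmM nmi mul1r !nmC.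
have -> : 2 * M * (b - a) = M * (b - a) + M * (b - a) by ring.
apply: lerD; apply: ri_bound => //; [exact: rcont_Re| |exact: rcont_Im|] => x /hM; apply: le_trans;
 [exact: ge_nm_Re|exact: ge_nm_Im].
Qed.
Lemma ci_FTC phi (Psi1 Psi2 : R -> R) a b : rcont phi -> `|a| < 2 -> `|b| < 2 ->
 (forall x : R, `|x| < 2 -> is_derive x 1 Psi1 (Re (phi x))) ->
 (forall x : R, `|x| < 2 -> is_derive x 1 Psi2 (Im (phi x))) ->
 ci phi a b = (Psi1 b - Psi1 a)%:C + 'i * (Psi2 b - Psi2 a)%:C.
Proof.
by move=> h a2 b2 h1 h2; rewrite /ci (ri_FTC (rcont_Re h) a2 b2 h1) (ri_FTC (rcont_Im h) a2 b2 h2).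
Qed.
Lemma rcont_cst c : rcont (fun=> c).
Proof. by move=> x e e0; exists 1 => // y _; rewrite subrr nm0. Qed.
Lemma rcont_real : rcont (fun x => x%:C).
Proof. by move=> x e e0; exists e => // y h; rewrite -rmorphB nmC. Qed.
Lemma rcont_comp (f : C -> C) phi : rcont phi -> (forall x, cont f (phi x)) -> rcont (fun x => f (phi x)).
Proof.
move=> h k x e e0; have [r r0 hr] := k x e e0; have [s s0 hs] := h x r r0.
by exists s => // y /hs/hr.
Qed.
Lemma rcontD phi psi : rcont phi -> rcont psi -> rcont (fun x => phi x + psi x).
Proof.
move=> hf hg x e e0; have e2 : 0 < e / 2 by rewrite divr_gt0.
have [r r0 hr] := hf x _ e2; have [s s0 hs] := hg x _ e2.
exists (Num.min r s); first by rewrite lt_min r0.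
move=> w; rewrite lt_min => /andP[/hr wr /hs ws].
rewrite opprD addrACA [e]splitr; apply: le_lt_trans (nmD _ _) _; exact: ltrD.
Qed.
Lemma rcontZ c phi : rcont phi -> rcont (fun x => c * phi x).
Proof.
move=> h; apply: (@rcont_comp (fun z => c * z)) => // x; apply: contM; [exact: cont_cst|exact: cont_id].
Qed.
Lemma ci_cst c a b : `|a| < 2 -> `|b| < 2 -> ci (fun=> c) a b = c * (b - a)%:C.
Proof.
move=> a2 b2; have -> : (fun=> c) = (fun _ : R => c * 1) by apply: funext => x; rewrite mulr1.
rewrite ciZ //; last exact: rcont_cst.
have -> := @ci_FTC (fun=> 1) id (cst 0) a b (rcont_cst 1) a2 b2 _ _; by rewrite subrr mulr0 addr0.
Qed.
Lemma ci_real a b : `|a| < 2 -> `|b| < 2 -> ci (fun x => x%:C) a b = ((b ^+ 2 - a ^+ 2) / 2)%:C.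
Proof.
move=> a2 b2.
have d1 x : `|x| < 2 -> is_derive x (1 : R) (2^-1 *: (id ^+ 2) : R -> R) (Re x%:C).
 move=> x2 /=; have h := is_deriveZ (2^-1 : R) (is_deriveX 2 (is_derive_id x (1 : R))).
 by apply: is_derive_eq h _; rewrite /GRing.scale /= expr1; field.
have d2 x : `|x| < 2 -> is_derive x (1 : R) (cst 0 : R -> R) (Im x%:C).
 by move=> _ /=; apply: is_derive_cst.
rewrite (ci_FTC rcont_real a2 b2 d1 d2) subrr mulr0 addr0 !fctE /GRing.scale /=.
by congr (_%:C); rewrite -mulrBr mulrC.
Qed.
Definition pt (x y : R) : C := x%:C + 'i * y%:C.

Lemma rcont_h y : rcont (fun x => pt x y).
Proof. by apply: rcontD; [apply: rcont_real | apply: rcont_cst]. Qed.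
Lemma rcont_v x : rcont (fun y => pt x y).
Proof. by apply: rcontD; [apply: rcont_cst | apply: rcontZ; apply: rcont_real]. Qed.
(** The boundary of the rectangle, counterclockwise: bottom, right, top and left edge; [a], [b]
    bound the real part and [c], [d] the imaginary part. *)
Definition J (f : C -> C) (a b c d : R) : C :=
 ci (fun x => f (pt x c)) a b + 'i * ci (fun y => f (pt b y)) c d
 - ci (fun x => f (pt x d)) a b - 'i * ci (fun y => f (pt a y)) c d.

Definition econt (f : C -> C) (a b c d : R) := [/\ rcont (fun x => f (pt x c)), rcont (fun y => f (pt b y)),
  rcont (fun x => f (pt x d)) & rcont (fun y => f (pt a y))].

Definition in2 (a b c d : R) := [/\ `|a| < 2, `|b| < 2, `|c| < 2 & `|d| < 2].

Lemma cont_econt f a b c d : (forall z, cont f z) -> econt f a b c d.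
Proof.
move=> h; split; [exact: (rcont_comp (rcont_h c))|exact: (rcont_comp (rcont_v b))|
 exact: (rcont_comp (rcont_h d))|exact: (rcont_comp (rcont_v a))].
Qed.
Lemma J_D f g a b c d : in2 a b c d -> econt f a b c d -> econt g a b c d ->
 J (fun z => f z + g z) a b c d = J f a b c d + J g a b c d.
Proof. by move=> [? ? ? ?] [? ? ? ?] [? ? ? ?]; rewrite /J !ciD //; ring. Qed.
Lemma J_Z f k a b c d : in2 a b c d -> econt f a b c d -> J (fun z => k * f z) a b c d = k * J f a b c d.
Proof. by move=> [? ? ? ?] [? ? ? ?]; rewrite /J !ciZ //; ring. Qed.
Lemma econtD f g a b c d : econt f a b c d -> econt g a b c d -> econt (fun z => f z + g z) a b c d.
Proof. by move=> [? ? ? ?] [? ? ? ?]; split; apply: rcontD. Qed.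
Lemma econtZ f k a b c d : econt f a b c d -> econt (fun z => k * f z) a b c d.
Proof. by move=> [? ? ? ?]; split; apply: rcontZ. Qed.
Lemma J_bound f a b c d M : in2 a b c d -> econt f a b c d -> a <= b -> c <= d ->
 (forall x, a <= x <= b -> nm (f (pt x c)) <= M /\ nm (f (pt x d)) <= M) ->
 (forall y, c <= y <= d -> nm (f (pt a y)) <= M /\ nm (f (pt b y)) <= M) ->
 nm (J f a b c d) <= 4 * M * ((b - a) + (d - c)).
Proof.
move=> [a2 b2 c2 d2] [h1 h2 h3 h4] ab cd hx hy.
have B1 := ci_bound h1 a2 b2 ab (fun x hx' => (hx x hx').1).
have B3 := ci_bound h3 a2 b2 ab (fun x hx' => (hx x hx').2).
have B2 := ci_bound h2 c2 d2 cd (fun x hx' => (hy x hx').2).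
have B4 := ci_bound h4 c2 d2 cd (fun x hx' => (hy x hx').1).
rewrite /J; apply: le_trans (nmD _ _) _; rewrite nmN nmM nmi mul1r.
have -> : 4 * M * (b - a + (d - c)) = (2 * M * (b - a) + 2 * M * (d - c) + 2 * M * (b - a)) + 2 * M * (d - c) by ring.
apply: lerD => //; apply: le_trans (nmD _ _) _; rewrite nmN; apply: lerD => //.
by apply: le_trans (nmD _ _) _; rewrite nmM nmi mul1r; apply: lerD.
Qed.
Lemma ci_split phi a m b : ci phi a b = ci phi a m + ci phi m b.
Proof. by rewrite /ci /ri !rmorphB; ring. Qed.
Lemma J_splitx f a m b c d : J f a b c d = J f a m c d + J f m b c d.
Proof. by rewrite /J !(ci_split _ a m b); ring. Qed.
Lemma J_splity f a b c m d : J f a b c d = J f a b c m + J f a b m d.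
Proof. by rewrite /J !(ci_split _ c m d); ring. Qed.
Lemma J_deg f a c d : J f a a c d = 0.
Proof. by rewrite /J /ci /ri !subrr !rmorph0; ring. Qed.
Lemma J_degy f a b c : J f a b c c = 0.
Proof. by rewrite /J /ci /ri !subrr !rmorph0; ring. Qed.
Lemma J_affine u v a b c d : in2 a b c d -> J (fun z => u + v * z) a b c d = 0.
Proof.
move=> [a2 b2 c2 d2]; have E : econt id a b c d by apply: cont_econt; apply: cont_id.
rewrite J_D //; [| by split; apply: rcont_cst | exact: econtZ].
rewrite J_Z // /J !ci_cst //= /pt.
rewrite !ciD //; try (by apply: rcont_cst); try (by apply: rcont_real); try (by apply: rcontZ; apply: rcont_real).
rewrite !ciZ //; try exact: rcont_cst; try exact: rcont_real.
by rewrite !ci_cst // !ci_real // !rmorphB; ring.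
Qed.

End ComplexIntegral.

(** * Goursat's lemma and Cauchy's formula on a square *)

Section Goursat.
Variable R : realType.
Notation C := R[i].

Lemma half_lim (w r : R) : 0 <= w -> 0 < r -> exists N, forall n, (N <= n)%N -> w / 2 ^+ n < r.
Proof.
move=> w0 r0; have [N hN] : exists N : nat, w / r < N%:R.
 by exists (Num.Def.archi_bound (w / r)); apply: le_lt_trans (ler_norm _) _; rewrite ger0_norm ?divr_ge0 ?(ltW r0) //; apply: archi_boundP; rewrite divr_ge0 // ltW.
exists N => n nN; rewrite ltr_pdivrMr ?exprn_gt0 // mulrC -ltr_pdivrMr //.
apply: lt_trans hN _; rewrite -natrX ltr_nat; apply: leq_ltn_trans nN (ltn_expl _ _) => //.
Qed.
(** A counterexample would produce a nested sequence of counterexamples, and the suprema of their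
    corners a point of all of them, against the local hypothesis. The index [n] counts the halvings
    of the sides. *)
Lemma bisection (P : R -> R -> nat -> Prop) (w h a0 c0 : R) : 0 <= w -> 0 <= h ->
 (forall a c n, P a c n.+1 -> P (a + w / 2 ^+ n.+1) c n.+1 -> P a (c + h / 2 ^+ n.+1) n.+1 ->
   P (a + w / 2 ^+ n.+1) (c + h / 2 ^+ n.+1) n.+1 -> P a c n) ->
 (forall al ga, exists N, forall n a c, (N <= n)%N -> a <= al <= a + w / 2 ^+ n ->
   c <= ga <= c + h / 2 ^+ n -> P a c n) -> P a0 c0 0%N.
Proof.
move=> w0 h0 step loc; apply: contrapT => nP0.
have /choice[nxt hnxt] : forall t : nat * (R * R), exists q : R * R, ~ P t.2.1 t.2.2 t.1 ->
  [/\ ~ P q.1 q.2 t.1.+1, q.1 = t.2.1 \/ q.1 = t.2.1 + w / 2 ^+ t.1.+1 &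
   q.2 = t.2.2 \/ q.2 = t.2.2 + h / 2 ^+ t.1.+1].
 move=> [n [a c]] /=; have [Pn|nPn] := pselect (P a c n); first by exists (a, c).
 have [p1|n1] := pselect (P a c n.+1); last by exists (a, c); split=> //; left.
 have [p2|n2] := pselect (P (a + w / 2 ^+ n.+1) c n.+1); last first.
  by exists (a + w / 2 ^+ n.+1, c); split=> //; [right|left].
 have [p3|n3] := pselect (P a (c + h / 2 ^+ n.+1) n.+1); last first.
  by exists (a, c + h / 2 ^+ n.+1); split=> //; [left|right].
 have [p4|n4] := pselect (P (a + w / 2 ^+ n.+1) (c + h / 2 ^+ n.+1) n.+1); last first.
  by exists (a + w / 2 ^+ n.+1, c + h / 2 ^+ n.+1); split=> //; right.
 by case: nPn; apply: step.
pose q := fix q n := if n is m.+1 then nxt (m, q m) else (a0, c0).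
have nq n : ~ P (q n).1 (q n).2 n by elim: n => [//|n IH] /=; have [] := hnxt (n, q n) IH.
have half (u : R) n : u / 2 ^+ n = u / 2 ^+ n.+1 + u / 2 ^+ n.+1.
 by rewrite exprS; field; rewrite expf_neq0.
have pos (u : R) n : 0 <= u -> 0 <= u / 2 ^+ n by move=> u0; rewrite divr_ge0 // exprn_ge0.
have mono (u : R) (s : nat -> R) : 0 <= u -> (forall n, s n.+1 = s n \/ s n.+1 = s n + u / 2 ^+ n.+1) ->
  exists al, forall n, s n <= al <= s n + u / 2 ^+ n.
 move=> u0 hs; have up n k : s n <= s (n + k)%N <= s n + u / 2 ^+ n - u / 2 ^+ (n + k).
  elim: k => [|k IH]; first by rewrite addn0 addrK lexx.
  rewrite addnS; move: IH; have := half u (n + k)%N; have := pos u (n + k).+1 u0.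
  by case: (hs (n + k)%N) => ->; move: (s _) (s _) (_ / _) (_ / _) (_ / _) => *; lra.
 have hb n m : s m <= s n + u / 2 ^+ n.
  have [/subnKC<-|/ltnW/subnKC e] := leqP n m.
   by have /andP[_] := up n (m - n)%N; have := pos u (n + (m - n))%N u0; lra.
  by have /andP[] := up m (n - m)%N; rewrite e; have := pos u n u0; lra.
 have sup_s : has_sup (range s).
  by split; [exists (s 0%N), 0%N | exists (s 0%N + u / 2 ^+ 0) => _ [m _ <-]].
 exists (sup (range s)) => n; apply/andP; split; first by apply: ub_le_sup; [case: sup_s|exists n].
 by apply: ge_sup; [case: sup_s | move=> _ [m _ <-]].
have [al hal] : exists al, forall n, (q n).1 <= al <= (q n).1 + w / 2 ^+ n.
 by apply: mono => // n /=; have [] := hnxt (n, q n) (nq n).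
have [ga hga] : exists al, forall n, (q n).2 <= al <= (q n).2 + h / 2 ^+ n.
 by apply: mono => // n /=; have [] := hnxt (n, q n) (nq n).
have [N hN] := loc al ga; apply: (nq N); exact: hN.
Qed.
Lemma nm_pt (x y x' y' : R) : nm (pt x y - pt x' y') <= `|x - x'| + `|y - y'|.
Proof. by apply: le_trans (nm_le _) _; rewrite /pt /= !(mul0r, mul1r, subr0, add0r, addr0). Qed.
Lemma between (a b x : R) : `|a| < 2 -> `|b| < 2 -> a <= x <= b -> `|x| < 2.
Proof. by rewrite !ltr_norml => /andP[? ?] /andP[? ?] /andP[? ?]; lra. Qed.
Lemma in2_sub (a b c d a' b' c' d' : R) : in2 a b c d -> a <= a' -> a' <= b -> a <= b' -> b' <= b ->
 c <= c' -> c' <= d -> c <= d' -> d' <= d -> in2 a' b' c' d'.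
Proof.
move=> [? ? ? ?] h1 h2 h3 h4 h5 h6 h7 h8.
by split; [apply: (@between a b)|apply: (@between a b)|apply: (@between c d)|apply: (@between c d)] => //; apply/andP.
Qed.
Definition clamp (lo hi t : R) := if t <= lo then lo else if hi <= t then hi else t.

Lemma clampP lo hi t : lo <= hi -> lo <= clamp lo hi t <= hi /\
 (lo < clamp lo hi t -> clamp lo hi t <= t) /\ (clamp lo hi t < hi -> t <= clamp lo hi t).
Proof.
move=> lh; rewrite /clamp; case: (lerP t lo) => h1; [|case: (lerP hi t) => h2];
 (split; [by apply/andP; split; lra | by split=> h3; lra]).
Qed.
Lemma clamp_mono lo hi t t' : lo <= hi -> t <= t' -> clamp lo hi t <= clamp lo hi t'.
Proof.
move=> lh tt; rewrite /clamp; case: (lerP t lo) => h1; case: (lerP t' lo) => h2; rewrite ?lexx //;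
 try case: (lerP hi t) => h3; try case: (lerP hi t') => h4; lra.
Qed.
Lemma goursat (f : C -> C) a b c d : in2 a b c d -> a <= b -> c <= d -> (forall z, cont f z) ->
 (forall x y, a <= x <= b -> c <= y <= d -> exists D, cder f (pt x y) D) -> J f a b c d = 0.
Proof.
move=> [a2 b2 c2 d2] ab cd fc fd; pose w := b - a; pose h := d - c.
have w0 : 0 <= w by rewrite subr_ge0.
have h0 : 0 <= h by rewrite subr_ge0.
apply/eqP; rewrite -nm_eq0; apply/eqP/le_anti; rewrite nm_ge0 andbT.
apply/ler_addgt0Pr => e e0; rewrite add0r.
pose e' := e / ((w + h) ^+ 2 + 1); have den : 0 < (w + h) ^+ 2 + 1 by rewrite ltr_wpDl ?sqr_ge0.
have e'0 : 0 < e' by rewrite divr_gt0.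
(* A bound by the square of the size: the bounds for the four quarters add up exactly to the bound
   for the whole. *)
pose P a' c' n := a <= a' -> a' + w / 2 ^+ n <= b -> c <= c' -> c' + h / 2 ^+ n <= d ->
 nm (J f a' (a' + w / 2 ^+ n) c' (c' + h / 2 ^+ n)) <= e' * (w / 2 ^+ n + h / 2 ^+ n) ^+ 2.
suff : P a c 0%N.
 rewrite /P expr0 !divr1 /w /h !(addrC a, addrC c) !subrK => /(_ (lexx _) (lexx _) (lexx _) (lexx _)) H.
 apply: le_trans H _; rewrite -/w -/h /e' mulrAC ler_pdivrMr //.
 by apply: ler_wpM2l; [exact: ltW | rewrite lerDl].
apply: (@bisection P w h a c w0 h0).
 move=> a' c' n p1 p2 p3 p4 h1 h2 h3 h4.
 have half (u : R) : u / 2 ^+ n = u / 2 ^+ n.+1 + u / 2 ^+ n.+1.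
  by rewrite exprS; field; rewrite expf_neq0.
 have pw : 0 <= w / 2 ^+ n.+1 by rewrite divr_ge0 // exprn_ge0.
 have ph : 0 <= h / 2 ^+ n.+1 by rewrite divr_ge0 // exprn_ge0.
 move: p1 p2 p3 p4 h2 h4; rewrite /P !half; move: (w / _) (h / _) pw ph => u v u0 v0 p1 p2 p3 p4 h2 h4.
 rewrite (J_splitx f a' (a' + u)) (J_splity f a' (a' + u) c' (c' + v)) (J_splity f (a' + u) _ c' (c' + v)).
 have -> : e' * (u + u + (v + v)) ^+ 2 = e' * (u + v) ^+ 2 + e' * (u + v) ^+ 2 + e' * (u + v) ^+ 2 + e' * (u + v) ^+ 2 by ring.
 have N4 (p q r s : C) : nm (p + q + (r + s)) <= nm p + nm q + (nm r + nm s).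
  by apply: le_trans (nmD _ _) _; apply: lerD; apply: nmD.
 have A1 : a' + u <= b by clear -h2 u0; lra.
 have A2 : a <= a' + u by clear -h1 u0; lra.
 have A3 : a' + u + u <= b by clear -h2; lra.
 have C1 : c' + v <= d by clear -h4 v0; lra.
 have C2 : c <= c' + v by clear -h3 v0; lra.
 have C3 : c' + v + v <= d by clear -h4; lra.
 have {}p1 := p1 h1 A1 h3 C1; have {}p2 := p2 A2 A3 h3 C1.
 have {}p3 := p3 h1 A1 C2 C3; have {}p4 := p4 A2 A3 C2 C3.
 apply: le_trans (N4 _ _ _ _) _; rewrite !addrA; move: p1 p2 p3 p4; rewrite ?addrA.
 by move: (nm _) (nm _) (nm _) (nm _) (e' * _) => n1 n2 n3 n4 n5 p1 p2 p3 p4; clear -p1 p2 p3 p4; lra.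
move=> al ga; have [[hal hga]|nin] := pselect ((a <= al <= b) /\ (c <= ga <= d)); last first.
 exists 0%N => n a' c' _ /andP[h1 h2] /andP[h3 h4] h5 h6 h7 h8; case: nin.
 by split; apply/andP; split; [clear -h1 h5|clear -h2 h6|clear -h3 h7|clear -h4 h8]; lra.
have [D [phi [p1 p2 p3]]] := fd _ _ hal hga.
have [|r r0 hr] := p3 (e' / 4); first by rewrite divr_gt0.
have [N hN] := half_lim (addr_ge0 w0 h0) r0.
exists N => n a' c' /hN; rewrite mulrDl => nr /andP[h1 h2] /andP[h3 h4] h5 h6 h7 h8.
have pw : 0 <= w / 2 ^+ n by rewrite divr_ge0 // exprn_ge0.
have ph : 0 <= h / 2 ^+ n by rewrite divr_ge0 // exprn_ge0.
move: (w / _) (h / _) pw ph nr h2 h4 h6 h8 => u v u0 v0 nr h2 h4 h6 h8.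
set p := pt al ga in p1 p2 p3 hr.
(* [f] minus its affine approximation at [p], which has integral 0 by [J_affine]. *)
pose g z := f z + (-1) * ((f p - D * p) + D * z).
have gE z : g z = (phi z - D) * (z - p).
 by rewrite /g mulrBl -p1; ring.
have i2 : in2 a' (a' + u) c' (c' + v).
 by apply: (@in2_sub a b c d) => //; [clear -u0 h6|clear -u0 h5|clear -v0 h8|clear -v0 h7]; lra.
have ea : econt (fun z => (f p - D * p) + D * z) a' (a' + u) c' (c' + v).
 apply: econtD; first by split; apply: rcont_cst.
 by apply: econtZ; apply: cont_econt; apply: cont_id.
have ef : econt f a' (a' + u) c' (c' + v) by apply: cont_econt.
have -> : J f a' (a' + u) c' (c' + v) = J g a' (a' + u) c' (c' + v).
 by rewrite /g J_D // ?J_Z // ?J_affine ?mulr0 ?addr0 //; apply: econtZ.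
have -> : e' * (u + v) ^+ 2 = 4 * (e' / 4 * (u + v)) * (a' + u - a' + (c' + v - c')) by field.
have key x y : a' <= x <= a' + u -> c' <= y <= c' + v -> nm (g (pt x y)) <= e' / 4 * (u + v).
 move=> /andP[x1 x2] /andP[y1 y2]; rewrite gE nmM.
 have le : nm (pt x y - p) <= u + v.
  apply: le_trans (nm_pt _ _ _ _) _; apply: lerD; rewrite ler_norml; [clear -x1 x2 h1 h2|clear -y1 y2 h3 h4]; apply/andP; split; lra.
 apply: ler_pM; rewrite ?nm_ge0 //; rewrite -p2; apply: ltW; apply: hr; exact: le_lt_trans nr.
apply: J_bound => //.
- by apply: econtD => //; apply: econtZ.
- by rewrite lerDl.
- by rewrite lerDl.
- by move=> x hx; split; apply: key => //; rewrite ?lexx ?lerDl // v0.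
- by move=> y hy; split; apply: key => //; rewrite ?lexx ?lerDl // u0.
Qed.
(** A small square around the exceptional point is cut out and intersected with the rectangle by
    [clamp]; continuity makes its contribution arbitrarily small. Thereby the lemma applies to
    difference quotients. *)
Lemma goursat_exc (S : seq C) (f : C -> C) : (forall z, cont f z) ->
 forall a b c d, in2 a b c d -> a <= b -> c <= d ->
 (forall x y, a <= x <= b -> c <= y <= d -> pt x y \notin S -> exists D, cder f (pt x y) D) ->
 J f a b c d = 0.
Proof.
move=> fc; elim: S => [|p S IH] a b c d i2 ab cd fd.
 by apply: goursat => // x y hx hy; apply: fd.
pose px := Re p; pose py := Im p.
have pE : p = pt px py by exact: complexRI.
have pt_inj x y : pt x y = p -> x = px /\ y = py.
 move=> e; rewrite /px /py -e /pt /= !(mul0r, mul1r, mulr0, subr0, add0r, addr0, oppr0); by split.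
have IH' a' b' c' d' : a <= a' -> a' <= b' -> b' <= b -> c <= c' -> c' <= d' -> d' <= d ->
  (a' < b' -> c' < d' -> b' < px \/ px < a' \/ d' < py \/ py < c') -> J f a' b' c' d' = 0.
 move=> h1 h2 h3 h4 h5 h6 away; move: i2 => [a2 b2 c2 d2].
 move: (h2); rewrite le_eqVlt => /orP[/eqP->|lt1]; first exact: J_deg.
 move: (h5); rewrite le_eqVlt => /orP[/eqP->|lt2]; first exact: J_degy.
 apply: IH => //.
  by apply: (@in2_sub a b c d) => //; [clear -h2 h3|clear -h1 h2|clear -h5 h6|clear -h4 h5]; lra.
 move=> x y /andP[hx1 hx2] /andP[hy1 hy2] nS; apply: fd.
 - by apply/andP; split; [clear -hx1 h1|clear -hx2 h3]; lra.
 - by apply/andP; split; [clear -hy1 h4|clear -hy2 h6]; lra.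
 rewrite inE negb_or nS andbT; apply/eqP => /pt_inj[xp yp].
 have := away lt1 lt2; rewrite -xp -yp; clear -hx1 hx2 hy1 hy2; lra.
have [r r0 hr] := fc p 1 ltr01.
apply/eqP; rewrite -nm_eq0; apply/eqP/le_anti; rewrite nm_ge0 andbT.
apply/ler_addgt0Pr => e e0; rewrite add0r.
pose M := nm (f p) + 1; have M0 : 0 < M by rewrite ltr_wpDl ?nm_ge0.
(* The first bound keeps the small square in the disc where [f] is bounded by [M]; the second makes
   the estimate of [J_bound] at most [e]. *)
pose s := Num.min (r / 4) (e / (16 * M)).
have s0 : 0 < s by rewrite lt_min !divr_gt0 // mulr_gt0.
have pxs : px - s < px + s by clear -s0; lra.
have pys : py - s < py + s by clear -s0; lra.
have [a1 [a2 a3]] := clampP (px - s) ab; have [b1 [b2 b3]] := clampP (px + s) ab.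
have [c1 [c2 c3]] := clampP (py - s) cd; have [d1 [d2 d3]] := clampP (py + s) cd.
have mx := clamp_mono ab (ltW pxs); have my := clamp_mono cd (ltW pys).
move: (clamp a b (px - s)) (clamp a b (px + s)) (clamp c d (py - s)) (clamp c d (py + s)) a1 a2 a3 b1 b2 b3 c1 c2 c3 d1 d2 d3 mx my.
move=> a' b' c' d' /andP[a1 a1'] a2 a3 /andP[b1 b1'] b2 b3 /andP[c1 c1'] c2 c3 /andP[d1 d1'] d2 d3 mx my.
have -> : J f a b c d = J f a' b' c' d'.
 rewrite (J_splitx f a a' b c d) (J_splitx f a' b' b c d) (J_splity f a' b' c c' d) (J_splity f a' b' c' d' d).
 rewrite (IH' a a' c d) //; last by move=> lt1 _; left; have := a2 lt1; clear -s0; lra.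
 rewrite (IH' b' b c d) //; last by move=> lt1 _; right; left; have := b3 lt1; clear -s0; lra.
 rewrite (IH' a' b' c c') //; last by move=> _ lt1; right; right; left; have := c2 lt1; clear -s0; lra.
 rewrite (IH' a' b' d' d) //; last by move=> _ lt1; right; right; right; have := d3 lt1; clear -s0; lra.
 by rewrite !add0r !addr0.
have [i1 i3 i4 i5] := i2.
move: mx; rewrite le_eqVlt => /orP[/eqP->|lt1]; first by rewrite J_deg nm0 ltW.
move: my; rewrite le_eqVlt => /orP[/eqP->|lt2]; first by rewrite J_degy nm0 ltW.
have hb := b2 (le_lt_trans a1 lt1); have ha := a3 (lt_le_trans lt1 b1').
have hd := d2 (le_lt_trans c1 lt2); have hc := c3 (lt_le_trans lt2 d1').
have sr : s <= r / 4 by rewrite ge_min lexx.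
have se : 16 * M * s <= e.
 by rewrite mulrC -ler_pdivlMr ?mulr_gt0 // ge_min lexx orbT.
have key x y : a' <= x <= b' -> c' <= y <= d' -> nm (f (pt x y)) <= M.
 move=> /andP[x1 x2] /andP[y1 y2]; rewrite -[f _](subrK (f p)) addrC.
 apply: le_trans (nmD _ _) _; rewrite lerD2l ltW //; apply: hr; rewrite pE.
 apply: le_lt_trans (nm_pt _ _ _ _) _.
 have hx : `|x - px| <= s by rewrite ler_norml; clear -x1 x2 ha hb; apply/andP; split; lra.
 have hy : `|y - py| <= s by rewrite ler_norml; clear -y1 y2 hc hd; apply/andP; split; lra.
 by move: (`|_|) (`|_|) hx hy => X Y hx hy; clear -hx hy sr r0; lra.
have := @J_bound _ f a' b' c' d' M; move=> /(_ _ _ (ltW lt1) (ltW lt2) _ _) H.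
apply: le_trans (H _ _ _ _) _.
- by apply: (@in2_sub a b c d).
- exact: cont_econt.
- by move=> x hx; split; apply: key => //; rewrite ?lexx (ltW lt2).
- by move=> y hy; split; apply: key => //; rewrite ?lexx (ltW lt1).
apply: le_trans se; have -> : 16 * M * s = 4 * M * (2 * s + 2 * s) by ring.
by apply: ler_wpM2l; [rewrite mulr_ge0 // ltW | clear -ha hb hc hd; lra].
Qed.
Lemma J_eq (f g : C -> C) a b c d : (forall x, f (pt x c) = g (pt x c)) -> (forall x, f (pt x d) = g (pt x d)) ->
 (forall y, f (pt a y) = g (pt a y)) -> (forall y, f (pt b y) = g (pt b y)) -> J f a b c d = J g a b c d.
Proof.
move=> h1 h2 h3 h4; rewrite /J; congr (_ + _ * _ - _ - _ * _); congr (ci _ _ _); exact: funext.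
Qed.
Lemma cder_near (f : C -> C) z D K r : 0 < r -> (forall w, nm (w - z) < r ->
  nm (f w - f z - D * (w - z)) <= K * nm (w - z) ^+ 2) -> cder f z D.
Proof.
move=> r0 h; exists (fun w => if w == z then D else (f w - f z) / (w - z)); split.
- move=> w; case: eqP => [->|/eqP wz]; first by rewrite !subrr mulr0.
 by rewrite mulfVK // subr_eq0.
- by rewrite eqxx.
move=> e e0; pose K' := `|K| + 1; have K0 : 0 < K' by rewrite ltr_wpDl.
exists (Num.min r (e / K')); first by rewrite lt_min r0 divr_gt0.
move=> w; rewrite lt_min eqxx => /andP[wr we].
case: (boolP (w == z)) => [_|wz]; first by rewrite subrr nm0.
have wz0 : w - z != 0 by rewrite subr_eq0.
have -> : (f w - f z) / (w - z) - D = (f w - f z - D * (w - z)) / (w - z) by field.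
have n0 : 0 < nm (w - z) by rewrite nm_gt0.
rewrite nmM nmV ltr_pdivrMr //; apply: le_lt_trans (h w wr) _.
rewrite expr2 mulrA ltr_pM2r // mulrC.
apply: le_lt_trans (_ : nm (w - z) * K' < _); last by rewrite -ltr_pdivlMr.
by apply: ler_wpM2l; [exact: ltW | rewrite /K'; apply: le_trans (ler_norm _) _; rewrite lerDl].
Qed.
Lemma rcont_bounded (phi : R -> C) a b : a <= b -> rcont phi ->
 exists2 M, 0 < M & forall x, a <= x <= b -> nm (phi x) <= M.
Proof.
move=> ab h; have cn : continuous (fun x => nm (phi x)).
 move=> x; apply/cvgrPdist_lt => e e0; have [r r0 hr] := h x e e0.
 exists r => // y; rewrite /ball_ /= distrC => /hr hy; apply: le_lt_trans hy.
 rewrite ler_norml lerBlDr; apply/andP; split.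
  by rewrite lerNl opprB lerBlDr; apply: le_trans (nmD _ _); rewrite subrK.
 by rewrite nmB; apply: le_trans (nmD _ _); rewrite subrK.
have [c _ hc] := EVT_max ab (continuous_subspaceT (A := `[a, b]) cn).
exists (nm (phi c) + 1); first by rewrite ltr_wpDl ?nm_ge0.
by move=> x hx; apply: le_trans (hc x _) _; rewrite ?lerDl // in_itv.
Qed.
Lemma cont_agree (f g : C -> C) z r : 0 < r -> cont f z -> cont g z ->
 (forall w, nm (w - z) < r -> w != z -> f w = g w) -> f z = g z.
Proof.
move=> r0 cf cg fg; apply/eqP; rewrite -subr_eq0 -nm_eq0; apply/eqP/le_anti; rewrite nm_ge0 andbT.
apply/ler_addgt0Pr => e e0; rewrite add0r.
have [s s0 hs] := contD cf (contN cg) e0; pose t := Num.min r s / 2.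
have t0 : 0 < t by rewrite divr_gt0 // lt_min r0.
have tr : t < Num.min r s by rewrite ltr_pdivrMr // ltr_pMr ?ltr1n // lt_min r0.
move: tr; rewrite lt_min => /andP[tr ts].
have nt : nm (t%:C + z - z) = t by rewrite addrK nmC gtr0_norm.
have := hs (t%:C + z); rewrite nt fg ?nt ?subrr ?sub0r ?nmN => // [/(_ ts)/ltW //|].
by rewrite -subr_eq0 addrK (inj_eq (@complexI R)) gt_eqF.
Qed.
Definition inside (z : C) := `|Re z| < 1 /\ `|Im z| < 1.

Lemma nm_inside z : nm z < 1 -> inside z.
Proof. by move=> h; split; apply: le_lt_trans h; [exact: ge_nm_Re|exact: ge_nm_Im]. Qed.
Lemma RePt x y : Re (pt x y : C) = x. Proof. by rewrite /pt /= !(mul0r, mul1r, mulr0, subr0, add0r, addr0, oppr0). Qed.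
Lemma ImPt x y : Im (pt x y : C) = y. Proof. by rewrite /pt /= !(mul0r, mul1r, mulr0, subr0, add0r, addr0, oppr0). Qed.
Lemma ReB (z w : C) : Re (z - w) = Re z - Re w. Proof. by case: z; case: w. Qed.
Lemma ImB (z w : C) : Im (z - w) = Im z - Im w. Proof. by case: z; case: w. Qed.
Lemma ReN (z : C) : Re (- z) = - Re z. Proof. by case: z. Qed.
Lemma ImN (z : C) : Im (- z) = - Im z. Proof. by case: z. Qed.
Definition onedge (z : C) := `|Re z| = 1 \/ `|Im z| = 1.

Lemma onedge_neq z w : inside z -> onedge w -> w - z != 0.
Proof.
move=> [h1 h2] e; rewrite subr_eq0; apply/eqP => wz; rewrite wz in e.
by case: e => e; [move: h1|move: h2]; rewrite e ltxx.
Qed.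
Lemma onedge_dist z w : nm z <= 1 / 2 -> onedge w -> 1 / 2 <= nm (w - z).
Proof.
move=> hz hw; have h1 : `|Re z| <= 1 / 2 := le_trans (ge_nm_Re z) hz.
have h2 : `|Im z| <= 1 / 2 := le_trans (ge_nm_Im z) hz.
case: hw => hw; [apply: le_trans (ge_nm_Re _)|apply: le_trans (ge_nm_Im _)]; rewrite raddfB;
 have := ler_distD 0 (Re w) (Re z); rewrite ?subr0 ?sub0r;
 [have := lerB_dist (Re w) (Re z)|have := lerB_dist (Im w) (Im z)]; rewrite hw; move: h1 h2; lra.
Qed.
Lemma leN11 : -1 <= 1 :> R. Proof. by lra. Qed.
Lemma Im_ci (phi : R -> C) a b : Im (ci phi a b) = ri (fun x => Im (phi x)) a b.
Proof. by rewrite /ci /= !(mul0r, mul1r, mulr0, subr0, add0r, addr0, oppr0). Qed.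
Lemma Re_ci (phi : R -> C) a b : Re (ci phi a b) = ri (fun x => Re (phi x)) a b.
Proof. by rewrite /ci /= !(mul0r, mul1r, mulr0, subr0, add0r, addr0, oppr0). Qed.
Lemma Imi (z : C) : Im ('i * z) = Re z.
Proof. by case: z => a b; rewrite /= !(mul0r, mul1r, mulr0, subr0, add0r, addr0, oppr0). Qed.
Definition I1 (g : C -> C) := J g (-1) 1 (-1) 1.

Lemma in2_1 : in2 (-1) 1 (-1) (1 : R).
Proof. by split; rewrite ?normrN normr1 ltr1n. Qed.
Lemma onedge_h x : onedge (pt x 1) /\ onedge (pt x (-1)).
Proof. by rewrite /onedge !ImPt normrN normr1; split; right. Qed.
Lemma onedge_v x : onedge (pt 1 x) /\ onedge (pt (-1) x).
Proof. by rewrite /onedge !RePt normrN normr1; split; left. Qed.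
Lemma econt_edge (g : C -> C) : (forall z, onedge z -> cont g z) -> econt g (-1) 1 (-1) 1.
Proof.
move=> h; split; [apply: (rcont_comp (rcont_h _))|apply: (rcont_comp (rcont_v _))|
 apply: (rcont_comp (rcont_h _))|apply: (rcont_comp (rcont_v _))] => x; apply: h;
 by have [] := onedge_h x; have [] := onedge_v x.
Qed.
Lemma I1_bound (g : C -> C) M : (forall z, onedge z -> cont g z) ->
 (forall z, onedge z -> `|Re z| <= 1 -> `|Im z| <= 1 -> nm (g z) <= M) -> nm (I1 g) <= 16 * M.
Proof.
move=> gc gM; have -> : 16 * M = 4 * M * ((1 - -1) + (1 - -1)) by ring.
apply: J_bound; [exact: in2_1|exact: econt_edge|lra|lra| |].
- by move=> x hx; have [e1 e2] := onedge_h x; split; apply: gM => //; rewrite ?RePt ?ImPt ?normrN ?normr1 // ler_norml.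
- by move=> x hx; have [e1 e2] := onedge_v x; split; apply: gM => //; rewrite ?RePt ?ImPt ?normrN ?normr1 // ler_norml.
Qed.
Lemma I1D f g : (forall z, onedge z -> cont f z) -> (forall z, onedge z -> cont g z) ->
 I1 (fun z => f z + g z) = I1 f + I1 g.
Proof. by move=> hf hg; apply: J_D; [exact: in2_1|exact: econt_edge|exact: econt_edge]. Qed.
Lemma I1Z f k : (forall z, onedge z -> cont f z) -> I1 (fun z => k * f z) = k * I1 f.
Proof. by move=> hf; apply: J_Z; [exact: in2_1|exact: econt_edge]. Qed.
Lemma I1_eq f g : (forall z, onedge z -> f z = g z) -> I1 f = I1 g.
Proof.
by move=> h; apply: J_eq => x; apply: h; have [] := onedge_h x; have [] := onedge_v x.
Qed.
Lemma edge_bound (g : C -> C) : (forall z, onedge z -> cont g z) ->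
 exists2 M, 0 < M & forall z, onedge z -> `|Re z| <= 1 -> `|Im z| <= 1 -> nm (g z) <= M.
Proof.
move=> /econt_edge[h1 h2 h3 h4]; have le1 : -1 <= 1 :> R by lra.
have [M1 M10 H1] := rcont_bounded le1 h1; have [M2 M20 H2] := rcont_bounded le1 h2.
have [M3 M30 H3] := rcont_bounded le1 h3; have [M4 M40 H4] := rcont_bounded le1 h4.
exists (M1 + M2 + M3 + M4); first by rewrite !addr_gt0.
move=> z; rewrite [z]complexRI -/(pt (Re z) (Im z)) RePt ImPt.
have aux (u M : R) : u <= M -> M = M1 \/ M = M2 \/ M = M3 \/ M = M4 -> u <= M1 + M2 + M3 + M4 by lra.
rewrite /onedge RePt ImPt => -[] + hx hy; rewrite ler_norml in hx; rewrite ler_norml in hy.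
 have [x0|x0] := lerP 0 (Re z); [rewrite ger0_norm // => e|rewrite ltr0_norm // => e].
  by rewrite e; apply: aux (H2 _ hy) _; auto.
 have -> : Re z = -1 by lra.
 by apply: aux (H4 _ hy) _; auto.
have [x0|x0] := lerP 0 (Im z); [rewrite ger0_norm // => e|rewrite ltr0_norm // => e].
 by rewrite e; apply: aux (H3 _ hx) _; auto.
have -> : Im z = -1 by lra.
by apply: aux (H1 _ hx) _; auto.
Qed.
Lemma contq (z w : C) : w - z != 0 -> cont (fun v => (v - z)^-1) w.
Proof.
by move=> h; apply: contV => //; apply: contD; [exact: cont_id | exact: cont_cst].
Qed.
(** In the place of the constant 2 pi i of Cauchy's formula: it is enough that it does not vanish
    and depends differentiably on [z]. *)
Definition kappa z := I1 (fun w => (w - z)^-1).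

(** The difference quotient [phi] at [z] is continuous, and differentiable except at [z] and on [S],
    so its integral is 0 by [goursat_exc]. *)
Lemma cauchy (S : seq C) (f : C -> C) z : (forall w, cont f w) ->
 (forall x y, -1 <= x <= 1 -> -1 <= y <= 1 -> pt x y \notin S -> exists D, cder f (pt x y) D) ->
 inside z -> z \notin S -> I1 (fun w => f w * (w - z)^-1) = f z * kappa z.
Proof.
move=> fc fd hz zS.
have [D [phi [p1 p2 p3]]] : exists D, cder f z D.
 rewrite [z]complexRI; apply: fd; rewrite -?[_ + _]/(pt (Re z) (Im z)).
 - by case: hz => h _; rewrite -ler_norml ltW.
 - by case: hz => _ h; rewrite -ler_norml ltW.
 - by rewrite /pt -complexRI.
have pE w : w != z -> phi w = (f w - f z) * (w - z)^-1.
 by move=> wz; rewrite p1 mulfK // subr_eq0.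
have nbh w : w != z -> forall v, nm (v - w) < nm (w - z) -> v != z.
 by move=> wz v; apply: contraTneq => ->; rewrite nmB ltxx.
have pc w : cont phi w.
 have [->//|wz] := eqVneq w z.
 apply: (@cont_eq _ (fun v => (f v - f z) * (v - z)^-1)).
  exists (nm (w - z)); first by rewrite nm_gt0 subr_eq0.
  by move=> v /(nbh _ wz) vz; rewrite pE.
 apply: contM; last by apply: contq; rewrite subr_eq0.
 by apply: contD => //; apply: cont_cst.
have J0 : I1 phi = 0.
 apply: (@goursat_exc (z :: S) phi pc _ _ _ _ in2_1 leN11 leN11).
 move=> x y hx hy; rewrite inE negb_or => /andP[wz nS]; have [E hE] := fd _ _ hx hy nS.
 have wz0 : pt x y - z != 0 by rewrite subr_eq0.
 have h1 := cderD hE (cder_cst (- f z) (pt x y)).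
 have h2 := @cderV R (fun w => w - z) _ _ wz0 (cderD (cder_id (pt x y)) (cder_cst (- z) (pt x y))).
 eexists; apply: cder_eq (cderM h1 h2); exists (nm (pt x y - z)); first by rewrite nm_gt0.
 by move=> v /(nbh _ wz) vz; rewrite pE.
have hq w : onedge w -> cont (fun v => (v - z)^-1) w by move=> e; apply: contq; apply: onedge_neq.
apply/eqP; rewrite -subr_eq0 -[X in _ == X]J0 /kappa -mulNr -I1Z // -I1D.
- apply/eqP/I1_eq => w e; have wz : w != z by rewrite -subr_eq0 onedge_neq.
 by rewrite pE // mulrBl mulNr.
- by move=> w e; apply: contM => //; apply: hq.
- by move=> w e; apply: contM; [exact: cont_cst | exact: hq].
Qed.
Lemma ImV (v : C) : Im v^-1 = - Im v / nm v ^+ 2.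
Proof. by case: v => a b; rewrite /nm sqr_sqrtr ?addr_ge0 ?sqr_ge0 //= mulNr. Qed.
Lemma ReV (v : C) : Re v^-1 = Re v / nm v ^+ 2.
Proof. by case: v => a b; rewrite /nm sqr_sqrtr ?addr_ge0 ?sqr_ge0. Qed.
(** Each of the four edges contributes at least [2 * (1 / 18)] to the imaginary part: the normal
    distance of [z] from an edge is at least [1 / 2], and squared distances are at most 9. *)
Lemma kappa_ge z : nm z <= 1 / 2 -> 4 / 9 <= nm (kappa z).
Proof.
move=> hz; apply: le_trans (ge_nm_Im _); apply: le_trans (ler_norm _).
have hr := le_trans (ge_nm_Re z) hz; have hi := le_trans (ge_nm_Im z) hz.
rewrite !ler_norml in hr hi; move/andP: hr => [hr1 hr2]; move/andP: hi => [hi1 hi2].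
have iz : inside z by apply: nm_inside; lra.
have [h1 h2 h3 h4] : econt (fun w => (w - z)^-1) (-1) 1 (-1) (1 : R).
 by apply: econt_edge => w e; apply: contq; apply: onedge_neq.
have far x y : -1 <= x <= 1 -> -1 <= y <= 1 -> nm (pt x y - z) ^+ 2 <= 9.
 move=> /andP[x1 x2] /andP[y1 y2]; have := nm_pt x y (Re z) (Im z); rewrite {2}/pt -complexRI => le.
 have le3 : nm (pt x y - z) <= 3.
  apply: le_trans le _.
  have : `|x - Re z| <= 3 / 2 by rewrite ler_norml; apply/andP; split; lra.
  have : `|y - Im z| <= 3 / 2 by rewrite ler_norml; apply/andP; split; lra.
  move: (`|_|) (`|_|) => *; lra.
 have := nm_ge0 (pt x y - z); move: (nm _) le3 => u *; nra.
have frac (u n : R) : 1 / 2 <= u -> 0 < n -> n <= 9 -> 1 / 18 <= u / n.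
 by move=> *; rewrite ler_pdivlMr //; lra.
have pos x y : onedge (pt x y) -> 0 < nm (pt x y - z) ^+ 2.
 by move=> e; rewrite exprn_gt0 // nm_gt0 onedge_neq.
have [b1 b2 b3 b4] := in2_1; have le1 : -1 <= 1 :> R by lra.
have B1 := ri_ge (M := 1 / 18) (rcont_Im h1) b1 b2 le1 _.
have B2 := ri_ge (M := 1 / 18) (rcont_Re h2) b1 b2 le1 _.
have hn3 := rcontZ (-1) h3; have hn4 := rcontZ (-1) h4.
have B3 := ri_ge (M := 1 / 18) (rcont_Im hn3) b1 b2 le1 _.
have B4 := ri_ge (M := 1 / 18) (rcont_Re hn4) b1 b2 le1 _.
have -> : kappa z = ci (fun x => (pt x (-1) - z)^-1) (-1) 1 + 'i * ci (fun y => (pt 1 y - z)^-1) (-1) 1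
  + ci (fun x => -1 * (pt x 1 - z)^-1) (-1) 1 + 'i * ci (fun y => -1 * (pt (-1) y - z)^-1) (-1) 1.
 by rewrite /kappa /I1 /J !ciZ //; ring.
have ImD (u v : C) : Im (u + v) = Im u + Im v by case: u; case: v.
rewrite ImD ImD ImD !Imi !Im_ci !Re_ci.
have {}B1 := B1 _; have {}B2 := B2 _; have {}B3 := B3 _; have {}B4 := B4 _.
have {}B1 : 1 / 18 * (1 - -1) <= ri (fun x => Im (pt x (-1) - z)^-1) (-1) 1.
 apply: B1 => x hx; rewrite ImV; apply: frac; [rewrite ImB ImPt; lra|apply: pos; apply: (onedge_h x).2|].
 by apply: far => //; apply/andP; split; lra.
have {}B2 : 1 / 18 * (1 - -1) <= ri (fun y => Re (pt 1 y - z)^-1) (-1) 1.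
 apply: B2 => x hx; rewrite ReV; apply: frac; [rewrite ReB RePt; lra|apply: pos; apply: (onedge_v x).1|].
 by apply: far => //; apply/andP; split; lra.
have {}B3 : 1 / 18 * (1 - -1) <= ri (fun x => Im (-1 * (pt x 1 - z)^-1)) (-1) 1.
 apply: B3 => x hx; rewrite mulN1r ImN ImV mulNr opprK; apply: frac; [rewrite ImB ImPt; lra|apply: pos; apply: (onedge_h x).1|].
 by apply: far => //; apply/andP; split; lra.
have {}B4 : 1 / 18 * (1 - -1) <= ri (fun y => Re (-1 * (pt (-1) y - z)^-1)) (-1) 1.
 apply: B4 => x hx; rewrite mulN1r ReN ReV -mulNr; apply: frac; [rewrite ReB RePt; lra|apply: pos; apply: (onedge_v x).2|].
 by apply: far => //; apply/andP; split; lra.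
move: (ri _ _ _) (ri _ _ _) (ri _ _ _) (ri _ _ _) B1 B2 B3 B4 => r1 r2 r3 r4 B1 B2 B3 B4; clear -B1 B2 B3 B4; lra.
Qed.

Section Kernel.
Variable F : C -> C.
Hypothesis Fc : forall w, cont F w.

Lemma half_inside z : nm z <= 1 / 2 -> inside z.
Proof. by move=> h; apply: nm_inside; apply: le_lt_trans h _; lra. Qed.
Lemma q_bound z w : nm z <= 1 / 2 -> onedge w -> nm (w - z)^-1 <= 2.
Proof.
move=> hz e; have h := onedge_dist hz e; rewrite nmV -[leRHS]invrK lef_pV2 ?posrE ?invr_gt0 //.
 by rewrite -[_^-1]mul1r.
by apply: lt_le_trans h; lra.
Qed.
Lemma q_cont z w : nm z <= 1 / 2 -> onedge w -> cont (fun v => (v - z)^-1) w.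
Proof. by move=> hz e; apply: contq; apply: onedge_neq => //; apply: half_inside. Qed.
Lemma I1_lin3 (f g h : C -> C) k : (forall z, onedge z -> cont f z) -> (forall z, onedge z -> cont g z) ->
 (forall z, onedge z -> cont h z) -> I1 f - I1 g - I1 h * k = I1 (fun z => f z + (-1 * g z + - k * h z)).
Proof.
move=> cf cg ch; rewrite I1D //; last first.
 by move=> z e; apply: contD; apply: contM; (exact: cont_cst || exact: cg || exact: ch).
rewrite I1D ?I1Z //; first ring.
- by move=> z e; apply: contM; [exact: cont_cst|exact: cg].
- by move=> z e; apply: contM; [exact: cont_cst|exact: ch].
Qed.
(** Differentiation under the integral: the second-order remainder of the kernel is [(v - z) ^+ 2]
    times a function bounded on the boundary, since [v] and [z] stay at distance [1 / 2] from it. *)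
Lemma kernel_der1 z : nm z < 1 / 2 ->
 cder (fun v => I1 (fun w => F w * (w - v)^-1)) z (I1 (fun w => F w * (w - z)^-1 ^+ 2)).
Proof.
move=> hz; have [M M0 hM] := edge_bound (fun w _ => Fc w).
have r0 : 0 < 1 / 2 - nm z by rewrite subr_gt0.
apply: (@cder_near _ _ _ (16 * (M * 8)) _ r0) => v hv.
have hv' : nm v <= 1 / 2.
 by rewrite -[v](subrK z); apply: le_trans (nmD _ _) _; clear -hv; move: (nm _) (nm _) hv => *; lra.
have hz' := ltW hz.
rewrite I1_lin3; last 3 first.
- by move=> w e; apply: contM => //; apply: q_cont.
- by move=> w e; apply: contM => //; apply: q_cont.
- by move=> w e; apply: contM => //; rewrite -[fun v => _]/(fun v => (v - z)^-1 * (v - z)^-1); apply: contM; apply: q_cont.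
rewrite (@I1_eq _ (fun w => (v - z) ^+ 2 * (F w * (w - z)^-1 ^+ 2 * (w - v)^-1))); last first.
 move=> w e; have h1 := onedge_neq (half_inside hz') e; have h2 := onedge_neq (half_inside hv') e.
 by field; rewrite h1 h2.
have hc w : onedge w -> cont (fun w => F w * (w - z)^-1 ^+ 2 * (w - v)^-1) w.
 move=> e; apply: contM; last exact: q_cont.
 by apply: contM => //; apply: contM; apply: q_cont.
rewrite I1Z // nmM nmX mulrC; apply: ler_wpM2r; first by rewrite exprn_ge0 // nm_ge0.
apply: I1_bound => // w e e1 e2; rewrite !nmM; have -> : M * 8 = M * (2 * 2) * 2 by ring.
have b1 := q_bound hz' e; have b2 := q_bound hv' e.
by do 2 (apply: ler_pM; rewrite ?mulr_ge0 ?nm_ge0 ?hM //); apply: ler_pM; rewrite ?nm_ge0.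
Qed.
Lemma kernel_der2 z : nm z < 1 / 2 ->
 cder (fun v => I1 (fun w => F w * (w - v)^-1 ^+ 2)) z (I1 (fun w => 2 * F w * (w - z)^-1 ^+ 3)).
Proof.
move=> hz; have [M M0 hM] := edge_bound (fun w _ => Fc w).
have r0 : 0 < 1 / 2 - nm z by rewrite subr_gt0.
apply: (@cder_near _ _ _ (16 * (M * 48)) _ r0) => v hv.
have hv' : nm v <= 1 / 2.
 by rewrite -[v](subrK z); apply: le_trans (nmD _ _) _; clear -hv; move: (nm _) (nm _) hv => *; lra.
have hz' := ltW hz.
have q2 u w : nm u <= 1 / 2 -> onedge w -> cont (fun v => (v - u)^-1 ^+ 2) w.
 by move=> hu e; apply: contM; apply: q_cont.
rewrite I1_lin3; last 3 first.
- by move=> w e; apply: contM => //; apply: q2.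
- by move=> w e; apply: contM => //; apply: q2.
- move=> w e; apply: contM; first by apply: contM => //; apply: cont_cst.
 by apply: contM; [exact: q_cont|exact: q2].
rewrite (@I1_eq _ (fun w => (v - z) ^+ 2 * (F w * ((w - z)^-1 ^+ 2 * (w - v)^-1 * ((w - v)^-1 + 2 * (w - z)^-1))))); last first.
 move=> w e; have h1 := onedge_neq (half_inside hz') e; have h2 := onedge_neq (half_inside hv') e.
 by field; rewrite h1 h2.
have hc w : onedge w -> cont (fun w => F w * ((w - z)^-1 ^+ 2 * (w - v)^-1 * ((w - v)^-1 + 2 * (w - z)^-1))) w.
 move=> e; apply: contM => //; apply: contM; first by apply: contM; [exact: q2|exact: q_cont].
 by apply: contD; [exact: q_cont | apply: contM; [exact: cont_cst|exact: q_cont]].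
rewrite I1Z // nmM nmX mulrC; apply: ler_wpM2r; first by rewrite exprn_ge0 // nm_ge0.
apply: I1_bound => // w e e1 e2; have -> : M * 48 = M * (2 * 2 * 2 * (2 + 2 * 2)) by ring.
have b1 := q_bound hz' e; have b2 := q_bound hv' e.
rewrite !nmM; apply: ler_pM; rewrite ?mulr_ge0 ?nm_ge0 ?hM //.
apply: ler_pM; rewrite ?mulr_ge0 ?nm_ge0 //.
 by do 2 (apply: ler_pM; rewrite ?mulr_ge0 ?nm_ge0 //).
apply: le_trans (nmD _ _) _; apply: lerD => //; rewrite nmM.
have -> : nm 2 = 2 :> R by rewrite -(rmorph_nat (real_complex R)) nmC ger0_norm.
by apply: ler_wpM2l.
Qed.
End Kernel.

Definition sqhol (S : seq C) (f : C -> C) := (forall w, cont f w) /\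
 forall x y, -1 <= x <= 1 -> -1 <= y <= 1 -> pt x y \notin S -> exists D, cder f (pt x y) D.

Lemma kappaE z : kappa z = I1 (fun w => 1 * (w - z)^-1).
Proof. by apply: I1_eq => w _; rewrite mul1r. Qed.
Lemma kappa_neq0 z : nm z <= 1 / 2 -> kappa z != 0.
Proof. by move=> /kappa_ge h; rewrite -nm_gt0; apply: lt_le_trans h; lra. Qed.
(** At the exceptional point 0 the formula follows from its validity nearby, as both sides are
    continuous. *)
Lemma cauchy_repr f z : sqhol [:: 0] f -> nm z < 1 / 2 -> f z = I1 (fun w => f w * (w - z)^-1) * (kappa z)^-1.
Proof.
move=> [fc fd] hz; have off w : nm w < 1 / 2 -> w != 0 -> f w = I1 (fun v => f v * (v - w)^-1) * (kappa w)^-1.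
 move=> /ltW hw w0; rewrite (cauchy fc fd) ?mulfK ?kappa_neq0 ?inE //; exact: half_inside.
have [z0|] := eqVneq z 0; last exact: off.
have h0 : nm (0 : C) < 1 / 2 by rewrite nm0; lra.
have k1 := kernel_der1 (fun w => cont_cst 1 w) h0; have k2 := kernel_der1 fc h0.
rewrite z0; apply: (@cont_agree f (fun z => I1 (fun w => f w * (w - z)^-1) * (kappa z)^-1) 0 (1 / 2)) => //.
 apply: contM; first exact: cder_cont k2.
 apply: contV; first exact: kappa_neq0 (ltW h0).
 apply: (@cont_eq _ (fun z => I1 (fun w => 1 * (w - z)^-1))); last exact: cder_cont k1.
 by exists 1 => // w _; rewrite -kappaE.
by move=> w; rewrite subr0 => hw w0; apply: off.
Qed.
(** By [cauchy_repr], [f] is a quotient of two kernel integrals, each differentiable twice, also at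
    the exceptional point; this removes the singularity. *)
Lemma sqhol_der f : sqhol [:: 0] f -> exists g : C -> C, forall z, nm z < 1 / 2 ->
 cder f z (g z) /\ exists D, cder g z D.
Proof.
move=> hf; have [fc fd] := hf; have oc : forall w, cont (fun=> 1 : C) w by move=> w; apply: cont_cst.
pose K v := I1 (fun w => 1 * (w - v)^-1); pose H v := I1 (fun w => f w * (w - v)^-1).
pose K2 v := I1 (fun w => 1 * (w - v)^-1 ^+ 2); pose H2 v := I1 (fun w => f w * (w - v)^-1 ^+ 2).
exists (fun z => H2 z * (K z)^-1 + H z * - (K2 z / K z ^+ 2)) => z hz.
have Kz : K z != 0 by rewrite /K -kappaE kappa_neq0 // ltW.
have dK := kernel_der1 oc hz; have dH := kernel_der1 fc hz.
have dK2 := kernel_der2 oc hz; have dH2 := kernel_der2 fc hz; split.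
 apply: cder_eq (cderM dH (cderV Kz dK)); exists (1 / 2 - nm z); first by rewrite subr_gt0.
 move=> w hw; rewrite (cauchy_repr hf); first by rewrite /K kappaE.
 by rewrite -[w](subrK z); apply: le_lt_trans (nmD _ _) _; move: hw; rewrite ltrBrDr.
have dKV := cderV Kz dK.
have K2z : K z ^+ 2 != 0 by rewrite expf_neq0.
have h1 : cder (fun w => (K w ^+ 2)^-1) z _ := @cderV R (fun w => K w ^+ 2) _ _ K2z (cderX 2 dK).
have h2 : cder (fun w => - (K2 w / K w ^+ 2)) z _ := cderN (cderM dK2 h1).
have h3 : cder (fun w => H2 w * (K w)^-1) z _ := cderM dH2 dKV.
have h4 : cder (fun w => H w * - (K2 w / K w ^+ 2)) z _ := cderM dH h2.
by eexists; apply: cderD h3 h4.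
Qed.
(** [72] is [16 * 2] divided by [4 / 9]: the constants of [I1_bound], [q_bound] and [kappa_ge]. *)
Lemma sqhol_bound f M z : sqhol [:: 0] f -> (forall w, onedge w -> `|Re w| <= 1 -> `|Im w| <= 1 -> nm (f w) <= M) ->
 nm z < 1 / 2 -> nm (f z) <= 72 * M.
Proof.
move=> hf hM hz; have [fc fd] := hf; have hz' := ltW hz.
rewrite (cauchy_repr hf hz) nmM nmV; have k := kappa_ge hz'.
have k0 : 0 < nm (kappa z) by apply: lt_le_trans k; lra.
rewrite ler_pdivrMr //.
have M0 : 0 <= M.
 by apply: le_trans (nm_ge0 (f (pt 1 0))) (hM _ (onedge_v 0).1 _ _); rewrite ?RePt ?ImPt ?normr1 ?normr0.
apply: le_trans (_ : 16 * (M * 2) <= _).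
 apply: I1_bound; first by move=> w e; apply: contM => //; apply: q_cont.
 by move=> w e e1 e2; rewrite nmM; apply: ler_pM; rewrite ?nm_ge0 ?hM ?q_bound.
have -> : 72 * M * nm (kappa z) = 72 * (M * nm (kappa z)) by rewrite mulrA.
have : M * (4 / 9) <= M * nm (kappa z) by apply: ler_wpM2l.
by clear; move: (M * nm _) => X; lra.
Qed.
Lemma clamp_lip lo hi t t' : lo <= hi -> `|clamp lo hi t - clamp lo hi t'| <= `|t - t'|.
Proof.
wlog tt : t t' / t <= t'.
 move=> H lh; case/orP: (le_total t t') => tt; first exact: H.
 by rewrite distrC (distrC t); apply: H.
move=> lh; rewrite distrC (distrC t) !ger0_norm ?subr_ge0 ?clamp_mono //.
rewrite /clamp; case: (lerP t lo) => h1; case: (lerP t' lo) => h2; rewrite ?lexx //;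
 try case: (lerP hi t) => h3; try case: (lerP hi t') => h4; lra.
Qed.
(** Retracts the plane onto a square, to extend a function from a disc to the whole plane. As
    [3 / 2] exceeds 1, it is the identity near the unit square; its values have modulus below 4,
    whence the scaling by [r / 4]. *)
Definition cclamp (z : C) := pt (clamp (- (3 / 2)) (3 / 2) (Re z)) (clamp (- (3 / 2)) (3 / 2) (Im z)).

Lemma cont_cclamp z : cont cclamp z.
Proof.
have le : - (3 / 2) <= 3 / 2 :> R by lra.
move=> e e0; exists (e / 2); first by rewrite divr_gt0.
move=> w hw; apply: le_lt_trans (nm_pt _ _ _ _) _; rewrite [ltRHS]splitr.
apply: ler_ltD; first apply: ltW; apply: le_lt_trans (clamp_lip _ _ le) _; apply: le_lt_trans hw;
 rewrite -raddfB; [exact: ge_nm_Re|exact: ge_nm_Im].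
Qed.
Lemma cclamp_bound z : nm (cclamp z) < 4.
Proof.
have le : - (3 / 2) <= 3 / 2 :> R by lra.
have := nm_pt (clamp (- (3 / 2)) (3 / 2) (Re z)) (clamp (- (3 / 2)) (3 / 2) (Im z)) 0 0.
rewrite {2}/pt mulr0 addr0 !subr0 => /le_lt_trans; apply.
have [/andP[h1 h2] _] := clampP (Re z) le; have [/andP[h3 h4] _] := clampP (Im z) le.
have : `|clamp (- (3 / 2)) (3 / 2) (Re z)| <= 3 / 2 by rewrite ler_norml h1.
have : `|clamp (- (3 / 2)) (3 / 2) (Im z)| <= 3 / 2 by rewrite ler_norml h3.
by clear; move: (`|_|) (`|_|) => *; lra.
Qed.
Lemma cclamp_id z : `|Re z| < 3 / 2 -> `|Im z| < 3 / 2 -> cclamp z = z.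
Proof.
rewrite !ltr_norml => /andP[h1 h2] /andP[h3 h4]; rewrite [RHS]complexRI /cclamp /clamp.
by rewrite !ifF //; apply/negbTE; rewrite -ltNge.
Qed.
Lemma sq_extend (f : C -> C) r S : 0 < r -> (forall z, nm z < r -> cont f z) ->
 (forall z, nm z < r -> z != 0 \/ S = [::] -> exists D, cder f z D) -> (S = [::] \/ S = [:: 0]) ->
 exists2 F, sqhol S F & forall z, nm z < 1 -> F z = f ((r / 4)%:C * z).
Proof.
move=> r0 fc fd hS; have r4 : 0 < r / 4 by rewrite divr_gt0.
have nr4 : nm (r / 4)%:C = r / 4 by rewrite nmC gtr0_norm.
have sm z : nm ((r / 4)%:C * cclamp z) < r.
 by rewrite nmM nr4 -[ltRHS](divfK (_ : 4 != 0)) // ltr_pM2l // cclamp_bound.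
have hid x y : -1 <= x <= 1 -> -1 <= y <= 1 -> forall w, nm (w - pt x y) < 1 / 2 -> cclamp w = w.
 move=> /andP[x1 x2] /andP[y1 y2] w hw; apply: cclamp_id.
  have := le_lt_trans (ge_nm_Re _) hw; rewrite ReB RePt !ltr_norml.
  by move: (Re w) => X; clear -x1 x2 => /andP[? ?]; apply/andP; split; lra.
 have := le_lt_trans (ge_nm_Im _) hw; rewrite ImB ImPt !ltr_norml.
 by move: (Im w) => X; clear -y1 y2 => /andP[? ?]; apply/andP; split; lra.
exists (fun z => f ((r / 4)%:C * cclamp z)).
 split.
  move=> w; apply: (@cont_comp _ (fun w => (r / 4)%:C * cclamp w)); last exact: fc.
  by apply: contM; [exact: cont_cst | exact: cont_cclamp].
 move=> x y hx hy nS.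
 have ptE : cclamp (pt x y) = pt x y by apply: (hid x y) => //; rewrite subrr nm0; lra.
 have [D hD] : exists D, cder f ((r / 4)%:C * pt x y) D.
  apply: fd; first by rewrite -ptE.
  case: hS => hS; [by right|left]; rewrite mulf_neq0 //; last by move: nS; rewrite hS inE.
  by rewrite (inj_eq (@complexI R)) gt_eqF.
 have := cder_comp (cderM (cder_cst (r / 4)%:C (pt x y)) (cder_id (pt x y))) hD.
 move=> h; eexists; apply: cder_eq h; exists (1 / 2); first lra.
 by move=> w /(hid _ _ hx hy) ->.
move=> z hz; rewrite cclamp_id //; apply: le_lt_trans (lt_trans hz _); (exact: ge_nm_Re || exact: ge_nm_Im || lra).
Qed.
Definition hol (f : C -> C) (r : R) := 0 < r /\ forall z, nm z < r -> exists D, cder f z D.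

Lemma hol_der f r : hol f r -> exists g r', 0 < r' /\ forall z, nm z < r' -> cder f z (g z) /\ exists D, cder g z D.
Proof.
move=> [r0 fd]; have [|||F [Fc Fd] FE] := @sq_extend f r [::] r0.
- by move=> w /fd[D /cder_cont].
- by move=> w hw _; apply: fd.
- by left.
have [|g hg] := @sqhol_der F; first by split=> // x y hx hy _; apply: Fd.
pose s := (r / 4)%:C : C; have s0 : s != 0 by rewrite (inj_eq (@complexI R)) gt_eqF ?divr_gt0.
have ns : 0 < nm s by rewrite nm_gt0.
exists (fun z => g (s^-1 * z) * s^-1), (nm s * (1 / 2)); split; first by rewrite mulr_gt0 //; lra.
move=> z hz; have hz' : nm (s^-1 * z) < 1 / 2 by rewrite nmM nmV mulrC ltr_pdivrMr // mulrC.
have [h1 [D h2]] := hg _ hz'.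
have lin : cder (fun w => s^-1 * w) z s^-1.
 by have := cderM (cder_cst s^-1 z) (cder_id z); rewrite mul0r add0r mulr1.
split; last by eexists; apply: cderM (cder_comp lin h2) (cder_cst _ _).
apply: cder_eq (cder_comp lin h1); exists (nm s * (1 / 2)); first by rewrite mulr_gt0 //; lra.
move=> w hw; rewrite FE ?mulVKf // nmM nmV mulrC ltr_pdivrMr // mul1r.
rewrite -[w](subrK z); apply: le_lt_trans (nmD _ _) _.
by move: hw hz; rewrite mul1r => hw hz; rewrite [ltRHS]splitr; apply: ltrD.
Qed.
(** The quotient by [z] is continuous and differentiable off 0, and [sqhol_der] gives
    differentiability at 0. *)
Lemma sqhol_div f : sqhol [::] f -> f 0 = 0 -> exists2 g, sqhol [::] g & forall z, f z = z * g z.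
Proof.
move=> [fc fd] f0; have [D [phi [p1 p2 p3]]] : exists D, cder f 0 D.
 have -> : 0 = pt 0 0 :> C by rewrite /pt mulr0 addr0.
 by apply: fd => //; apply/andP; split; lra.
have pE w : w != 0 -> phi w = f w * w^-1 by move=> w0; have := p1 w; rewrite f0 !subr0 => ->; rewrite mulfK.
have pc w : cont phi w.
 have [->//|w0] := eqVneq w 0.
 apply: (@cont_eq _ (fun v => f v * v^-1)); last by apply: contM => //; apply: contV => //; apply: cont_id.
 exists (nm w); first by rewrite nm_gt0.
 by move=> v hv; rewrite pE //; apply: contraTneq hv => ->; rewrite sub0r nmN ltxx.
have pd w D' : w != 0 -> cder f w D' -> exists D, cder phi w D.
 move=> w0 h; eexists; apply: cder_eq (cderM h (cderV w0 (cder_id w))).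
 exists (nm w); first by rewrite nm_gt0.
 by move=> v hv; rewrite pE //; apply: contraTneq hv => ->; rewrite sub0r nmN ltxx.
have hp : sqhol [:: 0] phi.
 by split=> // x y hx hy; rewrite inE => w0; have [D' h] := fd _ _ hx hy isT; apply: pd h.
exists phi; last by move=> z; have := p1 z; rewrite f0 !subr0 mulrC.
split=> // x y hx hy _; have [e0|w0] := eqVneq (pt x y) 0.
 have [g hg] := sqhol_der hp; have [|h _] := hg 0; first by rewrite nm0; lra.
 by rewrite e0; exists (g 0).
by have [D' h] := fd _ _ hx hy isT; apply: pd h.
Qed.
(** If division by [z] never stops, [f] is [z ^+ N] times some [g] for every [N]. On the boundary,
    where moduli are at least 1, [g] is bounded like [f], so inside [nm (f z)] is at most
    [72 * M / 2 ^+ N]. *)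
Lemma sqhol_order f : sqhol [::] f -> (forall z, nm z < 1 / 2 -> f z = 0) \/
 exists k u, [/\ sqhol [::] u, u 0 != 0 & forall z, f z = z ^+ k * u z].
Proof.
move=> hf; have [[k [u [h1 h2 h3]]]|nk] := pselect (exists k u, [/\ sqhol [::] u, u 0 != 0 & forall z, f z = z ^+ k * u z]).
 by right; exists k, u.
left=> z hz; have hk k : exists2 g, sqhol [::] g & forall z, f z = z ^+ k * g z.
 elim: k => [|k [g hg gE]]; first by exists f => // w; rewrite expr0 mul1r.
 have g0 : g 0 = 0 by apply/eqP; apply: contrapT => /negP g0; apply: nk; exists k, g.
 by have [h hh hE] := sqhol_div hg g0; exists h => // w; rewrite gE hE exprSr mulrA.
have [M M0 hM] := edge_bound (fun w _ => hf.1 w).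
apply/eqP; rewrite -nm_eq0; apply/eqP/le_anti; rewrite nm_ge0 andbT.
apply/ler_addgt0Pr => e e0; rewrite add0r.
have [|N hN] := @half_lim (72 * M) e _ e0; first by rewrite mulr_ge0 // ltW.
apply: le_trans (ltW (hN N (leqnn _))); have [g [gc gd] gE] := hk N.
rewrite gE nmM nmX mulrC -exprVn; apply: ler_pM; rewrite ?exprn_ge0 ?nm_ge0 //; last first.
 by apply: lerXn2r; rewrite ?nnegrE ?nm_ge0 ?invr_ge0 // -[2^-1]mul1r ltW.
apply: sqhol_bound => //; first by split=> // x y hx hy _; apply: gd.
move=> w ew e1 e2; apply: le_trans (hM w ew e1 e2); rewrite gE nmM nmX ler_peMl ?nm_ge0 //.
apply: exprn_ege1; case: ew => <-; [exact: ge_nm_Re|exact: ge_nm_Im].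
Qed.
Lemma hol_order f r : hol f r -> (forall z, nm z < r / 8 -> f z = 0) \/
 exists k u r', [/\ hol u r', u 0 != 0 & forall z, nm z < r' -> f z = z ^+ k * u z].
Proof.
move=> [r0 fd]; have [|||F hF FE] := @sq_extend f r [::] r0.
- by move=> w /fd[D /cder_cont].
- by move=> w hw _; apply: fd.
- by left.
pose s := (r / 4)%:C : C; have s0 : s != 0 by rewrite (inj_eq (@complexI R)) gt_eqF ?divr_gt0.
have ns : 0 < nm s by rewrite nm_gt0.
have ns2 : 0 < nm s * (1 / 2) by rewrite mulr_gt0 //; lra.
have small z : nm z < nm s * (1 / 2) -> nm (s^-1 * z) < 1 / 2.
 by move=> hz; rewrite nmM nmV mulrC ltr_pdivrMr // mulrC.
have fE z : nm z < nm s * (1 / 2) -> f z = F (s^-1 * z).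
 by move=> /small hz; rewrite FE ?mulVKf //; apply: lt_trans hz _; lra.
have [h|[k [u [[uc ud] u0 uE]]]] := sqhol_order hF.
 have nsE : r / 8 = nm s * (1 / 2) by rewrite nmC gtr0_norm ?divr_gt0 //; field.
 by left => z; rewrite nsE => hz; rewrite fE // h // small.
right; exists k, (fun z => s^-1 ^+ k * u (s^-1 * z)), (nm s * (1 / 2)); split.
- split=> // z /small hz; have [D hD] : exists D, cder u (s^-1 * z) D.
  rewrite [s^-1 * z]complexRI; apply: ud => //; rewrite -ler_norml ltW //; apply: lt_trans (_ : 1 / 2 < 1); try lra.
   exact: le_lt_trans (ge_nm_Re _) hz.
  exact: le_lt_trans (ge_nm_Im _) hz.
 have lin : cder (fun w => s^-1 * w) z s^-1.
  by have := cderM (cder_cst s^-1 z) (cder_id z); rewrite mul0r add0r mulr1.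
 by eexists; apply: cderM (cder_cst _ _) (cder_comp lin hD).
- by rewrite mulr0 mulf_neq0 // expf_neq0 // invr_eq0.
by move=> z hz; rewrite fE // uE exprMn; ring.
Qed.
End Goursat.

(** * Continuity of roots and of factors *)

Section RootClusters.
Variable R : realType.
Notation C := R[i].

Lemma prodXsubC_perm (s t : seq C) : \prod_(x <- s) ('X - x%:P) = \prod_(x <- t) ('X - x%:P) -> perm_eq s t.
Proof.
elim: s t => [|x s IH] t.
 rewrite big_nil => /esym e; have : size (\prod_(x <- t) ('X - x%:P)) = 1%N by rewrite e size_poly1.
 by rewrite size_prod_XsubC => -[/size0nil->].
move=> e; have xt : x \in t by rewrite -root_prod_XsubC -e root_prod_XsubC mem_head.
rewrite perm_sym (perm_trans (perm_to_rem xt)) // perm_cons perm_sym; apply: IH.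
move: e; rewrite big_cons (big_rem _ xt) /=; by apply: mulfI; rewrite polyXsubC_eq0.
Qed.
(** With [K] the bound for [t], one more factor gives at most [K + M * K] for coefficients and
    [K * e + (M + 1) * (K * e) + e * K] for differences, whence the base [M + 3]. *)
Lemma prodXsubC_close (M e : R) (t : seq (C * C)) : 0 <= M -> 0 <= e <= 1 ->
 {in t, forall p, nm p.2 <= M /\ nm (p.1 - p.2) <= e} -> forall l,
 nm (\prod_(p <- t) ('X - p.2%:P))`_l <= (M + 3) ^+ size t /\
 nm (\prod_(p <- t) ('X - p.1%:P) - \prod_(p <- t) ('X - p.2%:P))`_l <= (M + 3) ^+ size t * e.
Proof.
move=> M0 /andP[e0 e1]; elim: t => [|p t IH] h l.
 have E0 : (1 - 1 : {poly C})`_l = 0 by rewrite subrr coef0.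
 rewrite !big_nil E0 nm0 expr0 coef1; split; last by rewrite mul1r.
 by case: (l == 0%N); rewrite ?nm1 ?nm0 ?lexx ?ler01.
have [h1 h2] := h p (mem_head _ _).
have {}IH m := IH (fun q qt => h q (mem_behead (s := p :: t) qt)) m.
set P := \prod_(p <- t) ('X - p.2%:P) in IH *; set P' := \prod_(p <- t) ('X - p.1%:P) in IH *.
pose K := (M + 3) ^+ size t; have K0 : 0 <= K by rewrite exprn_ge0 // addr_ge0.
rewrite !big_cons -/P -/P' exprS -/K.
have cX (q : {poly C}) : nm ('X * q)`_l <= nm q`_l.-1 by rewrite coefXM; case: eqP => // _; rewrite nm0 nm_ge0.
split.
 rewrite mulrBl coefB mul_polyC coefZ.
 apply: le_trans (nmD _ _) _; rewrite nmN nmM.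
 have b1 := le_trans (cX P) (IH l.-1).1; have b2 := (IH l).1; rewrite -/K in b1 b2.
 have b3 : nm p.2 * nm P`_l <= M * K by apply: ler_pM; rewrite ?nm_ge0.
 by clear -b1 b3 K0; move: (nm ('X * P)`_l) (_ * nm _) b1 b3 => u v b1 b3; rewrite mulrDl; lra.
have -> : ('X - p.1%:P) * P' - ('X - p.2%:P) * P = 'X * (P' - P) - p.1 *: (P' - P) - (p.1 - p.2) *: P.
 by rewrite -!mul_polyC polyCB; ring.
rewrite coefB coefZ coefB coefZ.
have b1 := le_trans (cX (P' - P)) (IH l.-1).2; have b2 := (IH l).2; have b3 := (IH l).1.
rewrite -/K in b1 b2 b3.
have n1 : nm p.1 <= M + 1 by rewrite -[p.1](subrK p.2); apply: le_trans (nmD _ _) _; clear -h1 h2 e1; lra.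
apply: le_trans (nmD _ _) _; rewrite nmN nmM.
have c1 : nm (('X * (P' - P))`_l - p.1 * (P' - P)`_l) <= K * e + (M + 1) * (K * e).
 by apply: le_trans (nmD _ _) _; rewrite nmN nmM; apply: lerD => //; apply: ler_pM; rewrite ?nm_ge0.
have c2 : nm (p.1 - p.2) * nm P`_l <= e * K by apply: ler_pM; rewrite ?nm_ge0.
have -> : (M + 3) * K * e = K * e + (M + 1) * (K * e) + e * K by ring.
exact: lerD.
Qed.
Lemma root_bound n (p : {poly C}) x : size p = n.+1 -> p \is monic -> root p x ->
 nm x <= 1 + \sum_(i < n) nm p`_i.
Proof.
move=> sn mp rx.
have S0 : 0 <= \sum_(i < n) nm p`_i by apply: sumr_ge0 => i _; apply: nm_ge0.
have [x1|x1] := lerP (nm x) 1; first by apply: le_trans x1 _; rewrite lerDl.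
have pn : p`_n = 1 by rewrite -(monicP mp) lead_coefE sn.
move/eqP: rx; rewrite horner_coef sn big_ord_recr /= pn mul1r addrC => /eqP; rewrite addr_eq0 => /eqP xE.
case: n sn pn xE S0 => [|n] sn pn xE S0.
 by move: xE; rewrite big_ord0 oppr0 expr0 => /eqP; rewrite oner_eq0.
apply: le_trans (_ : \sum_(i < n.+1) nm p`_i <= _); last by rewrite lerDr.
have xp : 0 < nm x ^+ n by rewrite exprn_gt0 // (lt_trans ltr01).
rewrite -(ler_pM2r xp) -exprS -(nmX x n.+1) xE nmN; apply: le_trans (nm_sum _ _ _) _.
rewrite mulr_suml; apply: ler_sum => i _; rewrite nmM nmX; apply: ler_wpM2l; first exact: nm_ge0.
by apply: ler_weXn2l; [exact: ltW | rewrite -ltnS].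
Qed.
Lemma finite_pos (T : finType) (P : T -> Prop) (F : T -> R) : (forall t, P t -> 0 < F t) ->
 exists2 d, 0 < d & forall t, P t -> d <= F t.
Proof.
move=> h; pose G t := if pselect (P t) is left _ then F t else 1.
have G0 t : 0 < G t by rewrite /G; case: pselect => // p; apply: h.
exists (\big[Num.min/1]_t G t).
 by elim/big_ind: _ => // x y x0 y0; rewrite lt_min x0.
move=> t Pt; apply: le_trans (_ : G t <= _); last by rewrite /G; case: pselect.
by rewrite (bigD1 t) //= ge_min lexx.
Qed.
Lemma third_sum (u v w d : R) : u <= w -> v < d / 3 -> w <= d / 3 -> 0 < d -> u + v < d.
Proof. by lra. Qed.

Section Cluster.
Variables (n : nat) (Q : C -> {poly C}) (z0 : C).
Hypothesis Qm : forall z, Q z \is monic.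
Hypothesis Qs : forall z, size (Q z) = n.+1.
Hypothesis Qc : forall i, cont (fun z => (Q z)`_i) z0.

Definition rts z : seq C := projT1 (closed_field_poly_normal (Q z)).
Lemma rtsE z : Q z = \prod_(x <- rts z) ('X - x%:P).
Proof. by rewrite /rts; case: closed_field_poly_normal => /= r {1}->; rewrite (monicP (Qm z)) scale1r. Qed.
Lemma size_rts z : size (rts z) = n.
Proof. by apply: succn_inj; rewrite -(Qs z) rtsE size_prod_XsubC. Qed.
Lemma root_rts z x : root (Q z) x = (x \in rts z). Proof. by rewrite rtsE root_prod_XsubC. Qed.
Lemma coef_close e : 0 < e -> exists2 r : R, 0 < r & forall z, nm (z - z0) < r -> forall i, nm (Q z - Q z0)`_i < e.
Proof.
move=> e0; have /choice[r hr] : forall i : 'I_n.+1, exists r : R, 0 < r /\ forall z, nm (z - z0) < r -> nm (Q z - Q z0)`_i < e.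
 move=> i; have [r r0 h] := Qc i e0; exists r; split=> // z /h; by rewrite coefB.
have [d d0 hd] := @finite_pos 'I_n.+1 (fun=> True) r (fun i _ => (hr i).1).
exists d => // z hz i; have [lt|ge] := ltnP i n.+1.
 by apply: ((hr (Ordinal lt)).2 z); apply: lt_le_trans hz (hd _ I).
by rewrite nth_default ?nm0 // (leq_trans (size_polyD _ _)) // size_polyN !Qs maxnn.
Qed.
(** A root [x] of [Q z] at distance at least [e] from all roots of [Q z0] would make [(Q z0).[x]] at
    least [e ^+ n] in modulus, although it is close to [(Q z).[x] = 0]. *)
Lemma root_close e : 0 < e -> exists2 r : R, 0 < r & forall z, nm (z - z0) < r ->
 {in rts z, forall x, exists2 a, a \in rts z0 & nm (x - a) < e}.
Proof.
move=> e0; pose B := 1 + \sum_(i < n) (nm (Q z0)`_i + 1).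
have B1 : 1 <= B by rewrite lerDl; apply: sumr_ge0 => i _; rewrite addr_ge0 ?nm_ge0.
have B0 : 0 < B by apply: lt_le_trans B1.
pose d := Num.min 1 (e ^+ n / (n.+1%:R * B ^+ n)).
have den : 0 < n.+1%:R * B ^+ n by rewrite mulr_gt0 ?ltr0n ?exprn_gt0.
have d0 : 0 < d by rewrite lt_min ltr01 divr_gt0 // exprn_gt0.
have [r r0 hr] := coef_close d0; exists r => // z hz x xz.
have xB : nm x <= B.
 have rx : root (Q z) x by rewrite root_rts.
 apply: le_trans (root_bound (Qs z) (Qm z) rx) _; rewrite lerD2l; apply: ler_sum => i _; have := hr z hz i; rewrite coefB lt_min => /andP[h _].
 rewrite -[(Q z)`_i](subrK (Q z0)`_i) addrC; apply: le_trans (nmD _ _) _; by rewrite lerD2l ltW.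
apply: contrapT => na; have {na}na a : a \in rts z0 -> e <= nm (x - a).
 by move=> az; rewrite leNgt; apply/negP => h; apply: na; exists a.
have lo : e ^+ n <= nm (Q z0).[x].
 rewrite rtsE horner_prod -(size_rts z0); elim: (rts z0) na => [|a s IH] na; first by rewrite big_nil nm1 expr0.
 rewrite big_cons nmM /= exprS; apply: ler_pM; rewrite ?exprn_ge0 ?(ltW e0) //.
  by rewrite !hornerE; apply: na; rewrite mem_head.
 by apply: IH => b bs; apply: na; rewrite inE bs orbT.
move: lo; apply/negP; rewrite -ltNge.
have -> : (Q z0).[x] = - (Q z - Q z0).[x].
 by rewrite hornerD hornerN; move: xz; rewrite -root_rts => /eqP->; rewrite sub0r opprK.
have sw : (size (Q z - Q z0)%R <= n.+1)%N by rewrite (leq_trans (size_polyD _ _)) // size_polyN !Qs maxnn.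
rewrite nmN (horner_coef_wide _ sw); apply: le_lt_trans (nm_sum _ _ _) _.
have [i0 _] : exists i : 'I_n.+1, True by exists ord0.
apply: lt_le_trans (_ : \sum_(i < n.+1) (e ^+ n / (n.+1%:R * B ^+ n)) * B ^+ n <= _).
 apply: ltr_sum; first by apply/hasP; exists i0 => //; rewrite mem_index_enum.
 move=> i _; rewrite nmM nmX.
 have h1 : nm (Q z - Q z0)`_i < e ^+ n / (n.+1%:R * B ^+ n).
  by apply: lt_le_trans (hr z hz i) _; rewrite ge_min lexx orbT.
 apply: le_lt_trans (_ : nm (Q z - Q z0)`_i * B ^+ n < _); last by rewrite ltr_pM2r // exprn_gt0.
 apply: ler_wpM2l; first exact: nm_ge0.
 apply: le_trans (_ : B ^+ i <= _); first by apply: lerXn2r; rewrite ?nnegrE ?nm_ge0 // ltW.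
 by apply: ler_weXn2l => //; rewrite -ltnS.
rewrite sumr_const card_ord -(mulr_natr (_ * _)).
have Bn : B ^+ n != 0 by rewrite gt_eqF // exprn_gt0.
have N0 : n.+1%:R != 0 :> R by rewrite pnatr_eq0.
move: (B ^+ n) (n.+1%:R : R) (e ^+ n) Bn N0 => b N x' b0 N0.
by rewrite le_eqVlt; apply/orP; left; apply/eqP; field; rewrite ?b0 ?N0.
Qed.
Definition cluster (D : pred C) z : {poly C} := \prod_(x <- rts z | D x) ('X - x%:P).

(** A map [f] of indices sends each root of [Q z] to a close root of [Q z0]. The finitely many
    products [Qf f] other than [Q z0] stay away from it, so near [z0] the map respects
    multiplicities. As [D] is locally constant at the roots, it selects corresponding roots on both
    sides. *)
Lemma cluster_cont (D : pred C) :
 (forall a, a \in rts z0 -> exists2 r : R, 0 < r & forall w, nm (w - a) < r -> D w = D a) ->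
 (exists2 r : R, 0 < r & forall z, nm (z - z0) < r -> size (cluster D z) = size (cluster D z0)) /\
 forall l, cont (fun z => (cluster D z)`_l) z0.
Proof.
move=> Dloc; pose L i := nth 0 (rts z0) i.
have Lin (i : 'I_n) : L i \in rts z0 by rewrite mem_nth // size_rts.
have /choice[rD hrD] : forall i : 'I_n, exists r : R, 0 < r /\ forall w, nm (w - L i) < r -> D w = D (L i).
 by move=> i; have [r r0 h] := Dloc _ (Lin i); exists r.
have [d1 d10 hd1] := @finite_pos 'I_n (fun=> True) rD (fun i _ => (hrD i).1).
pose Qf (f : {ffun 'I_n -> 'I_n}) : {poly C} := \prod_(j < n) ('X - (L (f j))%:P).
have /choice[lf hlf] : forall f, exists l, Qf f != Q z0 -> (Qf f - Q z0)`_l != 0.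
 move=> f; have [|/eqP nf] := eqVneq (Qf f) (Q z0); first by exists 0%N.
 apply: contrapT => h; apply: nf; apply/polyP => l; apply/eqP; rewrite -subr_eq0 -coefB.
 by apply: contrapT => /negP hl; apply: h; exists l.
have [d2 d20 hd2] := @finite_pos {ffun 'I_n -> 'I_n} (fun f => Qf f != Q z0) (fun f => nm (Qf f - Q z0)`_(lf f))
  (fun f h => etrans (nm_gt0 _) (hlf f h)).
pose M := \sum_(x <- rts z0) nm x.
have M0 : 0 <= M by apply: sumr_ge0 => x _; apply: nm_ge0.
have LM (i : 'I_n) : nm (L i) <= M.
 by rewrite /M (big_rem _ (Lin i)) /= lerDl; apply: sumr_ge0 => x _; apply: nm_ge0.
pose K := (M + 3) ^+ n; have K1 : 1 <= K by apply: exprn_ege1; apply: ler_wpDl; rewrite ?ler1n.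
have K0 : 0 < K by apply: lt_le_trans K1.
suff main e : 0 < e -> e <= 1 -> e <= d1 -> K * e <= d2 / 3 -> exists2 r : R, 0 < r & forall z, nm (z - z0) < r ->
  size (cluster D z) = size (cluster D z0) /\ forall l, nm (cluster D z - cluster D z0)`_l <= K * e.
 split.
  pose e := Num.min 1 (Num.min d1 (d2 / 3 / K)).
  have e0 : 0 < e by rewrite !lt_min ltr01 d10 !divr_gt0.
  have p1 : e <= 1 by rewrite ge_min lexx.
  have p2 : e <= d1 by rewrite !ge_min lexx orbT.
  have p3 : K * e <= d2 / 3 by rewrite mulrC -ler_pdivlMr // !ge_min lexx !orbT.
  have [r r0 hr] := main e e0 p1 p2 p3.
  by exists r => // z /hr[].
 move=> l e e0; pose e' := Num.min (e / K / 2) (Num.min 1 (Num.min d1 (d2 / 3 / K))).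
 have e'0 : 0 < e' by rewrite !lt_min ltr01 d10 !divr_gt0.
 have p1 : e' <= 1 by rewrite !ge_min lexx orbT.
 have p2 : e' <= d1 by rewrite !ge_min lexx !orbT.
 have p3 : K * e' <= d2 / 3 by rewrite mulrC -ler_pdivlMr // !ge_min lexx !orbT.
 have [r r0 hr] := main e' e'0 p1 p2 p3.
 exists r => // z /hr[_ /(_ l)]; rewrite coefB => /le_lt_trans; apply.
 rewrite mulrC -ltr_pdivlMr // gt_min; apply/orP; left.
 by rewrite ltr_pdivrMr // ltr_pMr ?ltr1n // divr_gt0.
move=> e0 e1 ed1 eK.
have [r1 r10 h1] := root_close e0; have [|r2 r20 h2] := @coef_close (d2 / 3); first by rewrite divr_gt0.
exists (Num.min r1 r2); first by rewrite lt_min r10.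
move=> z; rewrite lt_min => /andP[/h1 {}h1 /h2 {}h2].
have /choice[f0 hf0] : forall j : 'I_n, exists i : 'I_n, nm (nth 0 (rts z) j - L i) < e.
 move=> j; have [|a az ha] := h1 (nth 0 (rts z) j); first by rewrite mem_nth // size_rts.
 have lt : (index a (rts z0) < n)%N by rewrite -(size_rts z0) index_mem.
 by exists (Ordinal lt); rewrite /L /= nth_index.
pose f := [ffun j => f0 j].
have rz (P : pred C) : \prod_(x <- rts z | P x) ('X - x%:P) = \prod_(j < n | P (nth 0 (rts z) j)) ('X - (nth 0 (rts z) j)%:P).
 by rewrite (big_nth 0) big_mkord size_rts.
pose t (P : pred 'I_n) := [seq (nth 0 (rts z) (nat_of_ord j), L (f j)) | j <- enum 'I_n & P j].
have t1 (P : pred 'I_n) : \prod_(p <- t P) ('X - p.1%:P) = \prod_(j < n | P j) ('X - (nth 0 (rts z) j)%:P).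
 by rewrite big_map big_filter big_enum_cond.
have t2 (P : pred 'I_n) : \prod_(p <- t P) ('X - p.2%:P) = \prod_(j < n | P j) ('X - (L (f j))%:P).
 by rewrite big_map big_filter big_enum_cond.
have tc (P : pred 'I_n) : {in t P, forall p, nm p.2 <= M /\ nm (p.1 - p.2) <= e}.
 by move=> _ /mapP[j _ ->]; split; [exact: LM | rewrite /= ffunE ltW].
have st (P : pred 'I_n) : (size (t P) <= n)%N.
 by rewrite size_map size_filter (leq_trans (count_size _ _)) // size_enum_ord.
have close (P : pred 'I_n) l : nm (\prod_(j < n | P j) ('X - (nth 0 (rts z) j)%:P) - \prod_(j < n | P j) ('X - (L (f j))%:P))`_l <= K * e.
 rewrite -t1 -t2; have [|_] := @prodXsubC_close M e (t P) M0 _ (tc P) l; first by rewrite (ltW e0).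
 move/le_trans; apply; apply: ler_wpM2r; first exact: ltW.
 by apply: ler_weXn2l => //; apply: ler_wpDl; rewrite ?ler1n.
have QfE : Qf f = Q z0.
 apply/eqP; apply: contrapT => /negP nf; have := hd2 f nf; apply/negP; rewrite -ltNge.
 have -> : Qf f - Q z0 = - (Q z - Qf f) + (Q z - Q z0) by ring.
 rewrite coefD coefN; apply: le_lt_trans (nmD _ _) _; rewrite nmN.
 have := close xpredT (lf f); rewrite -(rz xpredT) -rtsE -/(Qf f) => c1; have c2 := h2 (lf f).
 exact: third_sum c1 c2 eK d20.
have pe : perm_eq [seq L (f j) | j <- enum 'I_n] (rts z0).
 by apply: prodXsubC_perm; rewrite -rtsE -QfE big_map big_enum.
have Df (j : 'I_n) : D (nth 0 (rts z) j) = D (L (f j)).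
 by apply: (hrD (f j)).2; rewrite ffunE; apply: lt_le_trans (hf0 j) (le_trans ed1 (hd1 _ I)).
have cz : cluster D z = \prod_(p <- t (fun j => D (L (f j)))) ('X - p.1%:P).
 by rewrite t1 /cluster rz; apply: eq_bigl => j; rewrite Df.
have cz0 : cluster D z0 = \prod_(p <- t (fun j => D (L (f j)))) ('X - p.2%:P).
 by rewrite t2 /cluster -(perm_big _ pe) big_map big_enum_cond.
split; last by move=> l; rewrite cz cz0 t1 t2; apply: close.
rewrite cz cz0 -(big_map (fun p : C * C => p.1) xpredT (fun x => 'X - x%:P)).
by rewrite -(big_map (fun p : C * C => p.2) xpredT (fun x => 'X - x%:P)) !size_prod_XsubC !size_map.
Qed.
End Cluster.

Lemma cont_sum (I : Type) (r : seq I) (P : pred I) (F : I -> C -> C) z :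
 (forall i, P i -> cont (F i) z) -> cont (fun w => \sum_(i <- r | P i) F i w) z.
Proof.
move=> h; elim: r => [|i r IH].
 by apply: (@cont_eq _ (fun=> 0)); [exists 1 => // w _; rewrite big_nil | apply: cont_cst].
case Pi: (P i); last by apply: cont_ext IH => w; rewrite big_cons Pi.
apply: (@cont_eq _ (fun w => F i w + \sum_(j <- r | P j) F j w)); first by exists 1 => // w _; rewrite big_cons Pi.
by apply: contD => //; apply: h.
Qed.
Lemma cont_prod (I : Type) (r : seq I) (P : pred I) (F : I -> C -> C) z :
 (forall i, P i -> cont (F i) z) -> cont (fun w => \prod_(i <- r | P i) F i w) z.
Proof.
move=> h; elim: r => [|i r IH].
 by apply: (@cont_eq _ (fun=> 1)); [exists 1 => // w _; rewrite big_nil | apply: cont_cst].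
case Pi: (P i); last by apply: cont_ext IH => w; rewrite big_cons Pi.
apply: (@cont_eq _ (fun w => F i w * \prod_(j <- r | P j) F j w)); first by exists 1 => // w _; rewrite big_cons Pi.
by apply: contM => //; apply: h.
Qed.
Lemma cont_det p (M : C -> 'M[C]_p) z : (forall i j, cont (fun w => M w i j) z) -> cont (fun w => \det (M w)) z.
Proof.
move=> h; apply: cont_sum => s _; apply: contM; first exact: cont_cst.
by apply: cont_prod => i _; apply: h.
Qed.
Lemma cont_invmx p (M : C -> 'M[C]_p) z : (forall i j, cont (fun w => M w i j) z) -> \det (M z) != 0 ->
 forall i j, cont (fun w => invmx (M w) i j) z.
Proof.
move=> h d0 i j; have cd := cont_det h; have [r r0 hr] := cont_neq0 cd d0.
apply: (@cont_eq _ (fun w => (\det (M w))^-1 * cofactor (M w) j i)).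
 by exists r => // w /hr dw; rewrite /invmx unitmxE unitfE dw !mxE.
apply: contM; first exact: contV.
apply: contM; first exact: cont_cst.
apply: (@cont_det _ (fun w => row' j (col' i (M w)))) => k l.
by apply: cont_ext (h (lift j k) (lift i l)) => w; rewrite !mxE.
Qed.

(* The increment of a factor solves a linear system whose matrix tends to the identity. *)
Lemma factor_cder (Q A B : C -> {poly C}) z0 (r : R) p n : 0 < r ->
 (forall z, nm (z - z0) < r -> [/\ Q z = A z * B z, A z \is monic & size (A z) = p.+1]) ->
 (forall z, (size (Q z) <= n)%N /\ (size (B z) <= n)%N) -> coprimep (A z0) (B z0) ->
 (forall l, cont (fun z => (B z)`_l) z0) -> (forall l, exists D, cder (fun z => (Q z)`_l) z0 D) ->
 forall l, exists D, cder (fun z => (A z)`_l) z0 D.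
Proof.
move=> r0 hQ sQB cop Bc Qd l.
have z00 : nm (z0 - z0) < r by rewrite subrr nm0.
have [Q0 A0m A0s] := hQ _ z00; set A0 := A z0 in cop A0m A0s Q0 *; set B0 := B z0 in cop Q0 *.
have [lp|pl] := ltnP l p; last first.
 exists 0; apply: (cder_eq _ (cder_cst (if l == p then 1 else 0) z0)); exists r => // w /hQ[_ mA sA].
 case: eqP => [->|/eqP lp]; first by rewrite -(monicP mA) lead_coefE sA.
 by rewrite nth_default // sA ltn_neqAle eq_sym lp.
have [V hV] : exists V, A0 %| V * B0 - 1.
 have /Bezout_coprimepP[[u v] /= /eqpP[[c1 c2] /= /andP[c10 c20] E]] := cop.
 exists ((c1 / c2) *: v); apply/dvdpP; exists (- ((c1 / c2) *: u)).
 have <- : (c1 / c2) *: (u * A0 + v * B0) = 1 by rewrite mulrC -scalerA E scalerA mulVf // scale1r.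
 by rewrite -!mul_polyC; ring.
pose cf (P : {poly C}) i := (P %% A0)`_i.
have cfD P P' i : cf (P + P') i = cf P i + cf P' i by rewrite /cf modpD coefD.
have cfZ k P i : cf (k *: P) i = k * cf P i by rewrite /cf modpZl coefZ.
have cf_sum m (c : 'I_m -> C) (P : 'I_m -> {poly C}) i : cf (\sum_j c j *: P j) i = \sum_j c j * cf (P j) i.
 elim: m c P => [|m IH] c P; first by rewrite !big_ord0 /cf mod0p coef0.
 by rewrite !big_ord_recl cfD cfZ IH.
have /choice[D /choice[phi hphi]] : forall l, exists D, exists phi : C -> C, [/\ forall w, (Q w)`_l - (Q z0)`_l = phi w * (w - z0), phi z0 = D & cont phi z0].
 by move=> i; have [D [phi h]] := Qd i; exists D, phi.
pose dA z := A z - A0; pose dB z := B z - B0; pose dQ z := Q z - Q z0.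
pose X z : 'rV[C]_p := \row_a (dA z)`_a.
pose Phi z : 'rV[C]_p := \row_i \sum_(b < n) phi b z * cf (V * 'X^b) i.
pose M z : 'M[C]_p := \matrix_(a, i) ((a == i)%:R + \sum_(b < n) (dB z)`_b * cf (V * 'X^a * 'X^b) i).
have sz (P : {poly C}) m : (size P <= m)%N -> P = \sum_(j < m) P`_j *: 'X^j.
 by move=> h; rewrite -[LHS]coefK (poly_def) (big_ord_widen m (fun j => P`_j *: 'X^j)) // big_mkcond;
   apply: eq_bigr => j _; case: ltnP => // h'; rewrite nth_default // scale0r.
have sA z : nm (z - z0) < r -> (size (dA z) <= p)%N.
 move=> /hQ[_ mA sAz]; apply/leq_sizeP => j; rewrite leq_eqVlt => /orP[/eqP<-|pj]; rewrite coefB.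
  by rewrite -[p]/(p.+1.-1) -{1}sAz -A0s -!lead_coefE (monicP mA) (monicP A0m) subrr.
 by rewrite !nth_default ?subrr // ?sAz ?A0s.
have sB z : (size (dB z) <= n)%N.
 by rewrite (leq_trans (size_polyD _ _)) // size_polyN geq_max !(sQB _).2.
have sQ z : (size (dQ z) <= n)%N.
 by rewrite (leq_trans (size_polyD _ _)) // size_polyN geq_max !(sQB _).1.
have key z : nm (z - z0) < r -> X z *m M z = (z - z0) *: Phi z.
 move=> hz; apply/rowP => i; rewrite !mxE.
 have E : V * dQ z = dA z + V * dA z * dB z + A0 * (V * dB z) + (V * B0 - 1) * dA z.
  by rewrite /dQ; have [-> _ _] := hQ _ hz; rewrite Q0 /dA /dB; ring.
 have cE : cf (V * dQ z) i = cf (dA z) i + cf (V * dA z * dB z) i.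
  rewrite E !cfD; have -> : cf (A0 * (V * dB z)) i = 0 by rewrite /cf modp_mulr coef0.
  have -> : cf ((V * B0 - 1) * dA z) i = 0.
   by move/dvdpP: hV => [u ->]; rewrite /cf mulrAC modp_mull coef0.
  by rewrite !addr0.
 transitivity (cf (V * dQ z) i); last first.
  rewrite {1}(sz _ _ (sQ z)) mulr_sumr; under eq_bigr do rewrite -scalerAr.
  rewrite cf_sum mulr_sumr; apply: eq_bigr => b _; have [h _ _] := hphi b.
  by rewrite coefB h mulrAC mulrC mulrA.
 rewrite cE; under eq_bigr do rewrite !mxE mulrDr; rewrite big_split /=; congr (_ + _).
  rewrite (bigD1 i) //= eqxx mulr1 big1 ?addr0 => [|a /negPf->]; last by rewrite mulr0.
  by rewrite /cf modp_small // A0s ltnS sA.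
 have -> : V * dA z * dB z = \sum_(a < p) (dA z)`_a *: (V * 'X^a * dB z).
  by rewrite {1}(sz _ _ (sA z hz)) mulr_sumr mulr_suml; apply: eq_bigr => a _; rewrite -scalerAr -scalerAl.
 rewrite cf_sum; apply: eq_bigr => a _; congr (_ * _).
 have -> : V * 'X^a * dB z = \sum_(b < n) (dB z)`_b *: (V * 'X^a * 'X^b).
  by rewrite {1}(sz _ _ (sB z)) mulr_sumr; apply: eq_bigr => b _; rewrite -scalerAr.
 by rewrite cf_sum.
have Mc i j : cont (fun z => M z i j) z0.
 apply: (@cont_eq _ (fun z => (i == j)%:R + \sum_(b < n) ((B z)`_b - B0`_b) * cf (V * 'X^i * 'X^b) j)).
  by exists 1 => // z _; rewrite mxE; congr (_ + _); apply: eq_bigr => b _; rewrite coefB.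
 apply: contD; first exact: cont_cst.
 apply: cont_sum => b _; apply: contM; last exact: cont_cst.
 by apply: contD => //; apply: cont_cst.
have M1 : M z0 = 1%:M.
 apply/matrixP => i j; rewrite !mxE big1 ?addr0 // => b _.
 by rewrite /dB subrr coef0 mul0r.
have d0 : \det (M z0) != 0 by rewrite M1 det1 oner_neq0.
have [r1 r10 hr1] := cont_neq0 (cont_det Mc) d0.
pose lo := Ordinal lp; pose psi (z : C) : C := (Phi z *m invmx (M z)) 0 lo.
have XE z : nm (z - z0) < r -> nm (z - z0) < r1 -> (dA z)`_l = (z - z0) * psi z.
 move=> hz /hr1 dz; have uM : M z \in unitmx by rewrite unitmxE unitfE.
 have := congr1 (mulmxr (invmx (M z))) (key z hz); rewrite /= mulmxK // -scalemxAl.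
 move=> e; have := congr1 (fun v : 'rV[C]_p => v 0 lo) e; rewrite [in LHS]mxE => ->; exact: mxE.
exists (psi z0).
exists (fun z => if (nm (z - z0) < r) && (nm (z - z0) < r1) then psi z else ((A z)`_l - A0`_l) / (z - z0)); split.
- move=> z; case: ifP => [/andP[h1 h2]|h]; first by rewrite -coefB -/(dA z) XE // mulrC.
 rewrite mulfVK // subr_eq0; apply/eqP => e; move: h; by rewrite e subrr nm0 r0 r10.
- by rewrite subrr nm0 r0 r10.
suff h : cont psi z0.
 apply: cont_eq h; exists (Num.min r r1); first by rewrite lt_min r0.
 by move=> z; rewrite lt_min => ->.
suff h : cont (fun z : C => \sum_(a < p) (\sum_(b < n) phi b z * cf (V * 'X^b) a) * invmx (M z) a lo : C) z0.
 by apply: cont_ext h => z; rewrite /psi mxE; apply: eq_bigr => a _; rewrite mxE.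
apply: cont_sum => a _; apply: contM; last exact: cont_invmx.
apply: cont_sum => b _; apply: contM; last exact: cont_cst.
by have [_ _] := hphi b.
Qed.

(** * Holomorphic germs and Puiseux's theorem *)

Definition near0 (P : C -> Prop) := exists2 r : R, 0 < r & forall z, nm z < r -> P z.

Lemma near0_and P Q : near0 P -> near0 Q -> near0 (fun z => P z /\ Q z).
Proof.
move=> [r r0 hr] [s s0 hs]; exists (Num.min r s); first by rewrite lt_min r0.
by move=> z; rewrite lt_min => /andP[/hr ? /hs].
Qed.
Lemma near0_imp (P Q : C -> Prop) : (forall z, P z -> Q z) -> near0 P -> near0 Q.
Proof. by move=> h [r r0 hr]; exists r => // z /hr/h. Qed.
Lemma near0_pow P N : (0 < N)%N -> near0 P -> near0 (fun z => P (z ^+ N)).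
Proof.
move=> N0 [r r0 hr]; exists (Num.min r 1); first by rewrite lt_min r0 ltr01.
move=> z; rewrite lt_min => /andP[zr z1]; apply: hr; rewrite nmX; apply: le_lt_trans zr.
by case: N N0 => // N _; rewrite exprS ler_piMr ?nm_ge0 //; apply: exprn_ile1; rewrite ?nm_ge0 // ltW.
Qed.
Lemma near0_fin n (P : nat -> C -> Prop) : (forall i, (i < n)%N -> near0 (P i)) -> near0 (fun z => forall i, (i < n)%N -> P i z).
Proof.
elim: n => [|n IH] h; first by exists 1.
have {}IH := IH (fun i lt => h i (ltnW lt)).
apply: near0_imp (near0_and IH (h n (ltnSn n))) => z [h1 h2] i; rewrite ltnS leq_eqVlt => /orP[/eqP->//|]; exact: h1.
Qed.
Definition hg (f : C -> C) := exists r, hol f r.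

Lemma hg_near f : hg f <-> near0 (fun z => exists D, cder f z D).
Proof. by split=> [[r [r0 h]]|[r r0 h]]; exists r. Qed.
Lemma hg_cst c : hg (fun=> c).
Proof. by apply/hg_near; exists 1 => // z _; exists 0; apply: cder_cst. Qed.
Lemma hg_id : hg id.
Proof. by apply/hg_near; exists 1 => // z _; exists 1; apply: cder_id. Qed.
Lemma hgD f g : hg f -> hg g -> hg (fun z => f z + g z).
Proof.
move=> /hg_near hf /hg_near h; apply/hg_near; apply: near0_imp (near0_and hf h) => z [[D ?] [E ?]].
by exists (D + E); apply: cderD.
Qed.
Lemma hgM f g : hg f -> hg g -> hg (fun z => f z * g z).
Proof.
move=> /hg_near hf /hg_near h; apply/hg_near; apply: near0_imp (near0_and hf h) => z [[D ?] [E ?]].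
by exists (D * g z + f z * E); apply: cderM.
Qed.
Lemma hgN f : hg f -> hg (fun z => - f z).
Proof. by move=> /hg_near hf; apply/hg_near; apply: near0_imp hf => z [D ?]; exists (- D); apply: cderN. Qed.
Lemma hgX f n : hg f -> hg (fun z => f z ^+ n).
Proof. by move=> /hg_near hf; apply/hg_near; apply: near0_imp hf => z [D ?]; exists (n%:R * f z ^+ n.-1 * D); apply: cderX. Qed.
Lemma hg_cont f : hg f -> cont f 0.
Proof. by move=> [r [r0 h]]; have [|D /cder_cont] := h 0; rewrite ?nm0. Qed.
Lemma hg_neq0 f : hg f -> f 0 != 0 -> near0 (fun z => f z != 0).
Proof.
move=> /hg_cont cf f0; have [r r0 h] := cont_neq0 cf f0; exists r => // z hz; apply: h.
by rewrite subr0.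
Qed.
Lemma hgV f : hg f -> f 0 != 0 -> hg (fun z => (f z)^-1).
Proof.
move=> hf f0; apply/hg_near; move/hg_near: (hf) => h; have n0 := hg_neq0 hf f0.
by apply: near0_imp (near0_and h n0) => z [[D ?] ?]; exists (- (D / f z ^+ 2)); apply: cderV.
Qed.
Lemma hg_sum (I : Type) (r : seq I) (P : pred I) (F : I -> C -> C) :
 (forall i, P i -> hg (F i)) -> hg (fun w => \sum_(i <- r | P i) F i w).
Proof.
move=> h; elim: r => [|i r IH].
 by have -> : (fun w => \sum_(i <- [::] | P i) F i w) = (fun=> 0); [apply: funext => w; rewrite big_nil | apply: hg_cst].
have -> : (fun w => \sum_(j <- i :: r | P j) F j w) = (fun w => (if P i then F i w else 0) + \sum_(j <- r | P j) F j w).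
 by apply: funext => w; rewrite big_cons; case: (P i); rewrite ?add0r.
apply: hgD => //; case Pi: (P i); [exact: h|exact: hg_cst].
Qed.
Lemma hg_eq f g : near0 (fun z => f z = g z) -> hg f -> hg g.
Proof.
move=> [r r0 fg] [s [s0 hs]]; apply/hg_near; exists (Num.min r s); first by rewrite lt_min r0.
move=> z; rewrite lt_min => /andP[zr /hs[D hD]]; exists D; apply: cder_eq hD.
exists (r - nm z); first by rewrite subr_gt0.
by move=> w hw; apply: fg; apply: (@nm_ball _ z).
Qed.
Lemma hg_ext f g : f =1 g -> hg f -> hg g.
Proof. by move=> fg; apply: hg_eq; exists 1. Qed.
Lemma hg_pow f N : (0 < N)%N -> hg f -> hg (fun z => f (z ^+ N)).
Proof.
move=> N0 /hg_near/(near0_pow N0) h; apply/hg_near; apply: near0_imp h => z [D hD].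
by eexists; apply: cder_comp (cderX N (cder_id z)) hD.
Qed.
Lemma hg_order f : hg f -> near0 (fun z => f z = 0) \/
 exists k u, [/\ hg u, u 0 != 0 & near0 (fun z => f z = z ^+ k * u z)].
Proof.
move=> [r hr]; have [h|[k [u [r' [h1 h2 h3]]]]] := hol_order hr.
 by left; exists (r / 8) => //; case: hr => r0 _; rewrite divr_gt0.
by right; exists k, u; split=> //; exists r' => //; case: h1.
Qed.
(** Monic of fixed degree everywhere, not only near 0, so that statements on degrees require no
    neighbourhood. *)
Definition fam n (Q : C -> {poly C}) := (forall z, Q z \is monic /\ size (Q z) = n.+1) /\
 forall i, hg (fun z => (Q z)`_i).

Lemma fam_poly n (co : nat -> C -> C) : (forall z, co n z = 1) -> (forall i, hg (co i)) ->
 fam n (fun z => \poly_(i < n.+1) co i z).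
Proof.
move=> co1 hco; split=> [z|i]; first split.
- by apply/monicP; rewrite lead_coef_poly ?co1 ?oner_neq0.
- by rewrite size_poly_eq ?co1 ?oner_neq0.
have [lt|ge] := ltnP i n.+1; first by apply: hg_ext (hco i) => z; rewrite coef_poly lt.
by apply: hg_ext (hg_cst 0) => z; rewrite coef_poly ltnNge ge.
Qed.
Lemma quarter_gap (d x u v : R) : 0 < d -> d <= x -> x <= u + v -> v < 2 * (d / 4) -> d / 4 <= u.
Proof. lra. Qed.
Lemma add_lt2 (d u v : R) : u < d -> v < d -> u + v < 2 * d.
Proof. lra. Qed.
Lemma lt_twice (d u : R) : 0 < d -> u < d -> u < 2 * d.
Proof. lra. Qed.

(** The roots of [Q z] stay close to those of [A0] or of [B0], two sets at distance at least [d];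
    the factors collect the two clusters. They are continuous by [cluster_cont] and therefore
    differentiable by [factor_cder]. *)
Theorem hensel n (Q : C -> {poly C}) A0 B0 : fam n Q -> A0 \is monic -> B0 \is monic ->
 Q 0 = A0 * B0 -> coprimep A0 B0 ->
 exists A B, [/\ fam (size A0).-1 A, fam (size B0).-1 B & near0 (fun z => Q z = A z * B z)].
Proof.
move=> [Qms Qh] mA mB Q0 cop; have Qm z := (Qms z).1; have Qs z := (Qms z).2.
have [ra raE] := closed_field_poly_normal A0; have [rb rbE] := closed_field_poly_normal B0.
rewrite (monicP mA) scale1r in raE; rewrite (monicP mB) scale1r in rbE.
have dis a b : a \in ra -> b \in rb -> a != b.
 move=> ha hb; apply/eqP => e; move/Pdiv.ClosedField.coprimepP: cop => /(_ a).
 by rewrite raE root_prod_XsubC => /(_ ha); rewrite e rbE -/(root _ b) root_prod_XsubC hb.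
have [d d0 hd] := @finite_pos ('I_(size ra) * 'I_(size rb))%type (fun=> True)
  (fun t => nm (nth 0 ra t.1 - nth 0 rb t.2)) (fun t _ => etrans (nm_gt0 _) (etrans (congr1 negb (subr_eq0 _ _)) (dis _ _ (mem_nth 0 (ltn_ord t.1)) (mem_nth 0 (ltn_ord t.2))))).
have {}hd a b : a \in ra -> b \in rb -> d <= nm (a - b).
 move=> ha hb; have ia : (index a ra < size ra)%N by rewrite index_mem.
 have ib : (index b rb < size rb)%N by rewrite index_mem.
 by have := hd (Ordinal ia, Ordinal ib) I; rewrite /= !nth_index.
(* With a quarter, points within [2 * rho] of a root of [B0] remain at distance at least [rho] from
   the roots of [A0]. *)
pose rho := d / 4; have rho0 : 0 < rho by rewrite divr_gt0.
have r0E : perm_eq (rts Q 0) (ra ++ rb).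
 by apply: prodXsubC_perm; rewrite -rtsE // big_cat /= -raE -rbE.
pose D : pred C := fun w => has (fun a => nm (w - a) < rho) ra.
have [r1 r10 hr1] : near0 (fun z => forall i, (i < n.+1)%N -> exists D, cder (fun z => (Q z)`_i) z D).
 by apply: (@near0_fin _ (fun i z => exists D, cder (fun z => (Q z)`_i) z D)) => i _; apply/hg_near.
have {}hr1 z : nm z < r1 -> forall i, exists D, cder (fun z => (Q z)`_i) z D.
 move=> hz i; have [lt|ge] := ltnP i n.+1; first exact: hr1.
 exists 0; apply: (cder_eq _ (cder_cst 0 z)); exists 1 => // w _.
 by rewrite nth_default // Qs.
have Qc z i : nm z < r1 -> cont (fun z => (Q z)`_i) z by move=> hz; have [E /cder_cont] := hr1 z hz i.
have n0 : nm (0 : C) < r1 by rewrite nm0.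
have [r2 r20 hr2] := root_close Qm Qs (fun i => Qc _ i n0) rho0.
have Dfar b w : b \in rb -> nm (w - b) < 2 * rho -> D w = false.
 move=> hb hw; apply/negbTE/hasPn => a ha; rewrite -leNgt.
 have h1 := hd a b ha hb; have h2 := nmBD a b w; rewrite (nmB a w) in h2.
 exact: quarter_gap d0 h1 h2 hw.
have Dnear a : a \in ra -> D a by move=> ha; apply/hasP; exists a => //; rewrite subrr nm0.
have Dloc z : nm z < r1 -> nm z < r2 -> forall x, x \in rts Q z -> exists2 r : R, 0 < r & forall w, nm (w - x) < r -> D w = D x.
 move=> h1 h2 x hx; have [|a + hxa] := hr2 z _ x hx; first by rewrite subr0.
 rewrite (perm_mem r0E) mem_cat => /orP[ha|hb].
  exists (rho - nm (x - a)); first by rewrite subr_gt0.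
  move=> w hw; have -> : D x by apply/hasP; exists a.
  by apply/hasP; exists a => //; apply: le_lt_trans (nmBD w a x) _; rewrite -ltrBrDr.
 exists rho => // w hw; rewrite (Dfar _ _ hb); last first.
  by apply: le_lt_trans (nmBD w a x) _; apply: add_lt2 hw hxa.
 by rewrite (Dfar _ _ hb) //; apply: lt_twice hxa.
have DlocN z : nm z < r1 -> nm z < r2 -> forall x, x \in rts Q z -> exists2 r : R, 0 < r & forall w, nm (w - x) < r -> predC D w = predC D x.
 by move=> h1 h2 x hx; have [r r0 h] := Dloc z h1 h2 x hx; exists r => // w /h /= ->.
have n02 : nm (0 : C) < r2 by rewrite nm0.
have cA0 : cluster Q D 0 = A0.
 rewrite /cluster (perm_big _ r0E) big_cat /= [X in _ * X]big1_seq ?mulr1; last first.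
  by move=> b /andP[Db hb]; rewrite (Dfar b b hb) // subrr nm0 mulr_gt0 in Db.
 by rewrite raE big_seq_cond [RHS]big_seq; apply: eq_bigl => a; case ha: (a \in ra) => //=; rewrite Dnear.
have cB0 : cluster Q (predC D) 0 = B0.
 rewrite /cluster (perm_big _ r0E) big_cat /= [X in X * _]big1_seq ?mul1r; last first.
  by move=> a /andP[/negP Da /Dnear].
 rewrite rbE big_seq_cond [RHS]big_seq; apply: eq_bigl => b; case hb: (b \in rb) => //=.
 by rewrite (Dfar b b hb) // subrr nm0 mulr_gt0.
have [[r3 r30 hr3] _] := cluster_cont Qm Qs (fun i => Qc _ i n0) (Dloc 0 n0 n02).
have [[r4 r40 hr4] _] := cluster_cont Qm Qs (fun i => Qc _ i n0) (DlocN 0 n0 n02).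
pose r := Num.min (Num.min r1 r2) (Num.min r3 r4).
have r0 : 0 < r by rewrite !lt_min r10 r20 r30.
have inr z : nm z < r -> [/\ nm z < r1, nm z < r2, nm z < r3 & nm z < r4].
 by rewrite !lt_min => /andP[/andP[-> ->] /andP[-> ->]].
have clm (E : pred C) z : cluster Q E z \is monic by apply: monic_prod => x _; apply: monicXsubC.
have clF (E : pred C) z : cluster Q E z = \prod_(x <- [seq x <- rts Q z | E x]) ('X - x%:P) by rewrite /cluster big_filter.
have QE z : Q z = cluster Q D z * cluster Q (predC D) z by rewrite (rtsE Qm) (bigID D).
(* The constant value away from 0 keeps the family monic of the right degree. *)
pose A z := if nm z < r then cluster Q D z else A0.
pose B z := if nm z < r then cluster Q (predC D) z else B0.
have sA0 : (size A0).-1.+1 = size A0 by rewrite prednK // lt0n size_poly_eq0 monic_neq0.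
have sB0 : (size B0).-1.+1 = size B0 by rewrite prednK // lt0n size_poly_eq0 monic_neq0.
have Ams z : A z \is monic /\ size (A z) = (size A0).-1.+1.
 rewrite sA0 /A; case: ifP => // /inr[_ _ h3 _]; split=> //.
 by rewrite hr3 ?cA0 // subr0.
have Bms z : B z \is monic /\ size (B z) = (size B0).-1.+1.
 rewrite sB0 /B; case: ifP => // /inr[_ _ _ h4]; split=> //.
 by rewrite hr4 ?cB0 // subr0.
have AB z : nm z < r -> Q z = A z * B z by move=> hz; rewrite /A /B hz.
have ball z w : nm (w - z) < r - nm z -> nm w < r.
 by move=> h; apply: (@nm_ball _ z).
have copz z : nm z < r -> coprimep (A z) (B z).
 move=> hz; rewrite /A /B hz; apply/Pdiv.ClosedField.coprimepP => x.
 rewrite !clF root_prod_XsubC mem_filter => /andP[Dx _].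
 by rewrite -/(root _ x) root_prod_XsubC mem_filter /= Dx.
have cont_if (E : pred C) P0 z l : nm z < r -> cont (fun z => (cluster Q E z)`_l) z ->
  cont (fun z => (if nm z < r then cluster Q E z else P0)`_l) z.
 move=> hz; apply: cont_eq; exists (r - nm z); first by rewrite subr_gt0.
 by move=> w /ball ->.
have cAc z l : nm z < r -> cont (fun z => (A z)`_l) z.
 move=> hz; have [h1 h2 _ _] := inr z hz; apply: cont_if => //.
 exact: (cluster_cont Qm Qs (fun i => Qc _ i h1) (Dloc z h1 h2)).2.
have cBc z l : nm z < r -> cont (fun z => (B z)`_l) z.
 move=> hz; have [h1 h2 _ _] := inr z hz; apply: cont_if => //.
 exact: (cluster_cont Qm Qs (fun i => Qc _ i h1) (DlocN z h1 h2)).2.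
pose m := (n.+1 + size A0 + size B0)%N.
exists A, B; split; [| |by exists r].
- split=> // l; apply/hg_near; exists r => // z hz; have rz : 0 < r - nm z by rewrite subr_gt0.
 have [h1 _ _ _] := inr z hz.
 apply: (@factor_cder Q A B z _ (size A0).-1 m rz) => //.
 + by move=> w /ball hw; split; [exact: AB|exact: (Ams w).1|exact: (Ams w).2].
 + by move=> w; rewrite Qs (Bms w).2 sB0 /m; split; [rewrite -addnA leq_addr|rewrite leq_addl].
 + exact: copz.
 + by move=> k; apply: cBc.
 + exact: hr1.
- split=> // l; apply/hg_near; exists r => // z hz; have rz : 0 < r - nm z by rewrite subr_gt0.
 have [h1 _ _ _] := inr z hz.
 apply: (@factor_cder Q B A z _ (size B0).-1 m rz) => //.
 + by move=> w /ball hw; split; [rewrite mulrC; exact: AB|exact: (Bms w).1|exact: (Bms w).2].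
 + by move=> w; rewrite Qs (Ams w).2 sA0 /m; split; [rewrite -addnA leq_addr|rewrite addnAC leq_addl].
 + by rewrite coprimep_sym; apply: copz.
 + by move=> k; apply: cAc.
 + exact: hr1.
Qed.
Lemma near0_ex P : near0 P -> exists2 z, z != 0 & P z.
Proof.
move=> [r r0 h]; exists ((r / 2)%:C).
 by rewrite -nm_eq0 nmC ?gt_eqF // normr_gt0 gt_eqF // divr_gt0.
by apply: h; rewrite nmC gtr0_norm ?divr_gt0 // ltr_pdivrMr // ltr_pMr // ltr1n.
Qed.
Lemma scale_roots_coef s (F : nat -> C) n i : (\prod_(0 <= j < n) ('X - (s * F j)%:P))`_i =
 s ^+ (n - i) * (\prod_(0 <= j < n) ('X - (F j)%:P))`_i.
Proof.
elim: n i => [|n IH] i; first by rewrite !big_nil sub0n expr0 mul1r.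
rewrite !big_nat_recr //= !mulrBr !coefB !coefMX !coefMC !IH.
have [-> /=|i0] := eqVneq i 0%N; first by rewrite !subn0 exprS; ring.
have e : (n - i.-1 = n.+1 - i)%N by lia.
rewrite e; have [lt|ge] := leqP i n; first by rewrite subSn // exprS; ring.
have -> : (\prod_(0 <= j < n) ('X - (F j)%:P))`_i = 0.
 by rewrite nth_default // size_prod_XsubC size_iota subn0.
by rewrite !(mulr0, mul0r) !subr0.
Qed.
Definition hp (P : C -> {poly C}) := forall i, hg (fun z => (P z)`_i).
Lemma hp_sum m (P : nat -> C -> {poly C}) : (forall i, hp (P i)) -> hp (fun z => \sum_(i < m) P i z).
Proof.
move=> h i; apply: (@hg_eq (fun z => \sum_(j < m) (P j z)`_i)); last by apply: hg_sum => j _; apply: h.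
by exists 1 => // z _; rewrite coef_sum.
Qed.
Lemma hpM P Q : hp P -> hp Q -> hp (fun z => P z * Q z).
Proof.
move=> h h' i; apply: (@hg_eq (fun z => \sum_(j < i.+1) (P z)`_j * (Q z)`_(i - j))).
 by exists 1 => // z _; rewrite coefM.
by apply: hg_sum => j _; apply: hgM.
Qed.
Lemma hpC f : hg f -> hp (fun z => (f z)%:P).
Proof.
move=> hf [|i].
 by apply: hg_ext hf => z; rewrite coefC.
by apply: (@hg_eq (fun=> 0)) (hg_cst 0); exists 1 => // z _; rewrite coefC.
Qed.
Lemma hpcst P : hp (fun=> P).
Proof. by move=> i; apply: hg_cst. Qed.
Lemma hpX P n : hp P -> hp (fun z => P z ^+ n).
Proof.
move=> h; elim: n => [|n IH]; first exact: (hpcst 1).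
move=> i; apply: hg_eq (hpM h IH i); by exists 1 => // z _; rewrite exprS.
Qed.
Lemma hpD P Q : hp P -> hp Q -> hp (fun z => P z + Q z).
Proof. by move=> h h' i; apply: hg_ext (hgD (h i) (h' i)) => z; rewrite coefD. Qed.
Lemma hp_comp n Q f : fam n Q -> hg f -> fam n (fun z => Q z \Po ('X + (f z)%:P)).
Proof.
move=> [ms h] hf; split=> [z|]; have s2 w : size ('X + w%:P : {poly C}) = 2 by rewrite size_XaddC.
 have [m s] := ms z; rewrite size_comp_poly2 //; split=> //; apply/monicP.
 by rewrite lead_coef_comp ?s2 // (monicP m) mul1r (_ : lead_coef _ = 1) ?expr1n //; apply/monicP; apply: monicXaddC.
move=> i; have H : hp (fun z => \sum_(j < n.+1) ((Q z)`_j)%:P * ('X + (f z)%:P) ^+ j).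
 by apply: (@hp_sum n.+1 (fun j z => ((Q z)`_j)%:P * ('X + (f z)%:P) ^+ j)) => j;
   apply: hpM; [apply: hpC | apply: hpX; apply: hpD; [apply: hpcst|apply: hpC]].
apply: hg_ext (H i) => z; rewrite comp_polyE (ms z).2; congr (nth 0 (polyseq _) i).
by apply: eq_bigr => j _; rewrite mul_polyC.
Qed.
Lemma comp_prodXsubC (F : nat -> C) n w : (\prod_(0 <= j < n) ('X - (F j)%:P)) \Po ('X - w%:P) =
 \prod_(0 <= j < n) ('X - (F j + w)%:P) :> {poly C}.
Proof.
elim: n => [|n IH]; first by rewrite !big_nil -polyC1 comp_polyC.
by rewrite !big_nat_recr //= comp_polyM IH comp_polyB comp_polyX comp_polyC polyCD; congr (_ * _); ring.
Qed.
Lemma prod_cat_nat (P : nat -> {poly C}) (Q : nat -> {poly C}) n1 n2 :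
 (\prod_(0 <= j < n1) P j) * (\prod_(0 <= j < n2) Q j) =
 \prod_(0 <= j < n1 + n2) (if (j < n1)%N then P j else Q (j - n1)%N).
Proof.
rewrite [RHS](@big_cat_nat _ _ _ n1) ?leq_addr //=; congr (_ * _).
 by apply: eq_big_nat => j /andP[_ ->].
transitivity (\prod_(0 + n1 <= j < n1 + n2) (if (j < n1)%N then P j else Q (j - n1)%N)) => //.
rewrite big_addn addKn; apply: eq_big_nat => j _.
by rewrite ltnNge leq_addl addnK.
Qed.

(** Induction on the degree. A translation makes the sum of the roots 0. For the least slope [w / e]
    of the Newton polygon, the substitution of [t ^+ e] for [z] and the scaling of the roots by
    [t ^+ w] yield a family [P] such that [P 0] has two distinct roots; [hensel] splits it into
    factors of smaller degree. *)
Theorem puiseux n Q : fam n Q -> exists N (th : nat -> C -> C),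
 [/\ (0 < N)%N, forall j, hg (th j) & near0 (fun t => Q (t ^+ N) = \prod_(0 <= j < n) ('X - (th j t)%:P))].
Proof.
elim/ltn_ind: n Q => n IH Q fQ; case: n IH fQ => [|n'] IH fQ.
 exists 1%N, (fun _ _ => 0); split=> //; first by move=> _; apply: hg_cst.
 exists 1 => // t _; rewrite big_nil; have [m s] := fQ.1 (t ^+ 1).
 have := size_poly1P (Q (t ^+ 1)); rewrite s eqxx => /elimT/(_ isT)[c c0 e].
 by move/monicP: m; rewrite e lead_coefC => ->.
set n := n'.+1 in IH fQ *.
have nC : n%:R != 0 :> C by rewrite pnatr_eq0.
(* The mean of the roots. *)
pose c z := - (Q z)`_n' / n%:R.
have hc : hg c by apply: hgM; [apply: hgN; apply: fQ.2|apply: hg_cst].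
have fQ' := hp_comp fQ hc; set Q' := (fun z => Q z \Po ('X + (c z)%:P)) in fQ'.
have QE z : Q z = Q' z \Po ('X - (c z)%:P).
 by rewrite /Q' -comp_polyA comp_polyD comp_polyX comp_polyC subrK comp_polyXr.
have Q'n z : (Q' z)`_n' = 0.
 have [m s] := fQ.1 z; have [xs E] := closed_field_poly_normal (Q z); rewrite (monicP m) scale1r in E.
 have sx : size xs = n by move: s; rewrite E size_prod_XsubC => -[].
 have sN : (size xs != 0)%N by rewrite sx.
 have E' : Q' z = \prod_(x <- [seq x - c z | x <- xs]) ('X - x%:P).
  rewrite /Q' E big_map; elim: (xs) => [|x ys IHy]; first by rewrite !big_nil -polyC1 comp_polyC.
  by rewrite !big_cons comp_polyM IHy comp_polyB comp_polyX comp_polyC polyCB; congr (_ * _); ring.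
 have := coefPn_prod_XsubC sN; rewrite -E sx /= => e1.
 have := @coefPn_prod_XsubC _ [seq x - c z | x <- xs]; rewrite size_map -E' sx big_map sumrB /= => -> //.
 rewrite big_const_seq count_predT sx iter_addr_0 -mulr_natr /c e1; field.
 exact: nC.
have /choice[k /choice[u hu]] : forall i, exists k, exists u, [/\ hg u, near0 (fun z => (Q' z)`_i = z ^+ k * u z) & u = (fun=> 0) \/ u 0 != 0].
 move=> i; have [z0|[k [u [h1 h2 h3]]]] := hg_order (fQ'.2 i).
  exists 0%N, (fun=> 0); split; [exact: hg_cst| |by left].
  by apply: near0_imp z0 => z ->; rewrite mulr0.
 by exists k, u; split=> //; right.
have un : u n' = (fun=> 0).
 have [h1 h2 [//|h3]] := hu n'; have [z z0 [e h]] := near0_ex (near0_and h2 (hg_neq0 h1 h3)).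
 by move/eqP: e; rewrite Q'n eq_sym mulf_eq0 (negPf h) expf_eq0 (negPf z0) andbF.
have nearu : near0 (fun z => forall i, (i < n)%N -> (Q' z)`_i = z ^+ k i * u i z).
 by apply: (@near0_fin n (fun i z => (Q' z)`_i = z ^+ k i * u i z)) => i _; have [] := hu i.
have [i1|noP] := pickP (fun i : 'I_n => u i 0 != 0); last first.
 exists 1%N, (fun _ => c); split=> //; apply: near0_imp nearu => z hz; rewrite expr1 QE.
 have -> : Q' z = 'X^n.
  apply/polyP => i; rewrite coefXn; have [m s] := fQ'.1 z.
  have [lt|gt|->] := ltngtP i n; last by move/monicP: m; rewrite lead_coefE s.
   rewrite hz //; have [_ _ [->|]] := hu i; first by rewrite mulr0.
   by have := noP (Ordinal lt) => /= ->.
  by rewrite nth_default // s.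
 have := comp_prodXsubC (fun=> 0) n (c z); rewrite !prodr_const_nat !subn0 subr0 add0r => <- //.
(* The slopes [k i / (n - i)] brought to the common denominator n factorial, so that they are
   compared as natural numbers. *)
move=> Pi1; pose M (i : 'I_n) := (k i * (n`! %/ (n - i)))%N.
case: (@arg_minnP _ i1 (fun i => u i 0 != 0) M Pi1) => i0 ui0 minM.
pose e := (n - i0)%N; pose w := k i0; have e0 : (0 < e)%N by rewrite subn_gt0.
have minK i : (i < n)%N -> u i 0 != 0 -> (w * (n - i) <= k i * e)%N.
 move=> lt ui; have := minM (Ordinal lt) ui; rewrite /M /= -/w -/e => h.
 have d1 : ((n - i) %| n`!)%N by apply: dvdn_fact; lia.
 have d2 : (e %| n`!)%N by apply: dvdn_fact; rewrite e0 leq_subr.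
 have : (w * (n`! %/ e) * (e * (n - i)) <= k i * (n`! %/ (n - i)) * (e * (n - i)))%N by rewrite leq_mul2r h orbT.
 have -> : (w * (n`! %/ e) * (e * (n - i)) = (w * (n - i)) * n`!)%N.
  by rewrite -{2}(divnK d2); ring.
 have -> : (k i * (n`! %/ (n - i)) * (e * (n - i)) = (k i * e) * n`!)%N.
  by rewrite -{2}(divnK d1); ring.
 by rewrite leq_mul2r gtn_eqF ?fact_gt0.
pose co i t : C := if i == n then 1 else t ^+ (k i * e - w * (n - i)) * u i (t ^+ e).
pose P t := \poly_(i < n.+1) co i t.
have con t : co n t = 1 by rewrite /co eqxx.
have fP : fam n P.
 apply: fam_poly => // i; rewrite /co; case: (i == n); first exact: hg_cst.
 by have [h1 _ _] := hu i; apply: hgM; [apply: hgX; apply: hg_id|apply: hg_pow].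
have Q'P : near0 (fun t => forall i, (Q' (t ^+ e))`_i = (t ^+ w) ^+ (n - i) * (P t)`_i).
 apply: near0_imp (near0_pow e0 nearu) => t ht i; have [m s] := fQ'.1 (t ^+ e).
 rewrite coef_poly ltnS; have [lt|gt|->] := ltngtP i n; last first.
 - by rewrite subnn expr0 con mulr1; move/monicP: m; rewrite lead_coefE s.
 - by rewrite mulr0 nth_default // s.
 rewrite ht // /co ltn_eqF //; have [_ _ [->|ui]] := hu i; first by rewrite !mulr0.
 by rewrite mulrA -!exprM -exprD subnKC ?minK // mulnC.
have [mP sP] := fP.1 0; have [xs E] := closed_field_poly_normal (P 0); rewrite (monicP mP) scale1r in E.
have sx : size xs = n by move: sP; rewrite E size_prod_XsubC => -[].
have Pi0 : (P 0)`_i0 != 0.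
 by rewrite coef_poly (ltn_trans (ltn_ord i0)) // /co ltn_eqF // expr0n mulnC subnn eqxx mul1r expr0n gtn_eqF.
have Pn : (P 0)`_n' = 0 by rewrite coef_poly ltnS ltnW // /co ltn_eqF // un mulr0.
pose a := nth 0 xs 0; have axs : a \in xs by rewrite mem_nth // sx.
(* If all roots of [P 0] coincided, they would be 0 because their sum is, and [P 0] would be a pure
   power, against [Pi0]. *)
have [b bxs ba] : exists2 b, b \in xs & b != a.
 apply/hasP; rewrite -[has _ _]negbK -all_predC; apply/negP => /allP al.
 have xsE : xs = nseq n a.
  by rewrite -sx; apply/all_pred1P; apply/allP => x /al /=; rewrite negbK.
 have a0 : a = 0.
  have := @coefPn_prod_XsubC _ xs; rewrite -E sx /= Pn xsE big_nseq iter_addr_0 => /(_ isT)/esym/eqP.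
  by rewrite oppr_eq0 mulrn_eq0 => /eqP.
 move: Pi0; rewrite E xsE a0 big_nseq subr0 iter_mulr_1 coefXn ltn_eqF ?eqxx //.
pose A0 := \prod_(x <- [seq x <- xs | x == a]) ('X - x%:P); pose B0 := \prod_(x <- [seq x <- xs | x != a]) ('X - x%:P).
have PE : P 0 = A0 * B0 by rewrite E (bigID (fun x => x == a)) /= /A0 /B0 !big_filter.
have sA : size A0 = (count (fun x => x == a) xs).+1 by rewrite /A0 size_prod_XsubC size_filter.
have sB : size B0 = (count (fun x => x != a) xs).+1 by rewrite /B0 size_prod_XsubC size_filter.
have sAB : (count (fun x => x == a) xs + count (fun x => x != a) xs = n)%N by rewrite -sx; exact: count_predC.
have cA : (0 < count (fun x => x == a) xs)%N by rewrite -has_count; apply/hasP; exists a.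
have cB : (0 < count (fun x => x != a) xs)%N by rewrite -has_count; apply/hasP; exists b.
have [|||A [B [fA fB AB]]] := hensel fP _ _ PE.
- by apply: monic_prod => x _; apply: monicXsubC.
- by apply: monic_prod => x _; apply: monicXsubC.
- apply/Pdiv.ClosedField.coprimepP => x; rewrite /A0 /B0 root_prod_XsubC mem_filter => /andP[/eqP-> _].
 by rewrite -/(root _ a) root_prod_XsubC mem_filter eqxx.
rewrite sA in fA; rewrite sB in fB; move: sAB cA cB fA fB.
move: (count _ xs) (count _ xs) => n2 n1 n12 n10 n20 /= fA fB.
have [lt1 lt2] : (n1 < n)%N /\ (n2 < n)%N by split; rewrite -n12; [rewrite -{1}[n1]addn0 ltn_add2l | rewrite -{1}[n2]add0n ltn_add2r].
have [N1 [th [N10 hth thE]]] := IH n1 lt1 A fA.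
have [N2 [et [N20 het etE]]] := IH n2 lt2 B fB.
have N120 : (0 < N1 * N2)%N by rewrite muln_gt0 N10.
pose ze j t := if (j < n1)%N then th j (t ^+ N2) else et (j - n1)%N (t ^+ N1).
exists (N1 * N2 * e)%N, (fun j t => t ^+ (N1 * N2 * w) * ze j t + c (t ^+ (N1 * N2 * e))); split.
- by rewrite muln_gt0 N120.
- move=> j; apply: hgD; last by apply: (@hg_pow c) hc; rewrite muln_gt0 N120.
 apply: hgM; first by apply: hgX; apply: hg_id.
 by rewrite /ze; case: (j < n1)%N; apply: hg_pow.
have h1 := near0_pow N120 Q'P; have h2 := near0_pow N120 AB.
apply: near0_imp (near0_and (near0_and h1 h2) (near0_and (near0_pow N20 thE) (near0_pow N10 etE))).
move=> t [[q1 q2] [q3 q4]]; rewrite QE -comp_prodXsubC; congr (_ \Po _).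
apply/polyP => i; rewrite scale_roots_coef (exprM t (N1 * N2) w) (exprM t (N1 * N2) e) q1; congr (_ * nth 0 (polyseq _) i).
rewrite q2 {1}mulnC (exprM t N2) q3 (exprM t N1) q4 prod_cat_nat n12; apply: eq_bigr => j _.
by rewrite /ze; case: ifP.
Qed.
Lemma punctured_ball (t : C) (s : R) : t != 0 -> nm t < s ->
 exists2 s' : R, 0 < s' & forall w, nm (w - t) < s' -> nm w < s /\ w != 0.
Proof.
move=> t0 ts; exists (Num.min (s - nm t) (nm t)); first by rewrite lt_min subr_gt0 ts nm_gt0.
move=> w; rewrite lt_min => /andP[h1 h2]; split; first exact: nm_ball h1.
by apply: contraTneq h2 => ->; rewrite sub0r nmN ltxx.
Qed.
End RootClusters.

(** * Selection of analytic curves *)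

Section CurveSelection.
Variable R : realType.
Notation C := R[i].

Lemma hol_cst r (c : C) : 0 < r -> hol (fun=> c) r.
Proof. by move=> r0; split=> // z _; exists 0; apply: cder_cst. Qed.
Lemma holD f g (r : R) : hol f r -> hol g r -> hol (fun z => f z + g z) r.
Proof. by move=> [r0 h] [_ k]; split=> // z hz; have [D ?] := h z hz; have [E ?] := k z hz; exists (D + E); apply: cderD. Qed.
Lemma holM f g (r : R) : hol f r -> hol g r -> hol (fun z => f z * g z) r.
Proof.
move=> [r0 h] [_ k]; split=> // z hz; have [D ?] := h z hz; have [E ?] := k z hz.
by exists (D * g z + f z * E); apply: cderM.
Qed.
Lemma hol_pow r n : 0 < r -> hol (fun z : C => z ^+ n) r.
Proof. by move=> r0; split=> // z _; exists (n%:R * z ^+ n.-1 * 1); apply: cderX; apply: cder_id. Qed.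
Lemma mero_poly D (th : 'I_D -> C -> C) r k (p : mpoly D C) : 0 < r -> (forall i, hol (th i) r) ->
 exists M H, hol H r /\ forall t, t != 0 -> H t = t ^+ M * meval (fun i => th i t / t ^+ k) p.
Proof.
move=> r0 hth; elim/mpoly_alg_ind: p => [c|i|p q [M [H [h1 h2]]] [M' [H' [h1' h2']]]|p q [M [H [h1 h2]]] [M' [H' [h1' h2']]]].
- by exists 0%N, (fun=> c); split; [apply: hol_cst|move=> t _; rewrite mevalC expr0 mul1r].
- exists k, (th i); split=> // t t0; rewrite mevalXU mulrC mulfVK // expf_neq0 //.
- exists (M + M')%N, (fun t => H t * t ^+ M' + H' t * t ^+ M); split.
  by apply: holD; apply: holM => //; apply: hol_pow.
 by move=> t t0; rewrite h2 // h2' // mevalD exprD; ring.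
- exists (M + M')%N, (fun t => H t * H' t); split; first exact: holM.
 by move=> t t0; rewrite h2 // h2' // mevalM exprD; ring.
Qed.
(** A root chosen point by point, with no continuity away from 0: it only has to transport
    statements that hold near 0. *)
Lemma nth_root_fun N : (0 < N)%N -> exists2 tau : C -> C, (forall z, tau z ^+ N = z) &
 forall P, near0 P -> near0 (fun z => P (tau z)).
Proof.
move=> N0; have /choice[tau tauE] : forall z : C, exists w, w ^+ N = z by move=> z; apply: closed_nth_root.
exists tau => // P [r r0 hr]; exists (r ^+ N); first by rewrite exprn_gt0.
move=> z; rewrite -{1}(tauE z) nmX => h; apply: hr; move: h; rewrite ltr_pXn2r ?nnegrE ?nm_ge0 ?(ltW r0) //.
Qed.
Lemma near0_ord D (P : 'I_D -> C -> Prop) : (forall i, near0 (P i)) -> near0 (fun z => forall i, P i z).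
Proof.
move=> h; have : near0 (fun z => forall m, (m < D)%N -> forall lt : (m < D)%N, P (Ordinal lt) z).
 apply: (@near0_fin R D (fun m z => forall lt : (m < D)%N, P (Ordinal lt) z)) => m lt0.
 by apply: near0_imp (h (Ordinal lt0)) => z hz lt; rewrite (bool_irrelevance lt lt0).
apply: near0_imp => z hz [m lt]; exact: hz.
Qed.
Lemma cont0_near (f : C -> C) : cont f 0 <-> forall e : R, 0 < e -> near0 (fun w => nm (f w - f 0) < e).
Proof.
by split=> h e /h[r r0 hr]; exists r => // w hw; apply: hr; move: hw; rewrite subr0.
Qed.
(** Only the coordinates in [B] are required to converge. The others may have poles and are replaced
    by 0 in the condition on the limit. *)
Definition mask D (B : pred 'I_D) (x : 'I_D -> C) i := if B i then x i else 0.

(** The second hypothesis says that [S] accumulates at [b] over the parameter 0, tested by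
    polynomials with continuous coefficients. It makes [limit_place] applicable to functions on the
    pairs of a parameter and a point. [selection_subfield] then replaces the coordinates by elements
    algebraic over the meromorphic germs, and [puiseux] turns these into meromorphic functions of an
    [N]-th root of the parameter. *)
Theorem curve_selection D (S : C -> ('I_D -> C) -> Prop) (B : pred 'I_D) (b : 'I_D -> C) :
 (forall z x, S z x -> z != 0) ->
 (forall (I : finType) (phi : I -> C -> C) (p : I -> mpoly D C), (forall j, cont (phi j) 0) ->
  \sum_j phi j 0 * meval (mask B b) (p j) != 0 ->
  exists z x, S z x /\ \sum_j phi j z * meval (mask B x) (p j) != 0) ->
 exists N (y : 'I_D -> C -> C), [/\ (0 < N)%N, (forall i, B i -> hg (y i) /\ y i 0 = b i),
  near0 (fun t => t != 0 -> forall i, exists E, cder (y i) t E),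
  (forall (p : mpoly D C) phi, hg phi -> (forall z x, S z x -> meval x p = phi z) ->
   near0 (fun t => t != 0 -> meval (fun i => y i t) p = phi (t ^+ N))) &
  near0 (fun t => t != 0 -> forall p : mpoly D C, (forall z x, S z x -> meval x p = 0) -> meval (fun i => y i t) p = 0)].
Proof.
move=> Sz Sn; pose X := ((R[i])^o * ('I_D -> (R[i])^o))%type.
(* On [S], [f] is a polynomial in the masked coordinates with coefficients continuous in the
   parameter; [c] is its value at the limit. *)
pose T (f : X -> C) (c : C) := exists (I : finType) (phi : I -> C -> C) (p : I -> mpoly D C),
 [/\ forall j, cont (phi j) 0, c = \sum_j phi j 0 * meval (mask B b) (p j) &
   forall z x, S z x -> f (z, x) = \sum_j phi j z * meval (mask B x) (p j)].
have Tphi phi (f : X -> C) : cont phi 0 -> (forall z x, S z x -> f (z, x) = phi z) -> T f (phi 0).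
 move=> cp fE; exists 'I_1, (fun=> phi), (fun=> mpolyC D 1); split=> //.
  by rewrite big_ord1 mevalC mulr1.
 by move=> z x /fE ->; rewrite big_ord1 mevalC mulr1.
have [||||L [kap [pi [W [PW pic piD piM [TW [pi0 pis]]]]]]] := @limit_place X C T.
- by move=> c; apply: (@Tphi (fun=> c)) => //; apply: cont_cst.
- move=> f g c d [I [phi [p [h1 h2 h3]]]] [J [psi [q [k1 k2 k3]]]].
 exists (I + J)%type, (fun s => match s with inl i => phi i | inr j => psi j end),
  (fun s => match s with inl i => p i | inr j => q j end); split.
 + by case.
 + by rewrite big_sumType /= h2 k2.
 + by move=> z x h; rewrite big_sumType /= h3 // k3.
- move=> f g c d [I [phi [p [h1 h2 h3]]]] [J [psi [q [k1 k2 k3]]]].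
 exists (I * J)%type, (fun s z => phi s.1 z * psi s.2 z), (fun s => p s.1 * q s.2); split.
 + by move=> s; apply: contM.
 + by rewrite h2 k2 big_distrlr pair_big /=; apply: eq_bigr => s _; rewrite mevalM; ring.
 + by move=> z x h; rewrite h3 // k3 // big_distrlr pair_big /=; apply: eq_bigr => s _; rewrite mevalM; ring.
- move=> f c [I [phi [p [h1 h2 h3]]]]; rewrite h2 => /(Sn _ _ _ h1)[z [x [h h4]]].
 by exists (z, x); rewrite h3.
have RW := place_rr PW.
have pi_ext f g : near0 (fun z => forall x, S z x -> f (z, x) = g (z, x)) -> pi f = pi g.
 move=> [r r0 fg]; pose chi (z : C) : C := if nm z < r then 1 else 0.
 have cchi : cont chi 0.
  by apply: cont_eq (cont_cst 1 0); exists r => // w; rewrite subr0 /chi => ->.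
 have Tc := @Tphi chi (fun a : X => if `[< S a.1 a.2 >] then chi a.1 else 0) cchi.
 have {Tc} : T (fun a : X => if `[< S a.1 a.2 >] then chi a.1 else 0) (chi 0).
  by apply: Tc => z x h /=; case: asboolP.
 move=> Tc; have := @pi0 _ (fun a => f a + -1 * g a) _ Tc; rewrite {1}/chi nm0 r0 oner_neq0 => /(_ isT) e.
 apply/eqP; rewrite -subr_eq0 -mulN1r -(rmorphN1 kap) -pic -piM -piD e // => -[z x] /=.
 case: asboolP; rewrite ?eqxx // /chi => h; case: ifP; rewrite ?eqxx // => hz _.
 by rewrite fg // mulN1r subrr.
have pi_ext' f g : (forall z x, S z x -> f (z, x) = g (z, x)) -> pi f = pi g.
 by move=> h; apply: pi_ext; exists 1 => // z _ x; apply: h.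
have piX f n : pi (fun a => f a ^+ n) = pi f ^+ n.
 elim: n => [|n IH]; first by rewrite expr0 -(rmorph1 kap) -pic.
 by rewrite exprS -IH -piM; congr pi; apply: funext => a; rewrite exprS.
have pi_sum m (f : nat -> X -> C) : pi (fun a => \sum_(i < m) f i a) = \sum_(i < m) pi (f i).
 elim: m => [|m IH].
  by rewrite big_ord0 -(rmorph0 kap) -pic; congr pi; apply: funext => a; rewrite big_ord0.
 by rewrite big_ord_recr /= -IH -piD; congr pi; apply: funext => a; rewrite big_ord_recr.
have pi_prod m (f : nat -> X -> C) : pi (fun a => \prod_(0 <= i < m) f i a) = \prod_(0 <= i < m) pi (f i).
 elim: m => [|m IH].
  by rewrite big_nil -(rmorph1 kap) -pic; congr pi; apply: funext => a; rewrite big_nil.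
 by rewrite big_nat_recr //= -IH -piM /=; congr pi; apply: funext => a; rewrite big_nat_recr.
have mmap_pi (f : 'I_D -> X -> C) p : mmap kap (fun i => pi (f i)) p = pi (fun a => meval (fun i => f i a) p).
 elim/mpoly_alg_ind: p => [c|i|p q IHp IHq|p q IHp IHq].
 - by transitivity (kap c); [exact: mmapC | rewrite -pic; congr pi; apply: funext => a; rewrite mevalC].
 - by rewrite mmapX mmap1U; congr pi; apply: funext => a; rewrite mevalXU.
 - by rewrite mmapD IHp IHq -piD; congr pi; apply: funext => a; rewrite mevalD.
 - by rewrite rmorphM /= IHp IHq -piM; congr pi; apply: funext => a; rewrite mevalM.
(* Germs in the parameter as elements of the field; [ze] is the parameter itself, an
   infinitesimal. *)
pose ga (phi : C -> C) := pi (fun a => phi a.1); pose ze := ga id.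
have gaW phi : cont phi 0 -> W (ga phi) (phi 0) by move=> h; apply: TW; apply: (Tphi phi).
have ne0 u c : W u c -> c != 0 -> u != 0.
 by move=> h; apply: contra_neq => e; apply: (rr0 RW); rewrite -e.
have ze0 : ze != 0.
 apply/eqP => e; have : ze * pi (fun a => a.1^-1) = 1.
  rewrite /ze /ga -piM -(rmorph1 kap) -pic; apply: pi_ext' => z x /Sz z0 /=; exact: divff.
 by rewrite e mul0r => /esym/eqP; rewrite oner_eq0.
have gaM f g : ga (fun z => f z * g z) = ga f * ga g by rewrite -piM.
have gaX n : ga (fun z => z ^+ n) = ze ^+ n by rewrite -piX.
have ga_near f g : near0 (fun z => f z = g z) -> ga f = ga g.
 by move=> h; apply: pi_ext; apply: near0_imp h => z e x _.
(* The field of meromorphic germs: holomorphic after multiplication by a power of the parameter. *)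
pose Sg u := exists phi k, hg phi /\ u * ze ^+ k = ga phi.
have Sga phi : hg phi -> Sg (ga phi) by exists phi, 0%N; rewrite expr0 mulr1.
have Sk c : Sg (kap c) by rewrite -pic; apply: (Sga (fun=> c)); apply: hg_cst.
have S1 : Sg 1 by rewrite -(rmorph1 kap); apply: Sk.
have SB u v : Sg u -> Sg v -> Sg (u - v).
 move=> [f [k [hf e]]] [g [l [h e']]]; exists (fun z => f z * z ^+ l + -1 * (g z * z ^+ k)), (k + l)%N; split.
  apply: hgD; first by apply: hgM => //; apply: hgX; apply: hg_id.
  by apply: hgM; [apply: hg_cst|apply: hgM => //; apply: hgX; apply: hg_id].
 have -> : ga (fun z => f z * z ^+ l + -1 * (g z * z ^+ k)) = ga f * ze ^+ l + kap (-1) * (ga g * ze ^+ k).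
  by rewrite -!gaX -!gaM -pic -piM -piD.
 by rewrite -e -e' rmorphN1 exprD; ring.
have SV u v : Sg u -> Sg v -> Sg (u / v).
 move=> [f [k [hf e]]] [g [l [h e']]]; have [->|v0] := eqVneq v 0.
  by rewrite invr0 mulr0 -(rmorph0 kap).
 have [nz|[j [w [hw w0 gw]]]] := hg_order h.
  have : v * ze ^+ l = 0 by rewrite e' (ga_near _ (fun=> 0)) // /ga pic rmorph0.
  by move/eqP; rewrite mulf_eq0 (negPf v0) expf_eq0 (negPf ze0) andbF.
 have hw' := hgV hw w0.
 have ww : ga w * ga (fun z => (w z)^-1) = 1.
  rewrite -gaM (ga_near _ (fun=> 1)) ?/ga ?pic ?rmorph1 //.
  by apply: near0_imp (hg_neq0 hw w0) => z wz; rewrite divff.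
 have E : ze ^+ j = v * ze ^+ l * ga (fun z => (w z)^-1).
  by rewrite e' (ga_near _ _ gw) gaM gaX -mulrA ww mulr1.
 exists (fun z => f z * (z ^+ l * (w z)^-1)), (k + j)%N; split.
  by apply: hgM => //; apply: hgM => //; apply: hgX; apply: hg_id.
 by rewrite !gaM gaX -e exprD E; field.
have zW : pinf W ze by have := gaW _ (cont_id 0).
have yW i : B i -> W (pi (fun a => a.2 i)) (b i).
 move=> Bi; apply: TW; exists 'I_1, (fun _ _ => 1), (fun=> mpolyX _ (mnm1 i)); split.
 - by move=> _; apply: cont_cst.
 - by rewrite big_ord1 mevalXU /mask Bi mul1r.
 - by move=> z x _; rewrite big_ord1 mevalXU /mask Bi mul1r.
have [u [uq uR uW]] := selection_subfield PW S1 SB SV Sk (Sga _ (hg_id R)) ze0 zW yW.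
have S0 : Sg 0 by rewrite -(rmorph0 kap).
have SN a : Sg a -> Sg (- a) by move=> h; rewrite -sub0r; apply: SB => //; rewrite -(rmorph0 kap).
have SD a c : Sg a -> Sg c -> Sg (a + c) by move=> h /SN h'; rewrite -[c]opprK; apply: SB.
have SM a c : Sg a -> Sg c -> Sg (a * c).
 by move=> h h'; rewrite -[c]invrK; apply: (SV) => //; rewrite -[c^-1]mul1r; apply: SV.
have [Q mQ [SQ rQ]] : exists2 Q : {poly L}, Q \is monic & (forall l, Sg Q`_l) /\ forall i, root Q (u i).
 have /choice[q hq] : forall i, exists q : {poly L}, [/\ q \is monic, forall l, Sg q`_l & root q (u i)].
  by move=> i; have [q ? [? ?]] := uq i; exists q.
 exists (\prod_i q i); first by apply: monic_prod => i _; have [] := hq i.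
 split=> [|i]; last by rewrite (bigD1 i) //= rootM; have [_ _ ->] := hq i.
 apply: (big_ind (fun P : {poly L} => forall l, Sg P`_l)) => [l|P P' hP hP' l|i _]; last by have [] := hq i.
  by rewrite coef1; case: (l == 0)%N; [exact: S1|exact: S0].
 rewrite coefM; by apply: (big_ind Sg) => // j _; apply: SM.
have [n sQ] : exists n, size Q = n.+1 by exists (size Q).-1; rewrite prednK // lt0n size_poly_eq0 monic_neq0.
have Qn : Q`_n = 1 by rewrite -[RHS](monicP mQ) lead_coefE sQ.
have /choice[phi0 /choice[kk hk]] := SQ.
pose k := \max_(l < n) kk l; pose phi l z : C := phi0 l z * z ^+ (k - kk l).
have hphi l : hg (phi l) by apply: hgM; [exact: (hk l).1|apply: hgX; apply: hg_id].
have phiE l : (l < n)%N -> ga (phi l) = Q`_l * ze ^+ k.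
 move=> lt; rewrite /phi gaM gaX -(hk l).2 -mulrA -exprD subnKC //.
 exact: (@leq_bigmax _ (fun l : 'I_n => kk l) (Ordinal lt)).
(* Clears the poles of the coefficients: the roots are multiplied by the [k]-th power of the
   parameter. *)
pose co l z : C := if l == n then 1 else phi l z * z ^+ (k * (n - l.+1)).
pose Qt z := \poly_(l < n.+1) co l z.
have con z : co n z = 1 by rewrite /co eqxx.
have fQ : fam n Qt.
 apply: fam_poly => // l; rewrite /co; case: (l == n); first exact: hg_cst.
 by apply: hgM => //; apply: hgX; apply: hg_id.
have [N [th [N0 hth thE]]] := puiseux fQ.
have [tau tauE tau_near] := nth_root_fun N0.
have tau0 : tau 0 = 0 by apply/eqP; have := tauE 0 => /eqP; rewrite expf_eq0 => /andP[].
have tauS z x : S z x -> tau z != 0.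
 by move=> /Sz; apply: contra_neq => e; rewrite -(tauE z) e expr0n gtn_eqF.
(* Germs in the [N]-th root [tau] of the parameter. *)
pose de (f : C -> C) := pi (fun a => f (tau a.1)); pose w := de id.
have deW f : cont f 0 -> W (de f) (f 0).
 move=> /cont0_near cf; rewrite -[in X in W _ X]tau0; apply: TW; apply: (Tphi (fun z => f (tau z))) => //.
 by apply/cont0_near => e /cf/tau_near; rewrite tau0.
have deM f g : de (fun z => f z * g z) = de f * de g by rewrite -piM.
have deB f g : de (fun t => f t + -1 * g t) = de f - de g by rewrite /de piD piM pic rmorphN1 mulN1r.
have deX m : de (fun z => z ^+ m) = w ^+ m by rewrite -piX.
have de_near f g : near0 (fun z => f z = g z) -> de f = de g.
 by move=> h; apply: pi_ext; apply: near0_imp (tau_near _ h) => z e x _.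
have de_near' f g : near0 (fun z => z != 0 -> f z = g z) -> de f = de g.
 move=> h; apply: pi_ext; apply: near0_imp (tau_near _ h) => z e x Szx; exact/e/tauS/Szx.
have deN f : de (fun t => f (t ^+ N)) = ga f.
 by apply: pi_ext' => z x _ /=; rewrite tauE.
have wN : w ^+ N = ze by rewrite -deX (deN id).
have w0 : w != 0 by apply: contra_neq ze0 => e; rewrite -wN e expr0n gtn_eqF.
(* A germ that is not identically 0 is a power of [t] times a germ with nonzero value, hence nonzero
   in the field. *)
have van H r : hol H r -> de H = 0 -> forall t, nm t < r / 8 -> H t = 0.
 move=> hH d0; have [//|[j [v [r' [[r'0 hv] v0 E]]]]] := hol_order hH.
 have hgv : hg v by exists r'.
 have : de H != 0.
  rewrite (@de_near H (fun t => t ^+ j * v t)); last by exists r'.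
  by rewrite deM deX mulf_neq0 ?expf_neq0 //; apply: ne0 (deW _ (hg_cont hgv)) v0.
 by rewrite d0 eqxx.
have /choice[jj jE] : forall i, exists j, ze ^+ k * u i = de (th j).
 move=> i; set v := ze ^+ k * u i; have [f fv] := pis v.
 have E : pi (fun a => (Qt a.1).[f a]) = \prod_(0 <= j < n) (v - de (th j)).
  transitivity (pi (fun a => \prod_(0 <= j < n) (f a + -1 * th j (tau a.1)))).
   apply: pi_ext; apply: near0_imp (tau_near _ thE) => z; rewrite tauE => e x _ /=.
   by rewrite e horner_prod; apply: eq_bigr => j _; rewrite !hornerE mulN1r.
  rewrite (pi_prod n (fun j a => f a + -1 * th j (tau a.1))); apply: eq_bigr => j _.
  by rewrite piD piM pic rmorphN1 mulN1r fv.
 have E0 : pi (fun a => (Qt a.1).[f a]) = 0.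
  transitivity (pi (fun a => \sum_(l < n.+1) co l a.1 * f a ^+ l)).
   by congr pi; apply: funext => a; rewrite horner_poly.
  rewrite (pi_sum n.+1 (fun l a => co l a.1 * f a ^+ l)).
  transitivity (ze ^+ (k * n) * Q.[u i]); last by rewrite (eqP (rQ i)) mulr0.
  rewrite horner_coef sQ mulr_sumr; apply: eq_bigr => l _; rewrite piM piX fv -/(ga (co l)).
  have [e|ln] := eqVneq (l : nat) n.
   rewrite e (_ : co n = fun=> 1) ?/ga ?pic ?rmorph1; last by apply: funext.
   by rewrite Qn !mul1r /v exprMn exprM.
  have lt : (l < n)%N by rewrite ltn_neqAle ln -ltnS ltn_ord.
  rewrite (_ : co l = fun z => phi l z * z ^+ (k * (n - l.+1))); last first.
   by apply: funext => z; rewrite /co (negPf ln).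
  rewrite gaM gaX phiE // /v exprMn -exprM.
  have -> : (k * n = k + k * (n - l.+1) + k * l)%N by rewrite -{1}(subnKC lt) -mulnS -mulnDr; congr (k * _)%N; lia.
  by rewrite !exprD; ring.
 move: E; rewrite E0 => /esym/eqP; rewrite big_mkord => /prodf_eq0[j _].
 by rewrite subr_eq0 => /eqP ->; exists j.
pose th' i := th (jj i); pose K := (N * k)%N; pose y0 i t := th' i t / t ^+ K.
have uE i : u i = de (y0 i).
 have wK : w ^+ K != 0 by rewrite expf_neq0.
 have e1 : w ^+ K * u i = de (th' i) by rewrite /K exprM wN jE.
 apply: (mulfI wK); rewrite e1 -deX -deM; apply: de_near'; exists 1 => // t _ t0.
 by rewrite /y0 mulrCA divff ?mulr1 // expf_neq0.
have [r0 r00 hr0] : near0 (fun t => forall i, exists E, cder (th' i) t E).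
 by apply: near0_ord => i; apply/hg_near; apply: hth.
have hol0 i : hol (th' i) r0 by split=> // t ht; apply: hr0.
have rel p f : hg f -> (forall z x, S z x -> meval x p = f z) ->
  de (fun t => meval (fun i => y0 i t) p) = ga f.
 move=> hf pf; have := uR p _ (Sga _ hf); rewrite mmap_pi => <-.
  by rewrite (_ : u = fun i => pi (fun a => y0 i (tau a.1))) ?mmap_pi //; apply: funext => i; exact: uE.
 by apply: pi_ext' => z x h /=; exact: pf.
(* A coordinate in [B] is finite at the place, so it has no pole, and its value at 0 is the one
   given by the place. *)
have /choice[Y hY] : forall i, exists Y, B i -> [/\ hg Y, Y 0 = b i & near0 (fun t => t != 0 -> Y t = y0 i t)].
 move=> i; have [Bi|_] := boolP (B i); last by exists (fun=> 0).
 have [nz|[j [v [hv v0 E]]]] := hg_order (hth (jj i)).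
  exists (fun=> 0) => _; split; first exact: hg_cst.
   have u0 : u i = 0.
    by rewrite uE (@de_near _ (fun=> 0)) ?/de ?pic ?rmorph0 //; apply: near0_imp nz => t e; rewrite /y0 /th' e mul0r.
   by have := uW i Bi; rewrite u0 => /(rr0 RW) ->.
  by apply: near0_imp nz => t e _; rewrite /y0 /th' e mul0r.
 have [le|lt] := leqP K j.
  have hY : hg (fun t => t ^+ (j - K) * v t) by apply: hgM => //; apply: hgX; apply: hg_id.
  have nY : near0 (fun t => t != 0 -> t ^+ (j - K) * v t = y0 i t).
   apply: near0_imp E => t e t0; rewrite /y0 /th' e -{2}(subnKC le) exprD.
   by field; rewrite expf_neq0.
  exists (fun t => t ^+ (j - K) * v t) => _; split=> //.
  have := deW _ (hg_cont hY); rewrite (de_near' _ _ nY) -uE => h.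
  exact: (rr_fun RW h (uW i Bi)).
 exfalso; have e : w ^+ (K - j) * u i = de v.
  rewrite uE -deX -deM; apply: de_near'; apply: near0_imp E => t e t0.
  rewrite /y0 /th' e -{2}(subnKC (ltnW lt)) exprD; field.
  by rewrite !expf_neq0.
 have h1 : W (w ^+ (K - j) * u i) (0 * b i).
  apply: (rrM RW) (uW i Bi); have := deW _ (hg_cont (hgX (K - j) (hg_id R))).
  by rewrite deX expr0n subn_eq0 leqNgt lt.
 move: h1; rewrite e mul0r => h1; have := rr_fun RW h1 (deW _ (hg_cont hv)) => /esym/eqP.
 by rewrite (negPf v0).
pose y i := if B i then Y i else y0 i.
have [r1 r10 hr1] : near0 (fun t => t != 0 -> forall i, y i t = y0 i t).
 have : near0 (fun t => forall i, t != 0 -> y i t = y0 i t).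
  apply: near0_ord => i; rewrite /y; case: ifP => Bi; last by exists 1.
  by have [] := hY i Bi.
 by apply: near0_imp => t h t0 i; apply: h.
have yE t p : nm t < r1 -> t != 0 -> meval (fun i => y i t) p = meval (fun i => y0 i t) p.
 by move=> ht t0; congr (meval _ _); apply: funext => i; apply: hr1.
exists N, y; split=> //.
- by move=> i Bi; rewrite /y Bi; have [] := hY i Bi.
- have : near0 (fun t => forall i, t != 0 -> exists E, cder (y i) t E).
  apply: near0_ord => i; rewrite /y; case: ifP => Bi.
   by have [/hg_near h _ _] := hY i Bi; apply: near0_imp h.
  have /hg_near := hth (jj i); apply: near0_imp => t [E hE] t0.
  have tK : t ^+ K != 0 by rewrite expf_neq0.
  have := cderM hE (@cderV _ (fun w => w ^+ K) t _ tK (cderX K (cder_id t))).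
  by move=> h; eexists; exact: h.
 by apply: near0_imp => t h t0 i; apply: h.
- move=> p f hf pf; have d := rel p f hf pf.
 have [M [H [hH HE]]] := mero_poly K p r00 hol0.
 have hgF : hg (fun t => H t + -1 * (t ^+ M * f (t ^+ N))).
  apply: hgD; first by exists r0.
  apply: hgM; first exact: hg_cst.
  by apply: hgM; [apply: hgX; apply: hg_id|apply: hg_pow].
 have d0 : de (fun t => H t + -1 * (t ^+ M * f (t ^+ N))) = 0.
  transitivity (de (fun t => t ^+ M * (meval (fun i => y0 i t) p + -1 * f (t ^+ N)))).
   by apply: de_near'; exists 1 => // t _ t0; rewrite HE //; ring.
  rewrite deM; have -> : de (fun t => meval (fun i => y0 i t) p + -1 * f (t ^+ N)) = 0; last by rewrite mulr0.
  by rewrite (deB (fun t => meval (fun i => y0 i t) p) (fun t => f (t ^+ N))) d deN subrr.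
 have [s hs] := hgF; have s0 := hs.1.
 exists (Num.min (s / 8) r1); first by rewrite lt_min r10 divr_gt0.
 move=> t; rewrite lt_min => /andP[t1 t2] t0; rewrite yE //.
 have := van _ _ hs d0 t t1; rewrite HE // -/(y0 _) => e.
 have tM : t ^+ M != 0 by rewrite expf_neq0.
 by apply: (mulfI tM); apply/eqP; rewrite -subr_eq0 -mulN1r e.
- exists (Num.min (r0 / 8) r1); first by rewrite lt_min r10 divr_gt0.
 move=> t; rewrite lt_min => /andP[t1 t2] t0 p p0; rewrite yE //.
 have [M [H [hH HE]]] := mero_poly K p r00 hol0.
 have d0 : de H = 0.
  rewrite (@de_near' _ (fun t => t ^+ M * meval (fun i => y0 i t) p)); last by exists 1 => // t' _ /HE.
  by rewrite deM (rel p (fun=> 0) (hg_cst 0) p0) /ga pic rmorph0 mulr0.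
 have := van _ _ hH d0 t t1; rewrite HE // => /eqP.
 by rewrite mulf_eq0 expf_eq0 (negPf t0) andbF => /eqP.
Qed.

End CurveSelection.

(** * Uncountability and accumulation points *)

Section Uncountable.
Variable R : realType.

(** Otherwise the real line would be a countable union of finite sets, against the Lebesgue measure
    of the unit interval. *)
Lemma complex_uncountable : uncountable_field R[i].
Proof.
move=> S cov; apply: contrapT => no.
have fin D : finite_set [set x : R | S D x%:C].
 apply: contrapT => /infiniteP/pcard_leP[f].
 apply: no; exists D => N; exists [seq ((f a)%:C : R[i]) | a <- iota 0 N]; split.
 - rewrite map_inj_in_uniq ?iota_uniq // => a b _ _ /complexI e.
  by apply: (@inj _ _ setT f); rewrite ?inE.
 - by rewrite size_map size_iota.
 - by move=> _ /mapP[a _ ->]; exact: (@funS _ _ _ _ f a I).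
have cT : countable [set: R].
 have -> : [set: R] = \bigcup_(D in [set: nat]) [set x : R | S D x%:C].
  by apply/seteqP; split=> // x _; have [D hD] := cov x%:C; exists D.
 by apply: bigcup_countable => // D _; apply: finite_set_countable.
have c01 : countable (`[0, 1]%classic : set R) by apply: sub_countable cT; apply: subset_card_le.
have := countable_lebesgue_measure0 c01; rewrite lebesgue_measure_itv /= lte_fin ltr01 => /eqP.
by rewrite -EFinB subr0 eqe oner_eq0.
Qed.
(** A cluster point, in a compact square, of the filter generated by the cofinite parts of [V]. *)
Lemma bounded_accumulation (V : R[i] -> Prop) (M : R) : (forall v, V v -> nm v <= M) ->
 (forall s : seq R[i], exists2 v, V v & v \notin s) ->
 exists a, forall r : R, 0 < r -> exists v, [/\ V v, v != a & nm (v - a) < r].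
Proof.
move=> bd inf; pose re (v : R[i]) : R := complex.Re v; pose im (v : R[i]) : R := complex.Im v.
pose F : set_system (R * R)%type := [set A | exists s : seq R[i], forall v, V v -> v \notin s -> A (re v, im v)].
have PF : ProperFilter F.
 apply: Build_ProperFilter_ex; first by move=> P [s hs]; have [v Vv vs] := inf s; exists (re v, im v); apply: hs.
 split.
 - by exists [::].
 - move=> P Q [s hs] [t ht]; exists (s ++ t) => v Vv; rewrite mem_cat negb_or => /andP[vs vt].
  by split; [apply: hs|apply: ht].
 - by move=> P Q PQ [s hs]; exists s => v Vv vs; apply/PQ/hs.
have K : compact (`[- M, M]%classic `*` `[- M, M]%classic : set (R * R)%type).
 by apply: compact_setX; apply: segment_compact.
have [|[x y] [_ cl]] := K F PF.
 exists [::] => v /bd hv _; split=> /=; rewrite in_itv /= -ler_norml; apply: le_trans hv; [exact: ge_nm_Re|exact: ge_nm_Im].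
pose a : R[i] := x +i* y; exists a => r r0.
have r2 : 0 < r / 2 by rewrite divr_gt0.
have [||[x' y'] [[v [Vv va e1 e2]] [bx byy]]] :=
  cl [set p | exists v, [/\ V v, v != a, re v = p.1 & im v = p.2]] (ball x (r / 2) `*` ball y (r / 2)).
- by exists [:: a] => v Vv; rewrite inE => va; exists v.
- exists (ball x (r / 2), ball y (r / 2)) => //=; split; exact: nbhsx_ballx.
exists v; split=> //; apply: le_lt_trans (nm_le _) _.
have [bx' by'] : `|x - x'| < r / 2 /\ `|y - y'| < r / 2 by [].
rewrite -[x']e1 -[y']e2 /re /im in bx' by'; rewrite [ltRHS](splitr r); apply: ltrD.
 by move: bx'; rewrite distrC; case: (v) => p q.
by move: by'; rewrite distrC; case: (v) => p q.
Qed.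
End Uncountable.

(** * Analytic curves in a matrix group *)

Section Tangent.
Variables (R : realType) (n' : nat).
Notation C := R[i].
Local Notation n := n'.+1.

Lemma cder_sum (I : Type) (s : seq I) (P : pred I) (f : I -> C -> C) (df : I -> C) z :
 (forall i, cder (f i) z (df i)) -> cder (fun w => \sum_(i <- s | P i) f i w) z (\sum_(i <- s | P i) df i).
Proof.
move=> h; elim: s => [|i s IH].
 by rewrite big_nil; apply: cder_ext (cder_cst 0 z) => w; rewrite big_nil.
rewrite big_cons; case Pi: (P i).
 by apply: cder_ext (cderD (h i) IH) => w; rewrite big_cons Pi.
by apply: cder_ext IH => w; rewrite big_cons Pi.
Qed.
Lemma cder_meval D (y : 'I_D -> C -> C) (dy : 'I_D -> C) z (p : mpoly D C) : (forall i, cder (y i) z (dy i)) ->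
 cder (fun w => meval (fun i => y i w) p) z (\sum_k meval (fun i => y i z) (mderiv k p) * dy k).
Proof.
move=> h; elim/mpoly_alg_ind: p => [c|i|p q IHp IHq|p q IHp IHq].
- rewrite big1 => [|k _]; last by rewrite mderivC meval0 mul0r.
 by apply: cder_ext (cder_cst c z) => w; rewrite mevalC.
- rewrite (bigD1 i) //= big1 => [|k ki].
  have -> : mderiv i (mpolyX C (mnm1 i)) = 1.
   by rewrite mderivX mnm1E eqxx scale1r -{1}[mnm1 i]add0m addmK mpolyX0.
  by rewrite meval1 mul1r addr0; apply: cder_ext (h i) => w; rewrite mevalXU.
 by rewrite mderivX mnm1E eq_sym (negPf ki) scale0r meval0 mul0r.
- have := cderD IHp IHq; rewrite -big_split /= => H.
 rewrite (eq_bigr (fun k => meval (fun i => y i z) (mderiv k p) * dy k + meval (fun i => y i z) (mderiv k q) * dy k)).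
  by apply: cder_ext H => w; rewrite mevalD.
 by move=> k _; rewrite mderivD mevalD mulrDl.
- have := cderM IHp IHq; rewrite mulr_suml mulr_sumr -big_split /= => H.
 rewrite (eq_bigr (fun k => meval (fun i => y i z) (mderiv k p) * dy k * meval (fun i => y i z) q + meval (fun i => y i z) p * (meval (fun i => y i z) (mderiv k q) * dy k))).
  by apply: cder_ext H => w; rewrite mevalM.
 by move=> k _; rewrite mderivM mevalD !mevalM mulrDl mulrA; congr (_ + _); rewrite mulrAC.
Qed.

Variable G : 'M[C]_n -> Prop.
Hypothesis GG : matrix_group G.

Lemma cder_mev (A : C -> 'M[C]_n) (A' : 'M[C]_n) z p : (forall i j, cder (fun w => A w i j) z (A' i j)) ->
 cder (fun w => mev p (A w)) z (\sum_k mev (mderiv k p) (A z) * mxvec A' 0 k).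
Proof.
move=> h; apply: (@cder_meval _ (fun k w => mxvec (A w) 0 k)) => k; case/mxvec_indexP: k => i j.
by rewrite mxvecE; apply: cder_ext (h i j) => w; rewrite mxvecE.
Qed.
(** The translated curve [B] stays in the group and passes through the identity at [z]; its
    derivative there kills the equations of [G]. *)
Lemma tangent_lie (A : C -> 'M[C]_n) (A' : 'M[C]_n) z (r : R) : 0 < r -> (forall w, nm (w - z) < r -> G (A w)) ->
 (forall i j, cder (fun w => A w i j) z (A' i j)) ->
 lie G (invmx (A z) *m A') /\ A z *m (invmx (A z) *m A') = A'.
Proof.
move=> r0 hG hA; have Gz : G (A z) by apply: hG; rewrite subrr nm0.
have u := mgrp_unit GG Gz; split; last by rewrite mulKVmx.
move=> q vq; set x := invmx (A z) *m A'; pose B w := invmx (A z) *m A w.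
have hB i j : cder (fun w => B w i j) z (x i j).
 rewrite mxE; apply: (@cder_eq _ (fun w => \sum_k invmx (A z) i k * A w k j)).
  by exists 1 => // w _; rewrite mxE.
 apply: cder_sum => k; have := cderM (cder_cst (invmx (A z) i k) z) (hA k j).
 by rewrite mul0r add0r.
have := cder_mev q hB; rewrite /B mulVmx // => h1.
have h2 : cder (fun w => mev q (invmx (A z) *m A w)) z 0.
 apply: cder_eq (cder_cst 0 z); exists r => // w hw; rewrite vq //; apply: (mgrpM GG); last exact: hG.
 exact: (mgrp_inv GG).
by rewrite mev_vfield mul1mx; apply: cder_unique h1 h2.
Qed.
Lemma lie_invariant_cder p (A : C -> 'M[C]_n) (A' : 'M[C]_n) z (r : R) :
 (forall x, lie G x -> vanishes G (vfield x p)) -> 0 < r -> (forall w, nm (w - z) < r -> G (A w)) ->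
 (forall i j, cder (fun w => A w i j) z (A' i j)) -> cder (fun w => mev p (A w)) z 0.
Proof.
move=> hp r0 hG hA; have [L E] := tangent_lie r0 hG hA.
have := cder_mev p hA; rewrite -{1}E -mev_vfield hp //; apply: hG; by rewrite subrr nm0.
Qed.

(* A regular function killed by the Lie algebra with infinitely many values would be non-constant along
  an analytic curve in the group. *)
Theorem lie_invariants_finite : finite_valued_invariants G.
Proof.
move=> p hp; apply: contrapT => nfin; pose V v := exists2 A, G A & mev p A = v.
have inf (s : seq C) : exists2 v, V v & v \notin s.
 apply: contrapT => h; apply: nfin; exists s => A GA; apply: contrapT => /negP ns.
 by apply: h; exists (mev p A) => //; exists A.
(* One argument for bounded and unbounded sets of values. The parameter [z] is tied to the value [v]
   by [a.[z] * v = b.[z]]: [z] is [v - al] near a finite accumulation point [al], and [v^-1] near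
   infinity. *)
suff key (a b : {poly C}) : (forall r : R, 0 < r -> exists z A, [/\ z != 0, nm z < r, G A & a.[z] * mev p A = b.[z]]) ->
  (forall v s, a.[s] * v = b.[s] -> a^`().[s] * v = b^`().[s] -> s = 0) -> False.
 have [[M bd]|nb] := pselect (exists M : R, forall v, V v -> nm v <= M).
  have [al hal] := bounded_accumulation bd inf; apply: (key 1 ('X + al%:P)) => [r r0|v s _].
   have [v [[A GA <-] va nv]] := hal r r0; exists (mev p A - al), A; split=> //; first by rewrite subr_eq0.
   by rewrite hornerC mul1r !hornerE subrK.
  rewrite -[1]polyC1 derivC derivD derivX derivC !hornerE => /eqP.
  by rewrite eq_sym oner_eq0.
 apply: (key 'X 1) => [r r0|v s].
  have [v [A GA pA] lt] : exists2 v, V v & r^-1 < nm v.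
   apply: contrapT => h; apply: nb; exists r^-1 => v Vv; rewrite leNgt; apply/negP => lt.
   by apply: h; exists v.
  have v0 : 0 < nm v by apply: lt_trans lt; rewrite invr_gt0.
  have vn : v != 0 by rewrite -nm_gt0.
  exists v^-1, A; split=> //; first by rewrite invr_eq0.
   by rewrite nmV -[ltRHS]invrK ltf_pV2 ?posrE ?invr_gt0.
  by rewrite hornerX hornerC pA mulVf.
 by rewrite derivX -[1]polyC1 derivC !hornerE => e1 e2; move/eqP: e1; rewrite e2 mulr0 eq_sym oner_eq0.
move=> acc sep; pose D := (n * n + 1)%N.
pose xs (z : C) (A : 'M[C]_n) (k : 'I_D) : C := match fintype.split k with inl k' => mxvec A 0 k' | inr _ => z end.
pose S (z : C) (x : 'I_D -> C) := [/\ z != 0 & exists2 A, G A & x = xs z A /\ a.[z] * mev p A = b.[z]].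
have [||N [y [N0 _ yd yrel yvan]]] := @curve_selection R D S pred0 (fun=> 0).
- by move=> z x [].
- move=> I phi q cphi h.
 have m0 (x : 'I_D -> C) : mask pred0 x = fun=> 0 by apply: funext => i.
 have cF : cont (fun z => \sum_j phi j z * meval (fun=> 0) (q j)) 0.
  by apply: cont_sum => j _; apply: contM => //; apply: cont_cst.
 have [|r r0 hr] := cont_neq0 cF; first by move: h; rewrite m0.
 have [z [A [z0 zr GA e]]] := acc r r0; exists z, (xs z A); split; first by split=> //; exists A.
 rewrite m0; apply: hr; by rewrite subr0.
pose Ay t : 'M[C]_n := vec_mx (\row_k y (lshift 1 k) t).
have AyE t k : mxvec (Ay t) 0 k = y (lshift 1 k) t by rewrite vec_mxK mxE.
have xsl z A k : xs z A (lshift 1 k) = mxvec A 0 k by rewrite /xs (unsplitK (inl _)).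
have xsr z A : xs z A (rshift (n * n) 0) = z by rewrite /xs (unsplitK (inr _)).
have nG : near0 (fun t => t != 0 -> G (Ay t)).
 apply: near0_imp yvan => t h t0; apply: (mgrp_closed GG) => q vq; have [Q hQ] := pf_lshift 1 q.
 rewrite /mev (_ : (fun k => _) = fun k => y (lshift 1 k) t); last by apply: funext => k; rewrite AyE.
 rewrite (hQ (fun i => y i t)); apply: h => // z x [_ [A GA [-> _]]]; rewrite -hQ.
 rewrite (_ : (fun k => _) = fun k => mxvec A 0 k); last by apply: funext => k; rewrite xsl.
 exact: vq.
have nz : near0 (fun t => t != 0 -> y (rshift (n * n) 0) t = t ^+ N).
 apply: near0_imp (yrel (mpolyX _ (mnm1 (rshift (n * n) 0))) id (hg_id R) _) => [t|z x].
  by rewrite mevalXU.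
 by move=> [_ [A GA [-> _]]]; rewrite mevalXU xsr.
have [Q hQ] : pf (fun x : 'I_D -> C => x) (fun x => a.[x (rshift (n * n) 0)] * meval (fun k => x (lshift 1 k)) p - b.[x (rshift (n * n) 0)]).
 have hor (c : {poly C}) : pf (fun x : 'I_D -> C => x) (fun x => c.[x (rshift (n * n) 0)]).
  apply: (@pf_eq _ _ _ _ (fun x => \sum_(l < size c) c`_l * \prod_(k < l) x (rshift (n * n) 0))).
   by move=> x; rewrite horner_coef; apply: eq_bigr => l _; rewrite prodr_const card_ord.
  apply: pf_sum => l; apply: pfM; first exact: pf_cst.
  by apply: pf_prod => k; exact: (pf_co (fun x : 'I_D -> C => x)).
 apply: pfD; last by apply: pfN; apply: hor.
 by apply: pfM; [apply: hor|exact: pf_lshift].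
have nrel : near0 (fun t => t != 0 -> a.[t ^+ N] * mev p (Ay t) = b.[t ^+ N]).
 have h : near0 (fun t => t != 0 -> meval (fun i => y i t) Q = 0).
  apply: (yrel Q (fun=> 0)); first exact: hg_cst.
  move=> z x [_ [A GA [-> e]]]; rewrite -hQ xsr.
  rewrite (_ : (fun k => _) = fun k => mxvec A 0 k); last by apply: funext => k; rewrite xsl.
  by rewrite -/(mev p A) e subrr.
 apply: near0_imp (near0_and h nz) => t [h1 h2] t0; move: (h1 t0); rewrite -hQ h2 // => /eqP.
 rewrite subr_eq0 => /eqP <-; rewrite /mev; congr (_ * meval _ p); apply: funext => k; by rewrite AyE.
have [r r0 hr] := near0_and (near0_and nG nrel) yd.
have [t t0 tr] : exists2 t : C, t != 0 & nm t < r by apply: near0_ex; exists r.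
have [r' r'0 ball] := punctured_ball t0 tr.
have [[hG1 hrel1] hd] := hr t tr; have /choice[dy hdy] := hd t0.
pose A' : 'M[C]_n := vec_mx (\row_k dy (lshift 1 k)).
have hA i j : cder (fun w => Ay w i j) t (A' i j).
 rewrite -mxvecE vec_mxK mxE; apply: cder_eq (hdy _); exists 1 => // w _.
 by rewrite -[RHS]mxvecE AyE.
have hG w : nm (w - t) < r' -> G (Ay w) by move=> /ball[wr w0]; have [[h _] _] := hr w wr; apply: h.
have d0 := lie_invariant_cder hp r'0 hG hA.
have hpoly (c : {poly C}) : cder (fun w => c.[w ^+ N]) t (c^`().[t ^+ N] * (N%:R * t ^+ N.-1)).
 have X := cderX N (cder_id t); have := @cder_comp R _ (fun s => c.[s]) t _ (c^`().[t ^+ N]) X.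
 rewrite mulr1; apply; move: (t ^+ N) => s; elim/poly_ind: c => [|c k IH].
  by rewrite deriv0 horner0; apply: cder_ext (cder_cst 0 s) => w; rewrite horner0.
 have := cderD (cderM IH (cder_id s)) (cder_cst k s).
 have -> : (c * 'X + k%:P)^`().[s] = c^`().[s] * s + c.[s] * 1 + 0 by rewrite derivD derivM derivX derivC !hornerE.
 move=> h.
 by apply: cder_ext h => w; rewrite !hornerE.
(* [p] has derivative 0 along the curve, so the relation is differentiated as if the value were
   constant; together with the relation itself, [sep] gives [t ^+ N = 0]. *)
have e1 := cderM (hpoly a) d0.
have e2 : cder (fun w => a.[w ^+ N] * mev p (Ay w)) t (b^`().[t ^+ N] * (N%:R * t ^+ N.-1)).
 apply: cder_eq (hpoly b); exists r' => // w /ball[wr w0]; have [[_ h] _] := hr w wr; by rewrite h.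
have := cder_unique e1 e2; rewrite mulr0 addr0 mulrAC => e.
have nt : N%:R * t ^+ N.-1 != 0 :> C by rewrite mulf_neq0 ?expf_neq0 // pnatr_eq0 -lt0n.
have tN := sep _ _ (hrel1 t0) (mulIf nt e).
by move/eqP: tN; rewrite expf_eq0 (negPf t0) andbF.
Qed.
End Tangent.

(** * From [GL_m] to closed matrix groups; reductivity *)

Section Embedding.
Variables (R : realType) (m : nat) (G : set 'M[R[i]]_m).
Notation C := R[i].

(* The determinant of [emb g] is 1, so that its inverse is the adjugate: Zariski closed subsets of
  GL_m become Zariski closed in the space of all matrices of size 1 + m. *)
Definition emb (g : 'M[C]_m) : 'M[C]_m.+1 := block_mx (((\det g)^-1)%:M : 'M[C]_1) 0 0 g.
Definition Gam (A : 'M[C]_m.+1) := exists2 g, G g & A = emb g.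
Definition mco (A : 'M[C]_m.+1) := fun k => mxvec A 0 k.
Definition dsub (A : 'M[C]_m.+1) : 'M[C]_m := @drsubmx C 1 m 1 m A.
(** Extends [gl_coords] to all matrices of size [1 + m] by polynomial functions. *)
Definition gco (A : 'M[C]_m.+1) (k : 'I_(m * m + 1)) : C :=
 match fintype.split k with inl k' => mxvec (dsub A) 0 k' | inr _ => A 0 0 end.

Lemma dsub_emb g : dsub (emb g) = g. Proof. exact: block_mxKdr. Qed.
Lemma emb00 g : emb g 0 0 = (\det g)^-1.
Proof.
have z : @lshift 1 m 0 = 0 :> 'I_m.+1 by apply: val_inj.
transitivity ((((\det g)^-1)%:M : 'M[C]_1) 0 0); last by rewrite mxE eqxx.
by rewrite -z; exact: (@block_mxEul C 1 m 1 m).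
Qed.
Lemma gco_emb g : gco (emb g) = gl_coords g.
Proof. by apply: funext => k; rewrite /gco /gl_coords dsub_emb emb00. Qed.
Lemma emb1 : emb 1%:M = 1%:M.
Proof. by rewrite /emb det1 invr1 -scalar_mx_block. Qed.
Lemma embM g h : emb (g *m h) = emb g *m emb h.
Proof.
rewrite /emb; symmetry; etransitivity; first exact: (@mulmx_block C 1 m 1 m 1 m).
by rewrite !mul0mx !mulmx0 !addr0 !add0r -scalar_mxM det_mulmx invfM.
Qed.
Lemma emb_unit g : g \in unitmx -> emb g \in unitmx.
Proof. by move=> ug; have e : emb g *m emb (invmx g) = 1%:M; [rewrite -embM mulmxV // emb1 | exact: (mulmx1_unit e).1]. Qed.
Lemma emb_inj g h : emb g = emb h -> g = h.
Proof. by move=> /(congr1 dsub); rewrite !dsub_emb. Qed.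
Lemma pf_mco i j : pf mco (fun A => A i j).
Proof. by apply: pf_eq (pf_co mco (mxvec_index i j)) => A; rewrite /mco mxvecE. Qed.
Lemma pf_gco k : pf mco (fun A => gco A k).
Proof.
rewrite /gco; case: (fintype.split k) => [k'|_]; last exact: pf_mco.
case/mxvec_indexP: k' => i j; apply: pf_eq (pf_mco (rshift 1 i) (rshift 1 j)) => A.
by rewrite mxvecE /dsub /drsubmx /dsubmx /rsubmx !mxE.
Qed.
Lemma pf_glev p : pf mco (fun A => meval (gco A) p).
Proof.
by apply: pf_eq (@pf_comp _ _ _ mco _ (fun k A => gco A k) p pf_gco) => A.
Qed.
Lemma pf_adj i j : pf mco (fun A => (\adj A) i j).
Proof.
apply: (@pf_eq _ _ _ _ (fun A => (-1) ^+ (j + i) * \det (row' j (col' i A)))).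
 by move=> A; rewrite mxE.
apply: pfM; first exact: pf_cst.
by apply: pf_det => a b; apply: pf_eq (pf_mco (lift j a) (lift i b)) => A; rewrite !mxE.
Qed.

Hypothesis LG : linear_algebraic_group G.

Lemma Gam_inv A : Gam A -> Gam (invmx A) /\ invmx A = \adj A.
Proof.
case: LG => -[G1 Gu GM GV] _ [g Gg ->]; have ug := Gu g Gg.
have e : emb g *m emb (invmx g) = 1%:M by rewrite -embM mulmxV // emb1.
have u : emb g \in unitmx by case/mulmx1_unit: e.
have -> : invmx (emb g) = emb (invmx g) by rewrite -[LHS]mulmx1 -e mulKmx.
split; first by exists (invmx g) => //; apply: GV.
have d1 : \det (emb g) = 1.
 transitivity (\det (((\det g)^-1)%:M : 'M[C]_1) * \det g); first exact: (@det_ublock C 1 m ((\det g)^-1)%:M 0 g).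
 by rewrite det_scalar1 mulVf // -unitfE -unitmxE.
have := mul_mx_adj (emb g); rewrite d1 => e'.
by rewrite -[RHS]mul1mx -(mulVmx u) -mulmxA e' mulmx1 -[RHS]mulmx1 -e mulKmx.
Qed.
Lemma Gam_group : matrix_group Gam.
Proof.
move: (LG) => [[G1 Gu GM GV] [S GS]]; split.
- by exists 1%:M => //; rewrite emb1.
- by move=> _ _ [g Gg ->] [h Gh ->]; exists (g *m h); rewrite ?embM //; apply: GM.
(* The block shape, and the product 1 of the corner with the determinant of the lower block, are
   equations of [Gam]; so [A] is [emb] of its lower block, which satisfies the equations of [G]. *)
- move=> A hA; have van f : pf mco f -> (forall g, G g -> f (emb g) = 0) -> f A = 0.
  by move=> [p h] k; rewrite h; apply: hA => _ [g Gg ->]; rewrite /mev -/(mco _) -h k.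
 have Aur : @ursubmx C 1 m 1 m A = 0.
  apply/matrixP => i j; rewrite /ursubmx /usubmx /rsubmx !mxE.
  apply: (van (fun A => A _ _)); first exact: pf_mco.
  by move=> g _; rewrite (@block_mxEur C 1 m 1 m) mxE.
 have Adl : @dlsubmx C 1 m 1 m A = 0.
  apply/matrixP => i j; rewrite /dlsubmx /dsubmx /lsubmx !mxE.
  apply: (van (fun A => A _ _)); first exact: pf_mco.
  by move=> g _; rewrite (@block_mxEdl C 1 m 1 m) mxE.
 have Ad : A 0 0 * \det (dsub A) = 1.
  apply/eqP; rewrite -subr_eq0; apply/eqP; apply: (van (fun A => A 0 0 * \det (dsub A) - 1)).
   apply: pfD; last exact: (@pf_cst _ _ _ _ (- 1)).
   apply: pfM; first exact: pf_mco.
   apply: pf_det => i j; apply: pf_eq (pf_mco (rshift 1 i) (rshift 1 j)) => B.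
   by rewrite /dsub /drsubmx /dsubmx /rsubmx !mxE.
  by move=> g /Gu; rewrite unitmxE unitfE => dg; rewrite emb00 dsub_emb mulVf // subrr.
 have dA : \det (dsub A) != 0 by apply/eqP => e; move/eqP: Ad; rewrite e mulr0 eq_sym oner_eq0.
 have AE : A = emb (dsub A).
  have ula : @ulsubmx C 1 m 1 m A = ((\det (dsub A))^-1)%:M.
   apply/matrixP => i j; rewrite !ord1 /ulsubmx /usubmx /lsubmx !mxE /=.
   rewrite (_ : lshift m 0 = 0); last exact: val_inj.
   by apply: (mulIf dA); rewrite Ad mulVf.
  by rewrite /emb -ula -[LHS](@submxK C 1 m 1 m) Aur Adl.
 exists (dsub A) => //; rewrite GS; split; first by rewrite unitmxE unitfE.
 move=> p Sp; rewrite /gl_eval -gco_emb -AE; apply: (van (fun A => meval (gco A) p)); first exact: pf_glev.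
 by move=> g; rewrite GS => -[_ h]; rewrite gco_emb; apply: h.
- have /choice[J hJ] : forall k : 'I_m.+1 * 'I_m.+1, exists p : mpoly (m.+1 * m.+1) C, forall A, (\adj A) k.1 k.2 = meval (mco A) p.
  by move=> k; apply: pf_adj.
 exists (\matrix_(i, j) J (i, j)) => A GA; have [GV' e] := Gam_inv GA.
 have -> : evm (\matrix_(i, j) J (i, j)) A = invmx A.
  rewrite e; apply/matrixP => i j; rewrite (hJ (i, j)) mxE; congr (mev _ A); exact: mxE.
 have uA : A \in unitmx by case: GA => g /Gu ug ->; apply: emb_unit.
 by rewrite mulmxV // mulVmx.
Qed.
Lemma rep_exists d (rho : 'M[C]_m -> 'M[C]_d) : rational_rep G rho ->
 exists r : 'M[mpoly (m.+1 * m.+1) C]_d, is_rep Gam r /\ forall g, G g -> evm r (emb g) = rho g.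
Proof.
move=> [ru rM [r0 rE]]; have [[G1 _ GM _] _] := LG.
have /choice[r hr] : forall k : 'I_d * 'I_d, exists p : mpoly (m.+1 * m.+1) C, forall A, meval (gco A) (r0 k.1 k.2) = meval (mco A) p.
 by move=> k; apply: pf_glev.
have E g : G g -> evm (\matrix_(i, j) r (i, j)) (emb g) = rho g.
 by move=> Gg; apply/matrixP => i j; rewrite !mxE /mev -/(mco _) -(hr (i, j)) gco_emb rE.
exists (\matrix_(i, j) r (i, j)); split=> //; split.
 rewrite -emb1 E //; have u1 := ru _ G1; have := rM _ _ G1 G1; rewrite mulmx1 => /(congr1 (mulmx (invmx (rho 1%:M)))).
 by rewrite mulVmx // mulKmx.
by move=> _ _ [g Gg ->] [h Gh ->]; rewrite -embM !E ?rM //; apply: GM.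
Qed.
Lemma nilpotent_size k (y : 'M[C]_k) N : y ^+ N = 0 -> y ^+ k = 0.
Proof.
case: k y => [|k] y yN; first by apply/matrixP => -[].
have [s E] := closed_field_poly_normal (char_poly y); rewrite (monicP (char_poly_monic y)) scale1r in E.
have ss : size s = k.+1 by have := size_char_poly y; rewrite E size_prod_XsubC => -[].
have s0 : s = nseq k.+1 0.
 rewrite -ss; apply/all_pred1P/allP => a; rewrite -root_prod_XsubC -E -eigenvalue_root_char => /eigenvalueP[v vy v0].
 have : v *m y ^+ N = a ^+ N *: v.
  elim: N {yN} => [|N IH]; first by rewrite !expr0 mulmx1 scale1r.
  by rewrite exprSr mulmxA IH -scalemxAl vy scalerA -exprSr.
 rewrite yN mulmx0 => /esym/eqP; rewrite scaler_eq0 (negPf v0) orbF expf_eq0 => /andP[_ /eqP->] /=.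
 by rewrite eqxx.
have := Cayley_Hamilton y; rewrite E s0 big_nseq subr0 iter_mulr_1 rmorphXn /= horner_mx_X.
by [].
Qed.
Lemma poly_nat_roots (q : {poly C}) : (forall a : nat, q.[a%:R] = 0) -> q = 0.
Proof.
move=> h; apply/eqP; apply: contraT => q0.
have := max_poly_roots q0 (rs := [seq a%:R | a <- iota 0 (size q)]); rewrite size_map size_iota ltnn; apply.
 by apply/allP => _ /mapP[a _ ->]; apply/eqP.
by rewrite map_inj_uniq ?iota_uniq // => a b /eqP; rewrite eqr_nat => /eqP.
Qed.
(** Binomial coefficients as polynomials in the upper argument, for powers of a unipotent matrix
    with scalar exponent. *)
Definition binp k : {poly C} := (k`!%:R)^-1 *: \prod_(j < k) ('X - j%:R%:P).
Lemma binpE k (a : nat) : (binp k).[a%:R] = 'C(a, k)%:R.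
Proof.
have kf : k`!%:R != 0 :> C by rewrite pnatr_eq0 -lt0n fact_gt0.
rewrite /binp hornerZ horner_prod; apply: (mulfI kf); rewrite mulVKf // -natrM mulnC bin_ffact.
elim: k {kf} => [|k IH]; first by rewrite big_ord0 ffactn0.
rewrite big_ord_recr /= IH ffactnSr natrM !hornerE; have [le|lt] := leqP k a; first by rewrite natrB.
by rewrite ffact_small // !mul0r.
Qed.

Hypothesis Gred : reductive G.

(** The elements of [G] that act trivially on the successive quotients of the flag of [N] form a
    closed normal unipotent subgroup [H]. It is connected, each element being joined to 1 by the
    curve of its powers, so it is trivial by reductivity. As [H] contains the exponentials of [N],
    these are 1 and [N] is 0. *)
Lemma reductive_nil_ideals : nil_ideals_trivial Gam.
Proof.
have GG := Gam_group; move: (LG) => [[G1 Gu GM GV] [SG GS]] N Nlie NAd Nnil.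
have [W [W0 Wn Wle Wst Wnil]] := nil_flag GG Nlie NAd Nnil.
pose un (U : 'M[C]_m.+1) := forall i w, w \in W i.+1 -> U *m w \in W i.
pose H : set 'M[C]_m := [set h | G h /\ un (emb h - 1%:M)].
have unP U k i w : un U -> w \in W (i + k)%N -> U ^+ k *m w \in W i.
 move=> hU; elim: k i w => [|k IH] i w; first by rewrite addn0 expr0 mul1mx.
 by rewrite addnS exprS -mulmxA => hw; apply: hU; apply: IH; rewrite addSn.
have unS U k i w : un U -> (0 < k)%N -> w \in W i.+1 -> U ^+ k *m w \in W i.
 case: k => // k hU _ hw; rewrite exprS -mulmxA; apply: (hU).
 elim: k => [|k IH]; first by rewrite expr0 mul1mx.
 by rewrite exprS -mulmxA; apply: (subvP (Wle i)); apply: hU.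
have unN U : un U -> U ^+ m.+1 = 0.
 move=> hU; apply/matrixP => i j; rewrite mxE.
 have : U ^+ m.+1 *m delta_mx j 0 \in W 0%N by apply: unP => //; rewrite Wn memvf.
 by rewrite W0 memv0 -colE => /eqP/matrixP/(_ i 0); rewrite !mxE.
have Wemb i g w : G g -> w \in W i -> emb g *m w \in W i by move=> Gg; apply: Wst; exists g.
(* Powers with scalar exponent by the binomial series, finite since [U] is nilpotent. The equations
   of [G] hold at natural exponents, hence at all. *)
have Hcurve h : H h -> exists E : C -> 'M[C]_m.+1, [/\ E 0 = 1%:M, E 1 = emb h,
  forall t, H (dsub (E t)) /\ emb (dsub (E t)) = E t &
  forall p, exists q : {poly C}, forall t, meval (mco (E t)) p = q.[t]].
 move=> [Gh uh]; pose U := emb h - 1%:M; pose E t : 'M[C]_m.+1 := \sum_(k < m.+1) (binp k).[t] *: U ^+ k.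
 have Un := unN _ uh.
 have Enat a : E a%:R = emb h ^+ a.
  have -> : emb h = U + 1 by rewrite /U subrK.
  rewrite /E exprD1n; under eq_bigr do rewrite binpE scaler_nat.
  pose F k := U ^+ k *+ 'C(a, k).
  have z1 k : (m.+1 <= k)%N -> F k = 0.
   by move=> le; rewrite /F -(subnKC le) exprD Un mul0r mul0rn.
  have z2 k : (a.+1 <= k)%N -> F k = 0 by move=> le; rewrite /F bin_small // mulr0n.
  transitivity (\sum_(k < m.+1 + a.+1) F k).
   by rewrite big_split_ord /= [X in _ + X]big1 ?addr0 // => k _; rewrite z1 // leq_addr.
  by rewrite addnC big_split_ord /= [X in _ + X]big1 ?addr0 // => k _; rewrite z2 // leq_addr.
 have Eq p : exists q : {poly C}, forall t, meval (mco (E t)) p = q.[t].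
  exists (mmap (@polyC C) (fun l => \sum_(k < m.+1) (mxvec (U ^+ k) 0 l)%:P * binp k) p) => t.
  rewrite horner_mmap; congr (meval _ p); apply: funext => l.
  rewrite horner_sum /mco; case/mxvec_indexP: l => i j; rewrite mxvecE /E summxE.
  by apply: eq_bigr => k _; rewrite hornerM hornerC mxvecE mxE mulrC.
 have EG t : Gam (E t).
  apply: (mgrp_closed GG) => p vp; have [q qE] := Eq p.
  rewrite /mev -/(mco _) qE (@poly_nat_roots q) ?horner0 // => a.
  rewrite -qE Enat; apply: vp; elim: a => [|a IH]; first by rewrite expr0; apply: (mgrp1 GG).
  by rewrite exprS; apply: (mgrpM GG) => //; exists h.
 exists E; split=> //.
 - by have := Enat 0%N; rewrite expr0.
 - by have := Enat 1%N; rewrite expr1.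
 - move=> t; have [g Gg e] := EG t; rewrite e dsub_emb; split=> //; split=> // i w hw.
  rewrite -e /E big_ord_recl expr0 /= /binp big_ord0 fact0 invr1 scale1r hornerC scale1r addrC addKr mulmx_suml.
  by apply: memv_suml => k _; rewrite -scalemxAl memvZ // unS.
have HE : H = [set 1%:M].
 apply: Gred.
 - by move=> h [].
 - split.
  + by split=> // i w _; rewrite emb1 subrr mul0mx mem0v.
  + by move=> g [/Gu].
  + move=> g h [Gg ug] [Gh uh]; split; first exact: GM.
   move=> i w hw; rewrite embM (_ : _ - _ = emb g *m (emb h - 1%:M) + (emb g - 1%:M)).
    by rewrite mulmxDl memvD ?ug // -mulmxA Wemb // uh.
   by rewrite mulmxBr mulmx1 addrA subrK.
  + move=> g [Gg ug]; split; first exact: GV.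
   move=> i w hw; have e : emb (invmx g) *m emb g = 1%:M by rewrite -embM mulVmx ?emb1 // Gu.
   rewrite (_ : _ - _ = - (emb (invmx g) *m (emb g - 1%:M))); last by rewrite mulmxBr mulmx1 e opprB.
   by rewrite mulNmx memvN -mulmxA Wemb ?ug //; apply: GV.
 - exists [set p | forall h, H h -> gl_eval p h = 0]; apply/seteqP; split=> g /=.
   by move=> Hg; split; [exact: (Gu g Hg.1)|move=> p; apply].
  move=> [ug hg]; have Gg : G g.
   by rewrite GS; split=> // p Sp; apply: hg => h -[]; rewrite GS => -[_ k] _; apply: k.
  (* Membership in [W i] is read on the projection to [W i], which yields regular functions of the
     group element that vanish on [H]. *)
  split=> // i w hw; suff e : projv (W i) ((emb g - 1%:M) *m w) = (emb g - 1%:M) *m w by rewrite -e memv_proj.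
  have lin a : exists2 p : mpoly (m * m + 1) C, True & forall h, h \in unitmx ->
    ((emb h - 1%:M) *m w - projv (W i) ((emb h - 1%:M) *m w)) a 0 = gl_eval p h.
   pose L := (fun v : 'cV[C]_m.+1 => v - projv (W i) v).
   have [p hp] : pf (fun h : 'M[C]_m => gl_coords h) (fun h => (L ((emb h - 1%:M) *m w)) a 0).
    apply: (@pf_eq _ _ _ _ (fun h => \sum_k \sum_l (emb h k l - (k == l)%:R) * (w l 0 * (L (delta_mx k 0)) a 0))).
     move=> h; have Ls c (f : 'I_c -> C) (g' : 'I_c -> 'cV[C]_m.+1) : L (\sum_k f k *: g' k) = \sum_k f k *: L (g' k).
      rewrite /L linear_sum -sumrB; apply: eq_bigr => k _; by rewrite linearZ /= scalerBr.
     rewrite [X in L X](_ : _ = \sum_k (((emb h - 1%:M) *m w) k 0) *: delta_mx k 0); last first.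
      by rewrite [LHS]matrix_sum_delta; apply: eq_bigr => k _; rewrite big_ord1.
     rewrite Ls summxE; apply: eq_bigr => k _; rewrite !mxE mulr_suml; apply: eq_bigr => l _.
     by rewrite !mxE mulrA.
    apply: pf_sum => k; apply: pf_sum => l; apply: pfM; last exact: pf_cst.
    apply: pfD; last exact: pf_cst.
    rewrite -[m.+1]/(1 + m)%N in k l *; case: (@splitP 1 m k) => k' ek; case: (@splitP 1 m l) => l' el.
    - have -> : k = lshift m k' by apply: val_inj.
     have -> : l = lshift m l' by apply: val_inj.
     apply: (pf_eq _ (pf_co _ (rshift (m * m) 0))) => h.
     rewrite /gl_coords (unsplitK (inr _)) /emb (@block_mxEul C 1 m 1 m) mxE !ord1 eqxx; by [].
    - have -> : k = lshift m k' by apply: val_inj.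
     have -> : l = rshift 1 l' by apply: val_inj.
     by apply: (pf_eq _ (pf_cst _ 0)) => h; rewrite /emb (@block_mxEur C 1 m 1 m) mxE.
    - have -> : k = rshift 1 k' by apply: val_inj.
     have -> : l = lshift m l' by apply: val_inj.
     by apply: (pf_eq _ (pf_cst _ 0)) => h; rewrite /emb (@block_mxEdl C 1 m 1 m) mxE.
    - have -> : k = rshift 1 k' by apply: val_inj.
     have -> : l = rshift 1 l' by apply: val_inj.
     apply: (pf_eq _ (pf_co _ (lshift 1 (mxvec_index k' l')))) => h.
     by rewrite /gl_coords (unsplitK (inl _)) mxvecE /emb (@block_mxEdr C 1 m 1 m).
   by exists p => // h _; rewrite /gl_eval -hp.
  apply/eqP; rewrite eq_sym -subr_eq0; apply/eqP/matrixP => a b; rewrite ord1 {b} [RHS]mxE.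
  have [p _ hp] := lin a; rewrite hp // hg // => h Hh; rewrite -hp ?(Gu _ Hh.1) //.
  have [_ uh] := Hh; rewrite projv_id ?subrr ?mxE //; exact: uh.
 - move=> A B [SA AE] [SB BE] cov dis.
  have H1 : H 1%:M by split=> // i w _; rewrite emb1 subrr mul0mx mem0v.
  have alt h (E : C -> 'M[C]_m.+1) (S : set (mpoly (m * m + 1) C)) (Z : set 'M[C]_m) :
    (forall t, H (dsub (E t)) /\ emb (dsub (E t)) = E t) ->
    (forall p, exists q : {poly C}, forall t, meval (mco (E t)) p = q.[t]) ->
    Z = [set g | g \in unitmx /\ forall p, S p -> gl_eval p g = 0] -> H h ->
    (forall t, Z (dsub (E t))) \/ exists2 q : {poly C}, q != 0 & forall t, Z (dsub (E t)) -> q.[t] = 0.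
   move=> hE Eq ZE Hh; have ev p : exists q : {poly C}, forall t, gl_eval p (dsub (E t)) = q.[t].
    have [P hP] := pf_glev p; have [q hq] := Eq P; exists q => t.
    by rewrite -hq -hP /gl_eval -gco_emb (hE t).2.
   have [[p [q [Sp q0 hq]]]|no] := pselect (exists p q, [/\ S p, q != 0 & forall t, gl_eval p (dsub (E t)) = q.[t]]).
    by right; exists q => // t; rewrite ZE => -[_ /(_ p Sp)]; rewrite hq.
   left=> t; rewrite ZE; split; first exact: (Gu _ (hE t).1.1).
   move=> p Sp; have [q hq] := ev p; rewrite hq; have [->|q0] := eqVneq q 0; first by rewrite horner0.
   by exfalso; apply: no; exists p, q.
  (* A curve not contained in a closed set meets it at finitely many parameters only; two such
     finite sets cannot cover the natural numbers, so [A] or [B] contains the curve from 1 to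
     [h]. *)
  have same h : H h -> (A 1%:M /\ A h) \/ (B 1%:M /\ B h).
   move=> Hh; have [E [E0 E1 hE Eq]] := Hcurve h Hh.
   have e0 : dsub (E 0) = 1%:M by apply: emb_inj; rewrite (hE 0).2 E0 emb1.
   have e1 : dsub (E 1) = h by rewrite E1 dsub_emb.
   have [hA|[q q0 hq]] := alt h E SA A hE Eq AE Hh; first by left; rewrite -e0 -e1; split; apply: hA.
   have [hB|[q' q'0 hq']] := alt h E SB B hE Eq BE Hh; first by right; rewrite -e0 -e1; split; apply: hB.
   exfalso; have : q * q' != 0 by rewrite mulf_neq0.
   rewrite (@poly_nat_roots (q * q')) ?eqxx // => a; rewrite hornerM.
   by case: (cov _ (hE a%:R).1) => [/hq->|/hq'->]; rewrite ?mul0r ?mulr0.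
  have nAB h : H h -> A h -> B h -> False.
   by move=> h1 h2 h3; have : (H `&` A `&` B) h by []; rewrite dis.
  have [[A1 _]|[B1 _]] := same _ H1.
   right; apply/seteqP; split=> // h [Hh Bh]; have [[_ Ah]|[B1 _]] := same h Hh; first exact: (nAB h).
   exact: (nAB _ H1).
  left; apply/seteqP; split=> // h [Hh Ah]; have [[A1 _]|[_ Bh]] := same h Hh; first exact: (nAB _ H1).
  exact: (nAB h).
 - move=> g h Gg [Gh uh]; split; first exact: (GM _ _ (GM _ _ Gg Gh) (GV _ Gg)).
  move=> i w hw; have e : emb g *m emb (invmx g) = 1%:M by rewrite -embM mulmxV ?emb1 // Gu.
  rewrite !embM (_ : _ - _ = emb g *m (emb h - 1%:M) *m emb (invmx g)); last first.
   by rewrite mulmxBr mulmx1 mulmxBl e.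
  by rewrite -!mulmxA Wemb // uh // Wemb //; apply: GV.
 - move=> h [Gh /unN uh]; apply: (@nilpotent_size _ _ m.+1).
  have bl (a : 'M[C]_1) (y : 'M[C]_m) k : (block_mx a 0 0 y : 'M[C]_m.+1) ^+ k = block_mx (a ^+ k) 0 0 (y ^+ k).
   elim: k => [|k IH]; first by rewrite !expr0 -[RHS]scalar_mx_block.
   rewrite !exprS IH; etransitivity; first exact: (@mulmx_block C 1 m 1 m 1 m).
   by rewrite !mul0mx !mulmx0 !addr0 !add0r.
  have e : emb h - 1%:M = (block_mx (((\det h)^-1)%:M - ((\det (1%:M : 'M[C]_m))^-1)%:M : 'M[C]_1) 0 0 (h - 1%:M) : 'M[C]_m.+1).
   have e1 := @opp_block_mx C 1 m 1 m (((\det (1%:M : 'M[C]_m))^-1)%:M) 0 0 (1%:M : 'M[C]_m).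
   have e2 := @add_block_mx C 1 m 1 m ((\det h)^-1)%:M 0 0 h (- ((\det (1%:M : 'M[C]_m))^-1)%:M) 0 0 (- 1%:M).
   rewrite !addr0 in e2; rewrite !oppr0 in e1.
   by rewrite -{1}emb1 /emb; etransitivity; last exact: e2; congr (_ + _); exact: e1.
  have -> : (h - 1%:M) ^+ m.+1 = dsub ((emb h - 1%:M) ^+ m.+1) by rewrite e bl; apply/esym; exact: block_mxKdr.
  by rewrite uh; apply/matrixP => i j; rewrite !mxE.
apply/eqP; rewrite -subv0; apply/subvP => x xN; rewrite memv0; apply/eqP.
have Gx := expm_lie GG (Nlie x xN) (Nnil x xN); apply: expm_eq1; first exact: Nnil.
have [h Gh e] := Gx; have : H h.
 split=> // i w hw; rewrite -e /expm big_ord_recl expr0 fact0 invr1 scale1r addrC addKr mulmx_suml.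
 apply: memv_suml => k _; rewrite -scalemxAl memvZ // unS // => j v; exact: Wnil.
by rewrite HE e => ->; rewrite emb1.
Qed.

End Embedding.

(** * Tangent ranks and the lifting of curves *)

Section Lifting.
Variables (R : realType) (n' : nat).
Notation C := R[i].
Local Notation n := n'.+1.
Variables (G : 'M[C]_n -> Prop) (d : nat) (r : 'M[mpoly (n * n) C]_d).
Hypotheses (GG : matrix_group G) (rr : is_rep G r) (NI : nil_ideals_trivial G).
Let unc : uncountable_field C := @complex_uncountable R.
Let FIN := lie_invariants_finite GG.

Lemma hol_meval D (y : 'I_D -> C -> C) (s : R) p : 0 < s -> (forall i, hol (y i) s) -> hol (fun t => meval (fun i => y i t) p) s.
Proof.
move=> s0 hy; split=> // t ht; have /choice[dy hdy] : forall i, exists E, cder (y i) t E by move=> i; apply: (hy i).2.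
by eexists; apply: cder_meval hdy.
Qed.
Lemma hg_meval D (y : 'I_D -> C -> C) p : (forall i, hg (y i)) -> hg (fun t => meval (fun i => y i t) p).
Proof.
move=> hy; have [s s0 hs] : near0 (fun t => forall i, exists E, cder (y i) t E) by apply: near0_ord => i; apply/hg_near.
by exists s; apply: hol_meval => // i; split=> // t ht; apply: hs.
Qed.
Lemma hg_prod (I : Type) (s : seq I) (P : pred I) (F : I -> C -> C) :
 (forall i, hg (F i)) -> hg (fun w => \prod_(i <- s | P i) F i w).
Proof.
move=> h; elim: s => [|i s IH]; first by apply: hg_ext (hg_cst 1) => w; rewrite big_nil.
case Pi: (P i); last by apply: hg_ext IH => w; rewrite big_cons Pi.
by apply: hg_ext (hgM (h i) IH) => w; rewrite big_cons Pi.
Qed.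
Lemma hg_det k (M : C -> 'M[C]_k) : (forall i j, hg (fun w => M w i j)) -> hg (fun w => \det (M w)).
Proof.
move=> h; apply: hg_sum => s _; apply: hgM; first exact: hg_cst.
by apply: hg_prod => i; apply: h.
Qed.
Lemma hg_zero (f : C -> C) : hg f -> near0 (fun t => t != 0 -> f t = 0) -> f 0 = 0.
Proof.
move=> hf h; apply/eqP; apply: contrapT => /negP f0.
have [t t0 [e ne]] := near0_ex (near0_and h (hg_neq0 hf f0)).
by move: ne; rewrite e // eqxx.
Qed.
Lemma hg_der (f : C -> C) : hg f -> exists2 g, hg g & near0 (fun t => cder f t (g t)).
Proof.
move=> [s hs]; have [g [s' [s'0 h]]] := hol_der hs; exists g.
 by apply/hg_near; exists s' => // t /h[].
by exists s' => // t /h[].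
Qed.
Lemma lie_basis : exists k (xb : 'I_k -> 'M[C]_n), (forall j, lie G (xb j)) /\
 forall x, lie G x -> exists a : 'I_k -> C, x = \sum_j a j *: xb j.
Proof.
have L0 : lie G 0 by apply: lie0.
have LD c u v : lie G u -> lie G v -> lie G (c *: u + v) by move=> hu hv; exact: (lieD (lieZ c hu) hv).
have [U UP] := subspace_vspace L0 LD.
exists (\dim U), (fun j => tnth (vbasis U) j); split.
 by move=> j; apply/UP; apply: vbasis_mem; apply: mem_tnth.
move=> x /UP xU; exists (fun j => coord (vbasis U) j x); rewrite {1}(coord_vbasis xU).
by apply: eq_bigr => j _; rewrite (tnth_nth 0).
Qed.

Section Rank.
Variables (k0 : nat) (xb : 'I_k0 -> 'M[C]_n).
Hypotheses (xbL : forall j, lie G (xb j)) (xbG : forall x, lie G x -> exists a : 'I_k0 -> C, x = \sum_j a j *: xb j).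

(* The rows span the tangent space of the orbit of [w]. *)
Definition tmx (w : 'cV[C]_d) : 'M[C]_(k0, d) := \matrix_(j, i) (drep r (xb j) *m w) i 0.

Lemma tmx_pf j i : exists p : mpoly d C, forall w, tmx w j i = ev p w.
Proof.
have [p hp] : pf (fun (w : 'cV[C]_d) i => w i 0) (fun w => \sum_l drep r (xb j) i l * w l 0).
 by apply: pf_sum => l; apply: pfM; [apply: pf_cst|exact: (pf_co (fun (w : 'cV[C]_d) i => w i 0))].
by exists p => w; rewrite mxE mxE hp.
Qed.
Lemma drep_tmx x w : lie G x -> ((drep r x *m w)^T <= tmx w)%MS.
Proof.
move=> /xbG[a ->]; rewrite linear_sum mulmx_suml linear_sum; apply: summx_sub => j _.
rewrite linearZ -scalemxAl linearZ; apply: scalemx_sub.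
have e : (drep r (xb j) *m w)^T = row j (tmx w) by apply/rowP => i; rewrite !mxE.
by have := row_sub j (tmx w); rewrite -e.
Qed.
(** Translation by [A] carries tangent spaces to tangent spaces, with the basis [xb] replaced by its
    conjugates. *)
Lemma tmx_rank A w : G A -> (\rank (tmx (evm r A *m w)) <= \rank (tmx w))%N.
Proof.
move=> GA; have u := mgrp_unit GG GA; have GV := mgrp_inv GG GA.
have rV : evm r A *m evm r (invmx A) = 1%:M by rewrite -rr.2 // mulmxV // rr.1.
suff : (tmx (evm r A *m w) <= tmx w *m (evm r A)^T)%MS.
 by move/mxrankS => h; apply: leq_trans h _; apply: mxrankM_maxl.
apply/row_subP => j; have Lx := lie_Ad GG GV (xbL j).
have -> : row j (tmx (evm r A *m w)) = (drep r (invmx A *m xb j *m invmx (invmx A)) *m w)^T *m (evm r A)^T.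
 rewrite -trmx_mul (drep_Ad GG rr GV (xbL j)) invmxK !mulmxA rV mul1mx.
 by apply/rowP => i; rewrite mxE mxE [RHS]mxE mulmxA.
by apply: submxMr; apply: drep_tmx.
Qed.
Lemma tmx_rank_min Y w v k : minset G r Y -> Y w -> (\rank (tmx w) <= k)%N -> Y v -> (\rank (tmx v) <= k)%N.
Proof.
move=> mY Yw rw Yv; apply/rank_minors => f g.
have [p hp] : pf (fun (w : 'cV[C]_d) i => w i 0) (fun x => \det (mxsub f g (tmx x))).
 by apply: pf_det => i j; have [p hp] := tmx_pf (f i) (g j); exists p => x; rewrite mxE.
rewrite hp; apply: (min_min mY Yw) Yv => A GA; rewrite /ev -hp.
have /rank_minors : (\rank (tmx (evm r A *m w)) <= k)%N by apply: leq_trans (tmx_rank _ GA) rw.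
by apply.
Qed.

(* The curve [y] leads from the orbit of [v] to the point [b] of [Y]. As the tangent spaces have constant
  rank along [y], it satisfies a linear differential equation y' = xi(t) y with analytic coefficients, and
  a function vanishing on [Y] with minimal order along [y] contradicts this equation. *)
Lemma minset_rank Y b v : minset G r Y -> Y b ->
 (forall f, ev f b != 0 -> exists2 A, G A & ev f (evm r A *m v) != 0) ->
 (\rank (tmx v) <= \rank (tmx b))%N -> Y v.
Proof.
move=> mY Yb cl rk; pose D := (n * n + d)%N.
pose yx (w : 'cV[C]_d) (k : 'I_D) : C := match fintype.split k with inl _ => 0 | inr i => w i 0 end.
pose xs A (k : 'I_D) : C := match fintype.split k with inl k' => mxvec A 0 k' | inr i => (evm r A *m v) i 0 end.
(* The selected curve consists of a group element and its image of [v]; only the image is required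
   to converge, the group element may have poles. *)
pose B (k : 'I_D) := if fintype.split k is inr _ then true else false.
pose S (z : C) (x : 'I_D -> C) := z != 0 /\ exists2 A, G A & x = xs A.
have mb : mask B (yx b) = yx b by apply: funext => k; rewrite /mask /B /yx; case: (fintype.split k).
have mx A : mask B (xs A) = yx (evm r A *m v) by apply: funext => k; rewrite /mask /B /yx /xs; case: (fintype.split k).
have [||N [y [N0 yB yd _ yvan]]] := @curve_selection R D S B (yx b).
- by move=> z x [].
- move=> I phi p cphi; rewrite mb => h.
 have [f hf] : pf (fun (w : 'cV[C]_d) i => w i 0) (fun w => \sum_j phi j 0 * meval (yx w) (p j)).
  apply: pf_sum => j; apply: pfM; first exact: pf_cst.
  apply: (@pf_comp _ _ _ _ _ (fun k w => yx w k)) => k; rewrite /yx; case: (fintype.split k) => [_|i]; first exact: pf_cst.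
  exact: (pf_co (fun (w : 'cV[C]_d) i => w i 0)).
 have [|A GA fA] := cl f; first by rewrite /ev -hf.
 have cF : cont (fun z => \sum_j phi j z * meval (yx (evm r A *m v)) (p j)) 0.
  by apply: cont_sum => j _; apply: contM => //; apply: cont_cst.
 have [|s s0 hs] := cont_neq0 cF; first by move: fA; rewrite /ev -hf.
 have [z z0 zs] : exists2 z : C, z != 0 & nm z < s by apply: near0_ex; exists s.
 exists z, (xs A); split; first by split=> //; exists A.
 by rewrite mx; apply: hs; rewrite subr0.
have Bl i : B (rshift (n * n) i) by rewrite /B (unsplitK (inr _)).
have hy i : hg (y (rshift (n * n) i)) by have [] := yB _ (Bl i).
pose Ay t : 'M[C]_n := vec_mx (\row_k y (lshift d k) t).
have AyE t k : mxvec (Ay t) 0 k = y (lshift d k) t by rewrite vec_mxK mxE.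
pose yv t : 'cV[C]_d := \col_i y (rshift (n * n) i) t.
have yvE t i : yv t i 0 = y (rshift (n * n) i) t by rewrite mxE.
have yv0 : yv 0 = b.
 by apply/colP => i; rewrite yvE (yB _ (Bl i)).2 /yx (unsplitK (inr _)).
have xsl A k : xs A (lshift d k) = mxvec A 0 k by rewrite /xs (unsplitK (inl _)).
have xsr A i : xs A (rshift (n * n) i) = (evm r A *m v) i 0 by rewrite /xs (unsplitK (inr _)).
have nG : near0 (fun t => t != 0 -> G (Ay t) /\ yv t = evm r (Ay t) *m v).
 apply: near0_imp yvan => t h t0; split.
  apply: (mgrp_closed GG) => q vq; have [Q hQ] := pf_lshift d q.
  rewrite /mev (_ : (fun k => _) = fun k => y (lshift d k) t); last by apply: funext => k; rewrite AyE.
  rewrite (hQ (fun i => y i t)); apply: h => // z x [_ [A GA ->]]; rewrite -hQ.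
  rewrite (_ : (fun k => _) = fun k => mxvec A 0 k); last by apply: funext => k; rewrite xsl.
  exact: vq.
 apply/colP => i; rewrite yvE mxE; apply/eqP; rewrite -subr_eq0.
 have [Q hQ] : pf (fun x : 'I_D -> C => x) (fun x => x (rshift (n * n) i) - \sum_l meval (fun k => x (lshift d k)) (r i l) * v l 0).
  apply: pfD; first exact: (pf_co (fun x : 'I_D -> C => x)).
  by apply: pfN; apply: pf_sum => l; apply: pfM; [apply: pf_lshift|apply: pf_cst].
 have := h t0 Q; rewrite -hQ => e; apply/eqP; rewrite -[RHS]e.
  congr (_ - _); apply: eq_bigr => l _; rewrite mxE /mev; congr (meval _ _ * _); apply: funext => k; by rewrite AyE.
 move=> z x [_ [A GA ->]]; rewrite -hQ xsr mxE; apply/eqP; rewrite subr_eq0; apply/eqP/eq_bigr => l _.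
 by rewrite mxE /mev; congr (meval _ _ * _); apply: funext => k; rewrite xsl.
have /choice[g hg_] : forall i, exists g, hg g /\ near0 (fun t => cder (fun w => yv w i 0) t (g t)).
 move=> i; have [|g hgg h] := @hg_der (fun w => yv w i 0); last by exists g.
 by apply: hg_ext (hy i) => t; rewrite yvE.
have ngd : near0 (fun t => forall i, cder (fun w => yv w i 0) t (g i t)) by apply: near0_ord => i; have [] := hg_ i.
(* Off 0 the curve moves inside the orbit of [v], so its velocity is tangent to this orbit. *)
have ntan : near0 (fun t => t != 0 -> ((\row_i g i t) <= tmx (yv t))%MS /\ (\rank (tmx (yv t)) <= \rank (tmx b))%N).
 have [s s0 hs] := near0_and (near0_and nG yd) ngd; exists s => // t ts t0.
 have [s' s'0 ball] := punctured_ball t0 ts.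
 have [[hG1 hd] hg1] := hs t ts; have [GA yE] := hG1 t0; have /choice[dy hdy] := hd t0.
 split; last by rewrite yE; apply: leq_trans (tmx_rank _ GA) rk.
 pose A' : 'M[C]_n := vec_mx (\row_k dy (lshift d k)).
 have hA i j : cder (fun w => Ay w i j) t (A' i j).
  rewrite -mxvecE vec_mxK mxE; apply: cder_eq (hdy _); exists 1 => // w _.
  by rewrite -[RHS]mxvecE AyE.
 have hG w : nm (w - t) < s' -> G (Ay w) by move=> /ball[ws w0]; have [[h _] _] := hs w ws; case: (h w0).
 have [Lx Ex] := tangent_lie GG s'0 hG hA; set x := invmx (Ay t) *m A' in Lx Ex.
 have e : \row_i g i t = (drep r (Ay t *m x *m invmx (Ay t)) *m yv t)^T.
  apply/rowP => i; rewrite [LHS]mxE [RHS]mxE.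
  apply: (@cder_unique R (fun w => yv w i 0) t) => //.
  have -> : (drep r (Ay t *m x *m invmx (Ay t)) *m yv t) i 0 = \sum_l (evm r (Ay t) *m drep r x) i l * v l 0.
   rewrite (drep_Ad GG rr GA Lx) yE -mulmxA [evm r (invmx _) *m _]mulmxA -rr.2 ?mulVmx ?rr.1 ?mul1mx ?mxE //.
    exact: (mgrp_unit GG).
   exact: (mgrp_inv GG).
  apply: (@cder_eq _ (fun w => \sum_l mev (r i l) (Ay w) * v l 0)).
   exists s' => // w /ball[ws w0]; have [[h _] _] := hs w ws; have [_ ->] := h w0; rewrite mxE.
   by apply: eq_bigr => l _; rewrite mxE.
  apply: cder_sum => l; have h := cderM (cder_mev (r i l) hA) (cder_cst (v l 0) t).
  rewrite mulr0 addr0 -{1}Ex -mev_vfield in h.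
  have -> : (evm r (Ay t) *m drep r x) i l = mev (vfield x (r i l)) (Ay t); last exact: h.
  by rewrite -(evm_vfield_rep GG rr Lx GA) !mxE.
 by rewrite e; apply: drep_tmx; apply: lie_Ad.
(* A minor that is nonzero at [b] remains so nearby. The rank does not exceed its size, so its rows
   span the tangent spaces, and Cramer's rule gives the analytic coefficients [xi]. *)
have [f [h fh]] := full_minor (tmx b); set k := \rank (tmx b) in ntan f h fh.
pose Mt t := mxsub f h (tmx (yv t)).
have hT j i : hg (fun t => tmx (yv t) j i).
 have [p hp] := tmx_pf j i; apply: (@hg_eq _ (fun t => meval (fun l => y (rshift (n * n) l) t) p)).
  by exists 1 => // t _; rewrite hp /ev; congr (meval _ p); apply: funext => l; rewrite yvE.
 exact: hg_meval.
have hM i j : hg (fun t => Mt t i j) by apply: hg_ext (hT (f i) (h j)) => t; rewrite [RHS]mxE.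
have dM0 : \det (Mt 0) != 0 by rewrite /Mt yv0.
have hdM := hg_det hM; have ndM := hg_neq0 hdM dM0.
pose xi t : 'rV[C]_k := (\row_l g (h l) t) *m ((\det (Mt t))^-1 *: \adj (Mt t)).
have hxi j : hg (fun t => xi t 0 j).
 apply: (@hg_eq _ (fun t => \sum_l g (h l) t * ((\det (Mt t))^-1 * ((-1) ^+ (j + l) * \det (row' j (col' l (Mt t))))))).
  by exists 1 => // t _; rewrite !mxE; apply: eq_bigr => l _; rewrite !mxE.
 apply: hg_sum => l _; apply: hgM; first by have [] := hg_ (h l).
 apply: hgM; first exact: hgV.
 apply: hgM; first exact: hg_cst.
 by apply: hg_det => a c; apply: hg_ext (hM (lift j a) (lift l c)) => t; rewrite !mxE.
have node : near0 (fun t => t != 0 -> \row_i g i t = xi t *m rowsub f (tmx (yv t))).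
 apply: near0_imp (near0_and ntan ndM) => t [h1 h2] t0; have [sub rkt] := h1 t0.
 have uM : Mt t \in unitmx by rewrite unitmxE unitfE.
 have full : (tmx (yv t) <= rowsub f (tmx (yv t)))%MS.
  have s1 : (rowsub f (tmx (yv t)) <= tmx (yv t))%MS by apply/row_subP => i; rewrite row_rowsub row_sub.
  rewrite -(geq_leqif (mxrank_leqif_sup s1)); apply: leq_trans rkt _.
  have := mxrank_sub id h (rowsub f (tmx (yv t))); rewrite (_ : mxsub id h _ = Mt t); last by apply/matrixP => i j; rewrite !mxE.
  by rewrite mxrank_unit.
 have /submxP[ze zeE] := submx_trans sub full; rewrite zeE; congr (_ *m _).
 have e : \row_l g (h l) t = ze *m Mt t.
  apply/rowP => l; have /rowP/(_ (h l)) := zeE; rewrite !mxE => ->.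
  by apply: eq_bigr => i _; rewrite !mxE.
 have iM : invmx (Mt t) = (\det (Mt t))^-1 *: \adj (Mt t) by rewrite /invmx uM.
 by rewrite /xi e -iM mulmxK.
have evy p t : ev p (yv t) = meval (fun l => y (rshift (n * n) l) t) p.
 by rewrite /ev; congr (meval _ p); apply: funext => l; rewrite yvE.
have hev p : hg (fun t => ev p (yv t)).
 by apply: hg_ext (hg_meval p hy) => t; rewrite evy.
have van p : (forall w, Y w -> ev p w = 0) -> near0 (fun t => ev p (yv t) = 0).
 move=> pY; have [//|[k1 [u1 [hu1 u10 E1]]]] := hg_order (hev p); exfalso.
 (* [m] will be the least order along the curve of an equation of [Y]. The derivatives [dq j] of
    such an equation along the Lie algebra are equations of [Y] again, so their order is at least
    [m], whereas the derivative in [t] lowers the order by 1. *)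
 pose K m := exists q u, [/\ forall w, Y w -> ev q w = 0, hg u, u 0 != 0 & near0 (fun t => ev q (yv t) = t ^+ m * u t)].
 have ex : exists m, `[< K m >] by exists k1; apply/asboolP; exists p, u1.
 case: (ex_minnP ex) => m /asboolP[q [u [qY hu u0 E]]] minm.
 have m0 : (0 < m)%N.
  rewrite lt0n; apply: contra_neq u0 => m0; have [s s0 hs] := E.
  by have := hs 0; rewrite nm0 yv0 qY // m0 expr0 mul1r => /(_ s0) <-.
 pose dq j : mpoly d C := \sum_i mderiv i q * \sum_l drep r (xb (f j)) i l *: mpolyX C (mnm1 l).
 have evdq j w : ev (dq j) w = \sum_i ev (mderiv i q) w * (drep r (xb (f j)) *m w) i 0.
  rewrite /dq /ev raddf_sum /=; apply: eq_bigr => i _; rewrite mevalM; congr (_ * _).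
  by rewrite raddf_sum mxE /=; apply: eq_bigr => l _; rewrite mevalZ mevalXU.
 have dqY j w : Y w -> ev (dq j) w = 0.
  by move=> Yw; rewrite evdq; apply: (lie_der rr (xbL (f j)) (min_stable mY) qY Yw).
 have /choice[V hV] : forall j, exists V, hg V /\ near0 (fun t => ev (dq j) (yv t) = t ^+ m * V t).
  move=> j; have [z|[m' [u' [hu' u'0 E']]]] := hg_order (hev (dq j)).
   by exists (fun=> 0); split; [exact: hg_cst|apply: near0_imp z => t ->; rewrite mulr0].
  have le : (m <= m')%N by apply: minm; apply/asboolP; exists (dq j), u'; split=> //; apply: dqY.
  exists (fun t => t ^+ (m' - m) * u' t); split; first by apply: hgM => //; apply: hgX; apply: hg_id.
  by apply: near0_imp E' => t ->; rewrite mulrA -exprD subnKC.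
 have [du hdu ndu] := hg_der hu.
 have nV : near0 (fun t => forall j, ev (dq j) (yv t) = t ^+ m * V j t) by apply: near0_ord => j; have [] := hV j.
 (* The two expressions of the derivative, subtracted and divided by [t ^+ m.-1]; at 0 there remains
    [m%:R * u 0]. *)
 pose F t := m%:R * u t + t * du t + -1 * (t * \sum_j xi t 0 j * V j t).
 have hF : hg F.
  apply: hgD; first by apply: hgD; apply: hgM => //; [apply: hg_cst|apply: hg_id].
  apply: hgM; first exact: hg_cst.
  apply: hgM; first exact: hg_id.
  by apply: hg_sum => j _; apply: hgM => //; have [] := hV j.
 suff : F 0 = 0.
  by rewrite /F !mul0r mulr0 !addr0 => /eqP; rewrite mulf_eq0 (negPf u0) pnatr_eq0 orbF gtn_eqF.
 apply: hg_zero => //; have [s s0 hs] := near0_and (near0_and E ndu) (near0_and nV (near0_and ngd node)).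
 exists s => // t ts t0; have [[e1 e2] [e3 [e4 e5]]] := hs t ts; have {}e5 := e5 t0.
 have c1 : cder (fun w => ev q (yv w)) t (m%:R * t ^+ m.-1 * 1 * u t + t ^+ m * du t).
  apply: cder_eq (cderM (cderX m (cder_id t)) e2); exists (s - nm t); first by rewrite subr_gt0.
  move=> w hw; have [|[-> _] _] := hs w => //.
  by apply: (@nm_ball _ t).
 have c2 := @cder_meval R d (fun i w => yv w i 0) (fun i => g i t) t q e4.
 have := cder_unique c1 c2.
 have -> : \sum_i meval (fun i => yv t i 0) (mderiv i q) * g i t = t ^+ m * \sum_j xi t 0 j * V j t.
  transitivity (\sum_j xi t 0 j * ev (dq j) (yv t)).
   under [RHS]eq_bigr do rewrite evdq mulr_sumr.
   rewrite exchange_big /=; apply: eq_bigr => i _.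
   have /rowP/(_ i) := e5; rewrite [LHS]mxE [RHS]mxE => ->; rewrite mulr_sumr; apply: eq_bigr => j _.
   by rewrite [rowsub _ _ _ _]mxE [tmx _ _ _]mxE mulrCA.
  by rewrite mulr_sumr; apply: eq_bigr => j _; rewrite e3 mulrCA.
 move=> e; have tm : t ^+ m.-1 != 0 by rewrite expf_neq0.
 apply: (mulfI tm); rewrite mulr0 /F; have tmE : t ^+ m = t ^+ m.-1 * t by rewrite -exprSr prednK.
 rewrite tmE in e; move: e; move: (t ^+ m.-1) (\sum_j _) => T Z e.
 have -> : T * (m%:R * u t + t * du t + -1 * (t * Z)) = m%:R * T * 1 * u t + T * t * du t - T * t * Z by ring.
 by rewrite e subrr.
(* The radius [s / 8] of [hol_order] does not depend on the function, so one [t] serves for all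
   equations of [Y]. *)
have [s s0 hs] : near0 (fun t => forall i, exists E, cder (y (rshift (n * n) i)) t E) by apply: near0_ord => i; apply/hg_near.
have [s1 s10 hs1] := nG.
have [t t0 [ts ts1]] : exists2 t : C, t != 0 & nm t < s / 8 /\ nm t < s1.
 by apply: near0_ex; apply: near0_and; [exists (s / 8) => //; rewrite divr_gt0|exists s1].
have [GA yE] := hs1 t ts1 t0.
have Yt : Y (yv t).
 apply: (min_closed mY) => p pY; rewrite evy.
 have hp : hol (fun t => meval (fun l => y (rshift (n * n) l) t) p) s by apply: hol_meval => // i; split=> // w hw; apply: hs.
 have [z|[m [u [s2 [[s20 hu] u0 E]]]]] := hol_order hp; first exact: z.
 have hgu : hg u by exists s2.
 have nE : near0 (fun t => meval (fun l => y (rshift (n * n) l) t) p = t ^+ m * u t) by exists s2.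
 have [w w0 [[e1 e2] e3]] := near0_ex (near0_and (near0_and (van p pY) nE) (hg_neq0 hgu u0)).
 move/eqP: e1; rewrite evy e2 mulf_eq0 expf_eq0 (negPf w0) andbF /=; by rewrite (negPf e3).
have -> : v = evm r (invmx (Ay t)) *m yv t.
 rewrite yE mulmxA -rr.2 ?mulVmx ?rr.1 ?mul1mx //; [exact: (mgrp_unit GG)|exact: (mgrp_inv GG)].
by apply: (min_stable mY) => //; apply: (mgrp_inv GG).
Qed.

End Rank.

Variables (N0 : nat) (sg : 'I_N0 -> mpoly d C).
Hypotheses (sgI : forall k A v, G A -> ev (sg k) (evm r A *m v) = ev (sg k) v)
 (sgG : forall q : mpoly d C, (forall A v, G A -> ev q (evm r A *m v) = ev q v) ->
   exists Q : mpoly N0 C, forall v, ev q v = meval (fun k => ev (sg k) v) Q).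

(** The invariants [q j] of [invariant_transfer] depend only on the fibre, so their combination with
    the [phi j z] is continuous in [z], and it is 1 at 0. If the given sum vanished on a stable set
    over [z], this combination would vanish too. Thus the points of the minimal set are limits of
    arbitrary nonempty stable sets in nearby fibres. *)
Lemma fibre_limit Y b (c : 'I_N0 -> C -> C) (I : finType) (phi : I -> C -> C) (p : I -> mpoly d C) :
 minset G r Y -> Y b -> (forall k, cont (c k) 0) -> (forall k, ev (sg k) b = c k 0) ->
 (forall j, cont (phi j) 0) -> \sum_j phi j 0 * ev (p j) b != 0 ->
 near0 (fun z => forall X, (exists x, X x) -> stable G r X -> (forall x, X x -> forall k, ev (sg k) x = c k z) ->
  exists2 x, X x & \sum_j phi j z * ev (p j) x != 0).
Proof.
move=> mY Yb cc cb cphi nz.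
have [q [qA qX qY]] := invariant_transfer GG rr NI FIN unc mY Yb nz.
have /choice[Q hQ] : forall j, exists Q : mpoly N0 C, forall v, ev (q j) v = meval (fun k => ev (sg k) v) Q.
 by move=> j; apply: sgG => A v GA; rewrite -ev_act qA.
have cmev (P : mpoly N0 C) : cont (fun z => meval (fun k => c k z) P) 0.
 elim/mpoly_alg_ind: P => [a|i|P P' h h'|P P' h h'].
 - by apply: cont_ext (cont_cst a 0) => w; rewrite mevalC.
 - by apply: cont_ext (cc i) => w; rewrite mevalXU.
 - by apply: cont_ext (contD h h') => w; rewrite mevalD.
 - by apply: cont_ext (contM h h') => w; rewrite mevalM.
have cF : cont (fun z => \sum_j phi j z * meval (fun k => c k z) (Q j)) 0.
 by apply: cont_sum => j _; apply: contM.
have F0 : \sum_j phi j 0 * meval (fun k => c k 0) (Q j) = 1.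
 rewrite -(qY b Yb); apply: eq_bigr => j _; rewrite hQ; congr (_ * meval _ _); apply: funext => k; by rewrite cb.
have [|s s0 hs] := cont_neq0 cF; first by rewrite F0 oner_neq0.
exists s => // z zs X [x Xx] Xs Xf; apply: contrapT => no.
have /eqP : \sum_j phi j z * ev (q j) x = 0.
 apply: (qX X Xs (fun j => phi j z)) => // x' Xx'; apply/eqP; apply: contrapT => /negP h.
 by apply: no; exists x'.
apply/negP; have := hs z; rewrite subr0 => /(_ zs); congr (_ != _).
apply: eq_bigr => j _; rewrite hQ; congr (_ * meval _ _); apply: funext => k; by rewrite Xf.
Qed.
Lemma exists_minset_fibre (c : 'I_N0 -> C) : (exists v, forall k, ev (sg k) v = c k) ->
 exists2 Y, minset G r Y & forall v, Y v -> forall k, ev (sg k) v = c k.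
Proof.
move=> ne; apply: (exists_minset GG rr unc (X := fun v => forall k, ev (sg k) v = c k)) => //.
 by move=> A v GA h k; rewrite sgI.
move=> v hv k; have := hv (sg k - mpolyC d (c k)); rewrite /ev mevalB mevalC => e; apply/eqP; rewrite -subr_eq0.
by apply/eqP/e => w hw; rewrite mevalB mevalC hw subrr.
Qed.

Theorem holomorphic_lift (c : 'I_N0 -> C -> C) : (forall k, hg (c k)) ->
 near0 (fun z => exists v, forall k, ev (sg k) v = c k z) ->
 exists N (y : 'I_d -> C -> C), [/\ (0 < N)%N, forall i, hg (y i) &
  near0 (fun t => (forall k, ev (sg k) (\col_i y i t) = c k (t ^+ N)) /\
   exists2 Y, minset G r Y & Y (\col_i y i t))].
Proof.
move=> hc [e0 e00 he0]; have cc k := hg_cont (hc k).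
have [k0 [xb [xbL xbG]]] := lie_basis.
have /choice[Y hY] : forall z, exists Y, nm z < e0 -> minset G r Y /\ forall v, Y v -> forall k, ev (sg k) v = c k z.
 move=> z; have [hz|_] := boolP (nm z < e0); last by exists (fun=> False).
 by have [Y h1 h2] := exists_minset_fibre (he0 z hz); exists Y.
pose T := tmx xb.
pose low k z := exists2 v, Y z v & (\rank (T v) <= k)%N.
(* The least such [k] is attained over parameters arbitrarily close to 0, the centre excluded, and
   bounds the rank on the minimal sets over all other nearby parameters from below. *)
pose acc k := forall s : R, 0 < s -> exists z, [/\ z != 0, nm z < s & low k z].
have ex : exists k, `[< acc k >].
 exists d; apply/asboolP => s s0; have m0 : 0 < Num.min s e0 by rewrite lt_min s0.
 have [z z0] : exists2 z : C, z != 0 & nm z < Num.min s e0 by apply: near0_ex; exists (Num.min s e0).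
 rewrite lt_min => /andP[zs ze]; exists z; split=> //; have [[v Yv] _ _ _] := (hY z ze).1.
 by exists v => //; apply: rank_leq_col.
case: (ex_minnP ex) => k /asboolP ak mink.
have nlow : near0 (fun z => z != 0 -> forall v, Y z v -> (k <= \rank (T v))%N).
 case: k ak mink => [|k] ak mink; first by exists 1.
 apply: contrapT => no; have /mink : `[< acc k >]; last by rewrite ltnn.
 apply/asboolP => s s0; apply: contrapT => h; apply: no; exists s => // z zs z0 v Yv.
 by rewrite ltnNge; apply/negP => le; apply: h; exists z; split=> //; exists v.
have n00 : nm (0 : C) < e0 by rewrite nm0.
have [m0 f0] := hY 0 n00; have [b Yb] := min_ex m0.
pose S (z : C) (x : 'I_d -> C) := [/\ z != 0, nm z < e0, Y z (\col_i x i) & (\rank (T (\col_i x i)) <= k)%N].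
have mT x : mask predT x = x :> ('I_d -> C) by apply: funext.
have colK (v : 'cV[C]_d) : \col_i v i 0 = v by apply/colP => i; rewrite mxE.
have [||N [y [Np yB yd yrel yvan]]] := @curve_selection R d S predT (fun i => b i 0).
- by move=> z x [].
- move=> I phi p cphi; rewrite mT => nz.
 have [s s0 hs] := fibre_limit m0 Yb cc (f0 b Yb) cphi nz.
 have m1 : 0 < Num.min s e0 by rewrite lt_min s0.
 have [z [z0 zm [v Yv rv]]] := ak _ m1; move: zm; rewrite lt_min => /andP[zs ze].
 have [mz fz] := hY z ze.
 (* The point found here need not be [v], but the bound on the rank spreads over the whole minimal
    set. *)
 have [x Yx nx] := hs z zs (Y z) (min_ex mz) (min_stable mz) fz.
 exists z, (fun i => x i 0); split; last by rewrite mT.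
 split; rewrite ?colK //; exact: (tmx_rank_min xbL xbG mz Yv rv Yx).
have hy i : hg (y i) by have [] := yB i isT.
have y0 : \col_i y i 0 = b by apply/colP => i; rewrite mxE (yB i isT).2.
have evy p t : ev p (\col_i y i t) = meval (fun i => y i t) p.
 by rewrite /ev; congr (meval _ p); apply: funext => i; rewrite mxE.
have nsg : near0 (fun t => forall k', t != 0 -> ev (sg k') (\col_i y i t) = c k' (t ^+ N)).
 apply: near0_ord => k'; apply: near0_imp (yrel (sg k') (c k') (hc k') _) => [t h t0|z x [z0 ze Yx _]].
  by rewrite evy h.
 have [_ fz] := hY z ze; have := fz _ Yx k' => <-; rewrite /ev; congr (meval _ _); apply: funext => i; by rewrite mxE.
have nrk : near0 (fun t => t != 0 -> (\rank (T (\col_i y i t)) <= k)%N).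
 apply: near0_imp yvan => t h t0; apply/rank_minors => f g.
 have [p hp] : pf (fun (w : 'cV[C]_d) i => w i 0) (fun x => \det (mxsub f g (T x))).
  by apply: pf_det => i j; have [p hp] := tmx_pf xb (f i) (g j); exists p => x; rewrite mxE.
 rewrite hp -/(ev _ _) evy; apply: h => // z x [_ _ _ /rank_minors/(_ f g)]; rewrite hp => <-.
 by congr (meval _ _); apply: funext => i; rewrite mxE.
have ne : near0 (fun z : C => nm z < e0) by exists e0.
exists N, y; split=> //.
apply: near0_imp (near0_and (near0_and nsg nrk) (near0_and (near0_pow Np ne) (near0_pow Np nlow))).
move=> t [[h1 h2] [h3 h4]]; have [->|t0] := eqVneq t 0.
 rewrite expr0n gtn_eqF // y0; split; first exact: f0.
 by exists (Y 0).
have tN : t ^+ N != 0 by rewrite expf_neq0.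
have [mz fz] := hY _ h3; split; first by move=> k'; apply: h1.
exists (Y (t ^+ N)) => //; have [b' Yb'] := min_ex mz.
apply: (minset_rank xbL xbG mz Yb').
 (* [fibre_limit] for a constant curve: the minimal set of a fibre lies in the closure of every
    orbit of this fibre. *)
 move=> f fb; have cst k' : cont (fun=> c k' (t ^+ N)) 0 by apply: cont_cst.
 have [||s s0 hs] := @fibre_limit _ b' (fun k' _ => c k' (t ^+ N)) 'I_1 (fun _ _ => 1) (fun=> f) mz Yb' cst (fz b' Yb').
 - by move=> _; apply: cont_cst.
 - by rewrite big_ord1 mul1r.
 have [||||x [A GA ->]] := hs 0 _ (fun x => exists2 A, G A & x = evm r A *m \col_i y i t).
 - by rewrite nm0.
 - by exists (\col_i y i t); exists 1%:M; [apply: (mgrp1 GG)|rewrite rr.1 mul1mx].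
 - by move=> A _ GA [A' GA' ->]; exists (A *m A'); [apply: (mgrpM GG)|rewrite rr.2 // mulmxA].
 - by move=> _ [A GA ->] k'; rewrite sgI // h1.
 by rewrite big_ord1 mul1r => h; exists A.
exact: leq_trans (h2 t0) (h4 tN _ Yb').
Qed.

End Lifting.

Theorem theorem3p4 (R : realType) (m d n : nat)
    (G : set 'M[R[i]]_m) (rho : 'M[R[i]]_m -> 'M[R[i]]_d)
    (sigma : n.-tuple (mpoly.mpoly d R[i]))
    (U : set (CC R)) (z0 : CC R) (c : CC R -> 'rV[R[i]]_n) :
  linear_algebraic_group G -> reductive G -> rational_rep G rho ->
  homogeneous_generators G rho sigma ->
  open U -> connected U -> U z0 ->
  holomorphic_on_rV U c ->
  (forall z, U z -> exists v : 'cV[R[i]]_d, sigma_map sigma v = c z) ->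
  exists N : nat, (0 < N)%N /\
    exists W : set (CC R), [/\ open W, W z0 &
      (forall z, W z -> U (z0 + (z - z0) ^+ N))] /\
    exists cbar : CC R -> 'cV[R[i]]_d,
      holomorphic_on_cV W cbar /\
      forall z, W z ->
        sigma_map sigma (cbar z) = c (z0 + (z - z0) ^+ N) /\
        v_zclosed (orbit_of G rho (cbar z)).
Proof.
move=> LG red rat [_ sinv sgen] oU _ Uz0 hol_c lift_c.
(* [Gam G] takes the place of [G]; by [rE] both have the same orbits. *)
have GG := Gam_group LG; have NI := reductive_nil_ideals LG red.
have [r [rr rE]] := rep_exists LG rat.
pose sg (k : 'I_n) : mpoly d R[i] := tnth sigma k.
have sgI k A v : Gam G A -> ev (sg k) (evm r A *m v) = ev (sg k) v.
 by move=> [g Gg ->]; rewrite rE //; exact: (sinv k g v Gg).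
have sgG (q : mpoly d R[i]) : (forall A v, Gam G A -> ev q (evm r A *m v) = ev q v) ->
  exists Q : mpoly n R[i], forall v, ev q v = meval (fun k => ev (sg k) v) Q.
 move=> hq; have [|Q ->] := sgen q.
  by move=> g v Gg; rewrite -rE //; apply: hq; exists g.
 by exists Q => v; rewrite /ev comp_mpoly_meval.
have [e e0 eU] : exists2 e : R, 0 < e & forall z : R[i], nm z < e -> U (z0 + z).
 have /near_nmP[e e0 he] : nbhs z0 U by apply: open_nbhs_nbhs.
 by exists e => // z hz; apply: he; rewrite addrC addKr.
have cmap z : U z -> exists v, forall k, ev (sg k) v = c z 0 k.
 by move=> /lift_c[v hv]; exists v => k; rewrite -hv mxE.
have hc k : hg (fun z : R[i] => c (z0 + z) 0 k).
 apply/hg_near; exists e => // z hz; have [D hD] := derivable_cder (hol_c k (z0 + z) (eU z hz)).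
 have := cder_comp (cderD (cder_cst z0 z) (cder_id z)) hD.
 by move=> h; eexists; exact: h.
have nc : near0 (fun z : R[i] => exists v, forall k, ev (sg k) v = c (z0 + z) 0 k).
 by exists e => // z hz; apply: cmap; apply: eU.
have [N [y [N0 hy [s s0 hs]]]] := holomorphic_lift GG rr NI sgI sgG hc nc.
have [s1 s10 hs1] : near0 (fun t : R[i] => (forall i, exists E, cder (y i) t E) /\ nm (t ^+ N) < e).
 apply: near0_and; first by apply: near0_ord => i; apply/hg_near.
 by apply: (@near0_pow R (fun z => nm z < e)) => //; exists e.
pose s2 := Num.min s s1; have s20 : 0 < s2 by rewrite lt_min s0.
exists N; split=> //; exists [set z : CC R | nm (z - z0) < s2]; split.
 split.
 - rewrite openE => z /= hz; apply/near_nmP; exists (s2 - nm (z - z0)); first by rewrite subr_gt0.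
  move=> w hw /=; rewrite -[w](subrK z) -addrA; apply: le_lt_trans (nmD _ _) _.
  by rewrite -ltrBrDr.
 - by rewrite /= subrr nm0.
 - by move=> z /=; rewrite lt_min => /andP[_ /hs1[_ h]]; apply: eU.
exists (fun z => \col_i y i (z - z0)); split.
 move=> i z /=; rewrite lt_min => /andP[_ /hs1[/(_ i)[E hE] _]].
 have h := cder_comp (cderD (cder_id z) (cder_cst (- z0) z)) hE.
 apply: cder_derivable; apply: cder_ext h => w; by rewrite mxE.
move=> z /=; rewrite lt_min => /andP[/hs[h1 [Y mY Yy]] _].
split; first by apply/rowP => k; rewrite mxE -h1.
set v := \col_i _ in Yy *.
(* The equations of the minimal set define the orbit, as this set is a single orbit by
   [minset_orbit]. *)
exists [set p | forall w, Y w -> v_eval p w = 0]; apply/seteqP; split=> w /=.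
 by move=> [g Gg <-] p; apply; rewrite -rE //; apply: (min_stable mY) => //; exists g.
move=> hw; have Yw : Y w by apply: (min_closed mY).
have [_ [g Gg ->] ->] := minset_orbit GG rr (@complex_uncountable R) mY Yy Yw.
by exists g => //; rewrite rE.
Qed.
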